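(* Let $(A,\lambda_A)$ be in $\mathrm{C}_{\mathcal O}(c)$, and let $M$ be a finitely generated $A$-module with $\operatorname{depth}_A M\ge c+1$ and $M_{\mathfrak p_A}\ne 0$ (then the $A_{\mathfrak p_A}$-module $M_{\mathfrak p_A}$ is free). Set $\mu:=\operatorname{rank}_{A_{\mathfrak p_A}}(M_{\mathfrak p_A})$. Then: (1) $\delta_A(M)\ge 0$, with equality if and only if $A$ is a complete intersection and there is an isomorphism of $A$-modules $M\cong A^{\mu}\oplus W$ with $W_{\mathfrak p_A}=0$. (2) If $\delta_A(M)=0$ and $e_A(M)\le \mu\cdot e(A)$, then $M\cong A^{\mu}$.
   Context: $\mathcal O$ is a discrete valuation ring with uniformizer $\varpi$. For a finitely generated $\mathcal O$-module $U$, $\operatorname{tors}(U)$ is its torsion submodule and $U^{\mathrm{tf}}:=U/\operatorname{tors}(U)$. $\mathrm{C}_{\mathcal O}(c)$ is the category of pairs $(A,\lambda_A)$ where $A$ is a complete noetherian local $\mathcal O$-algebra and $\lambda_A\colon A\to\mathcal O$ is a surjective map of $\mathcal O$-algebras such that, with $\mathfrak p_A:=\operatorname{Ker}\lambda_A$, the local ring $A_{\mathfrak p_A}$ is regular of Krull dimension $c$. $\mathcal O$ is an $A$-module via $\lambda_A$. For a finitely generated $A$-module $M$, the natural map $M\to M/\mathfrak p_AM$ induces a map of $\mathcal O$-modules $\operatorname{Ext}^c_A(\mathcal O,M)^{\mathrm{tf}}\to \operatorname{Ext}^c_A(\mathcal O,M/\mathfrak p_AM)^{\mathrm{tf}}$;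 its cokernel is the congruence module $\Psi_A(M)$ (it is an $\mathcal O$-module of finite length). Put $\Phi_A:=\operatorname{tors}(\mathfrak p_A/\mathfrak p_A^2)$. The Wiles defect is $$\delta_A(M):=(\operatorname{rank}_{A_{\mathfrak p_A}}M_{\mathfrak p_A})\cdot\operatorname{length}_{\mathcal O}\Phi_A-\operatorname{length}_{\mathcal O}\Psi_A(M).$$ $e_A(M)$ is the Hilbert–Samuel multiplicity of $M$ with respect to the maximal ideal of $A$, and $e(A):=e_A(A)$. A complete local ring is a complete intersection if it is a quotient of a regular local ring by a regular sequence. *)

(* Defs.v *)
From HB Require Import structures.
From mathcomp Require Import all_boot all_order all_algebra.
From mathcomp Require Import mathcomp_extra boolp classical_sets functions.
From mathcomp Require Import cardinality fsbigop ring.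

Set Implicit Arguments.
Unset Strict Implicit.
Unset Printing Implicit Defensive.

Import GRing.Theory.
Local Open Scope classical_set_scope.
Local Open Scope ring_scope.
Local Open Scope quotient_scope.

Section SubmoduleOfSet.
Variables (R : comNzRingType) (V : lmodType R).

Definition submod_set (S : set V) : Prop :=
  S 0 /\ forall (a : R) (u v : V), S u -> S v -> S (a *: u + v).

Section Mk.
Variables (S : set V) (hS : submod_set S).

Definition asbool_pred of submod_set S : V -> bool := fun x => `[< S x >].

Fact asbool_pred_closed : GRing.submod_closed (asbool_pred hS).
Proof.
case: (hS) => h0 hD; split=> [|a u v]; rewrite !unfold_in; first exact/asboolP.
by move=> /asboolP hu /asboolP hv; apply/asboolP; apply: hD.
Qed.

HB.instance Definition _ :=
  GRing.isSubmodClosed.Build R V (asbool_pred hS) asbool_pred_closed.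

Definition mksubm : submodClosed V :=
  GRing.SubmodClosed.clone R V (asbool_pred hS) _.

Lemma mksubmP (x : V) : reflect (S x) (x \in mksubm).
Proof. exact: asboolP. Qed.

End Mk.

End SubmoduleOfSet.

(* Submodules and ideals are the boolean closed predicates of the library; by
   [mksubm] this covers every Prop-valued submodule. *)
Notation ideal R := (submodClosed (R : comNzRingType)^o).

Section SubQuotients.
Variables (R : comNzRingType) (V : lmodType R) (N : submodClosed V).

Record subm : Type := Subm { submval : V; _ : submval \in N }.
HB.instance Definition _ := [isSub for submval].
HB.instance Definition _ := [Choice of subm by <:].
HB.instance Definition _ := [SubChoice_isSubLmodule of subm by <:].
Fact submval_linear : linear submval. Proof. by []. Qed.
HB.instance Definition _ := GRing.isLinear.Build R subm V _ submval submval_linear.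

Definition zmod_pred : V -> bool := fun x => x \in N.
Fact zmod_pred_closed : zmod_closed zmod_pred.
Proof. exact: GRing.submod_closedB (submodClosedP N). Qed.
HB.instance Definition _ := GRing.isZmodClosed.Build V zmod_pred zmod_pred_closed.

Definition submZ : zmodClosed V := GRing.ZmodClosed.clone V zmod_pred _.

Definition quotm : Type := Quotient.quot submZ.
HB.instance Definition _ := GRing.Zmodule.on quotm.

Definition pim (x : V) : quotm := \pi_(Quotient.quot submZ) x.

Lemma pim_eq (x y : V) : (pim x = pim y) <-> (x - y \in N).
Proof.
split=> [/eqP|h]; first by rewrite -Quotient.idealrBE.
by apply/eqP; rewrite -Quotient.idealrBE.
Qed.

Lemma pim_surj (q : quotm) : exists x, q = pim x.
Proof. by exists (repr q); rewrite /pim reprK. Qed.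

Lemma pimD : {morph pim : x y / x + y}.
Proof. exact: raddfD. Qed.

Definition quot_scale (a : R) (q : quotm) : quotm := pim (a *: repr q).

Lemma quot_scaleE a x : quot_scale a (pim x) = pim (a *: x).
Proof.
apply/pim_eq; rewrite -scalerBr rpredZ //; apply/pim_eq.
by rewrite /pim reprK.
Qed.

Fact quot_scalerA a b q : quot_scale a (quot_scale b q) = quot_scale (a * b) q.
Proof. by case: (pim_surj q) => x ->; rewrite !quot_scaleE scalerA. Qed.
Fact quot_scale1r : left_id 1 quot_scale.
Proof. by move=> q; case: (pim_surj q) => x ->; rewrite quot_scaleE scale1r. Qed.
Fact quot_scalerDr : right_distributive quot_scale +%R.
Proof.
move=> a q r; case: (pim_surj q) => x ->; case: (pim_surj r) => y ->.
by rewrite -pimD !quot_scaleE scalerDr pimD.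
Qed.
Fact quot_scalerDl q : {morph quot_scale^~ q : a b / a + b}.
Proof.
by move=> a b; case: (pim_surj q) => x ->; rewrite !quot_scaleE scalerDl pimD.
Qed.
HB.instance Definition _ := GRing.Zmodule_isLmodule.Build R quotm
  quot_scalerA quot_scale1r quot_scalerDr quot_scalerDl.

Fact pim_linear : linear pim.
Proof. by move=> a x y; rewrite pimD -quot_scaleE. Qed.
HB.instance Definition _ := GRing.isLinear.Build R V quotm _ pim pim_linear.

End SubQuotients.

Section SubmoduleConstructions.
Variables (R : comNzRingType).
Implicit Types U V : lmodType R.

Fact genby_subproof V (S : set V) :
  submod_set [set x | forall N : submodClosed V, (forall y, S y -> y \in N) -> x \in N].
Proof.
split=> [N _|a u v hu hv N hN]; first exact: rpred0.
by rewrite rpredD ?rpredZ ?hu ?hv.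
Qed.
Definition genby V (S : set V) : submodClosed V := mksubm (genby_subproof S).

Definition topm V : submodClosed V := genby [set: V].
Definition zerom V : submodClosed V := genby set0.

(* I N, generated by the products of elements of I and N. *)
Definition imul (I : ideal R) V (N : submodClosed V) : submodClosed V :=
  genby [set w | exists a v, [/\ a \in I, v \in N & w = a *: v]].

Fact kerm_subproof U V (f : {linear U -> V}) : submod_set [set x | f x = 0].
Proof.
by split=> [|a u v /= hu hv]; rewrite /= ?linear0 // linearP hu hv scaler0 addr0.
Qed.
Definition kerm U V (f : {linear U -> V}) : submodClosed U :=
  mksubm (kerm_subproof f).

Fact imm_subproof U V (f : {linear U -> V}) : submod_set (range f).
Proof.
split=> [|a _ _ [x _ <-] [y _ <-]]; first by exists 0; rewrite ?linear0.
by exists (a *: x + y); rewrite ?linearP.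
Qed.
Definition imm U V (f : {linear U -> V}) : submodClosed V :=
  mksubm (imm_subproof f).

Definition cokerm U V (f : {linear U -> V}) : lmodType R := quotm (imm f).

Fact subin_subproof V (N B : submodClosed V) :
  submod_set [set x : subm N | submval x \in B].
Proof.
split=> [|a u v /= hu hv] /=; first exact: rpred0.
by rewrite rpredD // rpredZ.
Qed.
(* B as a submodule of N, when B is contained in N. *)
Definition subin V (N B : submodClosed V) : submodClosed (subm N) :=
  mksubm (subin_subproof N B).

Section SubMap.
Variables (U V : lmodType R) (f : {linear U -> V}).
Variables (N : submodClosed U) (N' : submodClosed V).
Hypothesis fN : forall x, x \in N -> f x \in N'.

Definition subm_map : subm N -> subm N' :=
  fun x => Subm (fN (valP x)).
Fact subm_map_linear : linear subm_map.
Proof. by move=> a x y; apply: val_inj; rewrite /= linearP. Qed.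
HB.instance Definition _ := GRing.isLinear.Build R (subm N) (subm N') _
  subm_map subm_map_linear.

Definition quot_map of (forall x, x \in N -> f x \in N') : quotm N -> quotm N' :=
  fun q => pim N' (f (repr q)).
Lemma quot_mapE x : quot_map fN (pim N x) = pim N' (f x).
Proof.
apply/pim_eq; rewrite -linearB; apply: fN; apply/pim_eq.
by rewrite /pim reprK.
Qed.
Fact quot_map_linear : linear (quot_map fN).
Proof.
move=> a q r; case: (pim_surj q) => x ->; case: (pim_surj r) => y ->.
by rewrite -linearP !quot_mapE -linearP -linearP.
Qed.
HB.instance Definition _ := GRing.isLinear.Build R (quotm N) (quotm N') _
  (quot_map fN) quot_map_linear.
End SubMap.

End SubmoduleConstructions.

Section Hom.
Variables (R : comNzRingType).
Implicit Types U V : lmodType R.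

Fact hom_subproof U V : submod_set [set f : U -> V | linear f].
Proof.
split=> [a u v|a f g /= hf hg b u v] /=.
  by rewrite /GRing.zero /= scaler0 addr0.
rewrite !fctE hf hg !scalerDr !scalerA (mulrC a b) !addrA; congr (_ + _).
by rewrite -!addrA; congr (_ + _); rewrite addrC.
Qed.
Definition Hom U V : lmodType R := subm (mksubm (@hom_subproof U V)).

Definition homf U V (f : Hom U V) : U -> V := submval f.
Fact homf_linear U V (f : Hom U V) : linear (homf f).
Proof. exact: (elimT (mksubmP (@hom_subproof U V) _) (valP f)). Qed.
HB.instance Definition _ U V (f : Hom U V) :=
  GRing.isLinear.Build R U V _ (homf f) (homf_linear f).

Definition hom_of U V (f : {linear U -> V}) : Hom U V :=
  Subm (introT (mksubmP (@hom_subproof U V) f) (fun a u v => linearP f a u v)).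

Definition precomp U U' V (g : {linear U' -> U}) (f : Hom U V) : Hom U' V :=
  hom_of (homf f \o g).
Fact precomp_linear U U' V (g : {linear U' -> U}) : linear (@precomp U U' V g).
Proof. by move=> a x y; apply: val_inj. Qed.
HB.instance Definition _ U U' V (g : {linear U' -> U}) :=
  GRing.isLinear.Build R (Hom U V) (Hom U' V) _ (@precomp U U' V g)
    (precomp_linear g).

Definition postcomp U V V' (h : {linear V -> V'}) (f : Hom U V) : Hom U V' :=
  hom_of (h \o homf f).
Fact postcomp_linear U V V' (h : {linear V -> V'}) : linear (@postcomp U V V' h).
Proof.
by move=> a x y; apply: val_inj; apply/funext => u; rewrite /= !fctE linearP.
Qed.
HB.instance Definition _ U V V' (h : {linear V -> V'}) :=
  GRing.isLinear.Build R (Hom U V) (Hom U V') _ (@postcomp U V V' h)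
    (postcomp_linear h).

Lemma pre_postcomp U U' V V' (g : {linear U' -> U}) (h : {linear V -> V'})
  (f : Hom U V) : precomp g (postcomp h f) = postcomp h (precomp g f).
Proof. exact: val_inj. Qed.

Lemma postcomp_ker U U' V V' (g : {linear U' -> U}) (h : {linear V -> V'}) f :
  f \in kerm (@precomp U U' V g) -> postcomp h f \in kerm (@precomp U U' V' g).
Proof.
move=> /mksubmP hf; apply/mksubmP.
have {}hf : precomp g f = 0 := hf.
suff : precomp g (postcomp h f) = 0 by [].
by rewrite pre_postcomp hf linear0.
Qed.

Lemma postcomp_im U U' V V' (g : {linear U' -> U}) (h : {linear V -> V'}) f :
  f \in imm (@precomp U U' V g) -> postcomp h f \in imm (@precomp U U' V' g).
Proof.
move=> /mksubmP [k _ <-]; apply/mksubmP; exists (postcomp h k); first exact: I.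
exact: pre_postcomp.
Qed.

End Hom.

Section Ext.
Variables (R : comNzRingType).

Section Free.
Variable K : choiceType.

Fact fsupp_subproof :
  submod_set [set f : K -> R^o | finite_set [set k | f k != 0]].
Proof.
split=> /= [|a f g hf hg].
  suff -> : [set k : K | (0 : K -> R^o) k != 0] = set0 by [].
  by apply/seteqP; split=> // k; rewrite /= eqxx.
apply: (@sub_finite_set _ _ ([set k | f k != 0] `|` [set k | g k != 0])).
  move=> k /=; rewrite !fctE; case: (eqVneq (f k) 0) => [->|]; last by left.
  by rewrite scaler0 add0r; right.
by rewrite finite_setU.
Qed.

(* The free module on the set K: finitely supported functions K -> R. *)
Definition freem : lmodType R := subm (mksubm fsupp_subproof).

End Free.

Variable N : lmodType R.

Definition fsupp (f : freem N) : set N := [set k | submval f k != 0].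

Lemma fsupp_finite (f : freem N) : finite_set (fsupp f).
Proof. exact: (elimT (mksubmP (fsupp_subproof N) _) (valP f)). Qed.

Definition free_eval (f : freem N) : N := \sum_(k \in fsupp f) (submval f k : R) *: k.

Lemma free_evalE (D : set N) (f : freem N) : finite_set D -> fsupp f `<=` D ->
  free_eval f = \sum_(k \in D) (submval f k : R) *: k.
Proof.
move=> finD sD; apply: fsbig_widen => // k [_ /=] /negP; rewrite negbK => /eqP.
by rewrite /= => ->; rewrite scale0r.
Qed.

Fact free_eval_linear : linear free_eval.
Proof.
move=> a f g; pose D := fsupp f `|` fsupp g.
have finD : finite_set D by rewrite finite_setU; split; exact: fsupp_finite.
rewrite (@free_evalE D f) ?(@free_evalE D g) //; try by move=> x hx; [left + right].
rewrite (@free_evalE D (a *: f + g)) //; last first.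
  move=> k; rewrite /fsupp /= !fctE /D /fsupp /=.
  case: (eqVneq (submval f k) 0) => [->|]; last by left.
  by rewrite scaler0 add0r; right.
rewrite !fsbig_finite // scaler_sumr -big_split /=; apply: eq_bigr => k _.
by rewrite !fctE scalerDl scalerA.
Qed.
HB.instance Definition _ := GRing.isLinear.Build R (freem N) N _ free_eval free_eval_linear.

End Ext.

(* Localization at the prime p: [den] is the complement of p, [loc M] is M_p,
   [locR] is the ring R_p, and [loc M] is a module over [locR]. *)
Section Localization.
Variables (R : comNzRingType) (p : prime_idealr R).

Record den : Type := Den { dval :> R; _ : dval \notin p }.
HB.instance Definition _ := [isSub for dval].
HB.instance Definition _ := [Choice of den by <:].

Lemma den1P : 1 \notin p. Proof. by rewrite idealr1. Qed.
Definition den1 : den := Den den1P.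
Lemma denMP (s t : den) : (s : R) * (t : R) \notin p.
Proof. by rewrite prime_idealrM negb_or (valP s) (valP t). Qed.
Definition denM (s t : den) : den := Den (denMP s t).

Lemma denMC s t : denM s t = denM t s.
Proof. by apply: val_inj; rewrite /= mulrC. Qed.
Lemma denMA s t u : denM s (denM t u) = denM (denM s t) u.
Proof. by apply: val_inj; rewrite /= mulrA. Qed.
Lemma den1M s : denM den1 s = s.
Proof. by apply: val_inj; rewrite /= mul1r. Qed.

Section LocModule.
Variable M : lmodType R.

Definition loc_rel (x y : M * den) : bool :=
  `[< exists t : den, (t : R) *: ((y.2 : R) *: x.1) = (t : R) *: ((x.2 : R) *: y.1) >].

Fact loc_rel_refl : reflexive loc_rel.
Proof. by move=> x; apply/asboolP; exists den1. Qed.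
Fact loc_rel_sym : symmetric loc_rel.
Proof. by move=> x y; apply/asboolP/asboolP => -[t ht]; exists t. Qed.
Fact loc_rel_trans : transitive loc_rel.
Proof.
move=> [y s'] [x s] [z s''] /asboolP[t /= ht] /asboolP[u /= hu].
apply/asboolP; exists (denM (denM t u) s') => /=.
transitivity (((u : R) * (s'' : R)) *: ((t : R) *: ((s' : R) *: x))).
  by rewrite !scalerA; congr (_ *: _); ring.
rewrite ht.
transitivity (((t : R) * (s : R)) *: ((u : R) *: ((s'' : R) *: y))).
  by rewrite !scalerA; congr (_ *: _); ring.
by rewrite hu !scalerA; congr (_ *: _); ring.
Qed.
Canonical loc_equiv := EquivRel loc_rel loc_rel_refl loc_rel_sym loc_rel_trans.

Definition loc : Type := {eq_quot loc_equiv}.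
HB.instance Definition _ := Choice.on loc.

Definition frac (m : M) (s : den) : loc := \pi_({eq_quot loc_equiv}) (m, s).

Lemma frac_eq m s m' s' : frac m s = frac m' s' <->
  exists t : den, (t : R) *: ((s' : R) *: m) = (t : R) *: ((s : R) *: m').
Proof.
split=> [/eqP|h]; first by rewrite eqmodE => /asboolP.
by apply/eqP; rewrite eqmodE; apply/asboolP.
Qed.

Lemma frac_surj (x : loc) : exists m s, x = frac m s.
Proof. by exists (repr x).1, (repr x).2; rewrite /frac -surjective_pairing reprK. Qed.

Lemma frac_repr (x : loc) : frac (repr x).1 (repr x).2 = x.
Proof. by rewrite /frac -surjective_pairing reprK. Qed.

Lemma frac_cancel m s (u : den) : frac ((u : R) *: m) (denM u s) = frac m s.
Proof.
by apply/frac_eq; exists den1; rewrite !scale1r /= !scalerA mulrC.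
Qed.

Definition loc_add (x y : loc) : loc :=
  let: (m, s) := repr x in let: (n, t) := repr y in
  frac ((t : R) *: m + (s : R) *: n) (denM s t).
Definition loc_opp (x : loc) : loc :=
  let: (m, s) := repr x in frac (- m) s.
Definition loc_zero : loc := frac 0 den1.

Lemma loc_addE m s n t :
  loc_add (frac m s) (frac n t) = frac ((t : R) *: m + (s : R) *: n) (denM s t).
Proof.
rewrite /loc_add; move: (frac_repr (frac m s)) (frac_repr (frac n t)).
case: (repr (frac m s)) (repr (frac n t)) => [m' s'] [n' t'] /=.
move=> /frac_eq[u hu] /frac_eq[v hv]; apply/frac_eq; exists (denM u v) => /=.
rewrite !scalerDr; congr (_ + _).
  transitivity (((v : R) * (t : R) * (t' : R)) *: ((u : R) *: ((s : R) *: m'))).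
    by rewrite !scalerA; congr (_ *: _); ring.
  by rewrite hu !scalerA; congr (_ *: _); ring.
transitivity (((u : R) * (s : R) * (s' : R)) *: ((v : R) *: ((t : R) *: n'))).
  by rewrite !scalerA; congr (_ *: _); ring.
by rewrite hv !scalerA; congr (_ *: _); ring.
Qed.

Lemma loc_oppE m s : loc_opp (frac m s) = frac (- m) s.
Proof.
rewrite /loc_opp; move: (frac_repr (frac m s)).
case: (repr (frac m s)) => [m' s'] /= /frac_eq[u hu].
by apply/frac_eq; exists u; rewrite !scalerN hu.
Qed.

Fact loc_addA : associative loc_add.
Proof.
move=> x y z; case: (frac_surj x) => [m [s ->]]; case: (frac_surj y) => [n [t ->]].
case: (frac_surj z) => [k [u ->]]; rewrite !loc_addE denMA; congr frac.
rewrite !scalerDr !addrA /= !scalerA.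
by congr (_ *: _ + _ *: _ + _ *: _); ring.
Qed.
Fact loc_addC : commutative loc_add.
Proof.
move=> x y; case: (frac_surj x) => [m [s ->]]; case: (frac_surj y) => [n [t ->]].
by rewrite !loc_addE denMC addrC.
Qed.
Fact loc_add0 : left_id loc_zero loc_add.
Proof.
move=> x; case: (frac_surj x) => [m [s ->]].
by rewrite loc_addE den1M scaler0 add0r scale1r.
Qed.
Fact loc_addN : left_inverse loc_zero loc_opp loc_add.
Proof.
move=> x; case: (frac_surj x) => [m [s ->]].
rewrite loc_oppE loc_addE scalerN addNr; apply/frac_eq; exists den1.
by rewrite !scaler0.
Qed.
HB.instance Definition _ :=
  GRing.isZmodule.Build loc loc_addA loc_addC loc_add0 loc_addN.

Lemma frac_add m s n t :
  frac m s + frac n t = frac ((t : R) *: m + (s : R) *: n) (denM s t).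
Proof. exact: loc_addE. Qed.

End LocModule.

Definition loc_scale (M : lmodType R) (a : loc R^o) (x : loc M) : loc M :=
  let: (r, s) := repr a in let: (m, t) := repr x in
  frac ((r : R) *: m) (denM s t).

Lemma loc_scaleE (M : lmodType R) (r : R^o) s (m : M) t :
  loc_scale (frac r s) (frac m t) = frac ((r : R) *: m) (denM s t).
Proof.
rewrite /loc_scale; move: (frac_repr (frac r s)) (frac_repr (frac m t)).
case: (repr (frac r s)) (repr (frac m t)) => [r' s'] [m' t'] /=.
move=> /frac_eq[u hu] /frac_eq[v hv]; apply/frac_eq; exists (denM u v) => /=.
transitivity (((u : R) * ((s : R) * (r' : R))) *: ((v : R) *: ((t : R) *: m'))).
  by rewrite !scalerA; congr (_ *: _); ring.
rewrite hv; have -> : (u : R) * ((s : R) * (r' : R)) = (u : R) * ((s' : R) * (r : R)) := hu.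
by rewrite !scalerA; congr (_ *: _); ring.
Qed.

Section LocScaleTheory.
Variable M : lmodType R.
Fact loc_scaleA (a b : loc R^o) (x : loc M) :
  loc_scale a (loc_scale b x) = loc_scale (loc_scale a b) x.
Proof.
case: (frac_surj a) => [r [s ->]]; case: (frac_surj b) => [q [t ->]].
by case: (frac_surj x) => [m [u ->]]; rewrite !loc_scaleE denMA scalerA.
Qed.
Fact loc_scale1 : left_id (frac (1 : R^o) den1) (@loc_scale M).
Proof.
by move=> x; case: (frac_surj x) => [m [u ->]]; rewrite loc_scaleE den1M scale1r.
Qed.
Fact loc_scaleDr : right_distributive (@loc_scale M) +%R.
Proof.
move=> a x y; case: (frac_surj a) => [r [s ->]].
case: (frac_surj x) => [m [t ->]]; case: (frac_surj y) => [n [u ->]].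
rewrite !frac_add !loc_scaleE frac_add.
rewrite -[LHS](frac_cancel _ _ s); congr frac.
  by rewrite !scalerDr !scalerA /=; congr (_ *: _ + _ *: _); ring.
by apply: val_inj; rewrite /=; ring.
Qed.
Fact loc_scaleDl (x : loc M) : {morph (@loc_scale M)^~ x : a b / a + b}.
Proof.
move=> a b; case: (frac_surj a) => [r [s ->]]; case: (frac_surj b) => [q [t ->]].
case: (frac_surj x) => [m [u ->]].
rewrite !frac_add !loc_scaleE frac_add.
rewrite -[LHS](frac_cancel _ _ u); congr frac.
  rewrite scalerDl scalerDr !scalerA /=; congr (_ *: _ + _ *: _).
    by rewrite /GRing.scale /=; ring.
  by rewrite /GRing.scale /=; ring.
by apply: val_inj; rewrite /=; ring.
Qed.
End LocScaleTheory.

Fact loc_scaleC : commutative (@loc_scale R^o).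
Proof.
move=> a b; case: (frac_surj a) => [r [s ->]]; case: (frac_surj b) => [q [t ->]].
by rewrite !loc_scaleE denMC; congr frac; exact: mulrC.
Qed.
Fact loc_one_neq0 : frac (1 : R^o) den1 != 0.
Proof.
apply/eqP => /frac_eq[t]; rewrite !scale1r scaler0 => t0.
have := valP t; rewrite /= -[dval t]mulr1 [X in X \notin _]t0.
by rewrite idealr0.
Qed.

Definition locR : Type := loc R^o.
HB.instance Definition _ := GRing.Zmodule.on locR.
HB.instance Definition _ := GRing.Zmodule_isComNzRing.Build locR
  (@loc_scaleA R^o) loc_scaleC (@loc_scale1 R^o)
  (fun a b x => @loc_scaleDl R^o x a b) loc_one_neq0.

HB.instance Definition _ (M : lmodType R) :=
  GRing.Zmodule_isLmodule.Build locR (loc M)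
    (@loc_scaleA M) (@loc_scale1 M) (@loc_scaleDr M) (@loc_scaleDl M).

End Localization.

Section ExtModules.
Variables (R : comNzRingType).
Implicit Types N M : lmodType R.

(* The canonical free resolution of N: syz N 0 is N, the n-th term is the free
   module on the underlying set of syz N n, and syz N n.+1 is the kernel of the
   evaluation map from that free module onto syz N n. *)
Fixpoint syz N (n : nat) : lmodType R :=
  if n is m.+1 then subm (kerm (@free_eval R (syz N m))) else N.

Definition resol N (n : nat) : lmodType R := freem R (syz N n).

Definition resol_d N (n : nat) : {linear resol N n.+1 -> resol N n} :=
  @submval _ _ (kerm (@free_eval R (syz N n))) \o @free_eval R (syz N n.+1).

Definition cocycle N M (n : nat) : submodClosed (Hom (resol N n) M) :=
  kerm (@precomp R _ _ M (resol_d N n)).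

Definition cobound N M (n : nat) : submodClosed (Hom (resol N n) M) :=
  match n with
  | 0 => zerom (Hom (resol N 0) M)
  | m.+1 => imm (@precomp R _ _ M (resol_d N m))
  end.

(* H^n(Hom(resol N, M)) *)
Definition Ext (n : nat) N M : lmodType R :=
  quotm (subin (cocycle N M n) (cobound N M n)).

Section ExtMap.
Variables (N M M' : lmodType R) (h : {linear M -> M'}) (n : nat).

Fact postcomp_cocycle (f : Hom (resol N n) M) :
  f \in cocycle N M n -> postcomp h f \in cocycle N M' n.
Proof. exact: postcomp_ker. Qed.

Fact postcomp_cobound (f : Hom (resol N n) M) :
  f \in cobound N M n -> postcomp h f \in cobound N M' n.
Proof.
case: n f => [|m] f; last exact: postcomp_im.
move=> /mksubmP /(_ (kerm (@postcomp R (resol N 0) _ _ h))) hf.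
have /mksubmP /= -> : f \in kerm (@postcomp R (resol N 0) _ _ h) by apply: hf.
exact: rpred0.
Qed.

Definition cocycle_map : {linear subm (cocycle N M n) -> subm (cocycle N M' n)} :=
  subm_map postcomp_cocycle.

Fact cocycle_map_cobound (x : subm (cocycle N M n)) :
  x \in subin (cocycle N M n) (cobound N M n) ->
  cocycle_map x \in subin (cocycle N M' n) (cobound N M' n).
Proof. by move=> /mksubmP hx; apply/mksubmP; exact: postcomp_cobound. Qed.

Definition Ext_map : {linear Ext n N M -> Ext n N M'} :=
  quot_map cocycle_map_cobound.
End ExtMap.

End ExtModules.

Section Restriction.
Variables (R S : comNzRingType) (f : {rmorphism R -> S}).

(* Restriction of scalars along f. *)
Definition restr of {rmorphism R -> S} := fun M : lmodType S => M : Type.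
Section RestrModule.
Variable M : lmodType S.
HB.instance Definition _ := GRing.Zmodule.on (restr f M).
Definition restr_scale (a : R) (x : restr f M) : restr f M := f a *: (x : M).
Fact restr_scaleA a b x : restr_scale a (restr_scale b x) = restr_scale (a * b) x.
Proof. by rewrite /restr_scale scalerA rmorphM. Qed.
Fact restr_scale1 : left_id 1 restr_scale.
Proof. by move=> x; rewrite /restr_scale rmorph1 scale1r. Qed.
Fact restr_scaleDr : right_distributive restr_scale +%R.
Proof. by move=> a x y; exact: scalerDr. Qed.
Fact restr_scaleDl x : {morph restr_scale^~ x : a b / a + b}.
Proof. by move=> a b; rewrite /restr_scale rmorphD scalerDl. Qed.
HB.instance Definition _ := GRing.Zmodule_isLmodule.Build R (restr f M)
  restr_scaleA restr_scale1 restr_scaleDr restr_scaleDl.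
End RestrModule.

Definition restr_fun (M M' : lmodType S) (g : {linear M -> M'}) :
  restr f M -> restr f M' := g.
Fact restr_fun_linear (M M' : lmodType S) (g : {linear M -> M'}) : linear (restr_fun g).
Proof. by move=> a x y; exact: linearP. Qed.
HB.instance Definition _ (M M' : lmodType S) (g : {linear M -> M'}) :=
  GRing.isLinear.Build R (restr f M) (restr f M') _ (restr_fun g) (restr_fun_linear g).

Definition restr_map (M M' : lmodType S) (g : {linear M -> M'}) :
  {linear restr f M -> restr f M'} := restr_fun g.

End Restriction.

Section Torsion.
Variable O : idomainType.
Implicit Types U V : lmodType O.

Fact tors_subproof U : submod_set [set u : U | exists2 s : O, s != 0 & s *: u = 0].
Proof.
split=> [|a u v [s s0 su] [t t0 tv]] /=; first by exists 1; rewrite ?oner_neq0 ?scaler0.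
exists (s * t); first by rewrite mulf_neq0.
rewrite scalerDr !scalerA (_ : s * t * a = (t * a) * s); last by ring.
by rewrite -!scalerA su tv !scaler0 addr0.
Qed.
Definition tors U : submodClosed U := mksubm (tors_subproof U).

Definition tf U : lmodType O := quotm (tors U).

Fact tors_map U V (f : {linear U -> V}) x : x \in tors U -> f x \in tors V.
Proof.
move=> /mksubmP[s s0 sx]; apply/mksubmP; exists s => //.
by rewrite -linearZ sx linear0.
Qed.
Definition tf_map U V (f : {linear U -> V}) : {linear tf U -> tf V} :=
  quot_map (tors_map f).
End Torsion.

Section Invariants.
Variable R : comNzRingType.
Implicit Types (V : lmodType R) (I m : ideal R).

Definition isom V (W : lmodType R) : Prop := exists f : {linear V -> W}, bijective f.

(* The junk value 0 is only used for modules which are not free of finite rank. *)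
Definition rank V : nat := xget 0%N [set n | isom V 'rV[R]_n].

Definition sub_chain V (n : nat) : Prop :=
  exists N : nat -> submodClosed V, forall i, (i < n)%N ->
    {subset N i <= N i.+1} /\ ~ {subset N i.+1 <= N i}.

(* The junk value 0 is only used for modules of infinite length. *)
Definition length V : nat :=
  xget 0%N [set n | sub_chain V n /\ ~ sub_chain V n.+1].

Definition prime_chain (n : nat) : Prop :=
  exists P : nat -> prime_idealr R, forall i, (i < n)%N ->
    {subset P i <= P i.+1} /\ ~ {subset P i.+1 <= P i}.

Definition krull_dim (d : nat) : Prop := prime_chain d /\ ~ prime_chain d.+1.

Definition finitely_generated V : Prop :=
  exists s : seq V, forall v, v \in genby [set x | x \in s].

Definition idgen (s : seq R) : ideal R := @genby R R^o [set x | x \in s].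

Definition noetherian : Prop := forall I, exists s, I =i idgen s.

Definition maximal_ideal m : Prop :=
  1 \notin m /\ forall I, 1 \notin I -> {subset m <= I} -> I =i m.

Definition local m : Prop := maximal_ideal m /\ forall m', maximal_ideal m' -> m' =i m.

(* m^n V *)
Definition ipow m V (n : nat) : submodClosed V := iter n (@imul R m V) (topm V).

(* The canonical map R -> lim_n R/m^n is bijective. *)
Definition adic_complete m : Prop :=
  forall a : nat -> R, (forall n, a n.+1 - a n \in ipow m R^o n) ->
    exists! l : R, forall n, l - a n \in ipow m R^o n.

(* Regular local of Krull dimension d. *)
Definition regular_local (d : nat) : Prop :=
  noetherian /\ krull_dim d /\
  exists m, local m /\ exists s, size s = d /\ m =i idgen s.

Definition regular_seq V (s : seq R) : Prop :=
  (forall i, (i < size s)%N -> forall v : V,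
     s`_i *: v \in imul (idgen (take i s)) (topm V) ->
     v \in imul (idgen (take i s)) (topm V)) /\
  exists v : V, v \notin imul (idgen s) (topm V).

(* depth V >= n, the depth being the supremum of the lengths of V-regular
   sequences in m. *)
Definition depth_ge m V (n : nat) : Prop :=
  exists s : seq R, [/\ (n <= size s)%N, {subset s <= m} & regular_seq V s].

(* The Hilbert-Samuel multiplicity d! * lim_n length(V/m^n V)/n^d, d = dim R,
   read off the Hilbert-Samuel polynomial P. *)
Definition is_multiplicity m V (e : rat) : Prop :=
  exists d (P : {poly rat}) n0,
    [/\ krull_dim d,
        forall n, (n0 <= n)%N -> (length (quotm (ipow m V n)))%:R = P.[n%:R]
      & e = (d`!)%:R * P`_d].

Definition multiplicity m V : rat := xget 0 [set e | is_multiplicity m V e].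

End Invariants.

Definition complete_intersection (A : comNzRingType) : Prop :=
  exists (Q : comNzRingType) (f : {rmorphism Q -> A}) (s : seq Q),
    [/\ exists d, regular_local Q d,
        forall a, exists q, f q = a,
        regular_seq Q^o s
      & forall q, f q = 0 <-> q \in idgen s].

(* A local principal ideal domain which is not a field. *)
Definition dvr (O : idomainType) : Prop :=
  (forall I : ideal O, exists x, I =i idgen [:: x]) /\
  exists2 m : ideal O, local m & exists2 x : O, x != 0 & x \in m.

Definition uniformizer (O : idomainType) (w : O) : Prop :=
  exists2 m : ideal O, local m & m =i idgen [:: w].

Section Augmentation.
Variables (O : idomainType) (A : comAlgType O) (lam : {rmorphism A -> O}).

Definition ker_pred of {rmorphism A -> O} : A -> bool := fun a => lam a == 0.

Fact ker_pred_idealr : idealr_closed (ker_pred lam).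
Proof.
split=> [||a u v]; rewrite !unfold_in ?rmorph0 ?rmorph1 ?oner_eq0 //.
by move=> /eqP hu /eqP hv; rewrite rmorphD rmorphM hu hv mulr0 addr0.
Qed.
HB.instance Definition _ := isIdealr.Build A (ker_pred lam) ker_pred_idealr.
Fact ker_pred_prime : prime_idealr_closed (ker_pred lam).
Proof. by move=> u v; rewrite !unfold_in rmorphM mulf_eq0. Qed.
HB.instance Definition _ := isPrimeIdealrClosed.Build A (ker_pred lam) ker_pred_prime.

(* Ker lam, as a prime ideal (kerP) and as a submodule of A (kerI). *)
Definition kerP : prime_idealr A := PrimeIdealr.clone A (ker_pred lam) _.

Fact kerI_subproof : @submod_set A A^o [set a | lam a = 0].
Proof.
split=> [|a u v /= hu hv]; first exact: rmorph0.
by rewrite /= rmorphD rmorphM hu hv mulr0 addr0.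
Qed.
Definition kerI : ideal A := mksubm kerI_subproof.

(* (A, lam) is an object of C_O(c) and m is the maximal ideal of A. The equation
   lam x%:A = x says that the ring morphism lam is O-linear. *)
Definition in_CO (m : ideal A) (c : nat) : Prop :=
  [/\ noetherian A, local m & adic_complete m] /\
  [/\ forall x : O, lam x%:A = x, forall x : O, exists a, lam a = x
    & regular_local (locR kerP) c].

(* O as an A-module via lam. *)
Definition augmod : lmodType A := restr lam O^o.

Definition over_base (M : lmodType A) : lmodType O := restr (in_alg A) M.

(* tors(p/p^2), where p^2 is the submodule p p of the A-module p. *)
Definition Phi : lmodType O :=
  subm (tors (over_base (quotm (imul kerI (topm (subm kerI)))))).

(* M / p_A M *)
Definition modp (M : lmodType A) : lmodType A := quotm (imul kerI (topm M)).

Definition congr_map (c : nat) (M : lmodType A) :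
  {linear tf (over_base (Ext c augmod M)) ->
          tf (over_base (Ext c augmod (modp M)))} :=
  tf_map (restr_map (in_alg A)
            (Ext_map augmod (@pim A M (imul kerI (topm M))) c)).

Definition Psi (c : nat) (M : lmodType A) : lmodType O := cokerm (congr_map c M).

(* Phi and Psi c M are of finite length for (A, lam) in C_O(c) and M finitely
   generated, so the junk value of [length] does not occur. *)
Definition wiles_defect (c : nat) (M : lmodType A) : int :=
  (rank (loc kerP M) * length Phi)%:Z - (length (Psi c M))%:Z.

End Augmentation.

(* Main.v *)
From HB Require Import structures.
Require Import Defs.
From mathcomp Require Import all_boot all_order all_algebra.
From mathcomp Require Import mathcomp_extra boolp classical_sets functions.
From mathcomp Require Import cardinality fsbigop ring zify.

Set Implicit Arguments.
Unset Strict Implicit.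
Unset Printing Implicit Defensive.

Import GRing.Theory.
Local Open Scope ring_scope.

(** Write [p] for the kernel of [lam], and let the cotangent module [p / p^2] be the
    sum of a free [O]-module, of rank [c], and of the [O / w ^ k_i], so that
    [length Phi] is [K = sum_i k_i].

    The congruence module is first freed from [Ext]. Since [depth M > c], generators
    [x] of the free part can be chosen to form an [M]-regular sequence in [p] such
    that [M / xM] still has positive depth ([setup]). Every element of [p] acts
    null-homotopically on a resolution of [O]; composing the homotopies of the [x_i]
    identifies [Ext^c(O, M)] with the elements of [M / xM] killed by [p], and, up to
    torsion, [Ext^c(O, M / pM)] with [M / pM]. Hence [Psi] is the cokernel of the map
    from the former to [X = (M / pM)^tf], which is free of rank [mu] ([Psi_isom]).

    The relations [w ^ k_i y_i = sum_j q_ij y_j], with [q_ij] in [p], of the torsion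
    part give by Cramer's rule a determinant [a0] with [a0 p <= (x)] and
    [lam a0 = w ^ K]. So the image of the elements killed by [p] contains [w ^ K X],
    whose colength [mu K] is the first term of the defect. Therefore the defect is
    nonnegative, and it vanishes if and only if this image is [w ^ K X]
    ([defect_char]).

    Suppose that it vanishes. By completeness [A] is a quotient of a power series ring
    [S] over [O] ([cohen]), in which the relations above lift to elements [f] of the
    kernel. Together with [x] and one more [M]-regular element they have the form
    [G z], for the regular sequence [z] of the variables and [w]. By Wiebe's theorem
    on the socle of such a quotient ([wiebe], [det_notin_param]), the vanishing says
    that [f] and the [M]-regular sequence form a parameter sequence, modulo which [M]
    contains a free module of rank [mu] over a self-injective artinian ring. This
    splits off and the splitting lifts along the regular sequence
    ([free_summand_criterion]), so that [M] has a free summand over [S / (f)]. As [M]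
    is an [A]-module, [A = S / (f)]; the complement [W] of [A ^ mu] vanishes at [p]
    ([retraction_splits]).

    Conversely, let [A] be the quotient of a regular ring [Q] by a regular sequence
    [s]. The kernel of [Q -> O] is generated by a regular sequence [u], and [(s, x)] is
    [G u] for a matrix whose determinant is divisible by [w ^ K] at [lam]. By Wiebe's
    theorem the elements of [A / xA] killed by [p] are multiples of [det G], up to
    multiples of [w ^ K] ([ci_torsion]), so the condition for vanishing holds for [A]
    and hence for [A ^ mu + W].

    For the last claim, [A] and [W] are shown to have Hilbert-Samuel polynomials, by
    counting standard monomials ([hilbert_samuel]). Multiplicity is additive, and
    positive for a nonzero [W] since [W] is a summand of [M], on which a parameter
    sequence of [A] is regular ([hilbert_samuel_pos]). So the bound on the
    multiplicity of [M] forces [W = 0]. *)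

(** * Submodules, generation and the noetherian condition *)

Section Submodules.
Variables (R : comNzRingType) (V : lmodType R).
Implicit Types (N K : submodClosed V) (s : seq V) (q : seq R).

Lemma inmk (S : set V) (hS : submod_set S) x : (x \in mksubm hS) <-> S x.
Proof. by split=> /mksubmP. Qed.

Lemma subm_opp N x : x \in N -> - x \in N.
Proof. by rewrite -scaleN1r => h; exact: rpredZ. Qed.

Lemma subm_sub N x y : x \in N -> y \in N -> x - y \in N.
Proof. by move=> hx hy; apply: rpredD => //; exact: subm_opp. Qed.

Lemma subm_eqmod N x y : x - y \in N -> (x \in N) = (y \in N).
Proof.
move=> h; apply/idP/idP => h'; last by rewrite -(subrK y x) rpredD.
by rewrite -(subKr x y) subm_sub.
Qed.

Definition sle N K := forall x, x \in N -> x \in K.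

Lemma sle_refl N : sle N N. Proof. by []. Qed.
Lemma sle_trans K N L : sle N K -> sle K L -> sle N L.
Proof. by move=> h k x /h /k. Qed.

Lemma in_zerom x : x \in zerom V <-> x = 0.
Proof.
split=> [/mksubmP h|->]; last exact: rpred0.
have h0 : submod_set [set y : V | y = 0].
  by split=> //= a u v -> ->; rewrite scaler0 addr0.
by move: (h (mksubm h0)) => /(_ (fun _ F => False_ind _ F)) /mksubmP.
Qed.

Lemma in_topm x : x \in topm V.
Proof. by apply/mksubmP=> N; apply. Qed.

Lemma zerom_sle N : sle (zerom V) N.
Proof. by move=> x /in_zerom ->; exact: rpred0. Qed.

Lemma genby_sle (S : set V) K : (forall x, S x -> x \in K) -> sle (genby S) K.
Proof. by move=> h x /mksubmP; apply. Qed.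

Lemma in_genby (S : set V) x : S x -> x \in genby S.
Proof. by move=> h; apply/mksubmP=> N; apply. Qed.

Fact addv_subproof N v : submod_set [set x | exists a : R, x - a *: v \in N].
Proof.
split=> [|a x y /= [b hb] [c hc]]; first by exists 0; rewrite scale0r subr0 rpred0.
exists (a * b + c); rewrite scalerDl -scalerA opprD addrACA -scalerBr.
by rewrite rpredD ?rpredZ.
Qed.
Definition addv N v := mksubm (addv_subproof N v).

Lemma in_addv N v x : x \in addv N v <-> exists a : R, x - a *: v \in N.
Proof. exact: inmk. Qed.

Fixpoint addvs N s := if s is v :: s' then addvs (addv N v) s' else N.

Fact adds_subproof N a : submod_set [set x | exists v : V, x - a *: v \in N].
Proof.
split=> [|b x y /= [v hv] [w hw]]; first by exists 0; rewrite scaler0 subr0 rpred0.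
exists (b *: v + w); rewrite scalerDr scalerA mulrC -scalerA opprD addrACA.
by rewrite -scalerBr rpredD ?rpredZ.
Qed.
(** The submodule [N + a V]; [addseq N q] below is [N + q_1 V + ... + q_n V]. *)
Definition adds N a := mksubm (adds_subproof N a).

Lemma in_adds N a x : x \in adds N a <-> exists v : V, x - a *: v \in N.
Proof. exact: inmk. Qed.

Fixpoint addseq N q := if q is a :: q' then addseq (adds N a) q' else N.

Fact addm_subproof N K : submod_set [set x | exists2 y, y \in N & x - y \in K].
Proof.
split=> [|b x y /= [v hv hv'] [w hw hw']]; first by exists 0; rewrite ?subr0 rpred0.
exists (b *: v + w); first by rewrite rpredD ?rpredZ.
by rewrite opprD addrACA -scalerBr rpredD ?rpredZ.
Qed.
Definition addm N K := mksubm (addm_subproof N K).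

Lemma in_addm N K x : x \in addm N K <-> exists2 y, y \in N & x - y \in K.
Proof. exact: inmk. Qed.

Fact capm_subproof N K : submod_set [set x | x \in N /\ x \in K].
Proof.
split=> [|b x y /= [v hv] [w hw]]; first by split; exact: rpred0.
by split; rewrite rpredD ?rpredZ.
Qed.
Definition capm N K := mksubm (capm_subproof N K).

Fact colon_subproof N (a : R) : submod_set [set x | a *: x \in N].
Proof.
split=> [|b x y /= hx hy] /=; first by rewrite scaler0 rpred0.
by rewrite scalerDr scalerA mulrC -scalerA rpredD // rpredZ.
Qed.
Definition colon N a := mksubm (colon_subproof N a).

Fact annv_subproof N (v : V) : @submod_set R R^o [set a | (a : R) *: v \in N].
Proof.
split=> [|b x y /= hx hy] /=; first by rewrite scale0r rpred0.
by rewrite scalerDl -scalerA rpredD // rpredZ.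
Qed.
Definition annv N v : ideal R := mksubm (annv_subproof N v).

Lemma in_annv N v (a : R) : a \in annv N v <-> a *: v \in N.
Proof. exact: iff_sym (rwP (mksubmP (annv_subproof N v) a)). Qed.

Lemma sle_addv N v : sle N (addv N v).
Proof. by move=> x hx; apply/in_addv; exists 0; rewrite scale0r subr0. Qed.

Lemma mem_addv N v : v \in addv N v.
Proof. by apply/in_addv; exists 1; rewrite scale1r subrr rpred0. Qed.

Lemma addv_min N K v : sle N K -> v \in K -> sle (addv N v) K.
Proof.
move=> h hv x /in_addv[a /h hx].
by rewrite -(subrK (a *: v) x) rpredD ?rpredZ.
Qed.

Lemma addv_mono N K v : sle N K -> sle (addv N v) (addv K v).
Proof. by move=> h x /in_addv[a /h ha]; apply/in_addv; exists a. Qed.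

Lemma sle_addvs N s : sle N (addvs N s).
Proof.
elim: s N => [|v s IH] N //=.
exact: sle_trans (@sle_addv _ _) (IH _).
Qed.

Lemma mem_addvs N s x : x \in s -> x \in addvs N s.
Proof.
elim: s N => [|v s IH] N //=; rewrite inE => /orP[/eqP ->|]; last exact: IH.
by apply: (@sle_addvs _ s); exact: mem_addv.
Qed.

Lemma addvs_min N K s : sle N K -> (forall x, x \in s -> x \in K) -> sle (addvs N s) K.
Proof.
elim: s N => [|v s IH] N //= h hs; apply: IH.
  by apply: addv_min => //; apply: hs; rewrite inE eqxx.
by move=> x hx; apply: hs; rewrite inE hx orbT.
Qed.

Lemma addvs_mono N K s : sle N K -> sle (addvs N s) (addvs K s).
Proof. by elim: s N K => [|v s IH] N K //= h; apply: IH; apply: addv_mono. Qed.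

Lemma addvs_cat N s1 s2 : addvs N (s1 ++ s2) = addvs (addvs N s1) s2.
Proof. by elim: s1 N => //= v s1 IH N; rewrite IH. Qed.

Lemma in_addvs_cons N v s x :
  x \in addvs N (v :: s) <-> exists a : R, x - a *: v \in addvs N s.
Proof.
split=> [h|[a ha]].
  apply/in_addv; apply: (@addvs_min N (addv (addvs N s) v) (v :: s)) h.
    exact: sle_trans (@sle_addvs N s) (@sle_addv _ _).
  move=> y; rewrite inE => /orP[/eqP ->|hy]; first exact: mem_addv.
  by apply: sle_addv; apply: mem_addvs.
rewrite -(subrK (a *: v) x) rpredD // ?rpredZ //; last exact/mem_addvs/mem_head.
by apply: (@addvs_mono N (addv N v)) ha; exact: sle_addv.
Qed.

Lemma in_addvs N s x : x \in addvs N s <->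
  exists c : nat -> R, x - \sum_(i < size s) c i *: s`_i \in N.
Proof.
split; last first.
  case=> c hc; rewrite -(subrK (\sum_(i < size s) c i *: s`_i) x) rpredD //.
    exact: sle_addvs hc.
  by apply: rpred_sum => i _; rewrite rpredZ // mem_addvs // mem_nth.
elim: s N => [|v s IH] N /= hx; first by exists (fun=> 0); rewrite big_ord0 subr0.
have [c /in_addv[a ha]] := IH _ hx.
exists (fun i => if i is j.+1 then c j else a).
by rewrite big_ord_recl /= opprD addrA (addrAC x).
Qed.

Lemma sle_adds N a : sle N (adds N a).
Proof. by move=> x hx; apply/in_adds; exists 0; rewrite scaler0 subr0. Qed.

Lemma mem_adds N a v : a *: v \in adds N a.
Proof. by apply/in_adds; exists v; rewrite subrr rpred0. Qed.

Lemma adds_min N K a : sle N K -> (forall v, a *: v \in K) -> sle (adds N a) K.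
Proof.
move=> h hv x /in_adds[v /h hx].
by rewrite -(subrK (a *: v) x) rpredD ?hv.
Qed.

Lemma adds_mono N K a : sle N K -> sle (adds N a) (adds K a).
Proof. by move=> h x /in_adds[v /h hv]; apply/in_adds; exists v. Qed.

Lemma sle_addseq N q : sle N (addseq N q).
Proof.
elim: q N => [|a q IH] N //=.
exact: sle_trans (@sle_adds _ _) (IH _).
Qed.

Lemma mem_addseq N q a v : a \in q -> a *: v \in addseq N q.
Proof.
elim: q N => [|b q IH] N //=; rewrite inE => /orP[/eqP ->|]; last exact: IH.
by apply: (@sle_addseq _ q); exact: mem_adds.
Qed.

Lemma addseq_min N K q : sle N K -> (forall a v, a \in q -> a *: v \in K) ->
  sle (addseq N q) K.
Proof.
elim: q N => [|a q IH] N //= h hs; apply: IH.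
  by apply: adds_min => // v; apply: hs; rewrite inE eqxx.
by move=> b v hb; apply: hs; rewrite inE hb orbT.
Qed.

Lemma addseq_mono N K q : sle N K -> sle (addseq N q) (addseq K q).
Proof. by elim: q N K => [|v s IH] N K //= h; apply: IH; apply: adds_mono. Qed.

Lemma addseq_cat N q1 q2 : addseq N (q1 ++ q2) = addseq (addseq N q1) q2.
Proof. by elim: q1 N => //= v s1 IH N; rewrite IH. Qed.

Lemma addseq_rcons N q a : addseq N (rcons q a) = adds (addseq N q) a.
Proof. by rewrite -cats1 addseq_cat. Qed.

Lemma addseq_sub N q1 q2 : {subset q1 <= q2} -> sle (addseq N q1) (addseq N q2).
Proof.
move=> h; apply: addseq_min; first exact: sle_addseq.
by move=> a v /h ha; apply: mem_addseq.
Qed.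

Lemma in_addseq N q x : x \in addseq N q <->
  exists v : nat -> V, x - \sum_(i < size q) q`_i *: v i \in N.
Proof.
split; last first.
  case=> c hc; rewrite -(subrK (\sum_(i < size q) q`_i *: c i) x) rpredD //.
    exact: sle_addseq hc.
  by apply: rpred_sum => i _; rewrite mem_addseq // mem_nth.
elim: q N => [|v s IH] N /= hx; first by exists (fun=> 0); rewrite big_ord0 subr0.
have [c /in_adds[a ha]] := IH _ hx.
exists (fun i => if i is j.+1 then c j else a).
by rewrite big_ord_recl /= opprD addrA (addrAC x).
Qed.

Lemma sle_addml N K : sle N (addm N K).
Proof. by move=> x hx; apply/in_addm; exists x; rewrite ?subrr ?rpred0. Qed.

Lemma sle_addmr N K : sle K (addm N K).
Proof. by move=> x hx; apply/in_addm; exists 0; rewrite ?subr0 ?rpred0. Qed.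

Lemma addm_min N K L : sle N L -> sle K L -> sle (addm N K) L.
Proof.
by move=> h k x /in_addm[y /h hy /k hxy]; rewrite -(subrK y x) rpredD.
Qed.

Definition noethm := forall N, exists s, (forall x, x \in s -> x \in N) /\
  sle N (addvs (zerom V) s).

Lemma noethm_chain (C : nat -> submodClosed V) : noethm ->
  (forall n, sle (C n) (C n.+1)) -> exists n, forall k, sle (C k) (C n).
Proof.
move=> hV hC.
have mono i j : (i <= j)%N -> sle (C i) (C j).
  elim: j => [|j IH]; first by rewrite leqn0 => /eqP ->.
  by rewrite leq_eqVlt => /orP[/eqP -> //|/IH h]; exact: sle_trans h (hC j).
have hU : submod_set [set x | exists n, x \in C n].
  split=> [|a u v [i hi] [j hj]] /=; first by exists 0%N; rewrite rpred0.
  exists (maxn i j); rewrite rpredD ?rpredZ //.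
    exact: (mono _ _ (leq_maxl i j)).
  exact: (mono _ _ (leq_maxr i j)).
have [s [hs1 hs2]] := hV (mksubm hU).
suff [n hn] : exists n, forall x, x \in s -> x \in C n.
  exists n => k x hx.
  apply: (@addvs_min (zerom V) (C n) s (@zerom_sle _) hn).
  by apply: hs2; apply/mksubmP; exists k.
elim: s {hs2} hs1 => [|v s IH] h; first by exists 0%N.
have [|n hn] := IH; first by move=> x hx; apply: h; rewrite inE hx orbT.
have /mksubmP[k hk] := h v (mem_head _ _).
exists (maxn n k) => x; rewrite inE => /orP[/eqP ->|/hn].
  exact: (mono _ _ (leq_maxr n k)).
exact: (mono _ _ (leq_maxl n k)).
Qed.

Lemma noethm_max (P : submodClosed V -> Prop) N0 : noethm -> P N0 ->
  exists N, [/\ P N, sle N0 N & forall K, P K -> sle N K -> sle K N].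
Proof.
move=> hV h0; apply: contrapT => hno.
pose T := {N | P N /\ sle N0 N}.
have step (t : T) : {t' : T | sle (sval t) (sval t') /\ ~ sle (sval t') (sval t)}.
  apply: cid; apply: contrapT => h1; apply: hno; exists (sval t).
  case: t h1 => N [/= hN hN0] h1; split=> // K hK hNK; apply: contrapT => h2.
  by apply: h1; exists (exist _ K (conj hK (sle_trans hN0 hNK))).
pose C := fix C n : T := if n is k.+1 then sval (step (C k)) else
  exist _ N0 (conj h0 (@sle_refl N0)).
have [|n hn] := @noethm_chain (fun n => sval (C n)) hV.
  by move=> n; exact: (svalP (step (C n))).1.
by apply: (svalP (step (C n))).2; exact: (hn n.+1).
Qed.

Lemma noethm_ind (P : submodClosed V -> Prop) : noethm ->
  (forall N, (forall K, sle N K -> ~ sle K N -> P K) -> P N) -> forall N, P N.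
Proof.
move=> hV h N; apply: contrapT => hN.
have [K [hK _ hmax]] := @noethm_max (fun N => ~ P N) N hV hN.
apply: hK; apply: h => L hL hLK; apply: contrapT => hPL.
by apply: hLK; exact: hmax.
Qed.

End Submodules.

Arguments sle_trans {R V K N L}.

Lemma subm_ext (R : comNzRingType) (V : lmodType R) (N K : submodClosed V) :
  sle N K -> sle K N -> N = K.
Proof.
move=> h1 h2.
have e : GRing.SubmodClosed.sort N = GRing.SubmodClosed.sort K.
  by apply/funext => x; apply/idP/idP => [/h1|/h2].
case: N K e {h1 h2} => f cf [g cg] /= e; case: _ / e cg => cg.
congr GRing.SubmodClosed.Pack; case: cf cg => [[a] [b]] [[c] [d]].
by rewrite (Prop_irrelevance a c) (Prop_irrelevance b d).
Qed.

Section Noetherian.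
Variable R : comNzRingType.

Lemma idgenE (s : seq R) : idgen s =i @addvs R R^o (zerom R^o) s.
Proof.
move=> x; apply/idP/idP => h.
  apply: (@genby_sle R R^o [set x | x \in s] _ _ x h) => y /= hy.
  exact: (@mem_addvs R R^o).
apply: (@addvs_min R R^o (zerom R^o) _ s _ _ x h); first exact: zerom_sle.
by move=> y hy; apply: (@in_genby R R^o).
Qed.

Lemma noetherian_noethm : noetherian R <-> noethm R^o.
Proof.
split=> h I.
  case: (h I) => s hs; exists s; split=> [x hx|x hx].
    have -> : (x \in I) = (x \in idgen s) by exact: hs.
    exact: (@in_genby R R^o).
  by have : x \in idgen s by [rewrite -hs]; rewrite idgenE.
case: (h I) => s [hs1 hs2]; exists s => x; rewrite idgenE; apply/idP/idP => hx; first exact: hs2.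
by apply: (@addvs_min R R^o (zerom R^o) _ s _ hs1 x hx); exact: zerom_sle.
Qed.

(** Only the leading coefficients need to be controlled: those of the elements
    of [N] with respect to one generator form an ideal. *)
Lemma noethm_fg (V : lmodType R) : noetherian R -> finitely_generated V -> noethm V.
Proof.
move=> hR [s hs] N.
have {}hs : sle (topm V) (addvs (zerom V) s).
  move=> v _; apply: genby_sle (hs v) => x /= hx; exact: mem_addvs.
suff h : forall N, sle N (addvs (zerom V) s) -> exists t,
    (forall x, x \in t -> x \in N) /\ sle N (addvs (zerom V) t).
  by apply: h => x _; apply: hs; apply: in_topm.
elim: s {hs N} => [|v s IH] N hN.
  by exists [::]; split.
have hI : @submod_set R R^o
    [set a | exists2 x, x \in N & x - (a : R) *: v \in addvs (zerom V) s].
  split=> [|a b c /= [x hx hx'] [y hy hy']] /=.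
    by exists 0; rewrite ?scale0r ?subr0 rpred0.
  exists (a *: x + y); first by rewrite rpredD ?rpredZ.
  by rewrite scalerDl -scalerA opprD addrACA -scalerBr rpredD ?rpredZ.
have [q [hq1 hq2]] := (noetherian_noethm.1 hR) (mksubm hI).
have ch (a : R) : {x : V | a \in q -> x \in N /\ x - a *: v \in addvs (zerom V) s}.
  apply: cid; case: (boolP (a \in q)) => [/hq1/mksubmP[x hx hx']|_]; last by exists 0.
  by exists x.
have [t [ht1 ht2]] := IH (capm N (addvs (zerom V) s))
  (fun x hx => ((inmk _ _).1 hx).2).
exists ([seq sval (ch a) | a <- q] ++ t); split=> [x|x hx].
  rewrite mem_cat => /orP[/mapP[a ha ->]|/ht1/mksubmP[] //].
  exact: (svalP (ch a) ha).1.
have hx' : exists a : R, x - a *: v \in addvs (zerom V) s.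
  exact/in_addvs_cons/hN.
case: hx' => a ha.
have /in_addvs[c /in_zerom /subr0_eq ac] :=
  hq2 a (introT (mksubmP hI a) (ex_intro2 _ _ x hx ha)).
pose y := \sum_(i < size q) c i *: sval (ch q`_i).
have hy : y \in N.
  apply: rpred_sum => i _; rewrite rpredZ //.
  exact: (svalP (ch q`_i) (mem_nth _ (ltn_ord i))).1.
have hxy : x - y \in addvs (zerom V) s.
  have -> : x - y = (x - a *: v) - (y - a *: v) by rewrite opprB addrA subrK.
  apply: subm_sub => //; rewrite ac scaler_suml -sumrB.
  apply: rpred_sum => i _; rewrite -scalerA -scalerBr rpredZ //.
  exact: (svalP (ch q`_i) (mem_nth _ (ltn_ord i))).2.
have /ht2 h2 : x - y \in capm N (addvs (zerom V) s).
  by apply/mksubmP; split=> //; apply: subm_sub.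
rewrite addvs_cat -(subrK y x) rpredD //.
  by apply: addvs_mono h2; exact: sle_addvs.
apply: sle_addvs; apply: rpred_sum => i _; rewrite rpredZ // mem_addvs //.
by apply/mapP; exists q`_i => //; rewrite mem_nth.
Qed.

End Noetherian.

(** * Local rings: Nakayama, Krull intersection, associated primes *)

Section Ideals.
Variable R : comNzRingType.
Implicit Types (I m P : ideal R) (a b : R).

Lemma inmkI (S : set R) (hS : @submod_set R R^o S) a : a \in mksubm hS <-> S a.
Proof. exact: iff_sym (rwP (mksubmP hS a)). Qed.

Lemma ideal_mull I r a : a \in I -> r * a \in I.
Proof. exact: (@rpredZ R R^o I r a). Qed.
Lemma ideal_mulr I r a : a \in I -> a * r \in I.
Proof. by rewrite mulrC; exact: ideal_mull. Qed.
Lemma idealD I a b : a \in I -> b \in I -> a + b \in I.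
Proof. exact: (@rpredD R^o I). Qed.
Lemma idealB I a b : a \in I -> b \in I -> a - b \in I.
Proof. exact: (@subm_sub R R^o I). Qed.
Lemma ideal0 I : (0 : R) \in I. Proof. exact: (@rpred0 R^o I). Qed.
Lemma ideal_eqmod I a b : a - b \in I -> (a \in I) = (b \in I).
Proof. exact: (@subm_eqmod R R^o I). Qed.
Lemma ideal_sum I (J : Type) (r : seq J) (p : pred J) (F : J -> R) :
  (forall i, p i -> F i \in I) -> \sum_(i <- r | p i) F i \in I.
Proof. exact: (@rpred_sum R^o I). Qed.

Definition primeI P := (1 : R) \notin P /\
  forall a b, a * b \in P -> a \in P \/ b \in P.

Lemma primeI_exp P a n : primeI P -> a ^+ n \in P -> a \in P.
Proof.
move=> [h1 hP]; elim: n => [|n IH]; first by rewrite expr0 => h; rewrite h in h1.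
by rewrite exprS => /hP[].
Qed.

(** For noetherian rings this is [local m], by [local_loc_ring] and
    [loc_ring_local]; ideals stay out of the computations with units. *)
Definition loc_ring m := (1 : R) \notin m /\
  forall a, a \notin m -> exists b, a * b = 1.

Lemma loc_ring_local m : loc_ring m -> local m.
Proof.
move=> [m1 hu].
have sub I : (1 : R) \notin I -> forall a, a \in I -> a \in m.
  move=> I1 a ha; apply: contraNT I1 => /hu[b <-]; exact: ideal_mulr.
have mm : maximal_ideal m.
  split=> // I I1 mI a; apply/idP/idP; [exact: sub I1 a|exact: mI].
split=> // m' [m'1 hm'] a.
by rewrite (hm' m m1 (sub _ m'1)).
Qed.

Lemma local_loc_ring m : noetherian R -> local m -> loc_ring m.
Proof.
move=> /noetherian_noethm hR [[m1 hm] huniq]; split=> // a ha.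
have [u hu] : exists u : R, 1 - u * a \in m.
  pose I := @addv R R^o m a.
  have : (1 : R) \in I.
    apply: contrapT => /negP I1.
    have e := hm I I1 (@sle_addv R R^o m a) a.
    by case/negP: ha; rewrite -e; exact: (@mem_addv R R^o m a).
  by move=> /(@in_addv R R^o m a)[u hu]; exists u.
pose J := @addv R R^o (zerom R^o) (u * a).
have [J1|J1] := boolP ((1 : R) \in J).
  move: J1 => /(@in_addv R R^o _ _)[b] /(@in_zerom R R^o) /subr0_eq h.
  by exists (u * b); rewrite [RHS]h /GRing.scale /=; ring.
have [m' [m'1 hJ hmax]] := @noethm_max R R^o (fun I => (1 : R) \notin I) J hR J1.
have : maximal_ideal m'.
  by split=> // I I1 hI x; apply/idP/idP; [exact: hmax I I1 hI x|exact: hI].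
move=> /huniq e.
have h : u * a \in m by rewrite -e; apply: hJ; exact: (@mem_addv R R^o).
by case/negP: m1; rewrite -(subrK (u * a) 1); exact: idealD.
Qed.

Lemma loc_unit m a : loc_ring m -> a \in m -> exists b, (1 - a) * b = 1.
Proof.
move=> [m1 hm] ha; apply: hm; apply: contra m1 => h.
by rewrite -(subrK a 1); exact: idealD.
Qed.

End Ideals.

Section LocalModules.
Variables (R : comNzRingType) (V : lmodType R).
Implicit Types (N K L : submodClosed V) (I m P : ideal R).

Lemma imul_min I N K : (forall a v, a \in I -> v \in N -> a *: v \in K) ->
  sle (imul I N) K.
Proof. by move=> h; apply: genby_sle => _ [a [v [ha hv ->]]]; exact: h. Qed.

Lemma mem_imul I N (a : R) v : a \in I -> v \in N -> a *: v \in imul I N.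
Proof. by move=> ha hv; apply: in_genby; exists a, v. Qed.

Lemma imul_mono I N K : sle N K -> sle (imul I N) (imul I K).
Proof. by move=> h; apply: imul_min => a v ha /h hv; exact: mem_imul. Qed.

(** If [N] were not inside [K], enlarge [K] to a maximal [L] with the same
    property: then any [v] in [N] outside of [L] generates [N] modulo [L], and
    so does [a v], which forces [a] to be outside of the radical. *)
Lemma nakayama m N K : loc_ring m -> noethm V ->
  sle N (addm K (imul m N)) -> sle N K.
Proof.
move=> hm hV hN; apply: contrapT => hNK.
have [L [hL hKL hmax]] := @noethm_max _ _ (fun L => ~ sle N L) K hV hNK.
apply: hL => x hx; apply: (addm_min hKL _ (hN x hx)).
apply: imul_min => a v ha hv; apply: contrapT => hav.
have [b hb] := loc_unit hm (ideal_mull (1 : R) ha).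
have hNL : sle N (addv L (a *: v)).
  apply: contrapT => h; apply: hav.
  exact: (hmax _ h (@sle_addv _ _ L _)) _ (mem_addv _ _).
have /in_addv[c hc] := hNL v hv; apply: hav.
have [d hd] := loc_unit hm (ideal_mull c ha).
have : d *: ((1 - c * a) *: v) \in L.
  by rewrite rpredZ // scalerBl scale1r -scalerA.
by rewrite scalerA (mulrC d) hd scale1r => hv'; rewrite rpredZ.
Qed.

Lemma nakayama1 m N K (a : R) : loc_ring m -> noethm V -> a \in m ->
  (forall x, x \in N -> exists2 y, y \in N & x - a *: y \in K) -> sle N K.
Proof.
move=> hm hV ha h; apply: (nakayama hm hV) => x /h[y hy hxy].
by apply/in_addm; exists (x - a *: y) => //; rewrite subKr mem_imul.
Qed.

(** A maximal annihilator among those of the multiples of [v] is prime. *)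
Lemma nzero_ass_mul N (v : V) (a : R) : noetherian R -> v \notin N -> a *: v \in N ->
  exists r : R, [/\ r *: v \notin N, primeI (annv N (r *: v)) & a \in annv N (r *: v)].
Proof.
move=> /noetherian_noethm hR hv hav.
pose Q (I : ideal R) := exists r : R, r *: v \notin N /\ I = annv N (r *: v).
have [|_ [[r [hr ->]] _ hmax]] := @noethm_max _ _ Q (annv N v) hR.
  by exists 1; rewrite scale1r.
exists r; split=> //; last by apply/in_annv; rewrite scalerA mulrC -scalerA rpredZ.
split=> [|b c /in_annv hbc]; first by apply/negP => /in_annv; rewrite scale1r; apply/negP.
have [hb|hb] := boolP (b *: (r *: v) \in N); first by left; apply/in_annv.
right; apply: (hmax (annv N (b *: (r *: v)))); last 1 first.
- by apply/in_annv; rewrite (scalerA c b) mulrC.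
- by exists (b * r); rewrite -scalerA; split.
- by move=> s /in_annv hs; apply/in_annv; rewrite (scalerA s b) mulrC -scalerA rpredZ.
Qed.

Lemma nzero_ass N (v : V) (a : R) : noetherian R -> v \notin N -> a *: v \in N ->
  exists2 w, w \notin N & primeI (annv N w) /\ a \in annv N w.
Proof.
by move=> hR hv /(nzero_ass_mul hR hv)[r [h1 h2 h3]]; exists (r *: v).
Qed.

Lemma ass_finite N : noetherian R -> noethm V -> exists Ps : seq (ideal R),
  (forall P, List.In P Ps -> exists2 w, w \notin N & primeI P /\ P = annv N w) /\
  forall w, w \notin N -> primeI (annv N w) -> List.In (annv N w) Ps.
Proof.
move=> hR hV.
suff [Ps hPs] : exists Ps : seq (ideal R),
    forall w, w \notin N -> primeI (annv N w) -> List.In (annv N w) Ps.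
  pose good P := `[< exists2 w, w \notin N & primeI P /\ P = annv N w >].
  exists (List.filter good Ps); split.
    by move=> P /List.filter_In[_ /asboolP].
  by move=> w hw pw; apply/List.filter_In; split; [exact: hPs|apply/asboolP; exists w].
move: N; apply: (noethm_ind hV) => N IH.
have [hN|/existsNP[v /negP hv]] := pselect (forall v, v \in N).
  by exists [::] => w; rewrite hN.
have [|w hw [pw _]] := @nzero_ass N v 0 hR hv; first by rewrite scale0r rpred0.
have [||Ps hPs] := IH (addv N w); first exact: sle_addv.
  by move=> h; case/negP: hw; apply: h; exact: mem_addv.
exists (annv N w :: Ps) => u hu pu.
have [[r [hr1 hr2]]|hno] :=
    pselect (exists r : R, r *: u \in addv N w /\ r *: u \notin N).
  left; case/in_addv: hr1 => s hs.
  have hs' : s *: w \notin N by rewrite -(subm_eqmod hs).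
  have sw : s \notin annv N w by apply/negP => /in_annv; apply/negP.
  have ru : r \notin annv N u by apply/negP => /in_annv; apply/negP.
  have key (b : R) : (b * s \in annv N w) = (b * r \in annv N u).
    apply/idP/idP => /in_annv h; apply/in_annv; move: h; rewrite -!scalerA.
      by rewrite (@subm_eqmod _ _ N (b *: (r *: u)) (b *: (s *: w))) // -scalerBr rpredZ.
    by rewrite -(@subm_eqmod _ _ N (b *: (r *: u)) (b *: (s *: w))) // -scalerBr rpredZ.
  apply: subm_ext => b hb.
    have /pu.2[//|h] : b * r \in annv N u by rewrite -key; exact: ideal_mulr.
    by rewrite h in ru.
  have /pw.2[//|h] : b * s \in annv N w by rewrite key; exact: ideal_mulr.
  by rewrite h in sw.
have e : annv N u = annv (addv N w) u.
  apply: subm_ext => r /in_annv hr; apply/in_annv; first exact: sle_addv.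
  by apply: contrapT => /negP h; apply: hno; exists r.
right; rewrite e; apply: hPs; last by rewrite -e.
apply/negP => hu'; apply: hno; exists 1; rewrite scale1r; split=> //.
Qed.

Lemma nil_pow m N : noetherian R -> noethm V ->
  (forall (a : R) v, a \in m -> exists j, a ^+ j *: v \in N) ->
  exists k, sle (ipow m V k) N.
Proof.
move=> hR hV; move: N; apply: (noethm_ind hV) => N IH h.
have [hN|/existsNP[v /negP hv]] := pselect (forall v, v \in N).
  by exists 0%N => v _.
have [|w hw [pw _]] := @nzero_ass N v 0 hR hv; first by rewrite scale0r rpred0.
have hmw (a : R) : a \in m -> a *: w \in N.
  move=> ha; have [j hj] := h a w ha; apply/in_annv.
  by apply: (@primeI_exp _ _ _ j pw); apply/in_annv.
have [|||k hk] := IH (addv N w); first exact: sle_addv.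
- by move=> h'; case/negP: hw; apply: h'; exact: mem_addv.
- by move=> a u ha; have [j hj] := h a u ha; exists j; exact: sle_addv.
exists k.+1; apply: imul_min => a u ha /hk/in_addv[b hb].
rewrite -(subrK (a *: (b *: w)) (a *: u)) -scalerBr.
by rewrite rpredD ?(rpredZ _ hb) // scalerA mulrC -scalerA rpredZ ?hmw.
Qed.

Lemma ipow_decr m k : sle (ipow m V k.+1) (ipow m V k).
Proof. by apply: imul_min => a v _ hv; rewrite rpredZ. Qed.

Lemma ipow_mono m i j : (i <= j)%N -> sle (ipow m V j) (ipow m V i).
Proof.
elim: j => [|j IH]; first by rewrite leqn0 => /eqP ->.
rewrite leq_eqVlt => /orP[/eqP -> //|/IH h].
exact: sle_trans (@ipow_decr m j) h.
Qed.

Lemma mem_ipow m (a : R) k v : a \in m -> a ^+ k *: v \in ipow m V k.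
Proof.
by move=> ha; elim: k => [|k IH]; rewrite ?in_topm // exprS -scalerA mem_imul.
Qed.

(** Krull: for the intersection [N], a submodule [L] maximal among those meeting
    [N] in [K + m N] contains a power of [m]; so [N] lies in [K + m N]. *)
Lemma krull_intersection m K x : loc_ring m -> noetherian R -> noethm V ->
  (forall k, x \in addm K (ipow m V k)) -> x \in K.
Proof.
move=> hm hR hV hx.
have hN0 : submod_set [set y | forall k, y \in addm K (ipow m V k)].
  split=> [k|a u v hu hv k]; first exact: rpred0.
  by apply: rpredD (hv k); exact: (@rpredZ _ _ _ a _ (hu k)).
pose N := mksubm hN0; pose D := addm K (imul m N).
have inN y : y \in N <-> forall k, y \in addm K (ipow m V k) by exact: inmk.
have DN : sle D N.
  apply: addm_min => [y hy|]; first by apply/inN => k; exact: sle_addml.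
  by apply: imul_min => a v _ hv; rewrite rpredZ.
suff h : sle N K by apply: h; apply/inN.
apply: (nakayama hm hV); rewrite -/D.
pose Q L := sle D L /\ forall y, y \in L -> y \in N -> y \in D.
have [|L [[DL LN] _ hmax]] := @noethm_max _ _ Q D hV; first by split.
have [|k hk] := @nil_pow m L hR hV.
  move=> a v ha; pose C j := colon L (a ^+ j).
  have inC j y : y \in C j <-> a ^+ j *: y \in L by exact: inmk.
  have [j u /inC hu|j hj] := @noethm_chain _ _ C hV.
    by apply/inC; rewrite exprS -scalerA rpredZ.
  exists j; apply: (hmax (adds L (a ^+ j))); last exact: mem_adds.
    split=> [y /DL|y /in_adds[u hu] hy]; first exact: sle_adds.
    suff hu' : a ^+ j *: u \in L.
      by apply: LN => //; rewrite (subm_eqmod hu).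
    apply/inC/(hj j.+1)/inC; rewrite exprS -scalerA.
    have : a *: y \in L by apply: DL; apply: sle_addmr; exact: mem_imul.
    by rewrite (subm_eqmod (y := a *: (a ^+ j *: u))) // -scalerBr rpredZ.
  exact: sle_adds.
move=> y hy; apply: LN => //; have /inN/(_ k) := hy.
by apply: addm_min => // z hz; apply: DL; exact: sle_addml.
Qed.

End LocalModules.

Section Avoidance.
Variable R : comNzRingType.
Implicit Types (P c : ideal R) (a : R).

(** Avoidance in a coset. To correct an element [a + e] which falls in [P], add
    an element of [c] outside of [P] which lies in all the other primes not
    contained in [P]; those contained in [P] are then avoided as well. *)
Lemma coset_avoid (Ps : seq (ideal R)) a c :
  (forall P, List.In P Ps -> primeI P /\ ~ (a \in P /\ sle c P)) ->
  exists2 e : R, e \in c & forall P, List.In P Ps -> a + e \notin P.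
Proof.
elim: Ps => [|P Ps IH] h; first by exists 0; first exact: ideal0.
have [|e he hPs] := IH; first by move=> Q hQ; apply: h; right.
have [pP hP] := h P (or_introl erefl).
have [aeP|aeP] := boolP (a + e \in P); last first.
  by exists e => // Q [<-|/hPs].
have [/hP[]|hcP] := pselect (a \in P /\ sle c P).
have {hcP} /existsNP[c0 /not_implyP[hc0 /negP c0P]] : ~ sle c P.
  move=> cP; apply: hcP; split=> //.
  by rewrite -(addrK e a); apply: idealB => //; exact: cP.
have [e' [e'c e'P e'Q]] : exists e' : R, [/\ e' \in c, e' \notin P &
    forall Q, List.In Q Ps -> ~ sle Q P -> e' \in Q].
  elim: Ps {IH h hPs} => [|Q Ps [e' [e'c e'P e'Q]]]; first by exists c0.
  have [QP|/existsNP[q /not_implyP[hq /negP qP]]] := pselect (sle Q P).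
    by exists e'; split=> // Q' [<- //|]; exact: e'Q.
  exists (q * e'); split; first exact: ideal_mull.
    by apply/negP => /pP.2[] h2; [rewrite h2 in qP|rewrite h2 in e'P].
  move=> Q' [<- _|hQ' /(e'Q _ hQ')]; first exact: ideal_mulr.
  exact: ideal_mull.
have aee'P : a + (e + e') \notin P.
  by apply: contra e'P => h2; have -> : e' = a + (e + e') - (a + e) by [ring]; exact: idealB.
exists (e + e'); first exact: idealD.
move=> Q [<- //|hQ]; have [QP|QP] := pselect (sle Q P).
  by apply: contra aee'P; exact: QP.
apply: contra (hPs Q hQ) => h2.
by have -> : a + e = a + (e + e') - e' by [ring]; apply: idealB => //; exact: e'Q.
Qed.

End Avoidance.
(** * Regular sequences and depth *)

Section RegularSequences.
Variables (R : comNzRingType) (V : lmodType R).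
Implicit Types (N K : submodClosed V) (q : seq R) (a b : R).

(** [a] is a nonzerodivisor on [V / N]. *)
Definition nzd N a := forall v, a *: v \in N -> v \in N.

(** [q] is a (weakly) regular sequence on [V / N]. *)
Fixpoint rseq N q := if q is a :: q' then nzd N a /\ rseq (adds N a) q' else True.

Lemma rseq_cat N q1 q2 : rseq N (q1 ++ q2) <-> rseq N q1 /\ rseq (addseq N q1) q2.
Proof.
elim: q1 N => [|a q IH] N /=; first by split=> [|[]].
by split=> [[h /IH[h1 h2]]|[[h1 h2] h3]]; split=> //; apply/IH.
Qed.

Lemma addsC N a b : adds (adds N a) b = adds (adds N b) a.
Proof.
apply: subm_ext; (apply: adds_min; first exact/adds_mono/sle_adds).
  by move=> v; apply: sle_adds; exact: mem_adds.
by move=> v; apply: sle_adds; exact: mem_adds.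
Qed.

Lemma addseq_adds N q a : addseq (adds N a) q = adds (addseq N q) a.
Proof. by elim: q N => //= b q IH N; rewrite addsC IH. Qed.

Lemma nzd_exp N a n : nzd N a -> nzd N (a ^+ n).
Proof.
move=> h; elim: n => [|n IH] v; first by rewrite expr0 scale1r.
by rewrite exprS -scalerA => /h/IH.
Qed.

Variable m : ideal R.
Hypotheses (hm : loc_ring m) (hR : noetherian R) (hV : noethm V).

Lemma nzd_swap N a b : a \in m -> nzd N a -> nzd (adds N a) b ->
  nzd N b /\ nzd (adds N b) a.
Proof.
move=> ha na nb; split.
  have inK v : v \in colon N b <-> b *: v \in N by exact: inmk.
  suff h : sle (colon N b) N by move=> v hv; apply: h; apply/inK.
  apply: (nakayama1 hm hV ha) => v /inK hv.
  have /nb/in_adds[w hw] : b *: v \in adds N a by exact: sle_adds.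
  exists w => //; apply/inK; apply: na.
  rewrite scalerA mulrC -scalerA -(@subm_eqmod _ _ N (b *: v)) //.
  by rewrite -scalerBr rpredZ.
move=> v /in_adds[w hw].
have /nb/in_adds[u hu] : b *: w \in adds N a.
  by apply/in_adds; exists v; rewrite -opprB subm_opp.
apply/in_adds; exists u; apply: na.
have -> : a *: (v - b *: u) = (a *: v - b *: w) + b *: (w - a *: u).
  by rewrite !scalerBr addrA subrK !scalerA mulrC.
by rewrite rpredD // rpredZ.
Qed.

Lemma rseq_to_head N q a q' : {subset q <= m} ->
  rseq N (q ++ a :: q') -> rseq N (a :: q ++ q').
Proof.
elim: q N => [|b q IH] N //= hq [hb].
move=> /IH[|ha hr]; first by move=> x hx; apply: hq; rewrite inE hx orbT.
have [h1 h2] := nzd_swap (hq b (mem_head _ _)) hb ha.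
by split=> //; split=> //; rewrite addsC.
Qed.

(** Two consecutive entries may be exchanged, by Nakayama's lemma. *)
Lemma rseq_perm N q q' : {subset q <= m} -> perm_eq q q' -> rseq N q -> rseq N q'.
Proof.
elim: q' N q => [|a q' IH] N q hq hqq' hr; first by case: q hqq' hr hq.
have aq : a \in q by rewrite (perm_mem hqq') mem_head.
case/splitPr: aq hq hqq' hr => q1 q2 hq hqq' hr.
have [ha hr'] : rseq N (a :: q1 ++ q2).
  by apply: rseq_to_head hr => x hx; apply: hq; rewrite mem_cat hx.
split=> //; apply: IH hr'.
  move=> x; rewrite mem_cat => hx; apply: hq; rewrite mem_cat inE.
  by case/orP: hx => ->; rewrite ?orbT.
by rewrite -(perm_cons a) -(perm_catCA q1 [:: a]).
Qed.

(** Some element of [c + a] is a nonzerodivisor, unless an associated prime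
    contains both [c] and [a]. *)
Lemma nzd_choice N a (c : ideal R) :
  (forall w, w \notin N -> primeI (annv N w) ->
     ~ (a \in annv N w /\ sle c (annv N w))) ->
  exists2 e : R, e \in c & nzd N (a + e).
Proof.
move=> h; have [Ps [Ps1 Ps2]] := @ass_finite _ _ N hR hV.
have [|e he hPs] := @coset_avoid _ Ps a c.
  by move=> P /Ps1[w hw [pP e]]; split=> //; rewrite e; apply: h; rewrite -?e.
exists e => // v hv; apply: contrapT => /negP hvN.
have [w hw [pw]] := nzero_ass hR hvN hv.
by apply/negP/hPs/Ps2.
Qed.

(** No nonzero element of [V / N] is killed by the maximal ideal: depth at
    least one. *)
Definition nosoc N := forall v, (forall a, a \in m -> a *: v \in N) -> v \in N.

Lemma nzd_nosoc N a : a \in m -> nzd N a -> nosoc N.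
Proof. by move=> ha na v /(_ a ha); exact: na. Qed.

Lemma nosoc_nzd2 N K : nosoc N -> nosoc K ->
  exists2 e : R, e \in m & nzd N e /\ nzd K e.
Proof.
move=> hN hK; have [Ps [Ps1 Ps2]] := @ass_finite _ _ N hR hV.
have [Qs [Qs1 Qs2]] := @ass_finite _ _ K hR hV.
have [|e he hPs] := @coset_avoid _ (List.app Ps Qs) 0 m.
  move=> P /List.in_app_iff[/Ps1|/Qs1][w hw [pP eP]]; split=> // -[_ hmP];
    case/negP: hw.
    by apply: hN => a /hmP; rewrite eP => /in_annv.
  by apply: hK => a /hmP; rewrite eP => /in_annv.
exists e => //; split=> v hv; apply: contrapT => /negP hv'.
  have [w hw [pw ew]] := nzero_ass hR hv' hv.
  have /hPs : List.In (annv N w) (List.app Ps Qs).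
    by apply/List.in_app_iff; left; exact: Ps2.
  by rewrite add0r ew.
have [w hw [pw ew]] := nzero_ass hR hv' hv.
have /hPs : List.In (annv K w) (List.app Ps Qs).
  by apply/List.in_app_iff; right; exact: Qs2.
by rewrite add0r ew.
Qed.

(** For nonzerodivisors [x] and [s] the socles of [V / x V] and [V / s V] are
    isomorphic, by [v |-> w] where [s v = x w]. *)
Lemma nosoc_exchange N x s : x \in m -> s \in m -> nzd N x -> nzd N s ->
  nosoc (adds N s) -> nosoc (adds N x).
Proof.
move=> hx hs nx ns hsoc v hv.
have /in_adds[w hw] := hv s hs.
have /in_adds[t ht] : w \in adds N s.
  apply: hsoc => a /hv/in_adds[u hu]; apply/in_adds; exists u; apply: nx.
  have -> : x *: (a *: w - s *: u) = s *: (a *: v - x *: u) - a *: (s *: v - x *: w).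
    rewrite !scalerBr !scalerA opprB (mulrC s a) [RHS]addrC addrA subrK.
    by rewrite (mulrC x a) (mulrC x s).
  by rewrite subm_sub // rpredZ.
apply/in_adds; exists t; apply: ns.
have -> : s *: (v - x *: t) = (s *: v - x *: w) + x *: (w - s *: t).
  by rewrite !scalerBr addrA subrK !scalerA mulrC.
by rewrite rpredD // rpredZ.
Qed.

(** [V / N] has depth at least [l]. *)
Definition dep N l := exists q, [/\ size q = l, {subset q <= m} & rseq N q].

Lemma dep_nosoc N l : dep N l.+1 -> nosoc N.
Proof.
case=> -[[]//|a q [_ hq [ha _]]]; exact: (@nzd_nosoc N a (hq a (mem_head _ _)) ha).
Qed.

(** Dividing by a nonzerodivisor lowers the depth by one only: a common
    nonzerodivisor [t] of [V / s V] and [V / x V] is exchanged with [s] and [x]. *)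
Lemma dep_adds N l x : dep N l.+1 -> x \in m -> nzd N x -> dep (adds N x) l.
Proof.
elim: l N x => [|l IH] N x; first by move=> _ _ _; exists [::].
case=> -[[]//|s q [/= [sq] hq [ns hr]]] hx nx.
have hs : s \in m by apply: hq; exact: mem_head.
have hd : dep (adds N s) l.+1.
  by exists q; split=> // y hy; apply: hq; rewrite inE hy orbT.
have soc1 := dep_nosoc hd.
have [t ht [t1 t2]] := nosoc_nzd2 soc1 (nosoc_exchange hx hs nx ns soc1).
have [r [sr hr1 hr2]] := IH _ _ hd ht t1.
have [nt nts] := nzd_swap hs ns t1.
have [_ ntx] := nzd_swap hx nx t2.
have [|r' [sr' hr1' hr2']] := IH (adds N t) x _ hx ntx.
  exists (s :: r); split; rewrite /= ?sr //; last by rewrite addsC.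
  by move=> y; rewrite inE => /orP[/eqP ->|/hr1].
exists (t :: r'); split; rewrite /= ?sr' //; last by rewrite addsC.
by move=> y; rewrite inE => /orP[/eqP ->|/hr1'].
Qed.

Section OneDimensionalPrime.
Variable p : ideal R.
(** [p] has coheight one: the radical of [p + (a)] is the maximal ideal. *)
Hypotheses (pp : primeI p)
  (hp : forall a b : R, a \notin p -> b \in m -> exists j, b ^+ j \in addv p a).

(** A prime of coheight one is not associated to a module of depth two: divide
    the element with annihilator [p] by the first nonzerodivisor [s] as long as
    possible; the result is nonzero modulo [s], and is killed there by [p] and
    by [s], hence by a power of the second nonzerodivisor. *)
Lemma dep2_not_ass N w : dep N 2 -> w \notin N -> annv N w <> p.
Proof.
case=> -[|s [|t [|? ?]]] [] // _ hq [ns [nt _]] hw ew.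
have hs : s \in m by apply: hq; rewrite inE eqxx.
have ht : t \in m by apply: hq; rewrite !inE eqxx orbT.
have key u : annv N u = p -> u \in adds N s.
  move=> eu; have sp : s \notin p.
    by rewrite -ew; apply/negP => /in_annv/ns; apply/negP.
  have [j] := hp sp ht; move=> /(@in_addv R R^o)[b hb].
  apply: (nzd_exp (n := j) nt); apply/in_adds; exists (b *: u).
  rewrite scalerA -scalerBl; apply/in_annv; rewrite eu.
  by have -> : t ^+ j - s * b = t ^+ j - b * s by [ring].
have hwk k : forall u, annv N u = p -> u \in addm N (ipow m V k).
  elim: k => [|k IH] u eu; first by apply: sle_addmr; exact: in_topm.
  have /in_adds[v hv] := key u eu.
  have /IH/in_addm[y hy hvy] : annv N v = p.
    rewrite -eu; apply: subm_ext => a /in_annv h; apply/in_annv.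
      have e : a *: u - a *: (s *: v) \in N by rewrite -scalerBr rpredZ.
      by rewrite (subm_eqmod e) scalerA mulrC -scalerA rpredZ.
    have e : a *: u - a *: (s *: v) \in N by rewrite -scalerBr rpredZ.
    by apply: ns; rewrite scalerA mulrC -scalerA -(subm_eqmod e).
  apply/in_addm; exists (u - s *: (v - y)); last by rewrite subKr mem_imul.
  by rewrite scalerBr opprB addrCA addrC rpredD // rpredZ.
by case/negP: hw; apply: (krull_intersection hm hR hV) => k; exact: hwk.
Qed.

Lemma nzd_coset N x (c : ideal R) : dep N 2 ->
  (forall a b : R, a \in p -> b \in p -> a * b \in c) ->
  exists2 e : R, e \in c & nzd N (x + e).
Proof.
move=> hd hc; apply: nzd_choice => w hw pw [_ cw].
have pP : sle p (annv N w).
  by move=> a ha; have [] // := pw.2 a a (cw _ (hc _ _ ha ha)).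
have [hP|/existsNP[a /not_implyP[ha /negP hap]]] := pselect (sle (annv N w) p).
  by apply: (dep2_not_ass hd hw); exact: subm_ext.
case/negP: hw; apply: (dep_nosoc hd) => b hb; apply/in_annv.
have [j hj] := hp hap hb; apply: (@primeI_exp _ _ _ j pw).
exact: (@addv_min R R^o p _ a pP ha _ hj).
Qed.

(** Elements of [p] may be corrected by elements of [p^2] into a regular
    sequence, as long as the depth exceeds their number. *)
Lemma rseq_coset N xs (c : ideal R) l : dep N (size xs + l.+1) ->
  sle c p -> {subset xs <= p} -> sle p m ->
  (forall a b : R, a \in p -> b \in p -> a * b \in c) ->
  exists ys, [/\ size ys = size xs, forall i, ys`_i - xs`_i \in c,
    {subset ys <= p}, rseq N ys & dep (addseq N ys) l.+1].
Proof.
move=> hd cp hx pm hc; elim: xs N hd hx => [|x xs IH] N /= hd hx.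
  by exists [::]; split=> // i; rewrite nth_nil subr0 ideal0.
have [|e he hn] := @nzd_coset N x c _ hc.
  have [q [sq hq hr]] := hd; exists (take 2 q); split.
  - by rewrite size_take sq; case: ltnP; lia.
  - by move=> y /mem_take/hq.
  - by move: hr; rewrite -{1}(cat_take_drop 2 q) => /rseq_cat[].
have hxe : x + e \in p by apply: idealD; [exact/hx/mem_head|exact: cp].
have [||ys [sy hy hyp hr hd']] := IH (adds N (x + e)).
- by apply: dep_adds => //; exact: pm.
- by move=> y hy; apply: hx; rewrite inE hy orbT.
exists (x + e :: ys); split=> /=; rewrite ?sy //.
  by case=> [|i] //=; rewrite addrAC subrr add0r.
by move=> y; rewrite inE => /orP[/eqP ->|/hyp].
Qed.

End OneDimensionalPrime.
End RegularSequences.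
(** * Length *)

Section Chains.
Variables (R : comNzRingType) (V : lmodType R).
Implicit Types (N K L : submodClosed V).

(** There is a chain of submodules from above [N] up to [K] with [n] strict
    inclusions. *)
Fixpoint schain N K n : Prop := if n is n'.+1 then
  exists K', [/\ schain N K' n', sle K' K & ~ sle K K'] else sle N K.

(** The module [K / N] has length [n]. *)
Definition rlen N K n := schain N K n /\ ~ schain N K n.+1.

Lemma schain_mono N K L n : schain N K n -> sle K L -> schain N L n.
Proof.
case: n => [|n] /=; first exact: sle_trans.
move=> [K' [h1 h2 h3]] KL; exists K'; split=> //; first exact: sle_trans h2 KL.
by move=> LK; apply: h3; exact: sle_trans KL LK.
Qed.

Lemma schain_sle N K n : schain N K n -> sle N K.
Proof. by elim: n K => [|n IH] K //= [K' [/IH h h' _]]; exact: sle_trans h h'. Qed.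

Lemma schainW N K n i : (i <= n)%N -> schain N K n -> schain N K i.
Proof.
elim: n => [|n IH]; first by rewrite leqn0 => /eqP ->.
rewrite leq_eqVlt => /orP[/eqP -> //|/IH h [K' [h1 h2 _]]].
exact: h (schain_mono h1 h2).
Qed.

Lemma schain_cat N K L a b : schain N K a -> schain K L b -> schain N L (a + b).
Proof.
elim: b L => [|b IH] L hN; first by rewrite addn0 => h; exact: schain_mono hN h.
by rewrite addnS => -[L' [/(IH _ hN) h1 h2 h3]]; exists L'.
Qed.

Lemma schain_split N K L n : sle N K -> schain N L n -> exists a b,
  [/\ (n <= a + b)%N, schain N (capm L K) a & schain K (addm L K) b].
Proof.
move=> NK; elim: n L => [|n IH] L /=.
  move=> h; exists 0%N, 0%N; split=> //=; last exact: sle_addmr.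
  by move=> x hx; apply/inmk; split; [exact: h|exact: NK].
move=> [L' [/IH[a [b [nab ha hb]]] h1 h2]].
have c1 : sle (capm L' K) (capm L K).
  by move=> x /inmk[hx hx']; apply/inmk; split=> //; exact: h1.
have c2 : sle (addm L' K) (addm L K).
  by apply: addm_min; [exact: sle_trans h1 (@sle_addml _ _ _ _)|exact: sle_addmr].
have [c3|c3] := pselect (sle (capm L K) (capm L' K)); last first.
  exists a.+1, b; split; [by rewrite addSn ltnS|by exists (capm L' K)|].
  exact: schain_mono hb c2.
exists a, b.+1; split; [by rewrite addnS ltnS|exact: schain_mono ha c1|].
exists (addm L' K); split=> // c4; apply: h2 => x hx.
have /c4/in_addm[y hy hxy] := @sle_addml _ _ L K x hx.
rewrite -(subrK y x) rpredD //.
have /c3/inmk[] // : x - y \in capm L K.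
by apply/inmk; split=> //; apply: subm_sub => //; exact: h1.
Qed.

Lemma capm_idl K L : sle K L -> capm L K = K.
Proof.
by move=> h; apply: subm_ext => x; [move/inmk => []|move=> hx; apply/inmk; split; auto].
Qed.
Lemma addm_idl K L : sle K L -> addm L K = L.
Proof. by move=> h; apply: subm_ext; [exact: addm_min|exact: sle_addml]. Qed.

Lemma rlen_le N K n i : rlen N K n -> schain N K i -> (i <= n)%N.
Proof.
by move=> [_ h] hi; rewrite leqNgt; apply/negP => ni; apply: h; exact: schainW hi.
Qed.

Lemma rlen_uniq N K n i : rlen N K n -> rlen N K i -> n = i.
Proof.
move=> hn hi; apply/eqP; rewrite eqn_leq (rlen_le hi hn.1).
by rewrite (rlen_le hn hi.1).
Qed.

Lemma rlen_ex N K n : sle N K -> ~ schain N K n.+1 ->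
  exists i, (i <= n)%N /\ rlen N K i.
Proof.
move=> NK; elim: n => [|n IH] h; first by exists 0%N.
have [h'|/IH[i [hi h']]] := pselect (schain N K n.+1); first by exists n.+1.
by exists i; split=> //; exact: leqW.
Qed.

Lemma rlen_add N K L a b : sle N K -> sle K L ->
  rlen N K a -> rlen K L b -> rlen N L (a + b).
Proof.
move=> NK KL ha hb; split; first exact: schain_cat ha.1 hb.1.
move=> /(schain_split NK)[i [j []]].
rewrite (capm_idl KL) (addm_idl KL) => + /(rlen_le ha) hi /(rlen_le hb) hj.
by rewrite ltnNge leq_add.
Qed.

Lemma rlen_split N K L n : sle N K -> sle K L -> rlen N L n ->
  exists a b, [/\ n = (a + b)%N, rlen N K a & rlen K L b].
Proof.
move=> NK KL hn.
have [a [_ ha]] : exists i, (i <= n)%N /\ rlen N K i.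
  apply: rlen_ex => // h; have := schain_mono h KL; move/(rlen_le hn).
  by rewrite ltnn.
have [b [_ hb]] : exists i, (i <= n)%N /\ rlen K L i.
  apply: rlen_ex => // h; have := schain_cat (NK : schain N K 0) h.
  by move/(rlen_le hn); rewrite ltnn.
exists a, b; split=> //; exact: rlen_uniq hn (rlen_add NK KL ha hb).
Qed.

Lemma rlen0 N K : rlen N K 0 -> K = N.
Proof.
move=> [/= h1 h2]; apply: subm_ext => //; apply: contrapT => h.
by apply: h2; exists N; split.
Qed.

Lemma rlen_refl N : rlen N N 0.
Proof. by split=> // -[K [h1 h2 []]]. Qed.

Lemma rlen_eq N K L n : sle N K -> sle K L -> rlen N L n -> rlen K L n -> K = N.
Proof.
move=> NK KL h1 h2; have [a [b [e ha hb]]] := rlen_split NK KL h1.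
have eb := rlen_uniq h2 hb; apply: rlen0.
by have -> : 0%N = a by lia.
Qed.

Lemma sub_chainE n : sub_chain V n <-> schain (zerom V) (topm V) n.
Proof.
split.
  move=> [C hC]; have h i : (i <= n)%N -> schain (zerom V) (C i) i.
    elim: i => [|i IH] hi; first exact: zerom_sle.
    have [h1 h2] := hC i hi; exists (C i); split=> //; apply: IH; exact: ltnW.
  by apply: schain_mono (h n _) _ => // x _; exact: in_topm.
suff : forall K, schain (zerom V) K n -> exists C : nat -> submodClosed V, C n = K /\
    forall i, (i < n)%N -> {subset C i <= C i.+1} /\ ~ {subset C i.+1 <= C i}.
  by move=> h /h[C [_ hC]]; exists C.
elim: n => [|n IH] K; first by exists (fun=> K).
move=> [K' [/IH[C [CK hC]] h1 h2]].
exists (fun i => if (i <= n)%N then C i else K); rewrite ltnn; split=> // i /=.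
rewrite ltnS; case: (ltngtP i n) => // [hi _|-> _]; first exact: hC.
by rewrite CK.
Qed.

Lemma lengthP n : rlen (zerom V) (topm V) n -> length V = n.
Proof.
move=> hn; rewrite /length; case: xgetP => [y -> [h1 h2]|h].
  by apply: (rlen_uniq _ hn); split=> [|h]; [exact/sub_chainE|apply/h2/sub_chainE].
have [] := h n; split; first exact/sub_chainE/hn.1.
by move/sub_chainE/hn.2.
Qed.

Lemma schain_n_sub N K v : sle N K -> v \in K -> v \notin N -> schain N K 1.
Proof. by move=> h hv hvN; exists N; split=> // h'; rewrite h' in hvN. Qed.

Lemma rlen_simple (m : ideal R) N v : loc_ring m ->
  (forall a : R, a \in m -> a *: v \in N) -> v \notin N -> rlen N (addv N v) 1.
Proof.
move=> [m1 hm] hv hvN; split.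
  exact: schain_n_sub (@sle_addv _ _ N v) (mem_addv _ _) hvN.
move=> [K [[K' [NK' K'K hK']] hK hno]]; apply: hno.
have [x /not_implyP[xK /negP xK']] : exists x, ~ (x \in K -> x \in K').
  exact/existsNP.
have /in_addv[a ha] := hK x xK.
have am : a \notin m.
  apply: contra xK' => /hv h; apply: (NK').
  by rewrite (subm_eqmod ha).
have [b hb] := hm a am.
have NK : sle N K by exact: sle_trans (NK' : sle N K') K'K.
apply: addv_min => //.
have : b *: (a *: v) \in K by rewrite rpredZ // -(subm_eqmod (NK _ ha)).
by rewrite scalerA mulrC hb scale1r.
Qed.

End Chains.

Section ChainImage.
Variables (R : comNzRingType) (U V : lmodType R) (f : {linear U -> V}).
Implicit Types (N K : submodClosed V) (D : submodClosed U).

Fact pre_subproof N : submod_set [set u | f u \in N].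
Proof.
split=> [|a u v /= hu hv] /=; first by rewrite linear0 rpred0.
by rewrite linearP rpredD // rpredZ.
Qed.
Definition pre N := mksubm (pre_subproof N).

Lemma in_pre N u : u \in pre N <-> f u \in N.
Proof. exact: inmk. Qed.

Fact img_subproof N D : submod_set [set x | exists2 u, u \in D & x - f u \in N].
Proof.
split=> [|a x y /= [u hu hx] [v hv hy]].
  by exists 0; [exact: rpred0|rewrite linear0 subr0; exact: rpred0].
exists (a *: u + v); first by rewrite rpredD // rpredZ.
by rewrite linearP opprD addrACA -scalerBr rpredD // rpredZ.
Qed.
Definition img N D := mksubm (img_subproof N D).

Lemma in_img N D x : x \in img N D <-> exists2 u, u \in D & x - f u \in N.
Proof. exact: inmk. Qed.

Lemma schain_pre N K n : sle N K ->
  (forall x, x \in K -> exists u, x - f u \in N) ->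
  schain N K n <-> schain (pre N) (pre K) n.
Proof.
move=> NK hK; split.
  elim: n K NK hK => [|n IH] K NK hK /=.
    by move=> h u /in_pre/h hu; apply/in_pre.
  move=> [K' [h1 h2 h3]]; have NK' := schain_sle h1.
  exists (pre K'); split.
  - by apply: IH => // x /h2/hK.
  - by move=> u /in_pre/h2 hu; apply/in_pre.
  - move=> h4; apply: h3 => x xK; have [u hu] := hK x xK.
    have /in_pre fu : u \in pre K'.
      by apply/h4/in_pre; rewrite -(subm_eqmod (NK _ hu)).
    by rewrite (subm_eqmod (NK' _ hu)).
suff h D : schain (pre N) D n -> schain N (img N D) n.
  move/h/schain_mono; apply=> x /in_img[u /in_pre fu xu].
  by rewrite (subm_eqmod (NK _ xu)).
elim: n D => [|n IH] D /=.
  move=> h x hx; apply/in_img; exists 0; [exact: rpred0|rewrite linear0 subr0; exact: hx].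
move=> [D' [h1 h2 h3]]; exists (img N D'); split; first exact: IH.
  by move=> x /in_img[u /h2 hu xu]; apply/in_img; exists u.
move=> h4; apply: h3 => u hu.
have /h4/in_img[u' hu' e] : f u \in img N D.
  by apply/in_img; exists u => //; rewrite subrr rpred0.
rewrite -(subrK u' u) rpredD // (schain_sle h1) //.
by apply/in_pre; rewrite linearB.
Qed.

Lemma rlen_pre N K n : sle N K ->
  (forall x, x \in K -> exists u, x - f u \in N) ->
  rlen N K n <-> rlen (pre N) (pre K) n.
Proof.
move=> NK hK; rewrite /rlen.
by split=> -[/(schain_pre _ NK hK) h1 h2]; split=> // /(schain_pre _ NK hK).
Qed.

End ChainImage.

Lemma quotm_len (R : comNzRingType) (V : lmodType R) (N : submodClosed V) n :
  rlen N (topm V) n -> length (quotm N) = n.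
Proof.
move=> h; apply: lengthP; apply/(@rlen_pre _ _ _ (pim N : {linear V -> quotm N})).
- exact: zerom_sle.
- by move=> q _; have [x ->] := pim_surj q; exists x; rewrite subrr rpred0.
have -> : pre (pim N : {linear V -> quotm N}) (zerom (quotm N)) = N.
  apply: subm_ext => x; first by move=> /in_pre/in_zerom e; rewrite -[x]subr0;
    apply/pim_eq; rewrite e linear0.
  by move=> hx; apply/in_pre/in_zerom; rewrite -(linear0 (pim N)); apply/pim_eq; rewrite subr0.
have -> // : pre (pim N : {linear V -> quotm N}) (topm (quotm N)) = topm V.
by apply: subm_ext => x _; [exact: in_topm|apply/in_pre; exact: in_topm].
Qed.

Lemma isom_len (R : comNzRingType) (V W : lmodType R) n :
  isom V W -> rlen (zerom V) (topm V) n -> rlen (zerom W) (topm W) n.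
Proof.
move=> [f [g gK fK]] h; apply/(@rlen_pre _ _ _ f); first exact: zerom_sle.
  by move=> x _; exists (g x); rewrite fK subrr rpred0.
have -> : pre f (zerom W) = zerom V.
  apply: subm_ext => x; last exact: zerom_sle.
  by move=> /in_pre/in_zerom e; apply/in_zerom; rewrite -(gK x) e -(linear0 f) gK.
have -> // : pre f (topm W) = topm V.
by apply: subm_ext => x _; [exact: in_topm|apply/in_pre; exact: in_topm].
Qed.

Section FiniteColength.
Variables (R : comNzRingType) (V : lmodType R) (m : ideal R).
Implicit Types (N K L : submodClosed V).
Hypotheses (hm : loc_ring m) (hR : noetherian R) (hV : noethm V).

(** [V / K] has finite length. *)
Definition cofin K := forall (a : R) v, a \in m -> exists j, a ^+ j *: v \in K.

Lemma cofin_mono K L : sle K L -> cofin K -> cofin L.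
Proof. by move=> h hK a v ha; have [j /h] := hK a v ha; exists j. Qed.

Lemma rlen_addvs N (s : seq V) :
  (forall v (a : R), v \in s -> a \in m -> a *: v \in N) ->
  exists2 n, (n <= size s)%N & rlen N (addvs N s) n.
Proof.
elim: s N => [|v s IH] N h /=; first by exists 0%N => //; exact: rlen_refl.
have [|n hn hl] := IH (addv N v).
  by move=> u a hu ha; apply: sle_addv; apply: h => //; rewrite inE hu orbT.
have [vN|vN] := boolP (v \in N).
  exists n; first exact: leqW.
  suff e : addv N v = N by rewrite -[X in rlen X _ _]e.
  by apply: subm_ext; [exact: addv_min|exact: sle_addv].
exists n.+1 => //; rewrite -add1n; apply: (rlen_add _ _ _ hl).
- exact: sle_addv.
- exact: sle_addvs.
- by apply: (rlen_simple hm _ vN) => a ha; apply: h => //; exact: mem_head.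
Qed.

Lemma cofin_rlen K : cofin K -> exists n, rlen K (topm V) n.
Proof.
move=> /(nil_pow hR hV)[k hk].
suff [n hn] : exists n, rlen (ipow m V k) (topm V) n.
  have [_ [b [_ _ hb]]] := rlen_split hk (fun x _ => in_topm x) hn.
  by exists b.
elim: k {hk K} => [|k [n hn]]; first by exists 0%N; exact: rlen_refl.
have [s [hs1 hs2]] := hV (ipow m V k).
have [|l _ hl] := @rlen_addvs (ipow m V k.+1) s.
  by move=> v a /hs1 hv ha; exact: mem_imul.
exists (l + n)%N; apply: (rlen_add _ _ _ hn).
- exact: ipow_decr.
- by move=> x _; exact: in_topm.
suff -> : ipow m V k = addvs (ipow m V k.+1) s by [].
apply: subm_ext; first exact: sle_trans hs2 (addvs_mono (@zerom_sle _ _ _)).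
by apply: addvs_min => //; exact: ipow_decr.
Qed.

Lemma cofin_adds_exp N z i : cofin (adds N z) -> cofin (adds N (z ^+ i)).
Proof.
move=> h; elim: i => [|i IH] a v ha.
  by exists 0%N; rewrite !expr0 scale1r -[v]scale1r; exact: mem_adds.
have [j /in_adds[w hw]] := h a v ha; have [k /in_adds[u hu]] := IH a w ha.
exists (k + j)%N; rewrite exprD -scalerA; apply/in_adds; exists u.
have -> : a ^+ k *: (a ^+ j *: v) - z ^+ i.+1 *: u =
    a ^+ k *: (a ^+ j *: v - z *: w) + z *: (a ^+ k *: w - z ^+ i *: u).
  by rewrite !scalerBr !scalerA exprS addrA (mulrC (a ^+ k) z) subrK.
by rewrite rpredD // rpredZ.
Qed.

(** Both sides are the length of [(N + b V) \cap (N + d V)] over [N + b d V]. *)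
Lemma rlen_colon_swap N b d n : nzd N b -> nzd N d ->
  rlen (adds N d) (colon (adds N d) b) n -> rlen (adds N b) (colon (adds N b) d) n.
Proof.
suff key x y : nzd N x -> rlen (adds N y) (colon (adds N y) x) n <->
    rlen (adds N (x * y)) (capm (adds N x) (adds N y)) n.
  move=> nb nd /(key _ _ nb); rewrite mulrC => h; apply/(key _ _ nd).
  suff -> : capm (adds N d) (adds N b) = capm (adds N b) (adds N d) by [].
  by apply: subm_ext => u /inmk[h1 h2]; apply/inmk.
move=> nx; pose f : {linear V -> V} := *:%R x.
have fE u : f u = x *: u by [].
have e1 : pre f (adds N (x * y)) = adds N y.
  apply: subm_ext => u.
    move=> /in_pre/in_adds[w hw]; apply/in_adds; exists w; apply: nx.
    by rewrite scalerBr scalerA.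
  move=> /in_adds[w hw]; apply/in_pre/in_adds; exists w.
  by rewrite fE -scalerA -scalerBr rpredZ.
have e2 : pre f (capm (adds N x) (adds N y)) = colon (adds N y) x.
  apply: subm_ext => u; first by move=> /in_pre/inmk[_ h]; apply/inmk.
  by move=> /inmk h; apply/in_pre/inmk; split=> //; exact: mem_adds.
have := @rlen_pre _ _ _ f (adds N (x * y)) (capm (adds N x) (adds N y)) n.
rewrite e1 e2 => h; apply: iff_sym; apply: h.
  move=> u /in_adds[w hw]; apply/inmk; split.
    by apply/in_adds; exists (y *: w); rewrite scalerA.
  by apply/in_adds; exists (x *: w); rewrite scalerA mulrC.
by move=> u /inmk[/in_adds[w hw] _]; exists w; exact: sle_adds.
Qed.

(** If [z] and [b] are nonzerodivisors on [V / N] and [z] is a parameter, then so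
    is [b]: the length of [V / (N + b V + z^i V)] is that of the part of
    [V / (N + b V)] killed by [z^i], and this is stationary in [i]. *)
Lemma cofin_exchange N z b : z \in m -> nzd N z -> nzd N b ->
  cofin (adds N z) -> cofin (adds N b).
Proof.
move=> hz nz nb hc.
pose Y := adds N b; pose C i := colon Y (z ^+ i).
pose W i := adds (adds N (z ^+ i)) b.
have lenW i : exists n, rlen (W i) (topm V) n /\ rlen Y (C i) n.
  have [l hl] := cofin_rlen (cofin_adds_exp i hc).
  have [a [b' [e1 h1 h2]]] :=
    rlen_split (@sle_adds _ _ _ b) (fun x _ => in_topm x) hl.
  have [|a' [b'' [e2 h3 h4]]] :=
    rlen_split (N := adds N (z ^+ i)) (K := colon (adds N (z ^+ i)) b) _
      (fun x _ => in_topm x) hl.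
    by move=> x hx; apply/inmk; exact: rpredZ.
  exists b'; split=> //; apply: rlen_colon_swap => //; first exact: nzd_exp.
  have e : a = b''.
    apply: rlen_uniq h1 _; apply/(@rlen_pre _ _ _ ( *:%R b : {linear V -> V})).
    - exact: sle_adds.
    - by move=> x /in_adds[v hv]; exists v.
    have -> : pre ( *:%R b : {linear V -> V}) (adds (adds N (z ^+ i)) b) = topm V.
      apply: subm_ext => x _; [exact: in_topm|apply/in_pre; exact: mem_adds].
    suff -> : pre ( *:%R b : {linear V -> V}) (adds N (z ^+ i)) =
      colon (adds N (z ^+ i)) b by [].
    by apply: subm_ext => x; [move=> /in_pre h; apply/inmk|move=> /inmk h; apply/in_pre].
  by have -> : b' = a' by lia.
have [i hi] : exists i, forall k, sle (C k) (C i).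
  apply: noethm_chain => // i x /inmk hx; apply/inmk.
  by rewrite /= exprS -scalerA rpredZ.
have eC : C i.+1 = C i.
  apply: subm_ext; first exact: hi.
  by move=> x /inmk hx; apply/inmk; rewrite /= exprS -scalerA rpredZ.
have eW : W i = W i.+1.
  have [n [h1 h2]] := lenW i; have [n' [h3 h4]] := lenW i.+1.
  rewrite eC in h4; rewrite (rlen_uniq h4 h2) in h3.
  apply: rlen_eq h3 h1; last by move=> x _; exact: in_topm.
  apply/adds_mono/adds_min; first exact: sle_adds.
  by move=> v; rewrite exprSr -scalerA; exact: mem_adds.
have hY : sle (adds Y (z ^+ i)) Y.
  apply: (nakayama1 hm hV hz) => x /in_adds[v hv].
  have : z ^+ i *: v \in W i.+1 by rewrite -eW; apply: sle_adds; exact: mem_adds.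
  rewrite /W addsC -/Y => /in_adds[u hu]; exists (z ^+ i *: u); first exact: mem_adds.
  by rewrite scalerA -exprS -(subrK (z ^+ i *: v) x) -addrA rpredD.
apply: cofin_mono (cofin_adds_exp i hc).
by apply: adds_min => [|v]; [exact: sle_adds|apply: hY; exact: mem_adds].
Qed.

End FiniteColength.
(** * Exchanging regular sequences, and a criterion for parameters *)

Section ListIdeals.
Variable R : comNzRingType.
Implicit Types (q : seq R) (I m P : ideal R) (a b : R).

Definition idl q : ideal R := @addseq R R^o (zerom R^o) q.

Lemma mem_idl q a : a \in q -> a \in idl q.
Proof.
move=> ha; have -> : a = a *: (1 : R^o) by rewrite /GRing.scale /= mulr1.
exact: (@mem_addseq R R^o).
Qed.

Lemma idl_min q I : (forall a, a \in q -> a \in I) -> sle (idl q) I.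
Proof.
move=> h; apply: addseq_min; first exact: zerom_sle.
by move=> a v /h ha; exact: ideal_mulr.
Qed.

Lemma idl_sub q1 q2 : {subset q1 <= q2} -> sle (idl q1) (idl q2).
Proof. by move=> h; apply: idl_min => a /h; exact: mem_idl. Qed.

Lemma idl_eqmem q1 q2 : q1 =i q2 -> idl q1 = idl q2.
Proof. by move=> h; apply: subm_ext; apply: idl_sub => x; rewrite h. Qed.

Lemma idl_rcons q a : @adds R R^o (idl q) a = idl (rcons q a).
Proof. by rewrite /idl addseq_rcons. Qed.

Lemma in_idl q a : a \in idl q <-> exists r : nat -> R, a = \sum_(i < size q) r i * q`_i.
Proof.
split=> [/(@in_addseq R R^o)[r /(@in_zerom R R^o)/subr0_eq e]|[r ->]].
  by exists r; rewrite {1}e; apply: eq_bigr => i _; rewrite mulrC.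
by apply: ideal_sum => i _; apply: ideal_mull; apply: mem_idl; exact: mem_nth.
Qed.

Lemma det_eqmod I n (G H : 'M[R]_n) :
  (forall i j, G i j - H i j \in I) -> \det G - \det H \in I.
Proof.
move=> h; rewrite /determinant -sumrB; apply: ideal_sum => s _.
rewrite -mulrBr; apply: ideal_mull.
elim/big_ind2: _ => [|x1 x2 y1 y2 hx hy|i _] /=; first by rewrite subrr; exact: ideal0.
  have -> : x2 * y2 - x1 * y1 = (x2 - x1) * y2 + x1 * (y2 - y1) by ring.
  by apply: idealD; [exact: ideal_mulr|exact: ideal_mull].
exact: h.
Qed.

Lemma det_mul_adj n (G : 'M[R]_n) (z b : 'I_n -> R) j :
  (forall i, b i = \sum_j G i j * z j) -> \det G * z j = \sum_i \adj G j i * b i.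
Proof.
move=> hb; pose Z := \col_i z i.
have e : (\adj G *m (G *m Z)) j 0 = \det G * z j.
  by rewrite mulmxA mul_adj_mx mul_scalar_mx !mxE.
rewrite -e mxE; apply: eq_bigr => i _; rewrite hb; congr (_ * _).
by rewrite mxE; apply: eq_bigr => k _; rewrite !mxE.
Qed.

Lemma det_mul_mem n (G : 'M[R]_n) (z b : 'I_n -> R) I :
  (forall i, b i = \sum_j G i j * z j) -> (forall i, b i \in I) ->
  forall j, \det G * z j \in I.
Proof.
move=> hb hI j.
rewrite (det_mul_adj _ hb).
by apply: ideal_sum => i _; exact: ideal_mull.
Qed.

End ListIdeals.

Section Exchange.
Variables (R : comNzRingType) (m : ideal R).
Hypotheses (hm : loc_ring m) (hR : noetherian R).
Implicit Types (q z b : seq R).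

Let hV : noethm R^o := (noetherian_noethm R).1 hR.

(** The [i]-th entries of [z] and of [b] are both nonzerodivisors modulo the
    first [i] entries of [b] and the entries of [z] after the [i]-th, so that one
    may pass from [z] to [b] by exchanging one entry after the other. *)
Definition exchangeable z b := forall i, (i < size z)%N ->
  let e := idl (take i b ++ drop i.+1 z) in
  @nzd R R^o e z`_i /\ @nzd R R^o e b`_i.

(** General position: each entry [b_i] is changed within its coset modulo the
    ideal [c] of the following entries. *)
Lemma general_position (Inv : seq R -> seq R -> Prop) (c : seq R -> ideal R) :
  (forall q, sle (c q) m) ->
  (forall pre x b, Inv pre (x :: b) ->
    (forall P, primeI P -> ~ sle m P -> (forall y, y \in pre -> y \in P) ->
      ~ (x \in P /\ sle (c b) P)) /\
    (forall e, e \in c b -> Inv (rcons pre (x + e)) b)) ->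
  forall z b pre, size z = size b -> {subset pre ++ z <= m} -> {subset b <= m} ->
    @rseq R R^o (zerom R^o) (pre ++ z) -> Inv pre b ->
  exists b', [/\ size b' = size b, {subset b' <= m},
    @rseq R R^o (zerom R^o) (pre ++ b'),
    forall i, (i < size b)%N -> b'`_i - b`_i \in c (drop i.+1 b) &
    forall i, (i < size z)%N ->
      let e := idl (pre ++ take i b' ++ drop i.+1 z) in
      @nzd R R^o e z`_i /\ @nzd R R^o e b'`_i].
Proof.
move=> cm hInv; elim=> [|y z IH] [|x b] // pre; first by move=> *; exists [::].
move=> /= [sz] hz hb hr hI; have [hP hI'] := hInv _ _ _ hI.
have ym : y \in m by apply: hz; rewrite mem_cat mem_head orbT.
have [hr1 ny] : @rseq R R^o (zerom R^o) (pre ++ z) /\ @nzd R R^o (idl (pre ++ z)) y.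
  have : @rseq R R^o (zerom R^o) ((pre ++ z) ++ [:: y]).
    apply: (rseq_perm hm hV hz) hr.
    by rewrite -catA perm_cat2l -(cat1s y) perm_catC.
  by move=> /rseq_cat[h1 [h2 _]].
have [|e ec nx] := @nzd_choice _ _ hR hV (idl (pre ++ z)) x (c b).
  move=> w hw pw; apply: hP => //; first by move=> h; case/negP: hw; apply/ny/in_annv/h.
  move=> u hu; apply/in_annv; apply: ideal_mulr; apply: mem_idl.
  by rewrite mem_cat hu.
have xem : x + e \in m by apply: idealD; [exact/hb/mem_head|exact: cm ec].
have pre_m u : u \in pre -> u \in m by move=> hu; apply: hz; rewrite mem_cat hu.
have z_m u : u \in z -> u \in m by move=> hu; apply: hz; rewrite mem_cat inE hu !orbT.
have [||||b' [sb' b'm hr' hb' hex]] := IH b (rcons pre (x + e)) sz.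
- move=> u; rewrite mem_cat mem_rcons inE.
  by case/orP => [/orP[/eqP ->//|/pre_m]|/z_m].
- by move=> u hu; apply: hb; rewrite inE hu orbT.
- have : @rseq R R^o (zerom R^o) ((pre ++ z) ++ [:: x + e]) by apply/rseq_cat.
  apply: (rseq_perm hm hV).
    move=> u; rewrite mem_cat mem_seq1 mem_cat.
    by case/orP => [/orP[/pre_m|/z_m]|/eqP ->].
  by rewrite cat_rcons -catA perm_cat2l cats1 perm_rcons.
- exact: hI'.
exists (x + e :: b'); split; rewrite /= ?sb' //.
- by move=> u; rewrite inE => /orP[/eqP ->|/b'm].
- by rewrite -cat_rcons.
- by case=> [_|i]; [rewrite drop0 addrAC subrr add0r|rewrite ltnS; exact: hb'].
- case=> [_|i]; first by rewrite take0 drop0.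
  by rewrite ltnS => /hex /=; rewrite cat_rcons.
Qed.

Section WiebeSection.
Variables (z b : seq R).
Hypotheses (sz : size b = size z) (hex : exchangeable z b).

Let e i := idl (take i b ++ drop i.+1 z).
Let cc i := take i b ++ drop i z.

Lemma cc_z i : (i < size z)%N -> idl (cc i) = @adds R R^o (e i) z`_i.
Proof.
move=> hi; rewrite /e idl_rcons; apply: idl_eqmem => x.
by rewrite /cc (drop_nth 0 hi) mem_rcons !(mem_cat, inE) orbCA.
Qed.

Lemma cc_b i : (i < size z)%N -> idl (cc i.+1) = @adds R R^o (e i) b`_i.
Proof.
move=> hi; rewrite /e idl_rcons; apply: idl_eqmem => x.
by rewrite /cc (take_nth 0) ?sz // mem_rcons !(mem_cat, mem_rcons, inE) orbA.
Qed.

Lemma cofin_idl_exchange : {subset z <= m} -> cofin m (idl z) -> cofin m (idl b).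
Proof.
move=> zm hz; suff h i : (i <= size z)%N -> cofin m (idl (cc i)).
  by have := h (size z) (leqnn _); rewrite /cc -{1}sz take_size drop_size cats0.
elim: i => [|i IH] hi; first by rewrite /cc take0 drop0.
have [h1 h2] := hex hi; rewrite cc_b //.
apply: (cofin_exchange hm hR hV _ h1 h2); first exact/zm/mem_nth.
by rewrite -cc_z //; apply: IH; exact: ltnW.
Qed.

(** If [b = G z], exchanging the [i]-th entry turns the multipliers of [(z)] into
    the intermediate ideal [(b_0, .., b_(i-1), z_i, ..)] from multiples of one
    leading principal minor of [G] into multiples of the next one: by Cramer's
    rule, [D_(i+1) z_i = D_i b_i] modulo the other entries. *)
Lemma wiebe (G : 'M[R]_(size z)) v :
  (forall i : 'I_(size z), b`_i = \sum_j G i j * z`_j) ->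
  (forall x, x \in z -> v * x \in idl b) ->
  exists r, v - \det G * r \in idl b.
Proof.
move=> hG.
pose H i : 'M[R]_(size z) := \matrix_(k, l) if (k < i)%N then G k l else (k == l)%:R.
have ccn i (k : 'I_(size z)) : (i <= size z)%N ->
    (cc i)`_k = if (k < i)%N then b`_k else z`_k.
  move=> hi; rewrite /cc nth_cat size_take sz.
  have -> : (if (i < size z)%N then i else size z) = i by case: ltnP; lia.
  by case: ltnP => hk; rewrite ?nth_take // nth_drop subnKC.
have hH i (k : 'I_(size z)) : (i <= size z)%N -> (cc i)`_k = \sum_l H i k l * z`_l.
  move=> hi; rewrite ccn //; case: ifP => hk.
    by rewrite hG; apply: eq_bigr => l _; rewrite mxE hk.
  rewrite (bigD1 k) //= big1 ?addr0 => [|l lk]; first by rewrite mxE hk eqxx mul1r.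
  by rewrite mxE hk eq_sym (negPf lk) mul0r.
suff h i : (i <= size z)%N -> forall v, (forall x, x \in z -> v * x \in idl (cc i)) ->
    exists r, v - \det (H i) * r \in idl (cc i).
  have := h (size z) (leqnn _) v.
  have -> : cc (size z) = b by rewrite /cc -{1}sz take_size drop_size cats0.
  suff -> : H (size z) = G by [].
  by apply/matrixP => k l; rewrite mxE ltn_ord.
elim: i => [|i IH] hi {}v hv.
  exists v; suff -> : H 0%N = 1%:M by rewrite det1 mul1r subrr; exact: ideal0.
  by apply/matrixP => k l; rewrite !mxE.
have [nz nb] := hex hi; pose o := Ordinal hi.
have cramer : \det (H i.+1) * z`_i - \det (H i) * b`_i \in e i.
  have e1 : \det (H i) = cofactor (H i.+1) o o.
    rewrite (expand_det_row _ o) (bigD1 o) //= big1 ?addr0 => [|l lo].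
      rewrite mxE /= ltnn eqxx mul1r /cofactor; congr (_ * \det _).
      apply/matrixP => k l; rewrite !mxE /=.
      have : nat_of_ord (lift o k) != i by rewrite eq_sym; exact: (neq_lift o k).
      by case: ltngtP => // h _; rewrite ltnS ?(ltnW h) // leqNgt h.
    by rewrite mxE /= ltnn eq_sym (negPf lo) mul0r.
  have -> : \det (H i.+1) * z`_i = \sum_k \adj (H i.+1) o k * (cc i.+1)`_k.
    exact: (@det_mul_adj _ _ (H i.+1) (fun j => z`_j) (fun k => (cc i.+1)`_k) o
      (fun k => hH i.+1 k hi)).
  rewrite (bigD1 o) // ccn // [nat_of_ord o]/= ltnSn mxE -e1 addrAC subrr add0r.
  apply: ideal_sum => k ko; apply: ideal_mull; apply: mem_idl; rewrite ccn //.
  have {ko} ko : nat_of_ord k != i by [].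
  rewrite mem_cat ltnS; case: ltngtP ko => // hk _; apply/orP; [left|right].
    have h1 : (k < size (take i b))%N by rewrite size_takel // sz ltnW.
    by rewrite -(nth_take 0 hk) mem_nth.
  have h1 : (k - i.+1 < size (drop i.+1 z))%N by rewrite size_drop; have := ltn_ord k; lia.
  by rewrite -(subnKC hk) -nth_drop mem_nth.
have vz : v * z`_i \in @adds R R^o (e i) b`_i by rewrite -cc_b //; exact/hv/mem_nth.
have [r hr] := (@in_adds R R^o _ _ _).1 vz.
have {}hr : v * z`_i - b`_i * r \in e i by [].
have [x hx|q] := IH (ltnW hi) r.
  rewrite cc_z //; have := hv x hx; rewrite cc_b // => /(@in_adds R R^o)[t ht].
  have {}ht : v * x - b`_i * t \in e i by [].
  apply/(@in_adds R R^o); exists t; apply: nb.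
  have -> : b`_i *: (r * x - z`_i *: t : R^o) =
     z`_i * (v * x - b`_i * t) - x * (v * z`_i - b`_i * r).
    by rewrite /GRing.scale /=; ring.
  by apply: idealB; exact: ideal_mull.
rewrite cc_z // => /(@in_adds R R^o)[t ht].
have {}ht : r - \det (H i) * q - z`_i * t \in e i by [].
exists q; rewrite cc_b //; apply/(@in_adds R R^o); exists t; apply: nz.
have -> : z`_i *: (v - \det (H i.+1) * q - b`_i *: t : R^o) =
    (v * z`_i - b`_i * r) + b`_i * (r - \det (H i) * q - z`_i * t)
    - q * (\det (H i.+1) * z`_i - \det (H i) * b`_i).
  by rewrite /GRing.scale /=; ring.
apply: idealB; last exact: ideal_mull.
by apply: idealD => //; exact: ideal_mull.
Qed.

End WiebeSection.

(** In a ring with a regular sequence [z] generating the maximal ideal, a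
    sequence of the same length generating a primary ideal is regular: adding
    to each entry a combination of the later ones makes it regular, and this
    can be undone when the sequence is read backwards. *)
Lemma cofin_rseq z b : size z = size b -> {subset z <= m} -> {subset b <= m} ->
  @rseq R R^o (zerom R^o) z -> cofin m (idl b) -> 
  @rseq R R^o (zerom R^o) b /\ exists b', [/\ size b' = size b, exchangeable z b',
    idl b' = idl b & forall i, (i < size b)%N -> b'`_i - b`_i \in idl (drop i.+1 b)].
Proof.
move=> szb zm bm hz hb.
pose Inv pre b := cofin m (idl (pre ++ b)) /\ {subset b <= m}.
have [|||b' [sb' b'm hr hb' hex]] :=
    @general_position Inv (fun q => capm (idl q) m) _ _ z b [::] szb zm bm hz.
- by move=> q x /inmk[].
- move=> pre x q [hc qm]; split=> [P pP mP preP [xP qP]|e /inmk[eq em]].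
    apply: mP => a ha; have [j hj] := hc a 1 ha.
    apply: (@primeI_exp _ _ _ j pP).
    suff : sle (idl (pre ++ x :: q)) P.
      by apply; move: hj; rewrite /GRing.scale /= mulr1.
    apply: idl_min => y; rewrite mem_cat inE => /or3P[/preP //|/eqP -> //|hy].
    by apply: qP; apply/inmk; split; [exact: mem_idl|apply: qm; rewrite inE hy orbT].
  split; last by move=> y hy; apply: qm; rewrite inE hy orbT.
  apply: cofin_mono hc; apply: idl_min => y.
  rewrite cat_rcons mem_cat inE => /or3P[hy|/eqP ->|hy].
  - by apply: mem_idl; rewrite mem_cat hy.
  - rewrite -[X in X \in _](addrK e x); apply: idealB.
      by apply: mem_idl; rewrite mem_cat mem_head orbT.
    by apply: (idl_sub _ eq) => u hu; rewrite mem_cat inE hu !orbT.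
  - by apply: mem_idl; rewrite mem_cat inE hy !orbT.
- by split.
have {}hb' i : (i < size b)%N -> b'`_i - b`_i \in idl (drop i.+1 b).
  by move=> /hb'/inmkI[].
have hrev : @rseq R R^o (zerom R^o) (rev b').
  by apply: (rseq_perm hm hV b'm _ hr); rewrite perm_sym perm_rev.
suff h : idl b' = idl b /\ @rseq R R^o (zerom R^o) (rev b).
  split; last by exists b'; split=> //; exact: h.1.
  apply: (rseq_perm hm hV _ _ h.2); last by rewrite perm_rev.
  by move=> x; rewrite mem_rev; exact: bm.
elim: b' b sb' hb' hrev {hb b'm hr hex szb bm} => [|x' b' IH] [|x b] //= [sb] hb'.
rewrite !rev_cons -!cats1 => /rseq_cat[hr [nx _]].
have [|e hr'] := IH b sb _ hr; first by move=> i hi; exact: (hb' i.+1 hi).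
have hx : x' - x \in idl b by have := hb' 0%N isT; rewrite /= drop0.
have e2 : idl (rev b) = idl b by apply: idl_eqmem => u; rewrite mem_rev.
have e2' : idl (rev b') = idl b by rewrite -e; apply: idl_eqmem => u; rewrite mem_rev.
split.
  have h1 : sle (idl b') (idl (x :: b)).
    by rewrite e; apply: idl_sub => u hu; rewrite inE hu orbT.
  have h2 : sle (idl b) (idl (x' :: b')).
    by rewrite -e; apply: idl_sub => u hu; rewrite inE hu orbT.
  apply: subm_ext; apply: idl_min => u; rewrite inE => /orP[/eqP ->|hu].
  - rewrite -(subrK x x'); apply: idealD; last exact/mem_idl/mem_head.
    by apply: h1; rewrite e.
  - by apply: h1; exact: mem_idl.
  - rewrite -(subKr x' x); apply: idealB; first exact/mem_idl/mem_head.
    exact: h2.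
  - by apply: h2; exact: mem_idl.
apply/rseq_cat; split=> //; split=> // v.
rewrite -/(idl (rev b)) e2 => hv; rewrite -/(idl (rev b')) e2' in nx; apply: nx.
have -> : x' *: v = x *: v + (x' - x) *: v by rewrite -scalerDl addrC subrK.
by apply: idealD => //; exact: ideal_mulr.
Qed.

(** The exchangeable sequence provided by [cofin_rseq] differs from [b] by a
    unitriangular matrix, which changes neither the ideal nor the determinant. *)
Lemma wiebe_param z b (G : 'M[R]_(size z)) v :
  size z = size b -> {subset z <= m} -> {subset b <= m} ->
  @rseq R R^o (zerom R^o) z -> cofin m (idl b) ->
  (forall i : 'I_(size z), b`_i = \sum_j G i j * z`_j) ->
  (forall x, x \in z -> v * x \in idl b) ->
  exists r, v - \det G * r \in idl b.
Proof.
move=> szb zm bm hz hb hG hv.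
have [_ [b' [sb' hex eb hb']]] := cofin_rseq szb zm bm hz hb.
have hE (i : nat) : {c : nat -> R | (i < size b)%N ->
    b'`_i - b`_i = \sum_(j < size z) c j * b`_j /\ forall j, (j <= i)%N -> c j = 0}.
  apply: cid; case: (ltnP i (size b)) => ib; last by exists (fun=> 0).
  have /in_idl[r er] := hb' i ib.
  exists (fun j => if (i < j)%N then r (j - i.+1)%N else 0) => _.
  split=> [|j ji]; last by rewrite ltnNge ji.
  pose F j := (if (i < j)%N then r (j - i.+1)%N else 0) * b`_j.
  have e := @big_addn R 0 +%R 0 (size b) i.+1 xpredT F; rewrite add0n in e.
  rewrite er size_drop szb -(big_mkord xpredT F) [RHS](big_cat_nat (n := i.+1)) //= e.
  rewrite [X in _ = X + _]big_nat_cond [X in _ = X + _]big1 ?add0r; last first.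
    by move=> j /andP[/andP[_ ji] _]; rewrite /F ltnNge -ltnS ji mul0r.
  rewrite big_mkord; apply: eq_bigr => j _; rewrite /F.
  by rewrite ifT ?addnK ?nth_drop 1?addnC //; lia.
pose U : 'M[R]_(size z) := \matrix_(i, j) ((i == j)%:R + sval (hE i) j).
have ib (i : 'I_(size z)) : (i < size b)%N by rewrite -szb.
have bU (i : 'I_(size z)) : b'`_i = \sum_k U i k * b`_k.
  have [e _] := svalP (hE i) (ib i); rewrite -(subrK b`_i b'`_i) e addrC.
  under [RHS]eq_bigr do rewrite mxE mulrDl.
  rewrite [RHS]big_split /= [X in _ = X + _](bigD1 i) //= eqxx mul1r.
  rewrite [X in _ = _ + X + _]big1 ?addr0 // => j ji.
  by rewrite eq_sym (negPf ji) mul0r.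
have detU : \det U = 1.
  rewrite -det_tr det_trig.
    rewrite big1 // => i _; rewrite !mxE eqxx.
    by have [_ ->] := svalP (hE i) (ib i); rewrite ?addr0.
  apply/is_trig_mxP => i j ij; rewrite !mxE.
  by have [_ ->] := svalP (hE j) (ib j); rewrite ?addr0 -?val_eqE ?gtn_eqF // ltnW.
have hG' (i : 'I_(size z)) : b'`_i = \sum_j (U *m G) i j * z`_j.
  rewrite bU; under eq_bigr => k _ do rewrite hG mulr_sumr.
  rewrite exchange_big /=; apply: eq_bigr => j _.
  by rewrite mxE mulr_suml; apply: eq_bigr => k _; rewrite mulrA.
have sb'z : size b' = size z by rewrite sb'.
have [x /hv|r] := wiebe sb'z hex hG' (v := v); first by rewrite eb.
by rewrite eb det_mulmx detU mul1r => h; exists r.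
Qed.

(** Suppose that [z] is regular and generates the maximal ideal, and let
    [b = G z]. If [det G] is not in [(b)], then it is not in [(b) + m^k] for some
    [k]. Change [b] modulo [m^(k+1)] into a regular sequence [b']; the socle
    modulo [(b')] is generated by a determinant congruent to [det G] modulo
    [m^k], so the ideal [(b) + m^k], which contains [(b')] but not [det G], is
    [(b')]; hence it is [(b)] by Nakayama. *)
Lemma det_notin_param z b (G : 'M[R]_(size z)) :
  size z = size b -> {subset z <= m} -> sle m (idl z) -> {subset b <= m} ->
  @rseq R R^o (zerom R^o) z ->
  (forall i : 'I_(size z), b`_i = \sum_j G i j * z`_j) -> \det G \notin idl b ->
  [/\ @rseq R R^o (zerom R^o) b, cofin m (idl b) &
      forall v, (forall a, a \in m -> a * v \in idl b) ->
        exists r, v - \det G * r \in idl b].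
Proof.
move=> szb zm mz bm hz hG hD.
have hcz : cofin m (idl z).
  move=> a v ha; exists 1%N; rewrite expr1; apply: ideal_mulr; exact: mz.
have [k hk] : exists k, \det G \notin addm (idl b) (ipow m R^o k).
  apply: contrapT => h; case/negP: hD.
  apply: (krull_intersection hm hR hV) => k; apply: contrapT => /negP h'.
  by apply: h; exists k.
pose I := addm (idl b) (ipow m R^o k).
have [|||b' [sb' b'm _ hb' hex]] :=
    @general_position (fun _ _ => True) (fun=> ipow m R^o k.+1) _ _ z b [::] szb zm bm hz.
- move=> _; apply: imul_min => a v ha _; exact: ideal_mulr.
- move=> pre x q _; split=> // P pP mP _ [_ h]; apply: mP => a ha.
  apply: (@primeI_exp _ _ _ k.+1 pP); apply: h.
  by have := mem_ipow k.+1 (1 : R^o) ha; rewrite /GRing.scale /= mulr1.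
- by [].
have sb'z : size b' = size z by rewrite sb'.
have {}hex : exchangeable z b' by [].
(* b' - b = E z with entries of E in m^k *)
have mkz x : x \in ipow m R^o k.+1 -> exists c : nat -> R,
    (forall j, c j \in ipow m R^o k) /\ x = \sum_(j < size z) c j * z`_j.
  pose S : set R^o := [set x | exists c : nat -> R,
    (forall j, c j \in ipow m R^o k) /\ x = \sum_(j < size z) c j * z`_j]%classic.
  have hS : submod_set S.
    split=> [|a u v [c [hc ->]] [d [hd ->]]].
      exists (fun=> 0); split=> [j|]; first exact: ideal0.
      by rewrite big1 // => j _; rewrite mul0r.
    exists (fun j => a * c j + d j); split=> [j|].
      by apply: idealD => //; exact: ideal_mull.
    rewrite scaler_sumr -big_split /=; apply: eq_bigr => j _.
    by rewrite mulrDl -mulrA.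
  suff : sle (ipow m R^o k.+1) (mksubm hS) by move=> h /h/inmk.
  apply: imul_min => a v ha hv; have [c ->] := (in_idl z a).1 (mz a ha).
  apply: (inmk hS _).2; exists (fun j => v * c j); split=> [j|]; first exact: ideal_mulr.
  rewrite /GRing.scale /= mulr_suml; apply: eq_bigr => j _.
  by rewrite mulrC mulrA.
have [E hE] : exists E : nat -> nat -> R, forall i, (i < size b)%N ->
    (forall j, E i j \in ipow m R^o k) /\ b'`_i - b`_i = \sum_(j < size z) E i j * z`_j.
  have h i : {c : nat -> R | (i < size b)%N -> (forall j, c j \in ipow m R^o k) /\
      b'`_i - b`_i = \sum_(j < size z) c j * z`_j}.
    apply: cid; have [hi|hi] := boolP (i < size b)%N; last by exists (fun=> 0).
    by have [c hc] := mkz _ (hb' i hi); exists c.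
  by exists (fun i => sval (h i)) => i; exact: (svalP (h i)).
pose G' : 'M[R]_(size z) := \matrix_(i, j) (G i j + E i j).
have hi (i : 'I_(size z)) : (i < size b)%N by rewrite -szb.
have hG' (i : 'I_(size z)) : b'`_i = \sum_j G' i j * z`_j.
  have [_ e] := hE i (hi i); rewrite -(subrK b`_i b'`_i) e hG -big_split /=.
  by apply: eq_bigr => j _; rewrite !mxE mulrDl addrC.
have detE : \det G' - \det G \in ipow m R^o k.
  apply: det_eqmod => i j; rewrite !mxE addrAC subrr add0r.
  by have [h _] := hE i (hi i); exact: h.
have mkI : sle (ipow m R^o k) I by exact: sle_addmr.
have bI : sle (idl b) I by exact: sle_addml.
have hD'I : \det G' \notin I.
  by apply: contra hk => h; rewrite -(ideal_eqmod (a := \det G')) //; exact: mkI.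
have b'b : sle (idl b') (addm (idl b) (ipow m R^o k.+1)).
  apply: idl_min => x /(nthP 0)[i]; rewrite sb' => hi' <-.
  rewrite -(subrK b`_i b'`_i); apply: idealD; first exact/sle_addmr/hb'.
  by apply: sle_addml; apply: mem_idl; exact: mem_nth.
have b'I : sle (idl b') I.
  apply: sle_trans b'b _; apply: addm_min => //.
  exact: sle_trans (@ipow_decr _ _ _ _) mkI.
have W v : (forall a, a \in m -> a * v \in idl b') ->
    exists r, v - \det G' * r \in idl b'.
  move=> hv; apply: (wiebe sb'z hex hG') => x /zm/hv; by rewrite mulrC.
have hc' : cofin m (idl b') := cofin_idl_exchange sb'z hex zm hcz.
have Ib' : sle I (idl b').
  move=> v vI; apply: contrapT => /negP vb'; case/negP: hD'I.
  have [|r [rv pr _]] := @nzero_ass_mul R R^o (idl b') v 0 hR vb'.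
    by rewrite scale0r; exact: (@rpred0 R^o).
  have rm a : a \in m -> a * (r * v) \in idl b'.
    move=> ha; have [j hj] := hc' a (r * v) ha.
    by apply/in_annv; apply: (@primeI_exp _ _ _ j pr); apply/in_annv.
  have [s hs] := W _ rm.
  have [sm|sm] := boolP (s \in m).
    case/negP: rv; rewrite (ideal_eqmod (a := r * v) hs) mulrC.
    have := mz s sm; rewrite mulrC; move: s {hs sm} => s hs.
    have : sle (idl z) (annv (idl b') (\det G' : R^o)).
      apply: idl_min => x /(nthP 0)[i hi' <-]; apply/in_annv.
      rewrite /GRing.scale /= mulrC.
      apply: (@det_mul_mem _ _ G' (fun j => z`_j) (fun k => b'`_k) _ hG' _ (Ordinal hi')) => j.
      by apply: mem_idl; apply: mem_nth; rewrite sb'z.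
    by move/(_ s hs)/in_annv; rewrite /GRing.scale /= mulrC.
  have [t st] := hm.2 s sm.
  have -> : \det G' = t * (r * v) - t * (r * v - \det G' * s).
    by rewrite mulrBr opprB addrCA subrr addr0 mulrCA (mulrC t) st mulr1.
  by apply: idealB; [do 2!apply: ideal_mull|apply/ideal_mull/b'I].
have Ib : sle I (idl b).
  apply: (nakayama hm hV) => v /Ib'/b'b; apply: addm_min; first exact: sle_addml.
  apply: sle_trans (@sle_addmr _ _ _ _); exact: imul_mono.
have eb : idl b = idl b'.
  by apply: subm_ext; [exact: sle_trans bI Ib'|exact: sle_trans b'I Ib].
have hcb : cofin m (idl b) by rewrite eb.
split=> //; first exact: (cofin_rseq szb zm bm hz hcb).1.
move=> v hv; have [a ha|r hr] := W v; first by rewrite -eb; exact: hv.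
exists r; have -> : v - \det G * r = v - \det G' * r + (\det G' - \det G) * r by ring.
apply: idealD; first by rewrite eb.
by apply: ideal_mulr; apply: Ib; exact: mkI.
Qed.

End Exchange.
(** * Lifting freeness and splittings along regular sequences *)

Section Rows.
Variables (R : comNzRingType).

Lemma rV_noethm n : noetherian R -> noethm 'rV[R]_n.
Proof.
move=> hR; apply: noethm_fg => //.
exists [seq delta_mx 0 i | i <- enum 'I_n] => v.
rewrite (row_sum_delta v); apply: rpred_sum => i _; apply: rpredZ.
by apply: in_genby => /=; apply: map_f; rewrite mem_enum.
Qed.

Fact vecI_subproof (I : ideal R) n :
  submod_set [set v : 'rV[R]_n | forall k, v 0 k \in I].
Proof.
split=> [k|a u v hu hv k] /=; first by rewrite mxE; exact: ideal0.
by rewrite !mxE; apply: idealD => //; exact: ideal_mull.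
Qed.
Definition vecI (I : ideal R) n := mksubm (vecI_subproof I n).

Lemma in_vecI (I : ideal R) n (v : 'rV[R]_n) : v \in vecI I n <-> forall k, v 0 k \in I.
Proof. exact: inmk. Qed.

Definition dot n (c y : 'rV[R]_n) : R := (c *m y^T) 0 0.

Lemma dotE n (c y : 'rV[R]_n) : dot c y = \sum_k c 0 k * y 0 k.
Proof. by rewrite /dot mxE; apply: eq_bigr => k _; rewrite mxE. Qed.

Lemma dotC n (c y : 'rV[R]_n) : dot c y = dot y c.
Proof. by rewrite !dotE; apply: eq_bigr => k _; rewrite mulrC. Qed.

Lemma dotDl n (c d y : 'rV[R]_n) : dot (c + d) y = dot c y + dot d y.
Proof. by rewrite /dot mulmxDl mxE. Qed.
Lemma dotZl n a (c y : 'rV[R]_n) : dot (a *: c) y = a * dot c y.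
Proof. by rewrite /dot -scalemxAl mxE. Qed.
Lemma dotBl n (c d y : 'rV[R]_n) : dot (c - d) y = dot c y - dot d y.
Proof. by rewrite -scaleN1r dotDl dotZl mulN1r. Qed.
Lemma dotDr n (c y z : 'rV[R]_n) : dot c (y + z) = dot c y + dot c z.
Proof. by rewrite !(dotC c) dotDl. Qed.
Lemma dotZr n a (c y : 'rV[R]_n) : dot c (a *: y) = a * dot c y.
Proof. by rewrite !(dotC c) dotZl. Qed.
Lemma dotBr n (c y z : 'rV[R]_n) : dot c (y - z) = dot c y - dot c z.
Proof. by rewrite !(dotC c) dotBl. Qed.

Lemma dot_mul q r (B : 'M[R]_(r, q)) c s : dot c (s *m B) = dot (c *m B^T) s.
Proof. by rewrite /dot trmx_mul mulmxA. Qed.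

Lemma dot_delta n (c : 'rV[R]_n) k : dot c (delta_mx 0 k) = c 0 k.
Proof.
rewrite dotE (bigD1 k) //= big1 ?addr0 => [|i ik]; first by rewrite mxE !eqxx mulr1.
by rewrite mxE eqxx (negPf ik) mulr0.
Qed.

Lemma dot_vecI (I : ideal R) n (c y : 'rV[R]_n) : y \in vecI I n -> dot c y \in I.
Proof.
by move=> /in_vecI h; rewrite dotE; apply: ideal_sum => k _; exact: ideal_mull.
Qed.

Definition lincomb (V : lmodType R) n (g : 'I_n -> V) (a : 'rV[R]_n) : V :=
  \sum_k a 0 k *: g k.

Fact lincomb_linear (V : lmodType R) n (g : 'I_n -> V) : linear (lincomb g).
Proof.
move=> a u v; rewrite /lincomb scaler_sumr -big_split /=; apply: eq_bigr => k _.
by rewrite !mxE scalerDl scalerA.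
Qed.
HB.instance Definition _ (V : lmodType R) n (g : 'I_n -> V) :=
  GRing.isLinear.Build R 'rV[R]_n V _ (lincomb g) (lincomb_linear g).

Lemma lincomb_delta (V : lmodType R) n (g : 'I_n -> V) k :
  lincomb g (delta_mx 0 k) = g k.
Proof.
rewrite /lincomb (bigD1 k) //= big1 ?addr0 => [|i ik]; first by rewrite mxE !eqxx scale1r.
by rewrite mxE eqxx (negPf ik) scale0r.
Qed.

End Rows.

Section Lifting.
Variables (R : comNzRingType) (m : ideal R).
Hypotheses (hm : loc_ring m) (hR : noetherian R).

(** Let [x] be regular on [V]. If the [n_j] are independent modulo [x V], with
    coefficients in [R / x R], then they are independent: coefficients of a
    relation are multiples of [x], and dividing by [x] gives another relation. *)
Lemma indep_lift (V : lmodType R) mu (n : 'I_mu -> V) xs (I0 : ideal R)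
    (N0 : submodClosed V) :
  {subset xs <= m} -> (forall a v, a \in I0 -> a *: v \in N0) -> rseq N0 xs ->
  (forall a, lincomb n a \in addseq N0 xs -> a \in vecI (@addseq R R^o I0 xs) mu) ->
  forall a, lincomb n a \in N0 -> a \in vecI I0 mu.
Proof.
elim: xs I0 N0 => [|x xs IH] I0 N0 //= hxs hI [nx hr] htop.
have hI' a v : a \in @adds R R^o I0 x -> a *: v \in adds N0 x.
  move=> /(@in_adds R R^o)[r hr']; rewrite -(subrK (x * r) a) scalerDl.
  apply: rpredD; last by rewrite -scalerA; exact: mem_adds.
  by apply: sle_adds; exact: hI.
have h1 := IH _ _ (fun y hy => hxs y (mem_behead (s := x :: xs) hy)) hI' hr htop.
suff h : sle (pre (lincomb n : {linear 'rV_mu -> V}) N0) (vecI I0 mu).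
  by move=> a ha; apply: h; apply/in_pre.
apply: (nakayama1 hm (@rV_noethm R mu hR) (hxs x (mem_head _ _))) => a /in_pre ha.
have /h1/in_vecI ha' : lincomb n a \in adds N0 x by exact: sle_adds.
have [r hr'] : exists r : 'I_mu -> R, forall k, a 0 k - x * r k \in I0.
  have h k : {r : R | a 0 k - x * r \in I0}.
    by apply: cid; have /(@in_adds R R^o)[r hr'] := ha' k; exists r.
  by exists (fun k => sval (h k)) => k; exact: (svalP (h k)).
have e : a - x *: (\row_k r k) \in vecI I0 mu.
  by apply/in_vecI => k; rewrite !mxE.
exists (\row_k r k) => //; apply/in_pre; apply: nx; rewrite -linearZ /=.
rewrite -(@subm_eqmod _ _ N0 (lincomb n a)) // -linearB /=.
by apply: rpred_sum => k _; apply: hI; exact: ((in_vecI _ _).1 e).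
Qed.

Definition addL (V : lmodType R) mu (n : 'I_mu -> V) (N0 : submodClosed V) :=
  addm (imm (lincomb n : {linear 'rV[R]_mu -> V})) N0.

Lemma in_addL (V : lmodType R) mu (n : 'I_mu -> V) N0 v :
  v \in addL n N0 <-> exists a, v - lincomb n a \in N0.
Proof.
split=> [/in_addm[_ /inmk[a _ <-] h]|[a h]]; first by exists a.
by apply/in_addm; exists (lincomb n a) => //; apply/inmk; exists a.
Qed.

(** Under the same hypotheses [x] remains regular on the quotient of [V] by the
    submodule which the [n_j] generate. *)
Lemma rseq_addL (V : lmodType R) mu (n : 'I_mu -> V) xs (I0 : ideal R)
    (N0 : submodClosed V) :
  {subset xs <= m} -> (forall a v, a \in I0 -> a *: v \in N0) -> rseq N0 xs ->
  (forall a, lincomb n a \in addseq N0 xs -> a \in vecI (@addseq R R^o I0 xs) mu) ->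
  rseq (addL n N0) xs.
Proof.
elim: xs I0 N0 => [|x xs IH] I0 N0 //= hxs hI [nx hr] htop.
have hI' a v : a \in @adds R R^o I0 x -> a *: v \in adds N0 x.
  move=> /(@in_adds R R^o)[r hr']; rewrite -(subrK (x * r) a) scalerDl.
  apply: rpredD; last by rewrite -scalerA; exact: mem_adds.
  by apply: sle_adds; exact: hI.
have hxs' : {subset xs <= m} by move=> y hy; apply: hxs; rewrite inE hy orbT.
have h1 := indep_lift hxs' hI' hr htop.
have -> : adds (addL n N0) x = addL n (adds N0 x).
  apply: subm_ext => v.
    move=> /in_adds[w /in_addL[a ha]]; apply/in_addL; exists a; apply/in_adds.
    by exists w; rewrite addrAC.
  move=> /in_addL[a /in_adds[w hw]]; apply/in_adds; exists w; apply/in_addL.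
  by exists a; rewrite addrAC.
split; last exact: IH hr htop.
move=> v /in_addL[a ha].
have /h1/in_vecI ha' : lincomb n a \in adds N0 x.
  by apply/in_adds; exists v; rewrite -opprB subm_opp.
have [r hr'] : exists r : 'I_mu -> R, forall k, a 0 k - x * r k \in I0.
  have h k : {r : R | a 0 k - x * r \in I0}.
    by apply: cid; have /(@in_adds R R^o)[r hr'] := ha' k; exists r.
  by exists (fun k => sval (h k)) => k; exact: (svalP (h k)).
apply/in_addL; exists (\row_k r k); apply: nx.
rewrite scalerBr -linearZ /= -(subrK (lincomb n a) (x *: v)) -addrA.
apply: rpredD => //; rewrite -linearB /=.
by apply: rpred_sum => k _; apply: hI; rewrite !mxE.
Qed.

(** [R / J] is an injective module over itself, in the form of a solvability
    criterion for linear systems: [a] is a combination modulo [J] of the rows of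
    [B] as soon as [a] satisfies all linear relations which these rows satisfy. *)
Definition selfinj (J : ideal R) := forall q r (B : 'M[R]_(r, q)) (a : 'rV[R]_q),
  (forall c, c *m B^T \in vecI J r -> dot c a \in J) ->
  exists s, a - s *m B \in vecI J q.

Section DoublePerp.
Variables (J : ideal R) (sigma : R).
Hypotheses (hJ : cofin m J) (hs : forall a, a \in m -> a * sigma \in J).
Hypothesis hsoc : forall v : R, (forall a, a \in m -> a * v \in J) ->
  exists r, v - sigma * r \in J.
Variable q : nat.
Let hV : noethm 'rV[R]_q := @rV_noethm R q hR.
Let Jq := vecI J q.
Implicit Types Y : submodClosed 'rV[R]_q.

Fact perp_subproof Y : submod_set [set c : 'rV[R]_q | forall y, y \in Y -> dot c y \in J].
Proof.
split=> [y _|a u v hu hv y hy] /=.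
  by rewrite dotE big1 ?ideal0 // => k _; rewrite mxE mul0r.
by rewrite dotDl dotZl; apply: idealD; [apply/ideal_mull/hu|exact: hv].
Qed.
Definition perp Y := mksubm (perp_subproof Y).

Lemma in_perp Y c : c \in perp Y <-> forall y, y \in Y -> dot c y \in J.
Proof. exact: inmk. Qed.

Lemma cofin_vecI : cofin m Jq.
Proof.
move=> a v ha.
suff [j hj] : exists j, forall k : 'I_q, a ^+ j * v 0 k \in J.
  by exists j; apply/in_vecI => k; rewrite mxE.
have h (k : 'I_q) : {j | a ^+ j * v 0 k \in J}.
  by apply: cid; have [j hj] := hJ (v 0 k : R^o) ha; exists j.
exists (\max_k sval (h k))%N => k.
have hk : (sval (h k) <= \max_k sval (h k))%N by exact: (leq_bigmax k).
rewrite -(subnK hk) exprD -mulrA; apply: ideal_mull; exact: (svalP (h k)).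
Qed.

(** Enlarging [Y] by a simple module shrinks its orthogonal by at most a simple
    module, as the socle of [R / J] is simple. *)
Lemma rlen_perp Y Y' n : sle Jq Y -> sle Y Y' -> rlen Y Y' n ->
  exists2 k, (k <= n)%N & rlen (perp Y') (perp Y) k.
Proof.
move=> + + hn; move: Y n hn; apply: (noethm_ind hV) => Y IH n hn JY YY'.
have [Y'Y|/existsNP[v /not_implyP[vY' /negP vY]]] := pselect (sle Y' Y).
  by exists 0%N => //; rewrite (subm_ext Y'Y YY'); exact: rlen_refl.
have [|r [rv pr _]] := @nzero_ass_mul _ _ Y v 0 hR vY; first by rewrite scale0r rpred0.
have rm a : a \in m -> a *: (r *: v) \in Y.
  move=> ha; have [j hj] := cofin_vecI (r *: v) ha.
  apply/in_annv; apply: (@primeI_exp _ _ _ j pr); apply/in_annv; exact: JY.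
set u := r *: v in rv pr rm.
have uY' : sle (addv Y u) Y' by apply: addv_min => //; exact: rpredZ.
have [a [b [e ha hb]]] := rlen_split (@sle_addv _ _ Y u) uY' hn.
have ea := rlen_uniq ha (rlen_simple hm rm rv).
have [||k hk hl] := IH _ (@sle_addv _ _ Y u) _ b hb _ uY'.
- by move=> h; case/negP: rv; apply: h; exact: mem_addv.
- exact: sle_trans JY (@sle_addv _ _ Y u).
have pY : sle (perp (addv Y u)) (perp Y).
  by move=> c /in_perp h; apply/in_perp => y hy; apply: h; exact: sle_addv.
have pY' : sle (perp Y') (perp (addv Y u)).
  by move=> c /in_perp h; apply/in_perp => y /uY'; exact: h.
have [pYu|/existsNP[c0 /not_implyP[c0Y /negP c0u]]] :=
    pselect (sle (perp Y) (perp (addv Y u))).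
  by exists k; [rewrite e; lia|rewrite (subm_ext pYu pY)].
have inpu c : c \in perp Y -> dot c u \in J -> c \in perp (addv Y u).
  move=> /in_perp hc hcu; apply/in_perp => y /in_addv[t ht].
  rewrite -(subrK (t *: u) y) dotDr dotZr; apply: idealD; first exact: hc.
  exact: ideal_mull.
have dsoc c : c \in perp Y -> exists t, dot c u - sigma * t \in J.
  move=> /in_perp hc; apply: hsoc => t ht; rewrite -dotZr; apply: hc; exact: rm.
have [t0 ht0] := dsoc _ c0Y.
have t0m : t0 \notin m.
  apply: contra c0u => ht; apply: inpu => //.
  by rewrite (ideal_eqmod ht0) mulrC; exact: hs.
have [i0 hi0] := hm.2 _ t0m.
have e1 : perp Y = addv (perp (addv Y u)) c0.
  apply: subm_ext => [c hc|]; last exact: addv_min.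
  have [t ht] := dsoc _ hc; apply/in_addv; exists (t * i0); apply: inpu.
    by apply: subm_sub => //; exact: rpredZ.
  have -> : dot (c - (t * i0) *: c0) u =
      (dot c u - sigma * t) - t * i0 * (dot c0 u - sigma * t0)
      + sigma * t * (1 - t0 * i0) by rewrite dotBl dotZl; ring.
  rewrite hi0 subrr mulr0 addr0; apply: idealB => //; exact: ideal_mull.
exists (k + 1)%N; first by rewrite e; lia.
apply: (rlen_add pY' pY hl); rewrite e1; apply: (rlen_simple hm) => // t ht.
apply: inpu; first exact: rpredZ.
by rewrite dotZl -dotZr; move/in_perp: c0Y; apply; exact: rm.
Qed.

Lemma perpK Y : sle Jq Y -> perp (perp Y) = Y.
Proof.
move=> JY; have tT (Z : submodClosed 'rV[R]_q) : sle Z (topm _) by move=> x _; exact: in_topm.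
have [L hL] := cofin_rlen hm hR hV cofin_vecI.
have [n [n' [eL hn hn']]] := rlen_split JY (tT Y) hL.
have Jp Z : sle Jq (perp Z).
  by move=> c hc; apply/in_perp => y _; rewrite dotC; exact: dot_vecI.
have pJ : perp Jq = topm 'rV[R]_q.
  apply: subm_ext => c _; first exact: in_topm.
  by apply/in_perp => y; exact: dot_vecI.
have pT : perp (topm 'rV[R]_q) = Jq.
  apply: subm_ext => // c /in_perp h; apply/in_vecI => k.
  by rewrite -dot_delta; apply: h; exact: in_topm.
have [k hk hlk] := rlen_perp (@sle_refl _ _ Jq) JY hn.
rewrite pJ in hlk.
have [k' [l' [e1 h1 h2]]] := rlen_split (Jp Y) (tT _) hL.
have e2 := rlen_uniq h2 hlk.
have [j hj hlj] := rlen_perp (Jp Y) (tT _) hlk.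
rewrite pT in hlj.
have Yp : sle Y (perp (perp Y)).
  by move=> y hy; apply/in_perp => c /in_perp/(_ y hy); rewrite dotC.
have [n1 [j' [e3 h3 h4]]] := rlen_split JY Yp hlj.
have e4 := rlen_uniq h3 hn.
have e5 : j' = 0%N by lia.
by rewrite e5 in h4; exact: rlen0 h4.
Qed.

End DoublePerp.

(** Artinian rings with simple socle are injective over themselves: a submodule
    of a free module is its own double orthogonal. *)
Lemma selfinj_socle (J : ideal R) (sigma : R) : cofin m J ->
  (forall a, a \in m -> a * sigma \in J) ->
  (forall v : R, (forall a, a \in m -> a * v \in J) -> exists r, v - sigma * r \in J) ->
  selfinj J.
Proof.
move=> hJ hs hsoc q r B a ha.
pose f : {linear 'rV[R]_r -> 'rV[R]_q} := mulmxr B.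
pose Y := addm (imm f) (vecI J q).
have JY : sle (vecI J q) Y by exact: sle_addmr.
have : a \in perp J (perp J Y).
  apply/in_perp => c /in_perp hc; rewrite dotC; apply: ha; apply/in_vecI => l.
  rewrite -dot_delta -dot_mul; apply: hc; apply: sle_addml; apply/inmk.
  by exists (delta_mx 0 l).
rewrite (perpK hJ hs hsoc JY) => /in_addm[_ /inmk[s _ <-] h].
by exists s.
Qed.

Definition colmod (I : ideal R) q r (B : 'M[R]_(r, q)) : submodClosed 'rV[R]_r :=
  addm (imm (mulmxr B^T : {linear 'rV[R]_q -> 'rV[R]_r})) (vecI I r).

Lemma in_colmod I q r (B : 'M[R]_(r, q)) v :
  v \in colmod I B <-> exists c, v - c *m B^T \in vecI I r.
Proof.
split=> [/in_addm[_ /inmk[c _ <-] h]|[c h]]; first by exists c.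
by apply/in_addm; exists (c *m B^T) => //; apply/inmk; exists c.
Qed.

(** The vanishing of [Ext^1(D, R / I)] for a module [D] on which a maximal regular
    sequence [xs] of [R / I] is regular; [B] is a presentation matrix of [D]. *)
Lemma selfinj_lift xs (I : ideal R) q r (B : 'M[R]_(r, q)) (a : 'rV[R]_q) :
  {subset xs <= m} -> selfinj (@addseq R R^o I xs) -> @rseq R R^o I xs ->
  rseq (colmod I B) xs ->
  (forall c, c *m B^T \in vecI I r -> dot c a \in I) ->
  exists s, a - s *m B \in vecI I q.
Proof.
elim: xs I q r B a => [|x xs IH] I q r B a /= hxs hinj hr hB ha; first exact: hinj.
have [nxI hrI] := hr; have [nxB hrB] := hB.
have hxs' : {subset xs <= m} by move=> y hy; apply: hxs; rewrite inE hy orbT.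
have div k (v : 'rV[R]_k) : v \in vecI (@adds R R^o I x) k ->
    exists w, v - x *: w \in vecI I k.
  move=> /in_vecI hv.
  have h j : {s : R | v 0 j - x * s \in I}.
    by apply: cid; have /(@in_adds R R^o)[s hs] := hv j; exists s.
  exists (\row_j sval (h j)); apply/in_vecI => j; rewrite !mxE; exact: (svalP (h j)).
have mul k (v w : 'rV[R]_k) : v - x *: w \in vecI I k -> v \in vecI (@adds R R^o I x) k.
  move=> /in_vecI h; apply/in_vecI => j; apply/(@in_adds R R^o); exists (w 0 j).
  by have := h j; rewrite !mxE.
have e : adds (colmod I B) x = colmod (@adds R R^o I x) B.
  apply: subm_ext => v.
    move=> /in_adds[w /in_colmod[c hc]]; apply/in_colmod; exists c.
    by apply: (mul _ _ w); rewrite addrAC.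
  move=> /in_colmod[c /div[w hw]]; apply/in_adds; exists w; apply/in_colmod; exists c.
  by rewrite addrAC.
rewrite e in hrB.
have Hsub : submod_set [set a : 'rV[R]_q | forall c, c *m B^T \in vecI I r -> dot c a \in I].
  split=> [c _|t u v hu hv c hc] /=.
    by rewrite dotC dotE big1 ?ideal0 // => k _; rewrite mxE mul0r.
  by rewrite dotDr dotZr; apply: idealD; [apply/ideal_mull/hu|exact: hv].
pose K := addm (imm (mulmxr B : {linear 'rV[R]_r -> 'rV[R]_q})) (vecI I q).
suff h : sle (mksubm Hsub) K.
  have /h/in_addm[_ /inmk[s _ <-] hs] : a \in mksubm Hsub by apply/inmk.
  by exists s.
apply: (nakayama1 hm (@rV_noethm R q hR) (hxs x (mem_head _ _))) => {ha}a /inmk ha.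
have [|s hs] := IH (@adds R R^o I x) q r B a hxs' hinj hrI hrB.
  move=> c /div[v hv].
  have /nxB/in_colmod[d hd] : x *: v \in colmod I B.
    by apply/in_colmod; exists c; rewrite -opprB subm_opp.
  have hcd : (c - x *: d) *m B^T \in vecI I r.
    rewrite mulmxBl -scalemxAl.
    have -> : c *m B^T - x *: (d *m B^T) = (c *m B^T - x *: v) + x *: (v - d *m B^T).
      by rewrite scalerBr addrA subrK.
    by rewrite rpredD // rpredZ.
  apply/(@in_adds R R^o); exists (dot d a).
  by have := ha _ hcd; rewrite dotBl dotZl.
have [a' ha'] := div _ _ hs; exists a'.
  apply/inmk => c hc; apply: nxI.
  have -> : x *: (dot c a' : R^o) = dot c a - dot (c *m B^T) s - dot c (a - s *m B - x *: a').
    by rewrite !dotBr dotZr dot_mul; rewrite /GRing.scale /=; ring.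
  apply: idealB; last exact: dot_vecI.
  by apply: idealB; [exact: ha|rewrite dotC; exact: dot_vecI].
apply/in_addm; exists (s *m B); first by apply/inmk; exists s.
by rewrite addrAC.
Qed.

Lemma rseq_pre (U V : lmodType R) (f : {linear U -> V}) (N : submodClosed V) xs :
  (forall v, exists u, f u = v) -> rseq N xs -> rseq (pre f N) xs.
Proof.
move=> hf; elim: xs N => [|x xs IH] N //= [nx hr]; split.
  by move=> u /in_pre; rewrite linearZ => /nx hu; apply/in_pre.
suff -> : adds (pre f N) x = pre f (adds N x) by exact: IH.
apply: subm_ext => u.
  move=> /in_adds[w /in_pre]; rewrite linearB linearZ => h; apply/in_pre/in_adds.
  by exists (f w).
move=> /in_pre/in_adds[v hv]; have [w hw] := hf v; apply/in_adds; exists w.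
by apply/in_pre; rewrite linearB linearZ /= hw.
Qed.

(** Let [z] be a regular sequence generating the maximal ideal, let [f ++ xs] be
    a sequence of the same length, equal to [G z], and let [V] be a module killed
    by [f] on which [xs] is regular. If elements [n_j] of [V] remain independent
    modulo [xs V] after multiplication by [det G], then [f ++ xs] is regular, and
    the [n_j] are the basis of a free direct summand of [V] over [R / (f)]. The
    vectors [s_j] describe the coordinate functions of the retraction on
    generators [g] of [V]. *)
Lemma free_summand_criterion (z f xs : seq R) (G : 'M[R]_(size z)) (V : lmodType R)
    mu (n : 'I_mu -> V) r (g : 'I_r -> V) :
  size z = size (f ++ xs) -> {subset z <= m} -> sle m (idl z) ->
  {subset f ++ xs <= m} -> @rseq R R^o (zerom R^o) z ->
  (forall i : 'I_(size z), (f ++ xs)`_i = \sum_j G i j * z`_j) ->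
  (forall v, exists a, lincomb g a = v) ->
  (forall a (v : V), a \in f -> a *: v = 0) -> rseq (zerom V) xs ->
  (forall a, \det G *: lincomb n a \in addseq (zerom V) xs -> a \in vecI m mu) ->
  (0 < mu)%N ->
  @rseq R R^o (zerom R^o) (f ++ xs) /\
  exists s : 'I_mu -> 'rV[R]_r,
    (forall v, lincomb g v = 0 -> forall j, dot v (s j) \in idl f) /\
    (forall v i, lincomb g v = n i -> forall j, dot v (s j) - (i == j)%:R \in idl f).
Proof.
move=> sz zm mz bm hz hG hg hf hxs hind mu0.
have xsm : {subset xs <= m} by move=> y hy; apply: bm; rewrite mem_cat hy orbT.
have eb : idl (f ++ xs) = @addseq R R^o (idl f) xs by rewrite /idl addseq_cat.
have bV a v : a \in idl (f ++ xs) -> a *: v \in addseq (zerom V) xs.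
  move=> ha; apply/in_annv; move: a ha; apply: idl_min => a.
  rewrite mem_cat => /orP[/hf h|h]; apply/in_annv; last exact: mem_addseq.
  by rewrite h rpred0.
have hD : \det G \notin idl (f ++ xs).
  apply/negP => h; have /in_vecI/(_ (Ordinal mu0)) :
    (delta_mx 0 (Ordinal mu0) : 'rV[R]_mu) \in vecI m mu by apply: hind; exact: bV.
  by rewrite mxE !eqxx; apply/negP; exact: hm.1.
have [hb hc hsoc] := det_notin_param hm hR sz zm mz bm hz hG hD.
split=> //.
have Dm a : a \in m -> a * \det G \in idl (f ++ xs).
  move: a; suff h : sle m (annv (idl (f ++ xs)) (\det G : R^o)) by move=> a /h/in_annv.
  apply: sle_trans mz _; apply: idl_min => x /(nthP 0)[i hi <-]; apply/in_annv.
  rewrite /GRing.scale /= mulrC.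
  apply: (@det_mul_mem _ _ G (fun j => z`_j) (fun k => (f ++ xs)`_k) _ hG _ (Ordinal hi)).
  by move=> j; apply: mem_idl; apply: mem_nth; rewrite -sz.
have hinj : selfinj (@addseq R R^o (idl f) xs).
  by rewrite -eb; exact: (selfinj_socle hc Dm hsoc).
have htop a : lincomb n a \in addseq (zerom V) xs ->
    a \in vecI (@addseq R R^o (idl f) xs) mu.
  rewrite -eb => ha; apply: contrapT => /negP aJ.
  have [|t [ta pt _]] := @nzero_ass_mul _ _ (vecI (idl (f ++ xs)) mu) a 0 hR aJ.
    by rewrite scale0r rpred0.
  have tm b : b \in m -> b *: (t *: a) \in vecI (idl (f ++ xs)) mu.
    move=> hb'; have [j hj] := cofin_vecI hc (t *: a) hb'.
    by apply/in_annv; apply: (@primeI_exp _ _ _ j pt); apply/in_annv.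
  have h k : {s : R | (t *: a) 0 k - \det G * s \in idl (f ++ xs)}.
    apply: cid; apply: hsoc => b /tm/in_vecI/(_ k); by rewrite mxE.
  pose s := \row_k sval (h k).
  have es : t *: a - \det G *: s \in vecI (idl (f ++ xs)) mu.
    apply/in_vecI => k; have -> : (t *: a - \det G *: s) 0 k =
        (t *: a) 0 k - \det G * sval (h k); last exact: (svalP (h k)).
      rewrite mxE; congr (_ + _); rewrite mxE mxE; congr (- (_ * _)); exact: mxE.
  have /hind/in_vecI sm : \det G *: lincomb n s \in addseq (zerom V) xs.
    rewrite -linearZ /= -[X in lincomb n X](subKr (t *: a)) linearB /= subm_sub //.
      by rewrite linearZ rpredZ.
    by apply: rpred_sum => k _; apply: bV; exact: ((in_vecI _ _).1 es).
  case/negP: ta; rewrite (subm_eqmod es); apply/in_vecI => k; rewrite mxE mulrC.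
  exact: Dm.
have hI a v : a \in idl f -> a *: v \in zerom V.
  move=> ha; apply/in_annv; move: a ha; apply: idl_min => a /hf h.
  by apply/in_annv; rewrite h rpred0.
have ind := indep_lift xsm hI hxs htop.
have hrD := rseq_addL xsm hI hxs htop.
have [_ hrI] := (rseq_cat _ _ _).1 hb.
(* the relations modulo the span of the n_j *)
pose P := pre (lincomb g : {linear 'rV[R]_r -> V}) (addL n (zerom V)).
have [zs [zs1 zs2]] := @rV_noethm R r hR P.
pose q := size zs; pose B : 'M[R]_(r, q) := \matrix_(l, k) zs`_k 0 l.
have BE c : c *m B^T = lincomb (fun k : 'I_q => zs`_k) c.
  apply/rowP => l; rewrite mxE /lincomb summxE; apply: eq_bigr => k _.
  by rewrite !mxE.
have ePB : colmod (idl f) B = P.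
  apply: subm_ext => v.
    move=> /in_colmod[c hc']; rewrite -(subrK (c *m B^T) v) rpredD //.
      apply/in_pre/in_addL; exists 0; rewrite linear0 subr0; apply: rpred_sum => k _.
      by apply: hI; exact: ((in_vecI _ _).1 hc').
    by rewrite BE; apply: rpred_sum => k _; rewrite rpredZ // zs1 // mem_nth.
  move=> /zs2/in_addvs[c /in_zerom/subr0_eq e]; apply/in_colmod; exists (\row_k c k).
  rewrite BE e; have -> : lincomb (fun k : 'I_q => zs`_k) (\row_k c k) =
    \sum_(i < size zs) c i *: zs`_i by apply: eq_bigr => k _; rewrite mxE.
  by rewrite subrr rpred0.
have beta (k : 'I_q) : {b | lincomb g zs`_k = lincomb n b}.
  apply: cid; have /zs1/in_pre/in_addL[b /in_zerom/subr0_eq e] := mem_nth 0 (ltn_ord k).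
  by exists b.
have hbeta c : lincomb g (c *m B^T) = lincomb n (\sum_k c 0 k *: sval (beta k)).
  rewrite BE /= {2}/lincomb !linear_sum; apply: eq_bigr => k _.
  by rewrite !linearZ /=; congr (_ *: _); exact: (svalP (beta k)).
have hs j : {s | \row_k sval (beta k) 0 j - s *m B \in vecI (idl f) q}.
  apply: cid; apply: (selfinj_lift xsm hinj hrI).
    rewrite ePB; apply: rseq_pre hrD => v; exact: hg.
  move=> c hc'.
  have /ind/in_vecI/(_ j) : lincomb n (\sum_k c 0 k *: sval (beta k)) \in zerom V.
    by rewrite -hbeta; apply: rpred_sum => k _; apply: hI; exact: ((in_vecI _ _).1 hc').
  suff -> : dot c (\row_k sval (beta k) 0 j) = (\sum_k c 0 k *: sval (beta k)) 0 j by [].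
  by rewrite dotE summxE; apply: eq_bigr => k _; rewrite !mxE.
have key v b : lincomb g v = lincomb n b ->
    forall j, dot v (sval (hs j)) - b 0 j \in idl f.
  move=> hv j; have : v \in colmod (idl f) B.
    by rewrite ePB; apply/in_pre/in_addL; exists b; rewrite /= hv subrr rpred0.
  move=> /in_colmod[c hc'].
  have /ind/in_vecI/(_ j) : lincomb n (\sum_k c 0 k *: sval (beta k) - b) \in zerom V.
    rewrite linearB /= -hbeta -hv -linearB /=; apply: rpred_sum => k _; apply: hI.
    by have := subm_opp hc'; rewrite opprB => /in_vecI.
  rewrite !mxE summxE => h1.
  have h2 := dot_vecI c (svalP (hs j)); rewrite dotBr dot_mul in h2.
  have h3 := dot_vecI (sval (hs j)) hc'; rewrite dotC dotBl in h3.
  have -> : dot v (sval (hs j)) - b 0 j =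
      (dot v (sval (hs j)) - dot (c *m B^T) (sval (hs j)))
      - (dot c (\row_k sval (beta k) 0 j) - dot (c *m B^T) (sval (hs j)))
      + (dot c (\row_k sval (beta k) 0 j) - b 0 j) by ring.
  apply: idealD; first exact: idealB.
  suff -> : dot c (\row_k sval (beta k) 0 j) = \sum_k (c 0 k *: sval (beta k)) 0 j by [].
  by rewrite dotE; apply: eq_bigr => k _; rewrite !mxE.
exists (fun j => sval (hs j)); split=> [v hv j|v i hv j].
  have := key v 0 _ j; rewrite mxE subr0; apply; by rewrite hv linear0.
have := key v (delta_mx 0 i) _ j; rewrite mxE eqxx /= eq_sym; apply.
by rewrite lincomb_delta.
Qed.

End Lifting.
(** * Cohomology of projective resolutions in terms of regular sequences *)

Lemma dep_choice (T : nat -> Type) (P : forall n, T n -> Prop)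
    (Q : forall n, T n -> T n.+1 -> Prop) (t0 : T 0%N) :
  P 0%N t0 -> (forall n t, P n t -> exists t', P n.+1 t' /\ Q n t t') ->
  exists s : forall n, T n, s 0%N = t0 /\ forall n, Q n (s n) (s n.+1).
Proof.
move=> h0 hS.
pose S n := {t : T n | P n t}.
have step n (t : S n) : {t' : S n.+1 | Q n (sval t) (sval t')}.
  apply: cid; have [t' [h1 h2]] := hS n _ (svalP t).
  by exists (exist _ t' h1).
pose s := fix s n : S n := if n is k.+1 then sval (step k (s k)) else exist _ t0 h0.
exists (fun n => sval (s n)); split=> // n; exact: (svalP (step n (s n))).
Qed.

Section Projective.
Variable A : comNzRingType.

Definition projm (P : lmodType A) := forall (X Y : lmodType A) (e : {linear X -> Y})
  (f : P -> Y), linear f -> (forall y, exists x, e x = f y) ->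
  exists g : {linear P -> X}, forall y, e (g y) = f y.

Section FreeLift.
Variables (K : choiceType) (X : lmodType A) (g : K -> X).

Let supp (f : freem A K) : set K := [set k | submval f k != 0].
Lemma supp_finite (f : freem A K) : finite_set (supp f).
Proof. exact: (elimT (mksubmP (fsupp_subproof A K) _) (valP f)). Qed.

Definition free_lift (f : freem A K) : X :=
  \sum_(k \in supp f) (submval f k : A) *: g k.

Lemma free_liftE (D : set K) (f : freem A K) : finite_set D ->
  (supp f `<=` D)%classic -> free_lift f = \sum_(k \in D) (submval f k : A) *: g k.
Proof.
move=> finD sD; apply: fsbig_widen => // k [_ /=] /negP; rewrite negbK => /eqP.
by rewrite /= => ->; rewrite scale0r.
Qed.

Fact free_lift_linear : linear free_lift.
Proof.
move=> a f h; pose D := (supp f `|` supp h)%classic.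
have finD : finite_set D by rewrite finite_setU; split; exact: supp_finite.
rewrite (@free_liftE D f) ?(@free_liftE D h) //; try by move=> x hx; [left + right].
rewrite (@free_liftE D (a *: f + h)) //; last first.
  move=> k; rewrite /supp /= !fctE /D /supp /=.
  case: (eqVneq (submval f k) 0) => [->|]; last by left.
  by rewrite scaler0 add0r; right.
rewrite !fsbig_finite // scaler_sumr -big_split /=; apply: eq_bigr => k _.
by rewrite !fctE scalerDl scalerA.
Qed.
HB.instance Definition _ := GRing.isLinear.Build A (freem A K) X _ free_lift
  free_lift_linear.

End FreeLift.

Section FreeBasis.
Variable K : choiceType.

Fact delta_subproof (k : K) :
  (fun j => (j == k)%:R : A^o) \in mksubm (fsupp_subproof A K).
Proof.
apply/mksubmP => /=; apply: (sub_finite_set _ (finite_set1 k)) => j /=.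
by have [//|_] := eqVneq j k; rewrite mulr0n eqxx.
Qed.
Definition fdelta (k : K) : freem A K := Subm (delta_subproof k).

Lemma free_lift_delta (X : lmodType A) (g : K -> X) k : free_lift g (fdelta k) = g k.
Proof.
rewrite (@free_liftE _ _ _ [set k]%classic) //; last first.
  by move=> j /=; have [//|_] := eqVneq j k; rewrite mulr0n eqxx.
by rewrite fsbig_set1 /= eqxx scale1r.
Qed.

Lemma free_decomp (f : freem A K) : free_lift fdelta f = f.
Proof.
have inj : injective (@submval A _ (mksubm (fsupp_subproof A K))) := val_inj.
have fin := supp_finite f; rewrite /free_lift fsbig_finite //.
apply: inj.
rewrite (linear_sum (@submval A _ (mksubm (fsupp_subproof A K)))).
apply/funext => j.
rewrite fct_sumE.
have [fj|fj] := eqVneq (submval f j) 0.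
  rewrite fj big1_seq // => k /andP[_ hk] /=.
  have /negP : submval f k != 0.
    by move: hk; rewrite in_fset_set // inE.
  rewrite /GRing.scale /= /GRing.scale /=.
  by case: (eqVneq j k) => [<-|]; [rewrite fj eqxx|rewrite mulr0].
rewrite (bigD1_seq j) /=; last 2 first.
- by rewrite in_fset_set // inE.
- exact: finmap.fset_uniq.
rewrite big1 ?addr0 => [|k kj].
  by rewrite /GRing.scale /= /GRing.scale /= eqxx mulr1.
by rewrite /GRing.scale /= /GRing.scale /= eq_sym (negPf kj) mulr0.
Qed.

Lemma linear_free (X : lmodType A) (f : freem A K -> X) : linear f ->
  forall y, f y = free_lift (fun k => f (fdelta k)) y.
Proof.
move=> lf y; have [f' hf'] : exists f' : {linear freem A K -> X}, f' =1 f.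
  pose L := GRing.isLinear.Build A _ _ _ f lf.
  by exists (HB.pack_for {linear freem A K -> X} f L).
have fin := supp_finite y.
rewrite -{1}(free_decomp y) /free_lift -hf' !fsbig_finite // linear_sum.
by apply: eq_bigr => k _; rewrite linearZ /= hf'.
Qed.

Lemma freem_projm : projm (freem A K).
Proof.
move=> X Y e f lf h.
have ch k : {x | e x = f (fdelta k)} by apply: cid; exact: h.
exists (free_lift (fun k => sval (ch k))) => y.
rewrite (linear_free lf).
have le : linear (fun y => e (free_lift (fun k => sval (ch k)) y)).
  by move=> a u v; rewrite !linearP.
rewrite (linear_free le); congr (free_lift _ _); apply/funext => k.
by rewrite free_lift_delta; exact: (svalP (ch k)).
Qed.

End FreeBasis.

(** Lifting modulo a submodule of the target. *)
Lemma projm_mod (P X V : lmodType A) (e : {linear X -> V}) (K : submodClosed V)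
    (f : P -> V) : projm P -> linear f -> (forall y, exists x, f y - e x \in K) ->
  exists g : {linear P -> X}, forall y, f y - e (g y) \in K.
Proof.
move=> hP lf h.
have [|y|g hg] := hP X (quotm K) (pim K \o e) (pim K \o f).
- by move=> a u v; rewrite /= lf linearP.
- by have [x hx] := h y; exists x; apply/esym/pim_eq.
- by exists g => y; apply/pim_eq; rewrite [LHS](esym (hg y)).
Qed.

(** Lifting with values in a submodule of the source. *)
Lemma projm_sub (P X Y : lmodType A) (e : {linear X -> Y}) (D : submodClosed X)
    (f : P -> Y) : projm P -> linear f ->
  (forall y, exists2 x, x \in D & e x = f y) ->
  exists g : {linear P -> X}, forall y, e (g y) = f y /\ g y \in D.
Proof.
move=> hP lf h.
have [y|g hg] := hP (subm D) Y (e \o @submval _ _ D) f lf.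
  by have [x hx <-] := h y; exists (Subm hx).
by exists (@submval _ _ D \o g) => y; split; [exact: hg|exact: (valP (g y))].
Qed.

End Projective.

(** Koszul complexes, with the grading kept outside of the types: [gr xs n] are
    the homogeneous elements of degree [n] of the exterior algebra [Kt xs], and
    the complex of [x :: xs] is the mapping cone of [x] on that of [xs]. *)
Section Koszul.
Variable A : comNzRingType.
Implicit Types (xs : seq A).

Fixpoint Kt xs : lmodType A := if xs is _ :: xs' then (Kt xs' * Kt xs')%type else A^o.

Fixpoint dK xs : Kt xs -> Kt xs :=
  if xs is x :: xs' then fun t => (dK t.1 + x *: t.2, - dK t.2) else fun=> 0.

Fact dK_linear xs : linear (@dK xs).
Proof.
elim: xs => [|x xs IH] a u v /=; first by rewrite scaler0 addr0.
rewrite !IH; congr (_, _); last by rewrite /= opprD scalerN.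
by rewrite /= !scalerDr !scalerA (mulrC x) addrACA.
Qed.
HB.instance Definition _ xs := GRing.isLinear.Build A (Kt xs) (Kt xs) _ (@dK xs)
  (@dK_linear xs).

Lemma dKD xs (u v : Kt xs) : dK (u + v) = dK u + dK v.
Proof. exact: (linearD (@dK xs : {linear Kt xs -> Kt xs})). Qed.
Lemma dK0 xs : dK (0 : Kt xs) = 0.
Proof. exact: (linear0 (@dK xs : {linear Kt xs -> Kt xs})). Qed.
Lemma dKZ xs a (u : Kt xs) : dK (a *: u) = a *: dK u.
Proof. by rewrite -[a *: u]addr0 dK_linear dK0 addr0. Qed.
Lemma dKN xs (u : Kt xs) : dK (- u) = - dK u.
Proof. exact: (linearN (@dK xs : {linear Kt xs -> Kt xs})). Qed.

Fixpoint grP xs n : Kt xs -> Prop := if xs is x :: xs' then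
    fun t => grP n t.1 /\ (if n is n'.+1 then grP n' t.2 else t.2 = 0)
  else fun t => n = 0%N \/ t = 0.

Fact gr_subproof xs n : submod_set (@grP xs n).
Proof.
elim: xs n => [|x xs IH] n /=.
  split=> [|a u v [->|->] [hn|->]]; try by [right|left].
  by right; rewrite scaler0 addr0.
have [h0 hD] := IH n; case: n h0 hD => [|n] h0 hD.
  by split=> // a u v [h1 h2] [h3 h4] /=; split; [exact: hD|rewrite h2 h4 scaler0 addr0].
have [h0' hD'] := IH n.
by split=> // a u v [h1 h2] [h3 h4] /=; split; [exact: hD|exact: hD'].
Qed.
Definition gr xs n := mksubm (gr_subproof xs n).

Lemma in_gr xs n t : t \in gr xs n <-> grP n t. Proof. exact: inmk. Qed.

Lemma gr_above xs n (t : Kt xs) : (size xs < n)%N -> grP n t -> t = 0.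
Proof.
elim: xs n t => [|x xs IH] n t /=; first by case: n => // n _ [].
case: n => // n hn [h1 h2]; case: t h1 h2 => t1 t2 /= h1 h2.
have e1 : t1 = 0 by apply: IH h1; exact: ltnW.
have e2 : t2 = 0 by apply: IH h2.
by rewrite e1 e2.
Qed.

Fixpoint in0 xs : A -> Kt xs := if xs is x :: xs' then fun a => (@in0 xs' a, 0) else id.
Fixpoint out0 xs : Kt xs -> A := if xs is x :: xs' then fun t => out0 t.1 else id.

Fact in0_linear xs : linear (@in0 xs : A^o -> Kt xs).
Proof.
elim: xs => [//|x xs IH] a u v /=.
by rewrite IH; congr (_, _); rewrite /= scaler0 addr0.
Qed.
HB.instance Definition _ xs := GRing.isLinear.Build A A^o (Kt xs) _ (@in0 xs)
  (@in0_linear xs).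

Fact out0_linear xs : linear (@out0 xs : Kt xs -> A^o).
Proof. by elim: xs => [//|x xs IH] a u v /=; rewrite IH. Qed.
HB.instance Definition _ xs := GRing.isLinear.Build A (Kt xs) A^o _ (@out0 xs)
  (@out0_linear xs).

Lemma in0D xs a b : in0 xs (a + b) = in0 xs a + in0 xs b.
Proof. by have := @in0_linear xs 1 a b; rewrite !scale1r. Qed.
Lemma in0Z xs a b : in0 xs (a * b) = a *: in0 xs b.
Proof.
have e : in0 xs 0 = 0 by elim: xs => //= x xs ->.
by have := @in0_linear xs a b 0; rewrite e !addr0.
Qed.
Lemma out0D xs (u v : Kt xs) : out0 (u + v) = out0 u + out0 v.
Proof. by have := @out0_linear xs 1 u v; rewrite !scale1r. Qed.
Lemma out0Z xs a (u : Kt xs) : out0 (a *: u) = a * out0 u.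
Proof.
have e : out0 (0 : Kt xs) = 0 by elim: xs {u} => //= x xs ->.
by have := @out0_linear xs a u 0; rewrite e !addr0.
Qed.

Lemma gr_in0 xs a : grP 0 (@in0 xs a).
Proof. by elim: xs => [|x xs IH] /=; [left|split]. Qed.

Lemma gr0E xs (t : Kt xs) : grP 0 t -> t = in0 xs (out0 t).
Proof. by elim: xs t => [//|x xs IH] [a b] /= [/IH <- ->]. Qed.

Lemma dK_gr1 xs (t : Kt xs) : grP 1 t -> out0 (dK t) \in idl xs.
Proof.
elim: xs t => [|x xs IH] t /=; first by move=> _; exact: ideal0.
case: t => a b /= [h1 h2]; rewrite out0D out0Z.
apply: idealD; first by apply: (@idl_sub _ xs _ _ _ (IH _ h1)) => y hy; rewrite inE hy orbT.
by apply: ideal_mulr; apply: mem_idl; exact: mem_head.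
Qed.

Lemma idl_dK xs a : a \in idl xs -> exists2 t : Kt xs, grP 1 t & dK t = in0 xs a.
Proof.
elim: xs a => [|x xs IH] a.
  move=> /(@in_zerom A A^o) ->; exists 0; first by right.
  by [].
move=> ha; have [r hr] : exists r, a - x * r \in idl xs.
  have : a \in idl (rcons xs x).
    by apply: (idl_sub _ ha) => y; rewrite mem_rcons.
  by rewrite -idl_rcons => /(@in_adds A A^o)[r hr]; exists r.
have [t ht e] := IH _ hr; exists (t, in0 xs r) => /=; first by split=> //; exact: gr_in0.
rewrite e -in0Z -in0D subrK; congr (_, _).
suff -> : dK (in0 xs r) = 0 by rewrite oppr0.
by elim: xs {IH ha hr t ht e} => [//|y ys IH] /=; rewrite IH scaler0 addr0 dK0 oppr0.
Qed.

(** Regularity up to multiplication by [s]. *)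
Fixpoint sreg (s : A) xs : Prop := if xs is x :: xs' then
  (forall v, x * v \in idl xs' -> s * v \in idl xs') /\ sreg s xs' else True.

Lemma koszul_exact s xs : sreg s xs -> exists k, forall n (t : Kt xs),
  grP n.+1 t -> dK t = 0 -> exists2 u, grP n.+2 u & dK u = s ^+ k.+1 *: t.
Proof.
elim: xs => [|x xs IH] /=.
  move=> _; exists 0%N => n t [//|->] _; exists 0; [by right|by rewrite scaler0].
move=> [hx /IH[k hk]]; exists (k + k.+1)%N => n [a b] /= [ha hb] [e1 e2].
have db : dK b = 0 by rewrite -[dK b]opprK e2 oppr0.
have [b' hb' eb'] : exists2 b', grP n.+1 b' & dK b' = s ^+ k.+1 *: b.
  case: n ha hb => [|n] ha hb; last exact: hk.
  have xb : x * out0 b \in idl xs.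
    have := dK_gr1 ha; have -> : dK a = - (x *: b) by apply/eqP; rewrite -addr_eq0 e1.
    by rewrite -scaleN1r !out0Z mulN1r => /(@subm_opp A A^o); rewrite opprK.
  have [t ht et] := idl_dK (hx _ xb).
  exists (s ^+ k *: t).
    have [h0 hD] := gr_subproof xs 1; rewrite -[_ *: t]addr0; exact: hD.
  rewrite dKZ et exprSr -scalerA; congr (_ *: _).
  by rewrite {2}(gr0E hb) -in0Z.
have [h0 hD] := gr_subproof xs n.+1.
have [u hu eu] : exists2 u, grP n.+2 u & dK u = s ^+ k.+1 *: (s ^+ k.+1 *: a + x *: b').
  apply: hk; first by apply: (hD _ _ _ ha); rewrite -[_ *: b']addr0; exact: hD.
  rewrite dKD !dKZ eb' scalerA mulrC -scalerA -scalerDr.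
  by rewrite e1 scaler0.
exists (u, - (s ^+ k.+1 *: b')) => /=.
  by split=> //; rewrite -scaleNr -[_ *: b']addr0; exact: hD.
rewrite -addSn exprD -scalerA eu; congr (_, _).
  by rewrite /= scalerN scalerDr (scalerA _ x) (scalerA x) (mulrC x) addrK.
by rewrite dKN dKZ eb' opprK.
Qed.

End Koszul.
(** * Evaluating cocycles of a projective resolution *)

Section Resolution.
Variables (A : comNzRingType) (F : nat -> lmodType A) (d : forall n, {linear F n.+1 -> F n}).
Hypotheses (Fproj : forall n, projm (F n)) (dd : forall n y, d n (d n.+1 y) = 0)
  (ex : forall n y, d n y = 0 -> exists w, d n.+1 w = y).
(** The complex [F] resolves a module isomorphic to [A / p], generated by the
    class of [z0]; the map [psi] lifts the augmentation to [A]. *)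
Variables (p : ideal A) (z0 : F 0) (psi : {linear F 0 -> A^o}).
Hypotheses (psi_z0 : psi z0 - (1 : A) \in p)
  (psiP : forall y, exists w, d 0 w = y - (psi y : A) *: z0)
  (psi_d : forall w, psi (d 0 w) \in p)
  (p_z0 : forall a : A, a \in p -> exists w, d 0 w = a *: z0).

Lemma psi_im y : psi y \in p -> exists w, d 0 w = y.
Proof.
move=> /p_z0[w hw]; have [w' hw'] := psiP y; exists (w' + w).
by rewrite linearD /= hw hw' subrK.
Qed.

Lemma p_F0 (x : A) y : x \in p -> exists w, d 0 w = x *: y.
Proof.
move=> hx; apply: psi_im; rewrite linearZ /=; exact: ideal_mulr.
Qed.

(** Multiplication by [x] lifts the zero map of [A / p]. *)
Lemma homotopy_exists (x : A) : x \in p -> exists h : forall n, {linear F n -> F n.+1},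
  (forall y, d 0 (h 0%N y) = x *: y) /\
  forall n y, d n.+1 (h n.+1 y) = x *: y - h n (d n y).
Proof.
move=> hx.
have [||h0 hh0] := @Fproj 0 (F 1) (F 0) (d 0) (fun y => x *: y).
- by move=> a u v; rewrite scalerDr !scalerA mulrC.
- by move=> y; exact: p_F0.
have [||h [eh hh]] := @dep_choice (fun n => {linear F n -> F n.+1})
  (fun n h => forall y, d n (x *: y - h (d n y)) = 0)
  (fun n h h' => forall y, d n.+1 (h' y) = x *: y - h (d n y)) h0.
- by move=> y; rewrite linearB linearZ /= hh0 subrr.
- move=> n h hh.
  have [||h' hh'] := @Fproj n.+1 (F n.+2) (F n.+1) (d n.+1)
    (fun y => x *: y - h (d n y)).
  + move=> a u v; rewrite (linearP (d n)) (linearP h) scalerDr scalerBr !scalerA.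
    by rewrite (mulrC x) opprD addrACA.
  + by move=> y; exact: ex.
  exists h'; split=> // y.
  by rewrite linearB linearZ /= hh' dd linear0 subr0 subrr.
by exists h; split=> // y; rewrite eh.
Qed.

Lemma homotopy_family : exists h : A -> forall n, {linear F n -> F n.+1},
  forall x, x \in p -> (forall y, d 0 (h x 0%N y) = x *: y) /\
  forall n y, d n.+1 (h x n.+1 y) = x *: y - h x n (d n y).
Proof.
have ch x : {h : forall n, {linear F n -> F n.+1} | x \in p ->
    (forall y, d 0 (h 0%N y) = x *: y) /\
    forall n y, d n.+1 (h n.+1 y) = x *: y - h n (d n y)}.
  apply: cid; have [/homotopy_exists[h hh]|_] := boolP (x \in p); first by exists h.
  by exists (fun n => \0 : {linear F n -> F n.+1}).
by exists (fun x => sval (ch x)) => x; exact: (svalP (ch x)).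
Qed.

(** Chain maps (up to a factor [t]) inducing zero on the augmentation are
    null-homotopic. *)
Lemma null_homotopy (t : A) (chi : forall n, {linear F n -> F n}) :
  (forall n y, d n (chi n.+1 y) = t *: chi n (d n y)) ->
  (forall y, exists w, d 0 w = chi 0%N y) ->
  exists k : forall n, {linear F n -> F n.+1}, (forall y, chi 0%N y = d 0 (k 0%N y)) /\
    forall n y, chi n.+1 y = d n.+1 (k n.+1 y) + t *: k n (d n y).
Proof.
move=> hchi h0.
have [||k0 hk0] := @Fproj 0 (F 1) (F 0) (d 0) (chi 0%N).
- exact: linearP.
- exact: h0.
have [||k [ek hk]] := @dep_choice (fun n => {linear F n -> F n.+1})
  (fun n k => forall y, d n (chi n.+1 y - t *: k (d n y)) = 0)
  (fun n k k' => forall y, d n.+1 (k' y) = chi n.+1 y - t *: k (d n y)) k0.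
- by move=> y; rewrite linearB linearZ /= hk0 hchi subrr.
- move=> n k hk.
  have [||k' hk'] := @Fproj n.+1 (F n.+2) (F n.+1) (d n.+1)
    (fun y => chi n.+1 y - t *: k (d n y)).
  + move=> a u v; rewrite (linearP (d n)) (linearP k) (linearP (chi n.+1)).
    by rewrite scalerDr scalerBr !scalerA (mulrC t) opprD addrACA.
  + by move=> y; exact: ex.
  exists k'; split=> // y.
  by rewrite linearB linearZ /= hk' dd linear0 scaler0 subr0 hchi subrr.
exists k; split=> [y|n y]; first by rewrite ek hk0.
by rewrite hk subrK.
Qed.

Variable h : A -> forall n, {linear F n -> F n.+1}.
Hypothesis hP : forall x, x \in p -> (forall y, d 0 (h x 0%N y) = x *: y) /\
  forall n y, d n.+1 (h x n.+1 y) = x *: y - h x n (d n y).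

(** The cycle modulo [xs] which detects cohomology classes in degree [size xs]. *)
Fixpoint zz (xs : seq A) : F (size xs) :=
  if xs is x :: xs' then h x (size xs') (zz xs') else z0.

Section Coboundaries.
Variable V : lmodType A.
Implicit Types (K : submodClosed V).

(** [f] is a coboundary as a cochain with values in [V / K]. *)
Definition cobd K n : (F n -> V) -> Prop := if n is m.+1
  then fun f => exists g : {linear F m -> V}, forall y, f y - g (d m y) \in K
  else fun f => forall y, f y \in K.

Lemma cobd_ext K n f f' : cobd K f -> (forall y : F n, f' y - f y \in K) -> cobd K f'.
Proof.
case: n f f' => [|n] f f' /=.
  by move=> hf e y; rewrite (subm_eqmod (e y)).
move=> [g hg] e; exists g => y.
by rewrite -(subrK (f y) (f' y)) -addrA rpredD.
Qed.

Lemma cobd_lin K n (a : A) f f' : cobd K f -> cobd K f' ->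
  cobd K (fun y : F n => a *: f y + f' y).
Proof.
case: n f f' => [|n] f f' /=.
  by move=> hf hf' y; rewrite rpredD // rpredZ.
move=> [g hg] [g' hg']; exists (a \*: g \+ g') => y /=.
by rewrite opprD addrACA -scalerBr rpredD // rpredZ.
Qed.

Lemma cobd0 K n : cobd K (fun _ : F n => 0).
Proof.
case: n => [|n] /=; first by move=> _; exact: rpred0.
by exists \0 => y; rewrite subr0 rpred0.
Qed.

Lemma cobdZ K n (a : A) f : cobd K f -> cobd K (fun y : F n => a *: f y).
Proof.
move=> hf; apply: (cobd_ext (cobd_lin a hf (@cobd0 K n))) => y.
by rewrite addr0 subrr rpred0.
Qed.

Lemma cobd_mono K L n (f : F n -> V) : sle K L -> cobd K f -> cobd L f.
Proof.
by case: n f => [|n] f KL; [move=> hf y; exact: KL|move=> [g hg]; exists g => y; exact: KL].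
Qed.

Lemma cobd_eq K n (f f' : F n -> V) : f =1 f' -> cobd K f -> cobd K f'.
Proof. by move=> e hf; apply: (cobd_ext hf) => y; rewrite e subrr rpred0. Qed.

Lemma d_zz x xs (g : {linear F (size xs) -> V}) : {subset x :: xs <= p} ->
  g (d (size xs) (zz (x :: xs))) \in addseq (zerom V) (x :: xs).
Proof.
elim: xs x g => [|x' xs IH] x g hxs.
  rewrite /= (hP (hxs x (mem_head _ _))).1 linearZ /=; exact: mem_adds.
rewrite [zz _]/= (hP (hxs x (mem_head _ _))).2 linearB linearZ; apply: subm_sub.
  by apply: mem_addseq; exact: mem_head.
have := IH x' (g \o h x (size xs)) (fun y hy => hxs y (mem_behead (s := x :: _) hy)).
by apply: addseq_sub => y hy; rewrite inE hy orbT.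
Qed.

Lemma cobd_zz K xs f : {subset xs <= p} -> cobd K f -> f (zz xs) \in addseq K xs.
Proof.
case: xs f => [|x xs] f hxs hf; first exact: hf.
have [g hg] := hf; rewrite (subm_eqmod (y := g (d (size xs) (zz (x :: xs))))).
  by apply: (addseq_mono (@zerom_sle _ _ K)); exact: d_zz.
exact: sle_addseq (hg _).
Qed.

Lemma theta_d K x n (f : {linear F n.+1 -> V}) : x \in p ->
  (forall y, f (d n.+1 y) \in K) -> forall y, f (h x n (d n y)) - x *: f y \in K.
Proof.
move=> hx hf y; have e : h x n (d n y) = x *: y - d n.+1 (h x n.+1 y).
  by rewrite (hP hx).2 subKr.
by rewrite e linearB linearZ /= addrAC subrr add0r subm_opp.
Qed.

(** A cocycle with values in [V / K] gives one of lower degree with values in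
    [V / (K + x V)]; this operation is injective when [x] is regular. *)
Lemma theta_cocycle K x n (f : {linear F n.+1 -> V}) : x \in p ->
  (forall y, f (d n.+1 y) \in K) -> forall y, (f \o h x n) (d n y) \in adds K x.
Proof.
move=> hx hf y; rewrite (subm_eqmod (y := x *: f y)); first exact: mem_adds.
by apply: sle_adds; exact: theta_d.
Qed.

Lemma theta_inj K x n (f : {linear F n.+1 -> V}) : x \in p -> nzd K x ->
  (forall y, f (d n.+1 y) \in K) -> cobd (adds K x) (f \o h x n) -> cobd K f.
Proof.
move=> hx nx hf hc.
have [phi [lphi phi1 phi2]] : exists phi : F n -> V, [/\ linear phi,
    forall y, phi y \in adds K x & forall y, phi (d n y) = f (h x n (d n y))].
  case: n f hf hc => [|n] f hf /=; first by exists (f \o h x 0%N); split=> //; exact: linearP.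
  move=> [e he]; exists (fun y => f (h x n.+1 y) - e (d n y)); split=> // [a u v|y].
    rewrite (linearP (h x n.+1)) (linearP f) (linearP (d n)) (linearP e).
    by rewrite scalerBr opprD addrACA.
  by rewrite dd linear0 subr0.
have [y|g hg] := @projm_mod _ _ V V ( *:%R x) K phi (@Fproj n) lphi.
  by have /in_adds[v hv] := phi1 y; exists v.
exists g => y; apply: nx.
have -> : x *: (f y - g (d n y)) =
    (f (h x n (d n y)) - x *: g (d n y)) - (f (h x n (d n y)) - x *: f y).
  by rewrite opprB [RHS]addrC addrA subrK scalerBr.
apply: subm_sub; last exact: theta_d.
by rewrite -phi2; exact: hg.
Qed.

(** It is onto when the cohomology in the lower degree vanishes. *)
Lemma theta_surj K x n (g : {linear F n -> V}) : x \in p -> nzd K x ->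
  (forall f : {linear F n -> V}, (forall y, f (d n y) \in K) -> cobd K f) ->
  (forall y, g (d n y) \in adds K x) ->
  exists f : {linear F n.+1 -> V}, (forall y, f (d n.+1 y) \in K) /\
    cobd (adds K x) (fun y => f (h x n y) - g y).
Proof.
move=> hx nx van hg.
have [||f hf] := @projm_mod _ _ V V ( *:%R x) K (g \o d n) (@Fproj n.+1).
- exact: linearP.
- by move=> y; have /in_adds[v hv] := hg y; exists v.
have fd y : f (d n.+1 y) \in K.
  by apply: nx; have := hf (d n.+1 y); rewrite /= dd linear0 sub0r => /subm_opp; rewrite opprK.
exists f; split=> //.
have hk y : (g \- (f \o h x n)) (d n y) \in K.
  rewrite /= -(subrK (x *: f y) (g (d n y))) -addrA; apply: rpredD; first exact: hf.
  by rewrite -opprB subm_opp // theta_d.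
have := cobd_mono (@sle_adds _ _ K x) (cobdZ (-1) (van _ hk)).
by apply: cobd_eq => y; rewrite scaleN1r /= opprB.
Qed.

Lemma zz_inj xs K (f : {linear F (size xs) -> V}) : {subset xs <= p} -> rseq K xs ->
  (forall y, f (d _ y) \in K) -> f (zz xs) \in addseq K xs -> cobd K f.
Proof.
elim: xs K f => [|x xs IH] K f hxs /=.
  move=> _ hf hz y; have [w hw] := psiP y.
  rewrite -(subrK ((psi y : A) *: z0) y) -hw linearD linearZ rpredD //; exact: rpredZ.
move=> [nx hr] hf hz; have hx := hxs x (mem_head _ _).
apply: (theta_inj hx nx hf).
apply: (IH (adds K x) (f \o h x (size xs)) _ hr (theta_cocycle hx hf) hz).
by move=> y hy; apply: hxs; rewrite inE hy orbT.
Qed.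

Lemma zz_ann xs K (f : {linear F (size xs) -> V}) (a : A) : {subset xs <= p} ->
  (forall y, f (d _ y) \in K) -> a \in p -> a *: f (zz xs) \in addseq K xs.
Proof.
elim: xs K f => [|x xs IH] K f hxs hf ha /=.
  by have [w hw] := p_z0 ha; rewrite -linearZ /= -hw.
have hx := hxs x (mem_head _ _).
apply: (IH (adds K x) (f \o h x (size xs)) _ (theta_cocycle hx hf) ha).
by move=> y hy; apply: hxs; rewrite inE hy orbT.
Qed.

Lemma cohomology_vanish n q e K (f : {linear F n -> V}) : size q = n ->
  {subset rcons q e <= p} -> rseq K (rcons q e) ->
  (forall y, f (d n y) \in K) -> cobd K f.
Proof.
move=> sq; case: n / sq f => f hq; rewrite -cats1 => /rseq_cat[hr [ne _]] hf.
have hqp : {subset q <= p} by move=> y hy; apply: hq; rewrite mem_rcons inE hy orbT.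
apply: zz_inj => //; apply: ne; apply: zz_ann => //.
by apply: hq; rewrite mem_rcons mem_head.
Qed.

(** For [xs] regular on [V / K], evaluation at [zz xs] identifies the cohomology
    in degree [size xs] with the elements of [V / (K + xs V)] killed by [p]. *)
Lemma zz_surj xs K v : {subset xs <= p} -> rseq K xs ->
  (forall a : A, a \in p -> a *: v \in addseq K xs) ->
  exists f : {linear F (size xs) -> V}, (forall y, f (d _ y) \in K) /\
    f (zz xs) - v \in addseq K xs.
Proof.
elim: xs K => [|x xs IH] K hxs /=.
  move=> _ hv; have lf : linear (fun y : F 0 => (psi y : A) *: v).
    by move=> a u w; rewrite linearP scalerDl scalerA.
  pose L := GRing.isLinear.Build A _ _ _ _ lf.
  exists (HB.pack_for {linear F 0 -> V} (fun y : F 0 => (psi y : A) *: v) L).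
  split=> [y|] /=; first exact: hv.
  by rewrite -[X in _ - X]scale1r -scalerBl; exact: hv.
move=> [nx hr] hv; have hx := hxs x (mem_head _ _).
have hxs' : {subset xs <= p} by move=> y hy; apply: hxs; rewrite inE hy orbT.
have [g [hg gz]] := IH (adds K x) hxs' hr hv.
have [f' hf'|f [hf hfg]] := theta_surj hx nx _ hg.
  have [q [e eq]] : exists q e, x :: xs = rcons q e.
    by case/lastP: xs {IH hxs hr hv hxs' g hg gz f' hf'} => [|q e];
      [exists [::], x|exists (x :: q), e; rewrite rcons_cons].
  have sq : size q = size xs by have := congr1 size eq; rewrite /= size_rcons => -[].
  by apply: (cohomology_vanish (e := e) sq) hf'; rewrite -eq //; exact: conj nx hr.
exists f; split=> //.
have := cobd_zz hxs' hfg => /(rpredD gz); rewrite addrC addrA subrK.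
by apply.
Qed.

End Coboundaries.

Section KoszulComparison.

Fixpoint kap (xs : seq A) : forall n, Kt xs -> F n :=
  if xs is x :: xs' then fun n => if n is n'.+1
    then fun t => kap n'.+1 t.1 + h x n' (kap n' t.2)
    else fun t => kap 0 t.1
  else fun n => if n is n'.+1 then fun=> 0 else fun a : A => a *: z0.

Fact kap_linear xs n : linear (@kap xs n).
Proof.
elim: xs n => [|x xs IH] [|n] a u v /=.
- by rewrite scalerDl scalerA.
- by rewrite scaler0 addr0.
- exact: IH.
- by rewrite !IH linearP scalerDr addrACA.
Qed.
HB.instance Definition _ xs n := GRing.isLinear.Build A (Kt xs) (F n) _ (@kap xs n)
  (@kap_linear xs n).

Lemma kapD xs n (u v : Kt xs) : kap n (u + v) = kap n u + kap n v.
Proof. by have := @kap_linear xs n 1 u v; rewrite !scale1r. Qed.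
Lemma kap0 xs n : kap n (0 : Kt xs) = 0.
Proof. by have := kapD n (0 : Kt xs) 0; rewrite addr0 -[X in X = _]addr0 => /addrI. Qed.
Lemma kapZ xs n a (u : Kt xs) : kap n (a *: u) = a *: kap n u.
Proof. by have := @kap_linear xs n a u 0; rewrite kap0 !addr0. Qed.
Lemma kapN xs n (u : Kt xs) : kap n (- u) = - kap n u.
Proof. by rewrite -scaleN1r kapZ scaleN1r. Qed.

Lemma d_kap xs n (t : Kt xs) : {subset xs <= p} -> grP n.+1 t ->
  d n (kap n.+1 t) = kap n (dK t).
Proof.
elim: xs n t => [|x xs IH] n t hxs.
  by move=> [//|->]; rewrite /= linear0; case: n => [|n] //=; rewrite scale0r.
case: t => a b /= [ha hb]; have hx := hP (hxs x (mem_head _ _)).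
have hxs' : {subset xs <= p} by move=> y hy; apply: hxs; rewrite inE hy orbT.
rewrite linearD /= IH //; case: n ha hb => [|n] ha hb /=.
  by rewrite hx.1 kapD kapZ.
by rewrite hx.2 IH // kapD kapZ kapN linearN addrA.
Qed.

Lemma kap_top xs (t : Kt xs) : grP (size xs) t -> exists a : A, kap (size xs) t = a *: zz xs.
Proof.
elim: xs t => [|x xs IH] t /=; first by move=> _; exists t.
case: t => a b /= [ha /IH[r e]]; exists r.
by rewrite e (gr_above (ltnSn _) ha) kap0 add0r linearZ.
Qed.

(** Over a ring where [xs] is regular and generates [p], up to multiplication by
    [s], the resolution [F] retracts onto the Koszul complex of [xs]; so a class
    in the top degree is determined by its value at [zz xs]. *)
Lemma zz_inj_torsion (s : A) xs : {subset xs <= p} -> sreg s xs ->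
  (forall a, a \in p -> s * a \in idl xs) ->
  exists k, forall (V : lmodType A) (K : submodClosed V) (f : {linear F (size xs) -> V}),
    (forall y, f (d _ y) \in K) -> f (zz xs) \in K ->
    cobd K (fun y => s ^+ k *: f y).
Proof.
move=> hxs hs hsp; have [k0 hk0] := koszul_exact hs.
set T := s ^+ k0.+1.
pose L := GRing.isLinear.Build A A^o (Kt xs) _ _ (@in0_linear A xs).
pose in0l : {linear A^o -> Kt xs} := HB.pack_for {linear A^o -> Kt xs} (@in0 A xs) L.
have [||phi [ephi hphi]] := @dep_choice (fun n => {linear F n -> Kt xs})
  (fun n f => (forall y, grP n (f y)) /\
    forall y, exists2 u, grP n.+1 u & dK u = T *: f (d n y))
  (fun n f f' => (forall y, grP n.+1 (f' y)) /\ forall y, dK (f' y) = T *: f (d n y))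
  (in0l \o psi).
- split=> y /=; first exact: gr_in0.
  have [t ht et] := idl_dK (hsp _ (psi_d y)).
  exists (s ^+ k0 *: t).
    have [h0 hD] := gr_subproof xs 1; rewrite -[_ *: t]addr0; exact: hD.
  transitivity (s ^+ k0 *: dK t); first exact: dKZ.
  by rewrite et in0Z scalerA -exprSr.
- move=> n f [hf1 hf2].
  have [||f' hf'] := @projm_sub A (F n.+1) (Kt xs) (Kt xs) (@dK A xs) (gr xs n.+1)
    (fun y => T *: f (d n y)) (@Fproj n.+1).
  + by move=> a u v; rewrite (linearP (d n)) (linearP f) scalerDr !scalerA (mulrC T).
  + by move=> y; have [u hu eu] := hf2 y; exists u => //; exact/in_gr.
  exists f'; have hf1' y : grP n.+1 (f' y) by apply/in_gr; exact: (hf' y).2.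
  have hf2' y : dK (f' y) = T *: f (d n y) by exact: (hf' y).1.
  split; last by split.
  split=> // y; apply: hk0 => //.
  by rewrite hf2' dd linear0 scaler0.
have gphi n y : grP n (phi n y).
  by case: n y => [|n] y; [rewrite ephi /=; exact: gr_in0|exact: (hphi n).1].
pose chi n : {linear F n -> F n} := (@kap xs n \o phi n) \- (T ^+ n \*: idfun).
have chiE n y : chi n y = kap n (phi n y) - T ^+ n *: y by [].
have [||k [k1 k2]] := @null_homotopy T chi.
- move=> n y; rewrite !chiE linearB linearZ /= d_kap //.
  by rewrite (hphi n).2 kapZ scalerBr exprS scalerA.
- move=> y; rewrite chiE ephi /= expr0 scale1r.
  have -> : kap 0 (in0 xs (psi y)) = (psi y : A) *: z0.
    by elim: xs {hxs hs hsp hk0 phi ephi hphi gphi chi chiE L in0l} => [|x xs IH] //=.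
  by have [w hw] := psiP y; exists (- w); rewrite linearN /= hw opprB.
exists (k0.+1 * size xs)%N => V K f hf hz; rewrite exprM -/T.
have val y : f (T ^+ size xs *: y) + f (chi (size xs) y) \in K.
  rewrite -linearD chiE addrC subrK.
  by have [a ->] := kap_top (gphi (size xs) y); rewrite linearZ rpredZ.
suff hc : cobd K (fun y => f (chi (size xs) y)).
  apply: (cobd_ext (cobdZ (-1) hc)) => y.
  by have := val y; rewrite linearZ /= scaleN1r opprK.
move: f hf {val hz}; case: (size xs) => [|n] f hf; first by move=> y; rewrite k1; exact: hf.
exists (T \*: (f \o k n)) => y.
rewrite k2 linearD linearZ /= addrK; exact: hf.
Qed.

End KoszulComparison.

Section Derivations.
(** [D] induces a map [p / p^2 -> A / p] of [A]-modules. *)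
Definition derivation (D : A -> A) := forall r a b, a \in p -> b \in p ->
  D (r * a + b) - (r * D a + D b) \in p.

Lemma derivation0 D : derivation D -> D 0 \in p.
Proof.
move=> hD; have := hD 0 0 0 (ideal0 p) (ideal0 p).
by rewrite !mul0r !add0r subrr => _; have := hD 1 0 0 (ideal0 p) (ideal0 p);
  rewrite !mul1r addr0 opprD addrA subrr add0r => /(@subm_opp A A^o); rewrite opprK.
Qed.

(** The class of [Ext^1] defined by a derivation, as a chain map of degree -1. *)
Lemma eps_exists D : derivation D -> exists eps : forall n, {linear F n.+1 -> F n},
  (forall y, psi (eps 0%N y) - D (psi (d 0 y)) \in p) /\
  forall n y, d n (eps n.+1 y) = - eps n (d n.+1 y).
Proof.
move=> hD; have D0 := derivation0 hD.
have [||e0 he0] := @Fproj 1 (F 0) (quotm p) (pim p \o psi)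
  (fun y : F 1 => pim p (D (psi (d 0 y)) : A^o)).
- move=> a u v; rewrite (linearP (d 0)) (linearP psi) -(linearP (pim p)).
  apply/pim_eq; exact: (hD a _ _ (psi_d u) (psi_d v)).
- move=> y; exists (D (psi (d 0 y)) *: z0); apply/pim_eq; rewrite linearZ /=.
  have -> : D (psi (d 0 y)) *: psi z0 - D (psi (d 0 y)) =
     D (psi (d 0 y)) * (psi z0 - (1 : A)) by rewrite /GRing.scale /=; ring.
  exact: ideal_mull.
have {}he0 y : psi (e0 y) - D (psi (d 0 y)) \in p by apply/pim_eq; exact: he0.
have [||eps [ee hee]] := @dep_choice (fun n => {linear F n.+1 -> F n})
  (fun n e => forall y, exists w, d n w = - e (d n.+1 y))
  (fun n e e' => forall y, d n (e' y) = - e (d n.+1 y)) e0.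
- move=> y; have [w hw] : exists w, d 0 w = e0 (d 1 y).
    apply: psi_im; have := he0 (d 1 y); rewrite dd linear0 => h'.
    by rewrite (ideal_eqmod h').
  by exists (- w); rewrite linearN /= hw.
- move=> n e he.
  have [||e' he'] := @Fproj n.+2 (F n.+1) (F n) (d n)
    (fun y : F n.+2 => - e (d n.+1 y)).
  + by move=> a u v; rewrite (linearP (d n.+1)) (linearP e) opprD scalerN.
  + exact: he.
  exists e'; split=> // y; apply: ex.
  by rewrite linearN /= he' dd linear0 !oppr0.
by exists eps; split=> // y; rewrite ee.
Qed.

Definition theta0 n : {linear F n -> A^o} -> A -> Prop := if n is m.+1
  then fun f x => cobd p (fun y => f (h x m y)) else fun _ _ => True.

(** Multiplying a class by [D] and lowering it with [x] anticommute up to [D x]. *)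
Lemma theta_eps D (eps : forall n, {linear F n.+1 -> F n}) x t n
  (g : {linear F n -> A^o}) : derivation D -> x \in p ->
  D x - t \in p ->
  (forall y, psi (eps 0%N y) - D (psi (d 0 y)) \in p) ->
  (forall n y, d n (eps n.+1 y) = - eps n (d n.+1 y)) ->
  (forall y, g (d n y) \in p) -> theta0 g x ->
  cobd p (fun y => g (eps n (h x n y)) - t *: g y).
Proof.
move=> hD hx hDx e0 eS hg hth; have [h0 hS] := hP hx.
pose chi n : {linear F n -> F n} := if n is m.+1
  then ((eps m.+1 \o h x m.+1) \+ (h x m \o eps m)) \- (t \*: idfun)
  else (eps 0%N \o h x 0%N) \- (t \*: idfun).
have [||k [k1 k2]] := @null_homotopy 1 chi.
- move=> [|m] y; rewrite scale1r /= linearB linearD linearZ /= eS hS.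
    by rewrite h0 linearB linearZ opprB /= subrK.
  by rewrite hS eS linearN opprK linearB linearZ opprB addrA subrK.
- move=> y; apply: psi_im; rewrite /= linearB linearZ /=.
  have h1 := e0 (h x 0%N y); rewrite h0 linearZ in h1.
  have h2 := hD (psi y) x 0 hx (ideal0 p); rewrite addr0 in h2.
  have -> : psi (eps 0%N (h x 0%N y)) - t *: psi y =
    (psi (eps 0%N (h x 0%N y)) - D (x *: psi y))
    + (D (psi y * x) - (psi y * D x + D 0)) + (psi y * (D x - t) + D 0).
    by rewrite /GRing.scale /= (mulrC x); ring.
  apply: idealD; first exact: idealD.
  by apply: idealD; [exact: ideal_mull|exact: derivation0].
case: n g hg hth => [|n] g hg hth.
  move=> y; have := congr1 g (k1 y); rewrite /= linearB linearZ /= => ->; exact: hg.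
have c1 : cobd p (fun y => g (chi n.+1 y)).
  exists (g \o k n) => y /=; rewrite -[X in g X - _]/(chi n.+1 y) k2 scale1r linearD addrK.
  exact: hg.
have c2 : cobd p (fun y => g (h x n (eps n y))).
  case: n g hg hth c1 => [|n] g hg hth c1.
    exists \0 => y; rewrite subr0; exact: hth.
  have [e he] := hth; exists (- 1 \*: (e \o eps n)) => y /=.
  have := he (eps n.+1 y); rewrite eS linearN scaleN1r.
  by rewrite opprK.
apply: (cobd_ext (cobd_lin (-1) c2 c1)) => y.
have e (a b r : A^o) : a - r - (- 1 *: b + (a + b - r)) = 0.
  by rewrite scaleN1r (addrC a b) -(addrA b) addKr subrr.
have hc : g (chi n.+1 y) = g (eps n.+1 (h x n.+1 y)) + g (h x n (eps n y)) - t *: g y.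
  by rewrite /= linearB linearD linearZ.
rewrite hc e; exact: ideal0.
Qed.

Fixpoint dual (Ds : seq (A -> A)) (xs : seq A) : Prop :=
  match Ds, xs with
  | D :: Ds', x :: xs' => [/\ derivation D, D x - 1 \in p,
      (forall D', List.In D' Ds' -> D' x \in p) & dual Ds' xs']
  | [::], [::] => True
  | _, _ => False
  end.

(** A product of [Ext^1] classes dual to [xs] takes the value 1 at [zz xs]. *)
Lemma zz_unit Ds xs : {subset xs <= p} -> dual Ds xs ->
  exists f : {linear F (size xs) -> A^o}, (forall y, f (d _ y) \in p) /\
    f (zz xs) - (1 : A) \in p.
Proof.
move=> hxs hd.
suff [f [h1 h2 _]] : exists f : {linear F (size xs) -> A^o},
    [/\ forall y, f (d _ y) \in p, f (zz xs) - (1 : A) \in p &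
    forall x, x \in p -> (forall D, List.In D Ds -> D x \in p) -> theta0 f x].
  by exists f.
elim: xs Ds hxs hd => [|x xs IH] [|D Ds] //= hxs; first by exists psi.
move=> [hD Dx hDs hd].
have hx := hxs x (mem_head _ _).
have hxs' : {subset xs <= p} by move=> y hy; apply: hxs; rewrite inE hy orbT.
have [g [g1 g2 g3]] := IH Ds hxs' hd.
have [eps [e0 eS]] := eps_exists hD.
exists (g \o eps (size xs)); split.
- move: g g1 {g2 g3 IH}; case: (size xs) => [|n] g g1 y /=; last first.
    by rewrite -[_ (d _ y)]opprK -eS linearN; apply: (@subm_opp A A^o); exact: g1.
  have [w <-] : exists w, d 0 w = eps 0%N (d 1 y); last exact: g1.
  apply: psi_im; have := e0 (d 1 y); rewrite dd linear0 => h'.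
  by rewrite (ideal_eqmod h'); exact: derivation0.
- have hc := theta_eps hD hx Dx e0 eS g1 (g3 x hx hDs).
  have h1 := cobd_zz hxs' hc; rewrite /= scale1r in h1.
  have h2 : sle (addseq p xs) p.
    by apply: addseq_min => // a v /hxs' ha; exact: ideal_mulr.
  have -> : g (eps (size xs) (h x (size xs) (zz xs))) - 1 =
    (g (eps (size xs) (h x (size xs) (zz xs))) - g (zz xs)) + (g (zz xs) - 1) by ring.
  by apply: idealD => //; exact: h2.
- move=> x' hx' hD'; apply: (cobd_ext (theta_eps (t := 0) hD hx' _ e0 eS g1 (g3 x' hx' _))).
  + by rewrite subr0; apply: hD'; left.
  + by move=> D'' hD''; apply: hD'; right.
  + by move=> y; rewrite /= scale0r subr0 subrr; exact: ideal0.
Qed.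

End Derivations.
End Resolution.
(** * The congruence module without Ext *)

(** Two surjections from a common module with the same kernel. *)
Lemma isom_surj (R : comNzRingType) (U V W : lmodType R) (f : {linear U -> V})
    (g : {linear U -> W}) : (forall v, exists u, f u = v) ->
  (forall w, exists u, g u = w) -> (forall u, f u = 0 <-> g u = 0) -> isom V W.
Proof.
move=> sf sg fg.
have ch v : {u | f u = v} by apply: cid; exact: sf.
have ch' v : {u | g u = v} by apply: cid; exact: sg.
pose h v := g (sval (ch v)); pose h' w := f (sval (ch' w)).
have hE u : h (f u) = g u.
  apply/eqP; rewrite -subr_eq0 -linearB; apply/eqP/fg.
  by rewrite linearB (svalP (ch (f u))) subrr.
have hE' u : h' (g u) = f u.
  apply/eqP; rewrite -subr_eq0 -linearB; apply/eqP/fg.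
  by rewrite linearB (svalP (ch' (g u))) subrr.
have lh : linear h.
  move=> a v v'; have [[u <-] [u' <-]] := (sf v, sf v').
  by rewrite -linearP !hE linearP.
pose L := GRing.isLinear.Build R V W _ h lh.
exists (HB.pack_for {linear V -> W} h L); exists h' => [v|w] /=.
  by have [u <-] := sf v; rewrite hE hE'.
by have [u <-] := sg w; rewrite hE' hE.
Qed.

Lemma free_eval_delta (A : comNzRingType) (N : lmodType A) (x : N) : free_eval (fdelta A x) = x.
Proof. exact: (free_lift_delta id). Qed.

Lemma pim0 (R : comNzRingType) (V : lmodType R) (N : submodClosed V) x :
  pim N x = 0 <-> x \in N.
Proof. by rewrite -[0](linear0 (pim N)) pim_eq subr0. Qed.

Lemma tf_quot_eq (O : idomainType) (A : comAlgType O) (V : lmodType A)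
    (N : submodClosed V) x y :
  pim (tors (over_base (quotm N))) (pim N x) = pim (tors (over_base (quotm N))) (pim N y)
  <-> exists2 t : O, t != 0 & t%:A *: (x - y) \in N.
Proof.
rewrite pim_eq inmk; split=> -[t t0 ht]; exists t => //.
  by apply/pim0; rewrite linearZ linearB.
change (t%:A *: (pim N x - pim N y) = 0).
by rewrite -linearB -linearZ; apply/pim0.
Qed.

Lemma Hom_ext (R : comNzRingType) (U V : lmodType R) (f g : Defs.Hom U V) : homf f =1 homf g -> f = g.
Proof. by move=> h; apply: val_inj; apply/funext. Qed.

Lemma in_subin (R : comNzRingType) (V : lmodType R) (N B : submodClosed V) (x : subm N) :
  x \in subin N B <-> submval x \in B.
Proof. exact: inmk. Qed.

Lemma tf_eq (O : idomainType) (A : comAlgType O) (V : lmodType A) (x y : V) :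
  pim (tors (over_base V)) x = pim (tors (over_base V)) y
  <-> exists2 t : O, t != 0 & t%:A *: (x - y) = 0.
Proof. by rewrite pim_eq inmk. Qed.

Lemma scale_hom (R : comNzRingType) (U V : lmodType R) (f : {linear U -> R^o}) (v : V) :
  exists g : Defs.Hom U V, forall y, homf g y = (f y : R) *: v.
Proof.
have lf : linear (fun y => (f y : R) *: v).
  by move=> a u w; rewrite linearP scalerDl scalerA.
pose L := GRing.isLinear.Build R U V _ _ lf.
by exists (hom_of (HB.pack_for {linear U -> V} (fun y => (f y : R) *: v) L)).
Qed.

Section HomEval.
Variables (R : comNzRingType) (U V : lmodType R) (z : U).
Definition hom_eval (f : Defs.Hom U V) : V := homf f z.
Fact hom_eval_linear : linear hom_eval.
Proof. by []. Qed.
HB.instance Definition _ := GRing.isLinear.Build R (Defs.Hom U V) V _ hom_eval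
  hom_eval_linear.
End HomEval.

Lemma homf_postcomp (R : comNzRingType) (U V V' : lmodType R) (a : R)
    (f : Defs.Hom U V') (g : Defs.Hom U V) (h : {linear V -> V'}) y :
  homf (a *: (f - postcomp h g)) y = a *: (homf f y - h (homf g y)).
Proof. by []. Qed.

Section Precomposition.
Variables (R : comNzRingType) (U U' V : lmodType R).

Lemma in_ker_precomp (g : {linear U' -> U}) (f : Defs.Hom U V) :
  f \in kerm (@precomp R U U' V g) <-> forall y, homf f (g y) = 0.
Proof.
split=> [/inmk h y|h].
  by rewrite -[LHS]/(homf (precomp g f) y) h.
by apply/inmk; apply: val_inj; apply/funext => y; exact: h.
Qed.

Lemma in_im_precomp (g : {linear U' -> U}) (f : Defs.Hom U' V) :
  f \in imm (@precomp R U U' V g) <->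
  exists k : {linear U -> V}, forall y, homf f y = k (g y).
Proof.
split=> [/inmk [k _ <-]|[k hk]]; first by exists (homf k).
by apply/inmk; exists (hom_of k) => //; apply: Hom_ext => y; rewrite hk.
Qed.
End Precomposition.

Section FreeResolution.
Variables (A : comNzRingType) (N : lmodType A).

Lemma resol_dE n (w : resol N n.+1) :
  resol_d N n w = @submval _ _ (kerm (@free_eval A (syz N n)))
    (@free_eval A (syz N n.+1) w).
Proof. by []. Qed.

Lemma resol_dd n y : resol_d N n (resol_d N n.+1 y) = 0.
Proof.
apply/eqP; rewrite -[X in _ == X](linear0 (@submval _ _ (kerm (@free_eval A (syz N n))))).
apply/eqP; congr submval.
exact: (mksubmP _ _ (valP (free_eval y))).
Qed.

Lemma resol_ex n y : resol_d N n y = 0 -> exists w, resol_d N n.+1 w = y.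
Proof.
move=> h.
have ky : y \in kerm (@free_eval A (syz N n.+1)).
  by apply/mksubmP; apply: val_inj; exact: h.
pose k : syz N n.+2 := Subm ky; exists (fdelta A k).
by rewrite resol_dE free_eval_delta.
Qed.

Lemma resol_ex0 y : free_eval y = 0 -> exists w, resol_d N 0 w = y.
Proof.
move=> h; have ky : y \in kerm (@free_eval A N) by apply/mksubmP.
pose k : syz N 1 := Subm ky; exists (fdelta A k).
by rewrite resol_dE free_eval_delta.
Qed.

Lemma free_eval_d y : free_eval (resol_d N 0 y) = 0.
Proof. exact: (mksubmP _ _ (valP (free_eval y))). Qed.

End FreeResolution.

Section CongruenceModule.
Variables (O : idomainType) (A : comAlgType O) (lam : {rmorphism A -> O}).
Hypothesis lamK : forall x : O, lam x%:A = x.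
Local Notation p := (kerI lam).
Local Notation F := (resol (augmod lam)).
Local Notation d := (resol_d (augmod lam)).

Lemma in_kerI a : a \in p <-> lam a = 0.
Proof. exact: inmkI. Qed.

Lemma kerI_sub_lam a : a - (lam a)%:A \in p.
Proof. by apply/in_kerI; rewrite rmorphB lamK subrr. Qed.

Definition aug1 : augmod lam := (1 : O).
Definition aug_lift (x : augmod lam) : A^o := (x : O)%:A.
Definition psi : {linear F 0 -> A^o} := @free_lift A (augmod lam) A^o aug_lift.

Definition gen0 : F 0 := @fdelta A (syz (augmod lam) 0) aug1.

Lemma free_eval_gen0 : @free_eval A (augmod lam) gen0 = aug1.
Proof. exact: free_eval_delta. Qed.

Lemma psi1 : psi (gen0) = (1 : A).
Proof. by rewrite /psi /gen0 /= free_lift_delta /aug_lift /aug1 scale1r. Qed.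

Lemma lam_psi y : lam (psi y) = free_eval y :> O.
Proof.
have lf : linear (fun y : F 0 => (lam (psi y) : augmod lam)).
  by move=> a u v; rewrite linearP rmorphD rmorphM.
have lg : linear (fun y : F 0 => free_eval y) by move=> a u v; rewrite linearP.
have e : (fun k : augmod lam => (lam (psi (fdelta A k)) : augmod lam)) =
    (fun k => free_eval (fdelta A k)).
  apply/funext => k; rewrite free_eval_delta /psi /= free_lift_delta.
  exact: lamK.
have := linear_free lf y; rewrite e -(linear_free lg); exact.
Qed.

Lemma psi_d w : psi (d 0 w) \in p.
Proof. by apply/in_kerI; rewrite lam_psi free_eval_d. Qed.

Lemma psiP y : exists w, d 0 w = y - (psi y : A) *: gen0.
Proof.
apply: resol_ex0; rewrite linearB linearZ /= free_eval_gen0.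
apply/eqP; rewrite subr_eq0; apply/eqP.
by rewrite -lam_psi; apply/esym/mulr1.
Qed.

Lemma p_z0 (a : A) : a \in p -> exists w, d 0 w = a *: gen0.
Proof.
move=> /in_kerI ha; apply: resol_ex0; rewrite linearZ /= free_eval_gen0.
by change (lam a * 1 = 0 :> O); rewrite ha mul0r.
Qed.

Lemma in_cocycle (V : lmodType A) n (f : Defs.Hom (F n) V) :
  f \in cocycle (augmod lam) V n <-> forall y, homf f (d n y) = 0.
Proof. exact: in_ker_precomp. Qed.

Lemma in_cobound (V : lmodType A) n (f : Defs.Hom (F n) V) :
  f \in cobound (augmod lam) V n <-> cobd d (zerom V) (homf f).
Proof.
case: n f => [|n] f.
  split=> [/in_zerom -> y|h]; first exact/in_zerom.
  by apply/in_zerom; apply: Hom_ext => y; apply/in_zerom; exact: h.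
apply: (iff_trans (in_im_precomp _ _)); split=> -[g hg]; exists g => y.
  by apply/in_zerom; rewrite hg subrr.
by have /in_zerom/eqP := hg y; rewrite subr_eq0 => /eqP.
Qed.

Section Value.
Variables (M : lmodType A) (xs : seq A) (s : A) (Ds : seq (A -> A)).
Hypotheses (xp : {subset xs <= p}) (xr : rseq (zerom M) xs) (sp : s \notin p)
  (xs_s : sreg s xs) (s_p : forall a, a \in p -> s * a \in idl xs) (xD : dual p Ds xs).

Local Notation c := (size xs).
Local Notation Mp := (Defs.modp lam M).
Local Notation pM := (@pim A M (imul p (topm M))).

Definition tfp : lmodType O := tf (over_base Mp).

Fact congL_subproof : submod_set [set x : tfp | exists2 v : M,
  (forall a, a \in p -> a *: v \in addseq (zerom M) xs) &
  x = pim (tors (over_base Mp)) (pM v)].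
Proof.
split=> [|a _ _ [v hv ->] [v' hv' ->]] /=.
  by exists 0 => [a _|]; rewrite ?scaler0 ?rpred0 // !linear0.
exists (a%:A *: v + v') => [b hb|]; last by rewrite !linearP.
by rewrite scalerDr scalerA mulrC -scalerA rpredD ?hv' // rpredZ // hv.
Qed.
(** By [Psi_isom], the image of [Ext^c(O, M)]. *)
Definition congL := mksubm congL_subproof.

Local Notation Cm := (cocycle (augmod lam) M c).
Local Notation Cp := (cocycle (augmod lam) Mp c).
Local Notation Bm := (subin Cm (cobound (augmod lam) M c)).
Local Notation Bp := (subin Cp (cobound (augmod lam) Mp c)).

Definition to_Psi : {linear over_base (subm Cp) -> Psi lam c M} :=
  @pim O _ (imm (congr_map lam c M)) \o
  (@pim O _ (tors (over_base (Ext c (augmod lam) Mp))) \o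
   restr_map (in_alg A) (@pim A (subm Cp) Bp)).

Definition to_congL (z : F c) : {linear over_base (subm Cp) -> quotm congL} :=
  @pim O _ congL \o (@pim O _ (tors (over_base Mp)) \o
   restr_map (in_alg A) (@hom_eval A (F c) Mp z \o @submval A _ Cp)).

Lemma congr_mapE (g : subm Cm) :
  congr_map lam c M (pim (tors (over_base (Ext c (augmod lam) M))) (pim Bm g)) =
  pim (tors (over_base (Ext c (augmod lam) Mp)))
    (pim Bp (@cocycle_map A (augmod lam) M Mp pM c g)).
Proof.
etransitivity; first exact: quot_mapE.
congr (pim _ _); exact: quot_mapE.
Qed.

Lemma to_Psi_eq0 (f : subm Cp) : to_Psi f = 0 <-> exists g : subm Cm,
  exists2 t : O, t != 0 & cobd d (zerom Mp)
    (fun y => t%:A *: (homf (submval f) y - pM (homf (submval g) y))).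
Proof.
rewrite -[to_Psi f]/(pim _ (pim (tors (over_base (Ext c (augmod lam) Mp))) (pim Bp f))).
have key (g : subm Cm) t :
    t%:A *: (f - @cocycle_map A (augmod lam) M Mp pM c g) \in Bp <->
    cobd d (zerom Mp) (fun y => t%:A *: (homf (submval f) y - pM (homf (submval g) y))).
  have e : submval (t%:A *: (f - @cocycle_map A (augmod lam) M Mp pM c g)) =
      t%:A *: (submval f - postcomp pM (submval g)).
    by rewrite linearZ linearB.
  rewrite in_subin e; apply: (iff_trans (in_cobound _)).
  by split; apply: cobd_eq => y; rewrite homf_postcomp.
rewrite pim0 inmk; split=> [[x _]|[g [t t0 hg]]].
  have [x' ->] := pim_surj x; have [g ->] := pim_surj x'.
  rewrite congr_mapE => /esym/tf_quot_eq[t t0 /key ht].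
  by exists g, t.
exists (pim (tors (over_base (Ext c (augmod lam) M))) (pim Bm g)) => //.
by rewrite congr_mapE; apply/esym/tf_quot_eq; exists t => //; apply/key.
Qed.

Lemma pM_kills (a : A) (x : Mp) : a \in p -> a *: x = 0.
Proof.
have [v ->] := pim_surj x => ha; rewrite -linearZ; apply/pim0.
by apply: mem_imul => //; apply/in_topm.
Qed.

(** The class of a cocycle is determined by its value at a single cycle, so the
    congruence module is the cokernel of [(M / xM)[p] -> (M / pM)^tf]. *)
Lemma Psi_isom : isom (Psi lam c M) (quotm congL).
Proof.
have Fproj n : projm (F n) by exact: freem_projm.
have dd := @resol_dd A (augmod lam).
have dex := @resol_ex A (augmod lam).
have psi1' : psi gen0 - (1 : A) \in p by rewrite psi1 subrr; exact: ideal0.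
have [h hP] := homotopy_family Fproj dd dex psiP p_z0.
pose z := zz gen0 h xs.
have [f0 [f0d f0z]] := zz_unit Fproj dd dex psi1' psiP psi_d p_z0 hP xp xD.
have Kz (x : Mp) : x \in addseq (zerom Mp) xs -> x = 0.
  move=> hx; apply/in_zerom; apply: addseq_min hx; first exact: sle_refl.
  by move=> a v /xp ha; apply/in_zerom; exact: pM_kills.
have coc_val (v : Mp) : exists2 f, f \in Cp & homf f z = v.
  have [f hf] := scale_hom f0 v; exists f.
    by apply/in_cocycle => y; rewrite hf; exact: pM_kills.
  rewrite hf; apply/eqP; rewrite -subr_eq0 -[X in _ - X]scale1r -scalerBl.
  by apply/eqP; apply: pM_kills; exact: f0z.
apply: (isom_surj (f := to_Psi) (g := to_congL z)).
- move=> q; have [x ->] := pim_surj q; have [y ->] := pim_surj x.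
  by have [g ->] := pim_surj y; exists g.
- move=> q; have [x ->] := pim_surj q; have [v ->] := pim_surj x.
  by have [f fc <-] := coc_val v; exists (Subm fc).
move=> f; have fc := valP f; move: fc => /in_cocycle fc.
have -> : to_congL z f = 0 <-> exists2 v, (forall a, a \in p ->
    a *: v \in addseq (zerom M) xs) &
    exists2 t : O, t != 0 & t%:A *: (homf (submval f) z - pM v) = 0.
  rewrite -[to_congL z f]/(pim congL (pim (tors (over_base Mp)) (homf (submval f) z))).
  rewrite pim0 inmk; split=> -[v hv hv']; exists v => //.
    by apply/tf_eq.
  by apply/tf_eq.
rewrite to_Psi_eq0; split=> [[g [t t0 hc]]|[v hv [t t0 ht]]].
  have /in_cocycle gc := valP g.
  exists (homf (submval g) z).
    move=> a ha; apply: (zz_ann p_z0 hP) => // y.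
    by apply/in_zerom; exact: gc.
  exists t => //; apply: Kz.
  exact: (cobd_zz gen0 hP xp hc).
have [|g [gc gz]] := zz_surj Fproj dd psi1' psiP psi_d p_z0 hP xp xr (v := v).
  exact: hv.
have gC : hom_of g \in Cm by apply/in_cocycle => y; apply/in_zerom; exact: gc.
have [k hk] := zz_inj_torsion Fproj dd dex psiP psi_d hP xp xs_s s_p.
pose e : Defs.Hom (F c) Mp := t%:A *: (submval f - postcomp pM (hom_of g)).
have eE y : homf e y = t%:A *: (homf (submval f) y - pM (g y)) by rewrite homf_postcomp.
have pgz : pM (g z) = pM v.
  apply/pim_eq; apply: addseq_min gz; first exact: zerom_sle.
  by move=> a u /xp ha; apply: mem_imul => //; apply/in_topm.
exists (Subm gC); exists (t * lam s ^+ k).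
  by rewrite mulf_neq0 // expf_neq0 //; apply/negP => /eqP/in_kerI; apply/negP.
have hc : cobd d (zerom Mp) (fun y => s ^+ k *: homf e y).
  have ez : homf e z = 0 by rewrite eE pgz.
  have ec y : homf e (d _ y) = 0.
    rewrite eE fc; have /in_zerom -> := gc y.
    by rewrite linear0 subr0 scaler0.
  by apply: hk => [y|]; apply/in_zerom; [exact: ec|exact: ez].
apply: cobd_eq hc => y; rewrite eE scalerA.
apply/eqP; rewrite -subr_eq0 -scalerBl; apply/eqP; apply: pM_kills.
apply/in_kerI; rewrite rmorphB rmorphM rmorphXn !lamK mulrC subrr //.
Qed.

End Value.
End CongruenceModule.
(** * Finitely generated modules over a discrete valuation ring *)

Lemma idgen_idl (R : comNzRingType) (s : seq R) : idgen s =i idl s.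
Proof.
move=> a; apply/idP/idP.
  by apply: (@genby_sle R R^o) => x; exact: mem_idl.
by apply: idl_min => x hx; apply: in_genby.
Qed.

Lemma in_idl1 (R : comNzRingType) (w a : R) : a \in idl [:: w] <-> exists e, a = e * w.
Proof.
rewrite in_idl; split=> [[r]|[e ->]].
  by rewrite big_ord1 => ->; exists (r 0%N).
by exists (fun=> e); rewrite big_ord1.
Qed.

Section Lincomb.
Variables (R : comNzRingType) (V : lmodType R).

Lemma lincombM n q (v : 'I_q -> V) (B : 'M[R]_(n, q)) a :
  lincomb (fun i => lincomb v (row i B)) a = lincomb v (a *m B).
Proof.
rewrite /lincomb; under eq_bigr do rewrite scaler_sumr.
rewrite exchange_big /=; apply: eq_bigr => j _.
by rewrite mxE scaler_suml; apply: eq_bigr => i _; rewrite mxE scalerA.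
Qed.

End Lincomb.

Section DVR.
Variables (O : idomainType) (w : O).
Hypotheses (hO : dvr O) (hw : uniformizer w).

Lemma dvr_noetherian : noetherian O.
Proof. by move=> I; have [x hx] := hO.1 I; exists [:: x]. Qed.

Lemma dvr_loc_ring : loc_ring (idl [:: w]) /\ w != 0.
Proof.
have [m hm mw] := hw; have [_ [m1 hm1 [x x0 xm]]] := hO.
have mE : m = idl [:: w] by apply: subm_ext => a; rewrite mw idgen_idl.
rewrite -mE; split; first exact: local_loc_ring dvr_noetherian hm.
apply/eqP => w0; move: xm; rewrite ((hm.2 _ hm1.1) x) mw idgen_idl => /in_idl1[e].
by rewrite w0 mulr0 => /eqP; rewrite (negPf x0).
Qed.

Let hloc : loc_ring (idl [:: w]) := dvr_loc_ring.1.
Let w0 : w != 0 := dvr_loc_ring.2.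

Lemma dvr_unit a : a \is a GRing.unit \/ exists e, a = e * w.
Proof.
have [/in_idl1|/hloc.2[b hb]] := boolP (a \in idl [:: w]); first by right.
by left; apply/unitrPr; exists b.
Qed.

Lemma w_dvd_unit a e : a \is a GRing.unit -> a <> e * w.
Proof.
move=> ua ae; case: hloc => /negP h _; apply: h; apply/in_idl1.
by exists (a^-1 * e); rewrite -mulrA -ae mulVr.
Qed.

Lemma dvr_val a : a != 0 -> exists k u, u \is a GRing.unit /\ a = u * w ^+ k.
Proof.
move=> a0; have hex : exists k, ~ exists e, a = e * w ^+ k.+1.
  apply: contrapT => h; case/negP: a0; apply/eqP/(@in_zerom O O^o).
  apply: (krull_intersection hloc dvr_noetherian).
    exact/noetherian_noethm/dvr_noetherian.
  move=> k; apply: sle_addmr.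
  have [e ->] : exists e, a = e * w ^+ k.+1.
    by apply: contrapT => h'; apply: h; exists k.
  apply: ipow_decr; rewrite mulrC -[_ * e]/(w ^+ k.+1 *: (e : O^o)).
  by apply: mem_ipow; apply: mem_idl; rewrite mem_head.
have [k hk hmin] := ex_minnP (ex_intro (fun k => `[< ~ exists e, a = e * w ^+ k.+1 >])
  (sval (cid hex)) (asboolT (svalP (cid hex)))).
have [u au] : exists u, a = u * w ^+ k.
  case: k hk hmin => [|k] _ hmin; first by exists a; rewrite mulr1.
  apply: contrapT => h; have /hmin := asboolT h.
  by rewrite ltnn.
exists k, u; split=> //; have [//|[e ue]] := dvr_unit u.
by move/asboolP: hk; case; exists e; rewrite exprS mulrA -ue.
Qed.

Lemma w_exp_dvd u i k e : u \is a GRing.unit -> u * w ^+ i = e * w ^+ k -> (k <= i)%N.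
Proof.
move=> uu h; rewrite leqNgt; apply/negP => ik.
apply: (w_dvd_unit (e := e * w ^+ (k - i.+1)) uu).
apply: (mulIf (expf_neq0 i w0)); rewrite h -!mulrA; congr (_ * _).
by rewrite -exprS -exprD; congr (_ ^+ _); lia.
Qed.

Lemma unit_dvd u a k e : u \is a GRing.unit -> a * u = e * w ^+ k ->
  exists e', a = e' * w ^+ k.
Proof. by move=> uu h; exists (e * u^-1); rewrite mulrAC -h mulrK. Qed.

(** Any system of generators can be changed by an invertible matrix to one whose
    only relations are [w ^ k_i u_i = 0] for [i < r]: a relation having a
    coefficient of minimal valuation splits off a cyclic summand. *)
Lemma dvr_structure (V : lmodType O) n (v : 'I_n -> V) :
  exists (B : 'M[O]_n) (r : nat) (k : nat -> nat),
    [/\ B \in unitmx, (r <= n)%N &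
      forall a, lincomb (fun i => lincomb v (row i B)) a = 0 <->
        forall i : 'I_n, if (i < r)%N then exists e, a 0 i = e * w ^+ k i else a 0 i = 0].
Proof.
elim: n v => [|n IH] v.
  exists 1%:M, 0%N, (fun=> 0%N); split=> // [|a]; first exact: unitmx1.
  by rewrite /lincomb big_ord0; split=> // _ [].
have [h0|hrel] := pselect (forall a, lincomb v a = 0 -> a = 0).
  exists 1%:M, 0%N, (fun=> 0%N); split=> // [|a]; first exact: unitmx1.
  rewrite lincombM mulmx1; split=> [/h0 -> i|h]; first by rewrite mxE.
  have -> : a = 0 by apply/rowP => i; rewrite mxE; exact: h.
  exact: (linear0 (lincomb v : {linear _ -> _})).
pose P k := `[< exists a j u, [/\ lincomb v a = 0, u \is a GRing.unit &
  a 0 j = u * w ^+ k] >].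
have hex : exists k, P k.
  have [a ha] : exists a, ~ (lincomb v a = 0 -> a = 0).
    by apply: contrapT => h; apply: hrel => a; apply: contrapT => h'; apply: h; exists a.
  have [ra /eqP/matrix0Pn[i [j aj]]] : lincomb v a = 0 /\ a <> 0.
    by split; [apply: contrapT|] => h; apply: ha.
  rewrite ord1 in aj.
  by have [k [u [uu e]]] := dvr_val aj; exists k; apply/asboolP; exists a, j, u.
have [k /asboolP[rho [j0 [u [rr uu e0]]]] hmin] := ex_minnP hex.
have hdiv a j : lincomb v a = 0 -> exists e, a 0 j = e * w ^+ k.
  move=> ra; have [aj|aj] := eqVneq (a 0 j) 0; first by exists 0; rewrite aj mul0r.
  have [k' [u' [uu' e']]] := dvr_val aj.
  have /hmin kk' : P k' by apply/asboolP; exists a, j, u'.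
  by exists (u' * w ^+ (k' - k)); rewrite e' -mulrA -exprD subnK.
have [q hq] : exists q : 'I_n.+1 -> O, forall j, rho 0 j = q j * w ^+ k.
  by exists (fun j => sval (cid (hdiv rho j rr))) => j; exact: (svalP (cid (hdiv rho j rr))).
pose q' := \row_j q j.
have rhoE : rho = w ^+ k *: q' by apply/rowP => j; rewrite !mxE hq mulrC.
have uq : q j0 \is a GRing.unit.
  suff -> : q j0 = u by [].
  by apply: (mulIf (expf_neq0 k w0)); rewrite -hq.
have [B' [r [k' [uB' rn hB']]]] := IH (v \o lift j0).
pose E : 'M[O]_(1 + n, n.+1) := col_mx q' (\matrix_(i, j) (lift j0 i == j)%:R).
have E0 j : E (lshift n ord0) j = q j by rewrite /E col_mxEu mxE.
have ES i j : E (rshift 1 i) j = (lift j0 i == j)%:R by rewrite /E col_mxEd mxE.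
have uE : (E : 'M_n.+1) \in unitmx.
  rewrite unitmxE (expand_det_col _ j0) (bigD1 ord0) //= big1 ?addr0 => [|i].
    have -> : (ord0 : 'I_(1 + n)) = lshift n ord0 by apply: val_inj.
    rewrite E0 unitrMr // /cofactor.
    have -> : row' (lshift n ord0) (col' j0 E) = 1%:M.
      apply/matrixP => i j; rewrite mxE mxE.
      have -> : lift (lshift n ord0) i = rshift 1 i by apply: val_inj.
      by rewrite ES (inj_eq lift_inj) mxE.
    by rewrite det1 mulr1 unitrX // unitrN1.
  case: (unliftP ord0 i) => [j ->|->] // _.
  have -> : lift ord0 j = rshift 1 j by apply: val_inj.
  by rewrite ES eq_sym (negPf (neq_lift j0 j)) mul0r.
pose D : 'M[O]_(1 + n) := block_mx 1%:M 0 0 B'.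
have uD : D \in unitmx by rewrite unitmxE det_lblock det1 mul1r -unitmxE.
exists (D *m E : 'M_n.+1), r.+1, (fun i => if i is i'.+1 then k' i' else k).
split=> // [|a]; first by rewrite unitmx_mul; apply/andP; split.
rewrite lincombM mulmxA.
pose a0 := a 0 ord0; pose a' : 'rV[O]_n := \row_i a 0 (lift ord0 i).
have aE : a = row_mx a0%:M a' :> 'rV[O]_(1 + n).
  apply/rowP => i; case: (unliftP ord0 i) => [j ->|->].
    have -> : lift ord0 j = rshift 1 j by apply: val_inj.
    by rewrite row_mxEr mxE; congr (a 0 _); apply: val_inj.
  have -> : (ord0 : 'I_(1 + n)) = lshift n ord0 by apply: val_inj.
  by rewrite row_mxEl mxE eqxx mulr1n; congr (a 0 _); apply: val_inj.
have -> : a *m D *m E = a0 *: q' + (a' *m B') *m \matrix_(i, j) (lift j0 i == j)%:R.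
  have hD : row_mx a0%:M a' *m D = row_mx a0%:M (a' *m B').
    by rewrite /D mul_row_block !mulmx0 mulmx1 addr0 add0r.
  have hE : row_mx a0%:M (a' *m B') *m E =
      a0 *: q' + (a' *m B') *m \matrix_(i, j) (lift j0 i == j)%:R.
    by rewrite /E mul_row_col mul_scalar_mx.
  by rewrite -hE -hD -aE.
rewrite linearD linearZ /=.
have hs : lincomb v (a' *m B' *m \matrix_(i, j) (lift j0 i == j)%:R) =
    lincomb (v \o lift j0) (a' *m B').
  rewrite -lincombM; congr (lincomb _ _); apply/funext => i /=.
  rewrite /lincomb (bigD1 (lift j0 i)) //= big1 ?addr0 => [|j ji].
    by rewrite !mxE eqxx scale1r.
  by rewrite !mxE eq_sym (negPf ji) scale0r.
rewrite hs; have q0 : w ^+ k *: lincomb v q' = 0 by rewrite -linearZ -rhoE.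
have hB2 := hB' a'; rewrite lincombM in hB2.
split=> [h i|h].
  have [e he] : exists e, a0 = e * w ^+ k.
    have [|e] := hdiv (a0 *: q' + a' *m B' *m \matrix_(i, j) (lift j0 i == j)%:R) j0.
      by rewrite linearD linearZ /= hs.
    rewrite !mxE big1 ?addr0 => [|l _]; last first.
      by rewrite [X in _ * X]mxE eq_sym (negPf (neq_lift j0 l)) mulr0.
    exact: unit_dvd.
  move: h; rewrite he -scalerA q0 scaler0 add0r => /hB2 h.
  have [i' ->|->] := unliftP ord0 i; last by exists e.
  by have := h i'; rewrite /a' mxE ltnS.
have [e he] := h ord0; rewrite -/a0 in he.
rewrite he -scalerA q0 scaler0 add0r; apply/hB2 => i.
by have := h (lift ord0 i); rewrite /a' mxE ltnS.
Qed.

Section Cyclic.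
Variable V : lmodType O.

Lemma rlen_cyclic (N : submodClosed V) (u : V) k : w ^+ k *: u \in N ->
  (forall a, a *: u \in N -> exists e, a = e * w ^+ k) -> rlen N (addv N u) k.
Proof.
move=> hk hN.
have st i : (i <= k)%N -> rlen N (addv N (w ^+ (k - i) *: u)) i.
  elim: i => [|i IH] ik.
    suff -> : addv N (w ^+ (k - 0) *: u) = N by exact: rlen_refl.
    apply: subm_ext; last exact: sle_addv.
    by apply: addv_min; [exact: sle_refl|rewrite subn0].
  have e : (k - i = (k - i.+1).+1)%N by lia.
  have -> : addv N (w ^+ (k - i.+1) *: u) =
      addv (addv N (w ^+ (k - i) *: u)) (w ^+ (k - i.+1) *: u).
    apply: subm_ext; first exact: addv_mono (@sle_addv _ _ _ _).
    apply: addv_min; last exact: mem_addv.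
    apply: addv_min; first exact: sle_addv.
    by rewrite e exprS -scalerA rpredZ // mem_addv.
  rewrite -[X in rlen _ _ X]addn1; apply: (rlen_add _ _ (IH (ltnW ik))); try exact: sle_addv.
  apply: (rlen_simple hloc) => [a /in_idl1[b ->]|].
    by rewrite scalerA -mulrA -exprS -e -scalerA rpredZ // mem_addv.
  apply/negP => /in_addv[b]; rewrite scalerA -scalerBl => /hN[c].
  rewrite e exprS mulrA => h.
  have h1 : (1 - b * w) * w ^+ (k - i.+1) = c * w ^+ k by rewrite mulrBl mul1r.
  have [ub|[d hd]] := dvr_unit (1 - b * w).
    by have := w_exp_dvd ub h1; lia.
  apply: (@w_dvd_unit 1 (d + b)); first exact: unitr1.
  by rewrite mulrDl -hd subrK.
by have := st k (leqnn k); rewrite subnn expr0 scale1r.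
Qed.

Lemma rlen_cyclics (N : submodClosed V) (u : nat -> V) (k : nat -> nat) r :
  (forall i, (i < r)%N -> w ^+ k i *: u i \in addvs N (mkseq u i) /\
    forall a, a *: u i \in addvs N (mkseq u i) -> exists e, a = e * w ^+ k i) ->
  rlen N (addvs N (mkseq u r)) (\sum_(i < r) k i).
Proof.
elim: r => [|r IH] h; first by rewrite big_ord0; exact: rlen_refl.
have -> : mkseq u r.+1 = mkseq u r ++ [:: u r].
  by rewrite /mkseq -addn1 iotaD map_cat.
rewrite big_ord_recr addvs_cat /=.
apply: (rlen_add (@sle_addvs _ _ _ _) (@sle_addv _ _ _ _)).
  by apply: IH => i ir; apply: h; lia.
by have [h1 h2] := h r (ltnSn r); exact: rlen_cyclic.
Qed.
End Cyclic.
End DVR.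

Lemma det_factor_leq (R : idomainType) n q (A : 'M[R]_(n, q)) (B : 'M[R]_(q, n)) :
  \det (A *m B) != 0 -> (n <= q)%N.
Proof.
move=> d0; pose f := @tofrac R.
have <- : \rank (map_mx f A *m map_mx f B) = n.
  by rewrite -map_mxM; apply: mxrank_unit; rewrite unitmxE det_map_mx unitfE tofrac_eq0.
exact: mulmx_max_rank.
Qed.

Lemma subm_len (R : comNzRingType) (V : lmodType R) (N : submodClosed V) n :
  rlen (zerom V) N n -> length (subm N) = n.
Proof.
pose f := @submval R V N : {linear subm N -> V}.
move=> h; apply: lengthP.
have := (rlen_pre (f := f) n (@zerom_sle _ _ N) _).1 _.
have -> : pre f (zerom V) = zerom (subm N).
  apply: subm_ext; last exact: zerom_sle.
  by move=> x /in_pre/in_zerom e; apply/in_zerom; apply: val_inj.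
have -> : pre f N = topm (subm N).
  by apply: subm_ext => x _; [exact/in_topm|apply/in_pre; exact: (valP x)].
by apply=> // x hx; exists (Subm hx); rewrite subrr rpred0.
Qed.
(** * Linear algebra up to denominators *)

Section RegularSequenceForms.
Variables (R : comNzRingType) (V : lmodType R).
Implicit Types (N : submodClosed V).

Lemma rseqP N q : rseq N q <->
  forall i, (i < size q)%N -> nzd (addseq N (take i q)) q`_i.
Proof.
elim: q N => [|a q IH] N //=; split=> [[na /IH h] [|i] //|h].
  by move=> iq; exact: h.
split; first exact: (h 0%N).
by apply/IH => i iq; exact: (h i.+1).
Qed.

Lemma imul_idgen (s : seq R) : imul (idgen s) (topm V) = addseq (zerom V) s.
Proof.
apply: subm_ext.
  apply: imul_min => a v; rewrite idgen_idl => ha _.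
  have : a \in annv (addseq (zerom V) s) v.
    by apply: idl_min ha => b hb; apply/in_annv; exact: mem_addseq.
  by move/in_annv.
apply: addseq_min; first exact: zerom_sle.
move=> a v ha; apply: mem_imul; last exact/in_topm.
by rewrite idgen_idl; exact: mem_idl.
Qed.

Lemma regular_seqE s : regular_seq V s <->
  rseq (zerom V) s /\ exists v, v \notin addseq (zerom V) s.
Proof.
rewrite /regular_seq imul_idgen rseqP.
by split=> -[h1 h2]; split=> // i hi v; have := h1 i hi v; rewrite imul_idgen.
Qed.

Lemma depth_ge_dep m l : depth_ge m V l -> dep m (zerom V) l.
Proof.
move=> [s [ls sm /regular_seqE[hs _]]]; exists (take l s); split.
- by rewrite size_take; case: ltnP => //; lia.
- by move=> a /mem_take; exact: sm.
- by move: hs; rewrite -{1}(cat_take_drop l s) => /rseq_cat[].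
Qed.
End RegularSequenceForms.

Section DeterminantTrick.
Variables (R : comNzRingType) (V : lmodType R) (N : submodClosed V).

Lemma det_kills n (H : 'M[R]_n) (v : 'I_n -> V) :
  (forall i, lincomb v (row i H) \in N) -> forall j, \det H *: v j \in N.
Proof.
move=> h j.
have -> : \det H *: v j = lincomb (fun i => lincomb v (row i H)) (row j (\adj H)).
  rewrite lincombM -row_mul mul_adj_mx /lincomb (bigD1 j) //= big1 ?addr0 => [|i ij].
    by rewrite !mxE eqxx mulr1n.
  by rewrite !mxE eq_sym (negPf ij) mulr0n scale0r.
by apply: rpred_sum => i _; apply: rpredZ; exact: h.
Qed.

Lemma imul_lincomb (I : ideal R) (K : submodClosed V) n (g : 'I_n -> V) :
  (forall v, v \in K -> exists a, v - lincomb g a \in N) ->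
  forall y, y \in imul I K -> exists2 q, q \in vecI I n & y - lincomb g q \in N.
Proof.
move=> hg y hy.
have : y \in @img R _ V (lincomb g : {linear 'rV[R]_n -> V}) N (vecI I n).
  apply: imul_min hy => a v ha /hg[b hb]; apply/in_img; exists (a *: b).
    by apply/in_vecI => k; rewrite mxE; exact: ideal_mulr.
  by rewrite linearZ -scalerBr rpredZ.
by move/in_img => -[q hq h]; exists q.
Qed.
End DeterminantTrick.

Section PrimeDenominators.
Variables (R : comNzRingType) (p : ideal R).
Hypotheses (hR : noetherian R) (pp : primeI p).

Lemma notin_prod s t : s \notin p -> t \notin p -> s * t \notin p.
Proof. by move=> /negP hs /negP ht; apply/negP => /pp.2[]. Qed.

Lemma fin_gens (V : lmodType R) (K : submodClosed V) : noethm V ->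
  exists n (g : 'I_n -> V), (forall i, g i \in K) /\
    forall v, v \in K -> exists a, v = lincomb g a.
Proof.
move=> hV; have [s [sK Ks]] := hV K; exists (size s), (fun i => s`_i).
split=> [i|v /Ks]; first by apply: sK; exact: mem_nth.
rewrite in_addvs => -[a /in_zerom/eqP]; rewrite subr_eq0 => /eqP ->.
by exists (\row_i a i); apply: eq_bigr => i _; rewrite mxE.
Qed.

(** Nakayama's lemma at the prime [p], with an explicit denominator. *)
Lemma s_nakayama (V : lmodType R) (K N : submodClosed V) s : noethm V -> s \notin p ->
  (forall v, v \in K -> s *: v \in addm N (imul p K)) ->
  exists2 s', s' \notin p & forall v, v \in K -> s' *: v \in N.
Proof.
move=> hV sp h; have [n [g [gK hg]]] := fin_gens K hV.
have hq i : {q | q \in vecI p n & s *: g i - lincomb g q \in N}.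
  apply: cid2; have /in_addm[y hy hy'] := h _ (gK i).
  have [q qp /in_zerom/eqP] : exists2 q, q \in vecI p n & s *: g i - y - lincomb g q \in zerom V.
    apply: (imul_lincomb (K := K)) => // v /hg[a ->]; exists a.
    by rewrite subrr rpred0.
  rewrite subr_eq0 => /eqP e; exists q => //.
  by rewrite -e opprB addrC subrK.
pose Q : 'M[R]_n := \matrix_(i, j) (s2val (hq i)) 0 j.
exists (\det (s%:M - Q)).
  have : \det (s%:M - Q) - \det (s%:M : 'M_n) \in p.
    apply: det_eqmod => i j; rewrite !mxE addrAC subrr add0r.
    by apply/(@subm_opp R R^o); exact: ((in_vecI _ _).1 (s2valP (hq i))).
  move/ideal_eqmod => ->; rewrite det_scalar.
  by apply/negP => /(primeI_exp pp); exact/negP.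
move=> v /hg[a ->]; rewrite -linearZ /lincomb /=; apply: rpred_sum => i _.
rewrite mxE mulrC -scalerA rpredZ //; apply: det_kills => j.
have -> : row j (s%:M - Q) = s *: delta_mx 0 j - s2val (hq j).
  by apply/rowP => k; rewrite !mxE eqxx /= eq_sym mulr_natr.
by rewrite linearB linearZ /= lincomb_delta; exact: (s2valP' (hq j)).
Qed.

(** [indep_lift] up to denominators outside of [p]. *)
Lemma s_indep_lift (V : lmodType R) mu (n : 'I_mu -> V) xs (I0 : ideal R)
    (N0 : submodClosed V) s :
  {subset xs <= p} -> (forall a v, a \in I0 -> a *: v \in N0) -> rseq N0 xs ->
  s \notin p ->
  (forall a, lincomb n a \in addseq N0 xs -> s *: a \in vecI (@addseq R R^o I0 xs) mu) ->
  exists2 s', s' \notin p & forall a, lincomb n a \in N0 -> s' *: a \in vecI I0 mu.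
Proof.
elim: xs I0 N0 => [|x xs IH] I0 N0 hxs hI /=; first by move=> _ sp h; exists s.
move=> [nx hr] sp htop.
have hI' a v : a \in @adds R R^o I0 x -> a *: v \in adds N0 x.
  move=> /(@in_adds R R^o)[r hr']; rewrite -(subrK (x * r) a) scalerDl.
  apply: rpredD; last by rewrite -scalerA; exact: mem_adds.
  by apply: sle_adds; exact: hI.
have [s1 s1p h1] := IH _ _ (fun y hy => hxs y (mem_behead (s := x :: xs) hy)) hI' hr sp htop.
have [|s' s'p hs'] := @s_nakayama _ (pre (lincomb n : {linear 'rV_mu -> V}) N0)
  (vecI I0 mu) s1 (@rV_noethm R mu hR) s1p; last first.
  by exists s' => // a ha; apply: hs'; apply/in_pre.
move=> a /in_pre ha.
have /h1/in_vecI ha' : lincomb n a \in adds N0 x by exact: sle_adds.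
have [r hr'] : exists r : 'I_mu -> R, forall k, (s1 *: a) 0 k - x * r k \in I0.
  have h k : {r : R | (s1 *: a) 0 k - x * r \in I0}.
    by apply: cid; have /(@in_adds R R^o)[r hr'] := ha' k; exists r.
  by exists (fun k => sval (h k)) => k; exact: (svalP (h k)).
have e : s1 *: a - x *: (\row_k r k) \in vecI I0 mu.
  by apply/in_vecI => k; have := hr' k; rewrite !mxE.
apply/in_addm; exists (s1 *: a - x *: (\row_k r k)) => //; rewrite subKr.
apply: mem_imul; first by apply: hxs; exact: mem_head.
apply/in_pre; apply: nx; rewrite -linearZ /=.
rewrite -(@subm_eqmod _ _ N0 (lincomb n (s1 *: a))); first by rewrite linearZ rpredZ.
rewrite -linearB /=.
by apply: rpred_sum => k _; apply: hI; exact: ((in_vecI _ _).1 e).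
Qed.
End PrimeDenominators.

Lemma inj_surj_bij (T U : Type) (f : T -> U) : injective f ->
  (forall y, exists x, f x = y) -> bijective f.
Proof.
move=> fi fs; have ch y : {x | f x = y} by apply: cid; exact: fs.
exists (fun y => sval (ch y)) => [x|y]; last exact: (svalP (ch y)).
by apply: fi; rewrite (svalP (ch (f x))).
Qed.

Section Rank.
Variable R : comNzRingType.

Lemma isom_sym (V W : lmodType R) : isom V W -> isom W V.
Proof.
move=> [f [g fg gf]]; have lg : linear g.
  by move=> a u v; apply: (can_inj fg); rewrite gf linearP !gf.
pose L := GRing.isLinear.Build R W V _ g lg.
by exists (HB.pack_for {linear W -> V} g L); exists f.
Qed.

Lemma isom_trans (U V W : lmodType R) : isom U V -> isom V W -> isom U W.
Proof. by move=> [f bf] [g bg]; exists (g \o f); exact: bij_comp. Qed.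

Lemma unit_factor_leq n q (A : 'M[R]_(n, q)) (B : 'M[R]_(q, n)) :
  A *m B = 1%:M -> (n <= q)%N.
Proof.
move=> h; rewrite leqNgt; apply/negP => qn.
have [k nk] : exists k, (n = q + k.+1)%N by exists (n - q).-1; lia.
move: A B h; rewrite {qn}nk => A B h.
pose A' : 'M_(q + k.+1) := row_mx A 0; pose B' : 'M_(q + k.+1) := col_mx B 0.
have AB : A' *m B' = 1%:M by rewrite /A' /B' mul_row_col mul0mx addr0.
have dA : \det A' = 0.
  rewrite (expand_det_col _ (rshift q ord0)) big1 // => i _.
  by rewrite /A' row_mxEr mxE mul0r.
have := congr1 determinant AB; rewrite det_mulmx dA mul0r det1 => /eqP.
by rewrite eq_sym oner_eq0.
Qed.

Lemma isom_rV_leq a b : isom 'rV[R]_a 'rV[R]_b -> (a <= b)%N.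
Proof.
move=> [f [g fg gf]]; have lg : linear g.
  by move=> r u v; apply: (can_inj fg); rewrite gf linearP !gf.
pose L := GRing.isLinear.Build R _ _ _ g lg.
pose g' := HB.pack_for {linear 'rV[R]_b -> 'rV[R]_a} g L.
apply: (@unit_factor_leq _ _ (lin1_mx f) (lin1_mx g')).
by apply/row_matrixP => i; rewrite !rowE mulmxA !mul_rV_lin1 /= fg mulmx1.
Qed.

Lemma rank_eq (V : lmodType R) n : isom V 'rV[R]_n -> rank V = n.
Proof.
move=> h; have hx : isom V 'rV[R]_(rank V).
  by rewrite /rank; case: xgetP => [k -> //|/(_ n)].
have h1 := isom_trans (isom_sym h) hx.
by apply/eqP; rewrite eqn_leq !isom_rV_leq //; exact: isom_sym.
Qed.
End Rank.

Section LocalizedBasis.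
Variables (R : comNzRingType) (p : prime_idealr R) (M : lmodType R).

Lemma frac0 t : Defs.frac (0 : M) t = 0 :> loc p M.
Proof. by apply/frac_eq; exists (den1 p); rewrite !scaler0. Qed.

Lemma fracD (m1 m2 : M) t : Defs.frac (m1 + m2) t = Defs.frac m1 t + Defs.frac m2 t :> loc p M.
Proof. by rewrite frac_add -scalerDr frac_cancel. Qed.

Lemma frac_lincomb mu (n : 'I_mu -> M) (b : 'rV[R]_mu) (a : 'rV[locR p]_mu) t :
  (forall j, a 0 j = Defs.frac (b 0 j : R^o) t) ->
  lincomb (fun j => Defs.frac (n j) (den1 p) : loc p M) a = Defs.frac (lincomb n b) t.
Proof.
move=> h; rewrite /lincomb (big_morph _ (fun x y => fracD x y t) (frac0 t)).
apply: eq_bigr => j _; rewrite h.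
have e : (Defs.frac (b 0 j : R^o) t : locR p) *: (Defs.frac (n j) (den1 p) : loc p M) =
  Defs.frac (b 0 j *: n j) (denM t (den1 p)) := loc_scaleE _ _ _ _.
by rewrite e denMC den1M.
Qed.

Lemma common_den mu (a : 'rV[locR p]_mu) : exists (b : 'rV[R]_mu) t,
  forall j, a 0 j = Defs.frac (b 0 j : R^o) t.
Proof.
have ch j : {xt : R * den p | a 0 j = Defs.frac (xt.1 : R^o) xt.2}.
  by apply: cid; have [x [t e]] := frac_surj (a 0 j); exists (x, t).
pose x j := (sval (ch j)).1; pose t j := (sval (ch j)).2.
have hp (P : pred 'I_mu) : \prod_(j | P j) (t j : R) \notin p.
  by elim/big_ind: _ => [|u v hu hv|j _]; [exact: (valP (den1 p))|
    exact: (valP (denM (Den hu) (Den hv)))|exact: (valP (t j))].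
exists (\row_j (x j * \prod_(i | i != j) (t i : R))), (Den (hp predT)) => j.
rewrite (svalP (ch j)) -/(x j) -/(t j) -(frac_cancel _ _ (Den (hp (fun i => i != j)))) /=.
congr Defs.frac; first by rewrite mxE mulrC.
by apply: val_inj; rewrite /= [RHS](bigD1 j) //= mulrC.
Qed.

Lemma frac_eq0 (v : M) t : Defs.frac v t = 0 :> loc p M <->
  exists2 s : R, s \notin p & s *: v = 0.
Proof.
split=> [/frac_eq[u]|[s sp h]].
  by rewrite scaler0 scaler0 scale1r => h; exists (u : R) => //; exact: (valP u).
by apply/frac_eq; exists (Den sp); rewrite scaler0 scaler0 scale1r.
Qed.

Lemma loc_basis mu (n : 'I_mu -> M) s s' : s \notin p -> s' \notin p ->
  (forall v, exists b, s *: v = lincomb n b) ->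
  (forall b, lincomb n b = 0 -> s' *: b = 0) -> isom (loc p M) 'rV[locR p]_mu.
Proof.
move=> sp s'p gen ind; apply: isom_sym.
pose g : {linear 'rV[locR p]_mu -> loc p M} :=
  lincomb (fun j => Defs.frac (n j) (den1 p) : loc p M).
have gE (b : 'rV[R]_mu) (a : 'rV[locR p]_mu) t : (forall j, a 0 j = Defs.frac (b 0 j : R^o) t) ->
    g a = Defs.frac (lincomb n b) t by exact: frac_lincomb.
exists g.
apply: inj_surj_bij => [|x].
  suff h a : g a = 0 -> a = 0.
    move=> a b e; apply/eqP; rewrite -subr_eq0; apply/eqP/h.
    by rewrite linearB e subrr.
  have [b [t e]] := common_den a; rewrite (gE _ _ _ e).
  move=> /frac_eq0[u up]; rewrite -linearZ => /ind h.
  apply/rowP => j; rewrite e mxE; apply/frac_eq.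
  have hs : s' * u \notin p by rewrite prime_idealrM negb_or s'p.
  exists (Den hs); rewrite scaler0 scaler0 scale1r.
  by have /rowP/(_ j) := h; rewrite !mxE mulrA.
have [v [t ->]] := frac_surj x; have [b hb] := gen v.
exists (\row_j (Defs.frac (b 0 j : R^o) (denM (Den sp) t) : locR p)).
rewrite (gE b _ (denM (Den sp) t)); last by move=> j; rewrite mxE.
by rewrite -hb; exact: (frac_cancel v t (Den sp)).
Qed.
End LocalizedBasis.
(** * The cotangent module at the augmentation *)

Section DVRBases.
Variables (O : idomainType) (w : O).
Hypotheses (hO : dvr O) (hw : uniformizer w).
Variable V : lmodType O.

Let w0 : w != 0 := (dvr_loc_ring hO hw).2.

Section Torsion.
Variables (n r : nat) (u : 'I_n -> V) (k : nat -> nat).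
Hypotheses (rn : (r <= n)%N)
  (hu : forall a, lincomb u a = 0 <->
     forall i : 'I_n, if (i < r)%N then exists e, a 0 i = e * w ^+ k i else a 0 i = 0)
  (gen : forall x, exists a, x = lincomb u a).

Lemma lincomb_tors a : lincomb u a \in tors V <->
  forall i : 'I_n, (r <= i)%N -> a 0 i = 0.
Proof.
split=> [/inmk[s s0]|h].
  rewrite -linearZ => /hu h i ri; have := h i; rewrite ltnNge ri mxE /=.
  by move/eqP; rewrite mulf_eq0 (negPf s0) => /eqP.
apply/inmk; exists (\prod_(i < n) w ^+ k i).
  by apply/prodf_neq0 => i _; rewrite expf_neq0.
rewrite -linearZ; apply/hu => i; case: ltnP => ri; last by rewrite mxE h ?mulr0.
by rewrite mxE (bigD1 i) //=; exists (\prod_(j < n | j != i) w ^+ k j * a 0 i); ring.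
Qed.

Lemma tors_bound x : x \in tors V -> (\prod_(i < n) w ^+ k i) *: x = 0.
Proof.
have [a ->] := gen x => /lincomb_tors h; rewrite -linearZ; apply/hu => i.
case: ltnP => ri; last by rewrite mxE h ?mulr0.
by rewrite mxE (bigD1 i) //=; exists (\prod_(j < n | j != i) w ^+ k j * a 0 i); ring.
Qed.

Let u' j : V := if insub j is Some i then u i else 0.

Let uE (i : 'I_n) : u' i = u i.
Proof. by rewrite /u' valK. Qed.

Let in_span i x : (i <= n)%N -> x \in addvs (zerom V) (mkseq u' i) <->
  exists2 a, x = lincomb u a & forall j : 'I_n, (i <= j)%N -> a 0 j = 0.
Proof.
move=> lin; rewrite in_addvs size_mkseq.
have sumE (c : nat -> O) : \sum_(j < i) c j *: (mkseq u' i)`_j =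
    lincomb u (\row_j if (j < i)%N then c j else 0).
  rewrite (eq_bigr (fun j : 'I_i => c j *: u' j)) => [|j _]; last by rewrite nth_mkseq.
  rewrite (big_ord_widen n (fun j => c j *: u' j) lin) big_mkcond.
  by apply: eq_bigr => j _; rewrite mxE uE; case: ifP => // _; rewrite scale0r.
split=> [[c /in_zerom/eqP]|[a -> ha]].
  rewrite subr_eq0 sumE => /eqP ->.
  by exists (\row_j (if (j < i)%N then c j else 0)) => // j; rewrite mxE ltnNge => ->.
pose cc j := if insub j is Some l then a 0 (l : 'I_n) else 0; exists cc; apply/in_zerom.
rewrite (sumE cc) -linearB; apply/hu => j; rewrite !mxE /cc valK.
have -> : a 0 j - (if (j < i)%N then a 0 j else 0) = 0.
  by case: ltnP => [_|/ha ->]; rewrite subrr.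
by case: ifP => // _; exists 0; rewrite mul0r.
Qed.

Lemma rlen_tors : rlen (zerom V) (tors V) (\sum_(i < r) k i).
Proof.
have -> : tors V = addvs (zerom V) (mkseq u' r).
  apply: subm_ext => x.
    by have [a ->] := gen x => /lincomb_tors h; apply/in_span => //; exists a.
  by move=> /(in_span _ rn)[a -> ha]; apply/lincomb_tors.
apply: (rlen_cyclics hO hw) => i ir.
have lin : (i < n)%N by exact: leq_trans ir rn.
have hi : u' i = lincomb u (delta_mx 0 (Ordinal lin)).
  by rewrite lincomb_delta -uE.
split.
  suff -> : w ^+ k i *: u' i = 0 by exact: rpred0.
  rewrite hi -linearZ; apply/hu => j; rewrite !mxE eqxx /=.
  have [->|_] := eqVneq j (Ordinal lin); first by rewrite ir; exists 1; rewrite mulr1 mul1r.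
  by rewrite mulr0; case: ifP => // _; exists 0; rewrite mul0r.
move=> a /(in_span _ (ltnW lin))[b /eqP e hb]; move: e.
rewrite hi -linearZ -subr_eq0 -linearB => /eqP/hu/(_ (Ordinal lin)) /=.
by rewrite ir !mxE !eqxx mulr1 hb //= subr0.
Qed.
End Torsion.

Lemma rlen_basis mu (n : 'I_mu -> V) K :
  (forall x, exists a, x = lincomb n a) -> (forall a, lincomb n a = 0 -> a = 0) ->
  rlen (adds (zerom V) (w ^+ K)) (topm V) (mu * K).
Proof.
move=> gen ind; set N := adds _ _.
pose u' j : V := if insub j is Some i then n i else 0.
have uE (i : 'I_mu) : u' i = n i by rewrite /u' valK.
have in_span i x : (i <= mu)%N -> x \in addvs N (mkseq u' i) ->
    exists a, x = lincomb n a /\ forall j : 'I_mu, (i <= j)%N -> exists e, a 0 j = e * w ^+ K.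
  move=> lin /in_addvs[c]; rewrite size_mkseq => /in_adds[v /in_zerom/eqP].
  have [b ->] := gen v; rewrite subr_eq0 subr_eq -linearZ => /eqP ->.
  rewrite (eq_bigr (fun j : 'I_i => c j *: u' j)) => [|j _]; last by rewrite nth_mkseq.
  rewrite (big_ord_widen mu (fun j => c j *: u' j) lin) big_mkcond.
  exists (w ^+ K *: b + \row_j (if (j < i)%N then c j else 0)); split.
    rewrite linearD /=; congr (_ + _); apply: eq_bigr => j _.
    by rewrite mxE uE; case: ifP => // _; rewrite scale0r.
  by move=> j; rewrite !mxE ltnNge => -> /=; exists (b 0 j); rewrite addr0 mulrC.
have -> : (mu * K = \sum_(i < mu) K)%N by rewrite sum_nat_const card_ord.
have -> : topm V = addvs N (mkseq u' mu).
  apply: subm_ext => x _; last exact/in_topm.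
  have [a ->] := gen x; rewrite /lincomb; apply: rpred_sum => j _; rewrite rpredZ //.
  by apply: mem_addvs; rewrite -uE; apply/mapP; exists (j : nat); rewrite // mem_iota /=.
apply: (rlen_cyclics hO hw) => i ir.
have hi : u' i = n (Ordinal ir) by rewrite -uE.
split; first by apply: sle_addvs; exact: mem_adds.
move=> a /(in_span _ _ (ltnW ir))[b []]; rewrite hi -(lincomb_delta n) -linearZ => /eqP.
rewrite -subr_eq0 -linearB => /eqP/ind/rowP/(_ (Ordinal ir)).
rewrite !mxE !eqxx mulr1 => /eqP; rewrite subr_eq0 => /eqP ->.
exact.
Qed.
End DVRBases.

Lemma in_imul_subm (R : comNzRingType) (V : lmodType R) (I : ideal R)
    (N : submodClosed V) (x : subm N) :
  x \in imul I (topm (subm N)) <-> submval x \in imul I N.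
Proof.
pose f := @submval R V N : {linear subm N -> V}; split=> h.
  suff : x \in pre f (imul I N) by move/in_pre.
  apply: imul_min h => a v ha _; apply/in_pre; rewrite linearZ.
  by apply: mem_imul => //; exact: (valP v).
have : submval x \in img f (zerom V) (imul I (topm (subm N))).
  apply: imul_min h => a v ha hv; apply/in_img.
  pose z : subm N := Subm hv; exists ((a : R) *: z).
    by apply: mem_imul => //; exact/in_topm.
  have -> : f ((a : R) *: z) = (a : R) *: v by [].
  by rewrite subrr rpred0.
move=> /in_img[u hu /in_zerom/eqP]; rewrite subr_eq0 => /eqP e.
by have -> : x = u by apply: val_inj.
Qed.

Section Cotangent.
Variables (O : idomainType) (w : O) (A : comAlgType O) (lam : {rmorphism A -> O}).
Hypotheses (hO : dvr O) (hw : uniformizer w) (lamK : forall x : O, lam x%:A = x).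
Local Notation p := (kerI lam).
Local Notation p2 := (imul p p).
Let w0 : w != 0 := (dvr_loc_ring hO hw).2.

Lemma kerI_prime : primeI p.
Proof.
split=> [|a b]; first by apply/negP => /in_kerI; rewrite rmorph1; apply/eqP/oner_neq0.
by move=> /in_kerI; rewrite rmorphM => /eqP; rewrite mulf_eq0 => /orP[] /eqP h;
  [left|right]; apply/in_kerI.
Qed.

Lemma notin_kerI a : a \notin p <-> lam a != 0.
Proof.
split=> [/negP h|/eqP h]; [apply/eqP => h'; apply: h; exact/in_kerI|].
by apply/negP => /in_kerI.
Qed.

Lemma kerI2_sub : sle p2 p.
Proof. by apply: imul_min => a v ha _; exact: ideal_mulr. Qed.

Lemma mem_kerI2 (a b : A) : a \in p -> b \in p -> a * b \in p2.
Proof. exact: mem_imul. Qed.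

(** The defining relations of the cotangent module [p / p^2] in the generators
    [y]: it is the sum of the [O / w ^ k_i] for [i < r] and a free module. *)
Definition cotangent n r (k : nat -> nat) (y : 'I_n -> A) :=
  [/\ (r <= n)%N, forall i, y i \in p,
      forall a, a \in p -> exists b, a = lincomb (y : 'I_n -> A^o) b &
      forall a, lincomb (y : 'I_n -> A^o) a \in p2 <->
        forall i : 'I_n, if (i < r)%N then exists e, lam (a 0 i) = e * w ^+ k i
                         else lam (a 0 i) = 0].

Lemma lincomb_p n (y : 'I_n -> A) b : (forall i, y i \in p) -> b \in vecI p n ->
  lincomb (y : 'I_n -> A^o) b \in p2.
Proof.
move=> yp /in_vecI hb; apply: rpred_sum => i _; exact: mem_kerI2.
Qed.

Lemma lincomb_lam n (y : 'I_n -> A) b : (forall i, y i \in p) ->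
  (lincomb (y : 'I_n -> A^o) b \in p2) =
  (lincomb (y : 'I_n -> A^o) (map_mx (in_alg A) (map_mx lam b)) \in p2).
Proof.
move=> yp; apply: subm_eqmod; rewrite -linearB; apply: lincomb_p => //.
by apply/in_vecI => i; rewrite !mxE; exact: kerI_sub_lam.
Qed.

Lemma cotangent_structure n (ys : 'I_n -> A) : (forall i, ys i \in p) ->
  (forall a, a \in p -> exists b, a = lincomb (ys : 'I_n -> A^o) b) ->
  exists (B : 'M[O]_n) r k, [/\ B \in unitmx,
    cotangent r k (fun i => lincomb (ys : 'I_n -> A^o) (row i (map_mx (in_alg A) B))) &
    length (Phi lam) = (\sum_(i < r) k i)%N].
Proof.
move=> yp gen.
pose Y i : subm p := Subm (yp i).
pose V := over_base (quotm (imul p (topm (subm p)))).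
pose v i : V := pim (imul p (topm (subm p))) (Y i).
have YE b : submval (lincomb Y b) = lincomb (ys : 'I_n -> A^o) b.
  by rewrite /lincomb linear_sum; apply: eq_bigr => i _; rewrite linearZ.
have vE (b : 'rV[O]_n) : lincomb v b =
    pim (imul p (topm (subm p))) (lincomb Y (map_mx (in_alg A) b)).
  rewrite /lincomb linear_sum; apply: eq_bigr => i _.
  by rewrite linearZ mxE.
have v0 (b : 'rV[O]_n) : lincomb v b = 0 <->
    lincomb (ys : 'I_n -> A^o) (map_mx (in_alg A) b) \in p2.
  by rewrite vE pim0 in_imul_subm YE.
have [B [r [k [uB rn hB]]]] := dvr_structure hO hw v.
have uB' : map_mx (in_alg A) (invmx B) *m map_mx (in_alg A) B = 1%:M.
  by rewrite -map_mxM mulVmx // map_mx1.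
exists B, r, k; set y := fun i => _; have yp' i : y i \in p.
  by apply: rpred_sum => j _; apply: ideal_mull; exact: yp.
split=> //.
  split=> //.
    move=> a /gen[b ->]; exists (b *m map_mx (in_alg A) (invmx B)).
    by rewrite lincombM -mulmxA uB' mulmx1.
  move=> a; rewrite lincomb_lam // lincombM -map_mxM -v0 -lincombM hB.
  by split=> h i; have := h i; rewrite mxE.
rewrite /Phi; apply: subm_len; apply: (rlen_tors hO hw rn hB) => x.
have [q ->] := pim_surj x; have [b eb] := gen _ (valP q).
exists (map_mx lam b *m invmx B); rewrite lincombM mulmxKV // vE.
apply/pim_eq/in_imul_subm; rewrite linearB /= YE {1}eb -linearB.
apply: lincomb_p => //.
by apply/in_vecI => i; rewrite !mxE; exact: kerI_sub_lam.
Qed.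
End Cotangent.

Section CotangentTheory.
Variables (O : idomainType) (w : O) (A : comAlgType O) (lam : {rmorphism A -> O}).
Hypotheses (hO : dvr O) (hw : uniformizer w) (lamK : forall x : O, lam x%:A = x).
Variable m : ideal A.
Hypotheses (hA : noetherian A) (hm : loc_ring m).
Local Notation p := (kerI lam).
Local Notation p2 := (imul p p).
Local Notation lc y := (lincomb (y : _ -> A^o)).
Let w0 : w != 0 := (dvr_loc_ring hO hw).2.
Let pp : primeI p := kerI_prime lam.

Lemma kerI_sub_max : sle p m.
Proof.
move=> a /in_kerI h; have [//|/hm.2[b hb]] := boolP (a \in m).
by move/eqP: (congr1 lam hb); rewrite rmorphM h mul0r rmorph1 eq_sym oner_eq0.
Qed.

Lemma lam_max b : b \in m -> exists e, lam b = e * w.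
Proof.
move=> bm; have [u|//] := dvr_unit hO hw (lam b).
case/negP: hm.1; have h := kerI_sub_max (kerI_sub_lam lamK (b * (lam b)^-1%:A)).
rewrite rmorphM lamK divrr // scale1r in h.
rewrite -(ideal_eqmod h); exact: ideal_mulr.
Qed.

Lemma kerI_dim1 a b : a \notin p -> b \in m -> exists j, b ^+ j \in @addv A A^o p a.
Proof.
move=> /notin_kerI a0 /lam_max[e be].
have [k [u [uu ek]]] := dvr_val hO hw a0; exists k.
apply/(@in_addv A A^o); exists ((e ^+ k * u^-1)%:A); apply/in_kerI.
rewrite rmorphB rmorphM !rmorphXn lamK be ek exprMn -mulrA mulKr //.
by rewrite subrr.
Qed.

Section Basis.
Variables (n r : nat) (k : nat -> nat) (y : 'I_n -> A).
Hypothesis hy : cotangent w lam r k y.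

Definition free_gens (y : 'I_n -> A) := [seq y i | i : 'I_n <- enum 'I_n & (r <= i)%N].

Lemma cotangent_mod (y' : 'I_n -> A) : (forall i, y' i - y i \in p2) ->
  cotangent w lam r k y'.
Proof.
have [rn yp gen rel] := hy => yy'.
have y'p i : y' i \in p by rewrite (ideal_eqmod (kerI2_sub (yy' i))).
have diff b : lc y' b - lc y b \in p2.
  rewrite /lincomb -sumrB; apply: rpred_sum => i _; rewrite -scalerBr rpredZ //.
split=> // [a ha|a]; last by rewrite (subm_eqmod (diff a)).
have hA' : noethm A^o by exact/noetherian_noethm.
have : sle p (imm (lc y' : {linear 'rV[A]_n -> A^o})).
  apply: (nakayama hm hA') => x hx; apply/in_addm.
  have [b ->] := gen x hx; exists (lc y' b); first by apply/inmk; exists b.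
  have h : lc y b - lc y' b \in p2 by rewrite -opprB subm_opp.
  by apply: imul_min h => c v hc hv; apply: mem_imul => //; exact: kerI_sub_max.
by move=> /(_ a ha)/inmk[b _ e]; exists b.
Qed.

Lemma mem_free_gens (i : 'I_n) : (r <= i)%N -> y i \in free_gens y.
Proof. by move=> ri; apply/mapP; exists i; rewrite // mem_filter ri mem_enum. Qed.

Lemma cotangent_rel : exists q : 'I_n -> 'rV[A]_n, forall i,
  q i \in vecI p n /\ ((i < r)%N -> (w ^+ k i)%:A * y i = lc y (q i)).
Proof.
have [rn yp gen rel] := hy.
have h (i : 'I_n) : {q | q \in vecI p n /\ ((i < r)%N -> (w ^+ k i)%:A * y i = lc y q)}.
  apply: cid; case: (ltnP i r) => ir; last first.
    by exists 0; split=> //; apply/in_vecI => j; rewrite mxE; exact: ideal0.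
  have hp2 : (w ^+ k i)%:A * y i \in p2.
    rewrite -[_ * _]/((w ^+ k i)%:A *: (y i : A^o)) -(lincomb_delta (y : _ -> A^o)).
    rewrite -linearZ; apply/rel => j; rewrite !mxE eqxx /=.
    have [->|_] := eqVneq j i; first by rewrite ir mulr1 lamK; exists 1; rewrite mul1r.
    by rewrite mulr0 rmorph0; case: ifP => // _; exists 0; rewrite mul0r.
  have [|q hq /in_zerom/eqP] := imul_lincomb (N := zerom A^o) (g := (y : _ -> A^o)) _ hp2.
    by move=> v /gen[b ->]; exists b; rewrite subrr rpred0.
  by rewrite subr_eq0 => /eqP e; exists q.
by exists (fun i => sval (h i)) => i; exact: (svalP (h i)).
Qed.

Let wo (i : 'I_r) : 'I_n := widen_ord (let: And4 rn _ _ _ := hy in rn) i.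

Definition torsion_mx (q : 'I_n -> 'rV[A]_n) : 'M[A]_r :=
  \matrix_(i, j) ((w ^+ k i)%:A *+ (i == j) - q (wo i) 0 (wo j)).

Lemma lam_det_torsion_mx q : (forall i, q i \in vecI p n) ->
  lam (\det (torsion_mx q)) = w ^+ (\sum_(i < r) k i).
Proof.
move=> hq; rewrite -det_map_mx.
have -> : map_mx lam (torsion_mx q) = diag_mx (\row_i w ^+ k i).
  apply/matrixP => i j; rewrite !mxE rmorphB rmorphMn /= lamK.
  have /in_vecI/(_ (wo j))/in_kerI -> := hq (wo i).
  by rewrite subr0 eq_sym.
rewrite det_diag; under eq_bigr do rewrite mxE.
by rewrite -expr_sum.
Qed.

Lemma det_torsion_mx_kills q a : (forall i, q i \in vecI p n) ->
  (forall i : 'I_n, (i < r)%N -> (w ^+ k i)%:A * y i = lc y (q i)) ->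
  a \in p -> \det (torsion_mx q) * a \in idl (free_gens y).
Proof.
move=> hq rq; have [rn yp gen rel] := hy => /gen[b ->].
have key j : \det (torsion_mx q) *: (y (wo j) : A^o) \in idl (free_gens y).
  apply: (@det_kills A A^o (idl (free_gens y)) r (torsion_mx q) (fun j => y (wo j))) => i.
  have e := rq (wo i) (ltn_ord i).
  have -> : lc (fun j => y (wo j)) (row i (torsion_mx q)) =
     \sum_(l < n | (r <= l)%N) q (wo i) 0 l *: (y l : A^o).
    rewrite /lincomb; under eq_bigr do rewrite !mxE scalerBl.
    rewrite sumrB (bigD1 i) //= eqxx mulr1n big1 ?addr0 => [|l li]; last first.
      by rewrite eq_sym (negPf li) mulr0n scale0r.
    rewrite -[_ *: _]/((w ^+ k (wo i))%:A * y (wo i)) e /lincomb.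
    rewrite (bigID (fun l : 'I_n => (l < r)%N)) /= addrC.
    rewrite [X in _ + X - _](_ : _ = \sum_(j < r) q (wo i) 0 (wo j) *: (y (wo j) : A^o)).
      by rewrite addrK; apply: eq_bigl => l; rewrite -leqNgt.
    rewrite (big_ord_narrow rn); apply: eq_bigr => l _.
    by have -> : widen_ord rn l = wo l by apply: val_inj.
  apply: rpred_sum => l rl; apply: ideal_mull; apply: mem_idl; exact: mem_free_gens.
rewrite mulrC /lincomb big_distrl; apply: ideal_sum => i _.
change (b 0 i * y i * \det (torsion_mx q) \in idl (free_gens y)).
rewrite -mulrA; apply: ideal_mull.
case: (ltnP i r) => ir; last by apply: ideal_mulr; apply: mem_idl; exact: mem_free_gens.
have -> : i = wo (Ordinal ir) by apply: val_inj.
by rewrite mulrC; exact: key.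
Qed.

Lemma size_free_gens : size (free_gens y) = (n - r)%N.
Proof.
rewrite size_map size_filter -(count_map val (fun i => (r <= i)%N)) val_enum_ord.
have [rn _ _ _] := hy.
rewrite -{1}(subnKC rn) iotaD count_cat add0n.
rewrite (eq_in_count (a2 := pred0)) ?count_pred0; last first.
  by move=> i; rewrite mem_iota /= => ?; apply/negbTE; lia.
rewrite (eq_in_count (a2 := predT)) ?count_predT ?size_iota // => i.
by rewrite mem_iota => /andP[-> _].
Qed.

(** The [n - r] coordinates of [p / p^2] modulo torsion. *)
Lemma coordinates : exists D : 'I_n -> A -> A, (forall i : 'I_n, (r <= i)%N -> derivation p (D i)) /\
  forall i j : 'I_n, (r <= i)%N -> D i (y j) - (i == j)%:R \in p.
Proof.
have [rn yp gen rel] := hy.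
have ch a : {b | a \in p -> a = lc y b}.
  apply: cid; have [/gen[b hb]|_] := boolP (a \in p); first by exists b.
  by exists 0.
pose D i a := (lam ((sval (ch a)) 0 i))%:A : A.
have DE (i : 'I_n) a b : (r <= i)%N -> a \in p -> a = lc y b -> lam ((sval (ch a)) 0 i) = lam (b 0 i).
  move=> ri ha e; apply/eqP; rewrite -subr_eq0 -rmorphB; apply/eqP.
  have h : lc y (sval (ch a) - b) \in p2.
    by rewrite linearB /= -(svalP (ch a) ha) -e subrr rpred0.
  by have := (rel _).1 h i; rewrite ltnNge ri /= !mxE.
exists D; split=> [i ri t a b ha hb|i j ri].
  apply/in_kerI; rewrite /D rmorphB rmorphD rmorphM !lamK.
  rewrite (DE i (t * a + b) (t *: sval (ch a) + sval (ch b)) ri).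
  - by rewrite !mxE rmorphD rmorphM subrr.
  - by apply: idealD => //; exact: ideal_mull.
  - by rewrite linearP /= -(svalP (ch a) ha) -(svalP (ch b) hb).
apply/in_kerI; rewrite /D rmorphB lamK (DE i (y j) (delta_mx 0 j) ri (yp j)).
  by rewrite mxE eqxx eq_sym rmorph_nat subrr.
by rewrite lincomb_delta.
Qed.

Lemma dual_free_gens : exists Ds, dual p Ds (free_gens y).
Proof.
have [D [hD hD']] := coordinates.
rewrite /free_gens; set s := [seq i <- enum 'I_n | _].
have us : uniq s by rewrite filter_uniq // enum_uniq.
have rs i : i \in s -> (r <= i)%N by rewrite mem_filter => /andP[].
have inD (t : seq 'I_n) D' : List.In D' [seq D j | j <- t] -> exists2 j, j \in t & D' = D j.
  elim: t => [//|j t IHt] /= [<-|/IHt[l lt ->]]; first by exists j; rewrite ?mem_head.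
  by exists l; rewrite // inE lt orbT.
exists [seq D i | i <- s]; elim: s us rs => [//|i s IH] /= /andP[i_s us] rs.
have ri := rs i (mem_head _ _); split.
- exact: hD.
- by have := hD' i i ri; rewrite eqxx.
- move=> D' /inD[j js ->].
  have /negPf ji : j != i by apply: contraNneq i_s => <-.
  by have := hD' j i (rs j (mem_behead (s := i :: s) js)); rewrite ji subr0.
- by apply: IH => // j js; apply: rs; rewrite inE js orbT.
Qed.
End Basis.
End CotangentTheory.
(** * The Wiles defect and the socle of [M / xM] *)

Lemma quotm_rlen (R : comNzRingType) (V : lmodType R) (N : submodClosed V) n :
  rlen N (topm V) n -> rlen (zerom (quotm N)) (topm (quotm N)) n.
Proof.
pose f := @pim R V N : {linear V -> quotm N}; move=> h.
apply/(rlen_pre (f := f)); first exact: zerom_sle.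
  by move=> x _; have [v ->] := pim_surj x; exists v; rewrite subrr rpred0.
have -> : pre f (zerom (quotm N)) = N.
  by apply: subm_ext => x; [move=> /in_pre/in_zerom/pim0|
    move=> hx; apply/in_pre/in_zerom/pim0].
by have -> : pre f (topm (quotm N)) = topm V by
  apply: subm_ext => x _; [exact/in_topm|apply/in_pre/in_topm].
Qed.

Section LocalGenerators.
Variables (R : comNzRingType) (P : prime_idealr R) (c : nat).

Lemma loc_gens : regular_local (locR P) c -> exists e : seq R,
  [/\ size e = c, forall a, a \in e -> a \in P &
    forall a, a \in P -> exists2 t, t \notin P & t * a \in idl e].
Proof.
move=> [hN [_ [m' [hloc [s [ss ms]]]]]].
have hm' := local_loc_ring hN hloc.
have mulE (a b : R) t u : (Defs.frac (a : R^o) t : locR P) * Defs.frac (b : R^o) u =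
    Defs.frac (a * b : R^o) (denM t u) := loc_scaleE _ _ _ _.
have ch j : {xt : R * den P | s`_j = Defs.frac (xt.1 : R^o) xt.2}.
  by apply: cid; have [x [t e]] := frac_surj (s`_j); exists (x, t).
pose e := mkseq (fun j => (sval (ch j)).1) c.
have eP a : a \in e -> a \in P.
  move=> /mapP[j]; rewrite mem_iota add0n /= => jc ->.
  have [//|h] := boolP ((sval (ch j)).1 \in P).
  case/negP: hm'.1.
  have hs : s`_j \in m' by rewrite ms idgen_idl; apply: mem_idl; rewrite mem_nth ?ss.
  have : (Defs.frac (dval (sval (ch j)).2 : R^o) (Den h) : locR P) * s`_j \in m'.
    exact: ideal_mull.
  rewrite [X in _ * X](svalP (ch j)) mulE.
  have -> // : Defs.frac (((sval (ch j)).2 : R) * (sval (ch j)).1 : R^o)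
    (denM (Den h) (sval (ch j)).2) = 1 :> locR P.
  by apply/frac_eq; exists (den1 P); rewrite !scale1r /= /GRing.scale /= mulr1 mulrC.
exists e; split=> //; first by rewrite size_mkseq.
have hI : @submod_set (locR P) (locR P)^o
    [set z | exists b t, b \in idl e /\ z = Defs.frac (b : R^o) t].
  split=> [|z u v [b [t [hb ->]]] [b' [t' [hb' ->]]]].
    by exists 0, (den1 P); split; [exact: ideal0|].
  have [r [q ->]] := frac_surj z.
  exists ((t' : R) * (r * b) + (denM q t : R) * b'), (denM (denM q t) t'); split.
    by apply: idealD; apply: ideal_mull => //; exact: ideal_mull.
  rewrite -[_ *: _]/((Defs.frac r q : locR P) * Defs.frac (b : R^o) t) mulE.
  exact: frac_add.
have hm : forall z, z \in m' -> z \in mksubm hI.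
  move=> z; rewrite ms idgen_idl; apply: idl_min => x hx.
  apply/inmkI; rewrite -(nth_index 0 hx) (svalP (ch _)).
  exists (sval (ch (index x s))).1, (sval (ch (index x s))).2; split=> //.
  apply: mem_idl; apply/mapP; exists (index x s) => //.
  by rewrite mem_iota /= add0n -ss index_mem.
move=> a aP; have : (Defs.frac (a : R^o) (den1 P) : locR P) \in m'.
  have [//|/hm'.2[z]] := boolP (_ \in m').
  have [r [t ->]] := frac_surj z; rewrite mulE => /frac_eq[u /=].
  rewrite !scale1r mul1r /GRing.scale /= mulr1 => h.
  have hP : (u : R) * (t : R) \in P by rewrite -h !prime_idealrM aP orbT.
  by have := valP (denM u t); rewrite /= hP.
move=> /hm/inmkI[b [t [hb /frac_eq[u]]]].
rewrite /GRing.scale /= mul1r => h; exists ((denM u t : R)).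
  exact: (valP (denM u t)).
by rewrite /= -mulrA h; exact: ideal_mull.
Qed.
End LocalGenerators.

Lemma sregM (A : comNzRingType) (s t : A) xs : sreg s xs -> sreg (s * t) xs.
Proof.
elim: xs => [|x xs IH] //= [h /IH h']; split=> // v /h hv.
by rewrite mulrAC; exact: ideal_mulr.
Qed.

Section Defect.
Variables (O : idomainType) (w : O) (A : comAlgType O) (lam : {rmorphism A -> O}).
Hypotheses (hO : dvr O) (hw : uniformizer w) (lamK : forall x : O, lam x%:A = x).
Variable m : ideal A.
Hypotheses (hA : noetherian A) (hm : loc_ring m).
Local Notation p := (kerI lam).
Local Notation lc y := (lincomb (y : _ -> A^o)).
Let w0 : w != 0 := (dvr_loc_ring hO hw).2.
Let pp : primeI p := kerI_prime lam.
Variable M : lmodType A.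
Hypothesis hM : noethm M.
Local Notation pM := (imul p (topm M)).

Lemma mem_pM a (v : M) : a \in p -> a *: v \in pM.
Proof. by move=> ha; apply: mem_imul => //; exact/in_topm. Qed.

Lemma pM_scale_lam (a : A) (v : M) : a *: v - (lam a)%:A *: v \in pM.
Proof. by rewrite -scalerBl; apply: mem_pM; exact: kerI_sub_lam. Qed.

Lemma pim_lam (a : A) (v : M) : pim pM (a *: v) = (lam a)%:A *: pim pM v.
Proof. by rewrite -linearZ; apply/pim_eq/pM_scale_lam. Qed.

Lemma addseq_pM xs : {subset xs <= p} -> sle (addseq (zerom M) xs) pM.
Proof.
by move=> xp; apply: addseq_min; [exact: zerom_sle|move=> a v /xp; exact: mem_pM].
Qed.

(** The [nb j] map to a basis of [M / pM] modulo torsion. *)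
Definition tf_basis mu (nb : 'I_mu -> M) :=
  (forall b (t : O), t != 0 -> t%:A *: lincomb nb b \in pM -> forall j, lam (b 0 j) = 0) /\
  exists2 t : O, t != 0 & forall v, exists b, t%:A *: (v - lincomb nb b) \in pM.

Lemma tf_basis_exists : exists mu (nb : 'I_mu -> M), tf_basis nb.
Proof.
have [n [g [_ gen]]] := fin_gens (topm M) hM.
pose V := over_base (quotm pM); pose v i : V := pim pM (g i).
have vE (a : 'rV[A]_n) : pim pM (lincomb g a) = lincomb v (map_mx lam a) :> V.
  rewrite /lincomb linear_sum; apply: eq_bigr => i _; rewrite mxE.
  by rewrite -[RHS]/((lam (a 0 i))%:A *: pim pM (g i)) -linearZ; apply/pim_eq/pM_scale_lam.
have [B [r [k [uB rn hB]]]] := dvr_structure hO hw v.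
have [mu en] : exists mu, n = (r + mu)%N by exists (n - r)%N; lia.
subst n; pose u i := lincomb v (row i B).
have gu x : exists a, x = lincomb u a.
  have [q ->] := pim_surj x; have [a ->] := gen q (in_topm _).
  by exists (map_mx lam a *m invmx B); rewrite lincombM mulmxKV // vE.
pose nb (j : 'I_mu) := lincomb g (map_mx (in_alg A) (row (rshift r j) B)).
have nbE (b : 'rV[A]_mu) : pim pM (lincomb nb b) = lincomb u (row_mx 0 (map_mx lam b)) :> V.
  rewrite /lincomb linear_sum big_split_ord /=.
  rewrite [X in _ = X + _]big1 ?add0r => [|i _]; last first.
    by rewrite row_mxEl mxE scale0r.
  apply: eq_bigr => j _; rewrite row_mxEr mxE.
  rewrite -[RHS]/((lam (b 0 j))%:A *: (u (rshift r j) : quotm pM)).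
  have -> : u (rshift r j) = pim pM (nb j) :> quotm pM.
    rewrite -[RHS]/(pim pM (nb j) : V) vE; congr (lincomb v _).
    by apply/rowP => i; rewrite !mxE lamK.
  exact: pim_lam.
have lt := lincomb_tors hO hw hB.
exists mu, nb; split=> [b t t0 h j|].
  have : lincomb u (row_mx 0 (map_mx lam b)) \in tors V.
    apply/inmk; exists t => //; rewrite -nbE.
    by rewrite -[_ *: _]/(t%:A *: pim pM (lincomb nb b)) -linearZ; apply/pim0.
  by move=> /lt /(_ (rshift r j)); rewrite row_mxEr mxE /= => -> //; exact: leq_addr.
exists (\prod_(i < r + mu) w ^+ k i) => [|x].
  by apply/prodf_neq0 => i _; rewrite expf_neq0.
have [a ea] := gu (pim pM x).
pose b : 'rV[A]_mu := map_mx (in_alg A) (rsubmx a).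
have e : (pim pM (x - lincomb nb b) : V) = lincomb u (a - row_mx 0 (map_mx lam b)).
  have -> : lincomb u (a - row_mx 0 (map_mx lam b)) =
      lincomb u a - lincomb u (row_mx 0 (map_mx lam b)) := linearB (lincomb u) _ _.
  by rewrite -nbE -ea; exact: (linearB (pim pM)).
have ht : lincomb u (a - row_mx 0 (map_mx lam b)) \in tors V.
  apply/lt => i ri; rewrite -(hsubmxK a) !mxE.
  case: (splitP i) => j ij; first by have := ltn_ord j; lia.
  by rewrite !mxE lamK subrr.
have := tors_bound hO hw hB gu ht; rewrite -e => h.
exists b; apply/pim0; rewrite linearZ; exact: h.
Qed.

Section Basis.
Variables (mu : nat) (nb : 'I_mu -> M).
Hypothesis hnb : tf_basis nb.

Section Regular.
Variables (xs : seq A) (a0 : A).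
Hypotheses (xp : {subset xs <= p}) (xm : {subset xs <= m}) (xr : rseq (zerom M) xs)
  (a0p : a0 \notin p) (ha0 : forall a, a \in p -> a0 * a \in idl xs).

Lemma tf_basis_top a : lincomb nb a \in addseq (zerom M) xs -> a0 *: a \in vecI (idl xs) mu.
Proof.
move=> /(addseq_pM xp) h; apply/in_vecI => j; rewrite mxE; apply: ha0; apply/in_kerI.
by apply: (hnb.1 a 1); rewrite ?oner_neq0 // !scale1r.
Qed.

Lemma tf_basis_indep : exists2 s', s' \notin p &
  forall b, lincomb nb b = 0 -> s' *: b = 0.
Proof.
have [a v /in_zerom ->|s' s'p h] := s_indep_lift hA pp (n := nb) (I0 := zerom A^o)
  xp _ xr a0p tf_basis_top; first by rewrite scale0r rpred0.
exists s' => // b /in_zerom /h /in_vecI hb; apply/rowP => j.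
by rewrite [RHS]mxE; apply/(@in_zerom A A^o); exact: hb.
Qed.

Lemma tf_basis_gen : exists2 s, s \notin p & forall v, exists b, s *: v = lincomb nb b.
Proof.
have [t t0 ht] := hnb.2.
have tp : t%:A \notin p by apply/notin_kerI; rewrite lamK.
have [|s sp h] := s_nakayama pp (K := topm M)
    (N := imm (lincomb nb : {linear 'rV[A]_mu -> M})) hM tp.
  move=> v _; have [b hb] := ht v; apply/in_addm; exists (t%:A *: lincomb nb b).
    by rewrite rpredZ //; apply/inmk; exists b.
  by rewrite -scalerBr.
by exists s => // v; have /inmk[b _ <-] := h v (in_topm _); exists b.
Qed.

Lemma tf_basis_loc : isom (loc (kerP lam) M) 'rV[locR (kerP lam)]_mu.
Proof.
have kP a : a \notin p -> a \notin kerP lam by move=> /notin_kerI.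
have [s /kP sp h] := tf_basis_gen; have [s' /kP s'p h'] := tf_basis_indep.
exact: (loc_basis sp s'p h h').
Qed.

Lemma sreg_exists : (0 < mu)%N -> exists2 s, s \notin p & sreg s xs.
Proof.
move=> mu0; pose j0 := Ordinal mu0.
suff H suf : forall pre, xs = pre ++ suf -> exists2 s, s \notin p & sreg s suf by exact: (H xs [::]).
elim: suf => [|x suf IH] pre e; first by exists 1 => //; exact: pp.1.
have [|s sp hs] := IH (rcons pre x); first by rewrite cat_rcons.
have pe : perm_eq xs (suf ++ x :: pre).
  by rewrite e perm_sym perm_catC /= -cat1s -[x :: suf]cat1s !catA perm_cat2r perm_catC.
have hr : rseq (zerom M) (suf ++ x :: pre) by apply: (rseq_perm (m := m)) pe xr.
have [_ hr2] := (rseq_cat _ _ _).1 hr.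
have sufp : {subset x :: pre <= p}.
  by move=> a ha; apply: xp; rewrite (perm_mem pe) mem_cat ha orbT.
have [|a|s' s'p hs'] := s_indep_lift hA pp (n := nb) (I0 := idl suf) sufp _ hr2 a0p.
- move=> a v; have : sle (idl suf) (annv (addseq (zerom M) suf) v).
    by apply: idl_min => b hb; apply/in_annv; exact: mem_addseq.
  by move=> h /h/in_annv.
- rewrite -addseq_cat => ha.
  have -> : @addseq A A^o (idl suf) (x :: pre) = idl xs.
    by rewrite /idl -addseq_cat; apply: idl_eqmem => z; rewrite (perm_mem pe).
  apply: tf_basis_top; apply: addseq_sub ha => z; by rewrite (perm_mem pe).
exists (s * s'); first exact: notin_prod.
split; last exact: sregM.
move=> v hv; rewrite -mulrA; apply: ideal_mull.
have /hs'/in_vecI/(_ j0) : lincomb nb (v *: delta_mx 0 j0) \in addseq (zerom M) suf.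
  rewrite linearZ /= lincomb_delta; apply: hr2.1.
  have : x * v \in annv (addseq (zerom M) suf) (nb j0).
    by apply: idl_min hv => b hb; apply/in_annv; exact: mem_addseq.
  by move=> /in_annv; rewrite scalerA.
by rewrite !mxE !eqxx mulr1.
Qed.

Local Notation X := (tfp lam M).
Let cl (v : M) : X := pim (tors (over_base (Defs.modp lam M))) (pim pM v).

Let clE v v' : cl v = cl v' <-> exists2 t, t != 0 & t%:A *: (v - v') \in pM.
Proof. exact: tf_quot_eq. Qed.

Let clZ t v : cl (t%:A *: v) = t *: cl v.
Proof. by rewrite /cl linearZ -[in RHS]linearZ. Qed.

Variables (K : nat).
Hypotheses (lam_a0 : lam a0 = w ^+ K) (hPhi : length (Phi lam) = K)
  (hPsi : isom (Psi lam (size xs) M) (quotm (congL lam M xs))).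

(** [a0] carries [M] into the elements of [M / xM] killed by [p], so the image of
    the latter in [X = (M / pM)^tf] contains [w ^ K X]; the colength of [w ^ K X]
    is [mu * K], and the Wiles defect is the length of the gap. *)
Lemma defect_char : 0 <= wiles_defect lam (size xs) M /\
  (wiles_defect lam (size xs) M = 0 <->
   forall v, (forall a, a \in p -> a *: v \in addseq (zerom M) xs) ->
     exists u (t : O), t != 0 /\ t%:A *: (v - (w ^+ K)%:A *: u) \in pM).
Proof.
pose nX j := cl (nb j).
have nXE (b : 'rV[O]_mu) : lincomb nX b = cl (lincomb nb (map_mx (in_alg A) b)).
  rewrite /cl /lincomb !linear_sum; apply: eq_bigr => j _.
  transitivity (cl ((b 0 j)%:A *: nb j)); first by rewrite clZ.
  by rewrite /cl mxE.
have genX x : exists b, x = lincomb nX b.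
  have [q ->] := pim_surj x; have [v ->] := pim_surj q.
  have [t t0 /(_ v)[b hb]] := hnb.2; exists (map_mx lam b).
  rewrite nXE; apply/clE; exists t => //.
  rewrite -(subrK (lincomb nb b) v) -addrA scalerDr rpredD // rpredZ //.
  rewrite -linearB; apply: rpred_sum => j _; apply: mem_pM.
  by rewrite !mxE; exact: kerI_sub_lam.
have indX b : lincomb nX b = 0 -> b = 0.
  move=> e0; have e : cl (lincomb nb (map_mx (in_alg A) b)) = cl 0.
    by rewrite -nXE e0 /cl !linear0.
  have /clE[t t0] := e; rewrite subr0 => ht; apply/rowP => j.
  by have := hnb.1 _ _ t0 ht j; rewrite !mxE lamK.
have lenX := rlen_basis hO hw K genX indX.
have hPsi' := hPsi; set L := congL lam M xs in hPsi'; set N := adds _ _ in lenX.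
have clL v : (forall a, a \in p -> a *: v \in addseq (zerom M) xs) -> cl v \in L.
  by move=> hv; apply/inmk; exists v.
have NL : sle N L.
  apply: adds_min; first exact: zerom_sle.
  move=> x; have [q ->] := pim_surj x; have [v ->] := pim_surj q; rewrite -/(cl v).
  have -> : w ^+ K *: cl v = cl (a0 *: v).
    rewrite -clZ -lam_a0; apply/esym/clE; exists 1; first exact: oner_neq0.
    by rewrite scale1r scale1r; exact: pM_scale_lam.
  apply: clL => a ha; rewrite scalerA mulrC.
  have : a0 * a \in annv (addseq (zerom M) xs) v.
    by apply: idl_min (ha0 ha) => b hb; apply/in_annv; exact: mem_addseq.
  by move/in_annv.
have [a [b [eab ha hb]]] := rlen_split NL (fun x _ => in_topm x) lenX.
have lPsi : length (Psi lam (size xs) M) = b.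
  exact: lengthP (isom_len (isom_sym hPsi') (quotm_rlen hb)).
have hrank : rank (loc (kerP lam) M) = mu by exact: rank_eq tf_basis_loc.
rewrite /wiles_defect hrank hPhi lPsi eab.
have -> : ((a + b)%N%:Z - b%:Z = a%:Z) by lia.
split; first by [].
split=> [a_0 v /clL vL|h].
  have {}a_0 : a = 0%N by lia.
  rewrite a_0 in ha; move: vL; rewrite (rlen0 ha) => /in_adds[x /in_zerom/eqP].
  have [q ->] := pim_surj x; have [u ->] := pim_surj q; rewrite -/(cl u) -clZ subr_eq0.
  by move=> /eqP/clE[t t0 ht]; exists u, t.
have LN : L = N.
  apply: subm_ext => // x /inmk[v hv ->]; have [u [t [t0 ht]]] := h v hv.
  apply/in_adds; exists (cl u); apply/in_zerom/eqP.
  by rewrite subr_eq0 -clZ; apply/eqP/clE; exists t.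
by have := rlen_uniq ha; rewrite LN => /(_ 0%N (rlen_refl _)) ->.
Qed.
End Regular.
End Basis.

Section Setup.
Variables (n : nat) (ys : 'I_n -> A) (c : nat).
Hypotheses (yp : forall i, ys i \in p)
  (gen : forall a, a \in p -> exists b, a = lc ys b).
Hypotheses (hreg : regular_local (locR (kerP lam)) c)
  (hdep : dep m (zerom M) c.+1) (v0 : M) (hv0 : forall s, s \notin p -> s *: v0 <> 0).

Lemma kerP_kerI a : (a \in kerP lam) = (a \in p).
Proof. by apply/idP/idP => [/eqP h|/in_kerI h]; [exact/in_kerI|exact/eqP]. Qed.

Lemma free_rank_leq r k (y : 'I_n -> A) : cotangent w lam r k y -> (n - r <= c)%N.
Proof.
move=> [rn yp' gen' rel]; have [e [se ep hloc]] := loc_gens hreg.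
have rj (i : 'I_(n - r)) : (r + i < n)%N by have := ltn_ord i; lia.
pose ro i := Ordinal (rj i).
have ch1 i : {tb : A * 'rV[A]_c | tb.1 \notin p /\
    tb.1 * y (ro i) = \sum_j tb.2 0 j * e`_j}.
  apply: cid; have yP : y (ro i) \in kerP lam by rewrite kerP_kerI.
  have [t tp /in_idl[b]] := hloc _ yP.
  rewrite se => hb; exists (t, \row_j b j); split=> /=; first by rewrite -kerP_kerI.
  by rewrite hb; apply: eq_bigr => j _; rewrite mxE.
have ch2 (j : 'I_c) : {g | e`_j = lc y g}.
  apply: cid; apply: gen'; rewrite -kerP_kerI; apply: ep.
  by rewrite mem_nth // se.
pose B : 'M[O]_(n - r, c) := \matrix_(i, j) lam ((sval (ch1 i)).2 0 j).
pose G : 'M[O]_(c, n - r) := \matrix_(j, l) lam ((sval (ch2 j)) 0 (ro l)).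
apply: (@det_factor_leq _ _ _ B G).
have -> : B *m G = diag_mx (\row_i lam (sval (ch1 i)).1).
  apply/matrixP => i l; have [ti hi] := svalP (ch1 i).
  pose b : 'rV[A]_n := (sval (ch1 i)).1 *: delta_mx 0 (ro i) -
    \sum_j (sval (ch1 i)).2 0 j *: sval (ch2 j).
  have hb : lc y b = 0.
    have hs : lc y (\sum_j (sval (ch1 i)).2 0 j *: sval (ch2 j)) =
        \sum_j (sval (ch1 i)).2 0 j * e`_j.
      by rewrite linear_sum; apply: eq_bigr => j _; rewrite linearZ /= -(svalP (ch2 j)).
    have -> : lc y b = lc y ((sval (ch1 i)).1 *: delta_mx 0 (ro i)) -
      lc y (\sum_j (sval (ch1 i)).2 0 j *: sval (ch2 j)) := linearB (lc y) _ _.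
    by rewrite hs linearZ /= lincomb_delta -hi subrr.
  have := (rel b).1 _ (ro l); rewrite hb => /(_ (rpred0 _)) /=.
  rewrite ltnNge leq_addr /= !mxE eqxx /= summxE rmorphB rmorph_sum rmorphM rmorph_nat.
  move=> /eqP; rewrite subr_eq0 => /eqP e1.
  transitivity (\sum_j lam (((sval (ch1 i)).2 0 j *: sval (ch2 j)) 0 (ro l))).
    by apply: eq_bigr => j _; rewrite /B /G !mxE rmorphM.
  rewrite -e1 -[RHS]mulr_natr; congr (_ * _%:R).
  by rewrite -[ro l == ro i]val_eqE /= eqn_add2l eq_sym.
rewrite det_diag; apply/prodf_neq0 => i _; rewrite mxE.
by apply/notin_kerI; have [] := svalP (ch1 i).
Qed.

(** The elements [y_i] can be modified modulo [p^2] so that the free part of the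
    cotangent module lifts to an [M]-regular sequence; as [M] is not torsion at
    [p], no further regular element of [M / xM] lies in [p]. *)
Lemma setup : exists B r k y,
  [/\ (B : 'M[O]_n) \in unitmx, cotangent w lam r k y,
    forall i, y i - lc ys (row i (map_mx (in_alg A) B)) \in imul p p,
    length (Phi lam) = (\sum_(i < r) k i)%N & 
    [/\ (n - r)%N = c, rseq (zerom M) (free_gens r y) &
       dep m (addseq (zerom M) (free_gens r y)) 1]].
Proof.
have [B [r [k [uB cot hPhi]]]] := cotangent_structure hO hw lamK yp gen.
set y := (fun i => _) in cot.
have nc := free_rank_leq cot.
have [rn yp' _ _] := cot.
set xs := free_gens r y.
have sxs : size xs = (n - r)%N by exact: size_free_gens cot.
have xp : {subset xs <= p} by move=> a /mapP[i _ ->].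
have hdep' : dep m (zerom M) (size xs + (c - (n - r)).+1).
  by rewrite sxs addnS subnKC.
have [ys' [sys yxs ysp ysr ysdep]] := rseq_coset hm hA hM
  (kerI_dim1 hO hw lamK hm) hdep' (@kerI2_sub _ _ lam) xp (kerI_sub_max hm)
  (fun a b ha hb => mem_kerI2 ha hb).
pose s := [seq i : 'I_n <- enum 'I_n | (r <= i)%N].
have us : uniq s by rewrite filter_uniq // enum_uniq.
have ss : size s = size xs by rewrite /xs /free_gens size_map.
pose y' (i : 'I_n) := if (r <= i)%N then ys'`_(index i s) else y i.
have y'y i : y' i - y i \in imul p p.
  rewrite /y'; case: leqP => ri; last by rewrite subrr rpred0.
  have is_ : i \in s by rewrite mem_filter ri mem_enum.
  have := yxs (index i s); rewrite /xs /free_gens -/s (nth_map i) ?index_mem //.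
  by rewrite nth_index.
have cot' := cotangent_mod hA hm cot y'y.
have fy' : free_gens r y' = ys'.
  have sz' : size (free_gens r y') = (n - r)%N by exact: size_free_gens cot'.
  apply: (@eq_from_nth _ 0) => [|j]; rewrite sz'.
    by rewrite sys sxs.
  move=> jn; have js : (j < size s)%N by rewrite ss sxs.
  have [i0 _] : exists i0 : 'I_n, True by case: (s) js => // i ? _; exists i.
  rewrite /free_gens -/s (nth_map i0) // /y' index_uniq //.
  by have := mem_nth i0 js; rewrite mem_filter => /andP[-> _].
exists B, r, k, y'; split=> //; rewrite fy'.
suff e : (n - r)%N = c by split=> //; move: ysdep; rewrite e subnn.
apply/eqP; rewrite eqn_leq nc leqNgt; apply/negP => lt.
have ysdep2 : dep m (addseq (zerom M) ys') 2.
  have [q [sq qm hq]] := ysdep; exists (take 2 q); split.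
  - by rewrite size_take sq; case: ltnP => //; lia.
  - by move=> a /mem_take; exact: qm.
  - by move: hq; rewrite -{1}(cat_take_drop 2 q) => /rseq_cat[].
have [q hq] := cotangent_rel lamK cot'.
pose a0 := \det (torsion_mx cot' q).
have a0p : a0 \notin p.
  apply/notin_kerI; rewrite /a0 (lam_det_torsion_mx lamK) ?expf_neq0 // => i.
  by have [] := hq i.
have ha0 a : a \in p -> a0 * a \in idl ys'.
  rewrite -fy'; apply: det_torsion_mx_kills => i; first by have [] := hq i.
  exact: (hq i).2.
have [v hv] : exists v, forall t, t \notin p -> t *: v \notin addseq (zerom M) ys'.
  apply: contrapT => hno.
  have hall v : exists t, t \notin p /\ t *: v \in addseq (zerom M) ys'.
    apply: contrapT => h; apply: hno; exists v => t tp.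
    by apply/negP => h'; apply: h; exists t.
  have [k1 [g [_ hg]]] := fin_gens (topm M) hM.
  pose t i := sval (cid (hall (g i))); pose T := \prod_i t i.
  have tP i := svalP (cid (hall (g i))).
  have Tp : T \notin p.
    rewrite /T; elim/big_ind: _ => [|a b|i _]; [exact: pp.1|exact: notin_prod|].
    by have [] := tP i.
  have [|s1 s1p h1] := s_nakayama pp (K := topm M) (N := zerom M) hM Tp.
    move=> u _; apply: sle_addmr; have [b ->] := hg u (in_topm _).
    rewrite -linearZ; apply: rpred_sum => i _; rewrite mxE mulrC -scalerA rpredZ //.
    apply: (addseq_pM ysp); rewrite /T (bigD1 i) //= mulrC -scalerA rpredZ //.
    by have [] := tP i.
  by apply: (hv0 s1p); apply/in_zerom; apply: h1; exact/in_topm.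
apply: (dep2_not_ass hm hA hM (kerI_dim1 hO hw lamK hm) ysdep2 (hv _ a0p)).
apply: subm_ext => b; last first.
  move=> /ha0 hb; apply/in_annv; rewrite scalerA mulrC.
  have : a0 * b \in annv (addseq (zerom M) ys') v.
    by apply: idl_min hb => d hd; apply/in_annv; exact: mem_addseq.
  by move/in_annv.
move=> /in_annv; rewrite scalerA => hb; have [//|bp] := boolP (b \in p).
by have := hv _ (notin_prod pp bp a0p); rewrite hb.
Qed.
End Setup.
End Defect.
(** * Power series rings *)

Definition fps (R : comNzRingType) : Type := nat -> R.

Section FpsRing.
Variable R : comNzRingType.
HB.instance Definition _ := GRing.Zmodule.on (fps R).
Implicit Types f g h : fps R.

Definition fps_mul f g : fps R := fun n => \sum_(i < n.+1) f i * g (n - i)%N.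
Definition fpsC (c : R) : fps R := fun n => if n is 0 then c else 0.

Let tr n f : {poly R} := \poly_(i < n.+1) f i.
Let tr_coef n f i : (i <= n)%N -> (tr n f)`_i = f i.
Proof. by move=> h; rewrite coef_poly ltnS h. Qed.

Let mul_coef n f g (P Q : {poly R}) : (forall i, (i <= n)%N -> P`_i = f i) ->
  (forall i, (i <= n)%N -> Q`_i = g i) ->
  forall i, (i <= n)%N -> (P * Q)`_i = fps_mul f g i.
Proof.
move=> hP hQ i le; rewrite coefM; apply: eq_bigr => j _.
by rewrite hP ?hQ //; have := ltn_ord j; lia.
Qed.

Fact fps_mulA : associative fps_mul.
Proof.
move=> f g h; apply/funext => n.
rewrite -(mul_coef (@tr_coef n f) (mul_coef (@tr_coef n g)
  (@tr_coef n h))) // mulrA.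
by rewrite (mul_coef (mul_coef (@tr_coef n f) (@tr_coef n g))
  (@tr_coef n h)).
Qed.

Fact fps_mulC : commutative fps_mul.
Proof.
move=> f g; apply/funext => n.
rewrite -(mul_coef (@tr_coef n f) (@tr_coef n g)) // mulrC.
by rewrite (mul_coef (@tr_coef n g) (@tr_coef n f)).
Qed.

Fact fps_mul1 : left_id (fpsC 1) fps_mul.
Proof.
move=> f; apply/funext => n; rewrite /fps_mul big_ord_recl /= mul1r subn0.
by rewrite big1 ?addr0 // => i _; rewrite mul0r.
Qed.

Fact fps_mulDl : left_distributive fps_mul +%R.
Proof.
move=> f g h; apply/funext => n.
have -> : (fps_mul f h + fps_mul g h) n = fps_mul f h n + fps_mul g h n by [].
rewrite -big_split /=.
by apply: eq_bigr => i _; rewrite mulrDl.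
Qed.

Fact fps_1_neq0 : fpsC 1 != 0.
Proof.
by apply/eqP => /(congr1 (fun f : fps R => f 0%N)) /= /eqP; rewrite (negPf (oner_neq0 R)).
Qed.

HB.instance Definition _ := GRing.Zmodule_isComNzRing.Build (fps R)
  fps_mulA fps_mulC fps_mul1 fps_mulDl fps_1_neq0.

Lemma fps_coefM f g n : (f * g) n = \sum_(i < n.+1) f i * g (n - i)%N.
Proof. by []. Qed.
Lemma fps_coefD f g n : (f + g) n = f n + g n.
Proof. by []. Qed.
Lemma fps_coefB f g n : (f - g) n = f n - g n.
Proof. by []. Qed.
Lemma fps_coef_sum (I : Type) (r : seq I) (P : pred I) (F : I -> fps R) n :
  (\sum_(i <- r | P i) F i) n = \sum_(i <- r | P i) F i n.
Proof. exact: (big_morph (fun f : fps R => f n)). Qed.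

Lemma fps_coefCM c f n : (fpsC c * f) n = c * f n.
Proof.
rewrite fps_coefM big_ord_recl /= subn0 big1 ?addr0 // => i _.
by rewrite mul0r.
Qed.

Fact fpsC_additive : zmod_morphism fpsC.
Proof. by move=> a b; apply/funext => -[|n]; rewrite fps_coefB /= ?subrr. Qed.
Fact fpsC_mult : monoid_morphism fpsC.
Proof.
split=> // a b; apply/funext => n; rewrite fps_coefCM.
by case: n => [|n] //=; rewrite mulr0.
Qed.
HB.instance Definition _ := GRing.isZmodMorphism.Build R (fps R) fpsC fpsC_additive.
HB.instance Definition _ := GRing.isMonoidMorphism.Build R (fps R) fpsC fpsC_mult.

Definition fps0 f : R := f 0%N.
Fact fps0_additive : zmod_morphism fps0. Proof. by []. Qed.
Fact fps0_mult : monoid_morphism fps0.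
Proof. by split=> // f g; rewrite /fps0 fps_coefM big_ord1. Qed.
HB.instance Definition _ := GRing.isZmodMorphism.Build (fps R) R fps0 fps0_additive.
HB.instance Definition _ := GRing.isMonoidMorphism.Build (fps R) R fps0 fps0_mult.

(** Divisibility by the [k]-th power of the variable. *)
Definition vt k f := forall i, (i < k)%N -> f i = 0.

Lemma vtM a b f g : vt a f -> vt b g -> vt (a + b) (f * g).
Proof.
move=> hf hg n nab; rewrite fps_coefM big1 // => i _.
by have [/hf ->|ai] := ltnP i a; rewrite ?mul0r // hg ?mulr0 //; have := ltn_ord i; lia.
Qed.

Lemma vtM_coef a b f g : vt a f -> vt b g -> (f * g) (a + b)%N = f a * g b.
Proof.
move=> hf hg; have aab : (a < (a + b).+1)%N by lia.
rewrite fps_coefM (bigD1 (Ordinal aab)) //= addKn big1 ?addr0 // => i ia.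
have {}ia : i != a :> nat by apply: contraNneq ia => e; apply/eqP/val_inj.
have [/hf ->|ai] := ltnP i a; rewrite ?mul0r // hg ?mulr0 //.
by have := ltn_ord i; lia.
Qed.

Lemma vtB k f g : vt k f -> vt k g -> vt k (f - g).
Proof. by move=> hf hg i ik; rewrite fps_coefB hf ?hg ?subrr. Qed.

Lemma vt_sum k n (F : 'I_n -> fps R) : (forall j, vt k (F j)) -> vt k (\sum_j F j).
Proof. by move=> h i ik; rewrite fps_coef_sum big1 // => j _; exact: h. Qed.

Definition fpsX : fps R := fun n => (n == 1%N)%:R.

Lemma fps_coefXM f n : (fpsX * f) n.+1 = f n.
Proof.
rewrite fps_coefM 2!big_ord_recl /= mul0r add0r mul1r subSS subn0 big1 ?addr0 // => i _.
by rewrite mul0r.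
Qed.

Lemma fpsX_exp k i : (fpsX ^+ k) i = (i == k)%:R.
Proof.
elim: k i => [|k IH] [|i]; rewrite ?expr0 // exprS.
  by rewrite fps_coefM big_ord1 mul0r.
by rewrite fps_coefXM IH.
Qed.

Lemma fpsX_vt k : vt k (fpsX ^+ k).
Proof. by move=> i ik; rewrite fpsX_exp (ltn_eqF ik). Qed.

Lemma fps_decomp f : f = fpsC (f 0%N) + fpsX * (fun n => f n.+1).
Proof.
apply/funext => -[|n]; rewrite fps_coefD /=.
  by rewrite fps_coefM big_ord1 mul0r addr0.
by rewrite fps_coefXM add0r.
Qed.

(** Successive approximation: if the lowest coefficients of the [g_j] generate
    the lowest coefficients of the elements of [I], then the [g_j] generate [I]. *)
Lemma succ_approx (I : ideal (fps R)) r (g : 'I_r -> fps R) k :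
  (forall j, g j \in I) -> (forall j, vt k (g j)) ->
  (forall n f, f \in I -> vt (k + n) f ->
     exists c : 'I_r -> R, f (k + n)%N = \sum_j c j * g j k) ->
  forall f, f \in I -> vt k f -> exists C : 'I_r -> fps R, f = \sum_j C j * g j.
Proof.
move=> gI gk hc f fI fk.
have [||h [h0 hS]] := @dep_choice (fun _ => fps R)
  (fun n f => f \in I /\ vt (k + n) f)
  (fun n f f' => vt (k + n.+1) f' /\
    exists c : 'I_r -> R, f' = f - \sum_j (fpsC (c j) * fpsX ^+ n) * g j) f.
- by rewrite addn0.
- move=> n f1 [f1I f1k]; have [c ec] := hc n f1 f1I f1k.
  have vk : vt (k + n) (\sum_j (fpsC (c j) * fpsX ^+ n) * g j).
    apply: vt_sum => j; rewrite addnC; apply: vtM => //.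
    by rewrite -[n]add0n; apply: vtM => //; exact: fpsX_vt.
  have vS : vt (k + n.+1) (f1 - \sum_j (fpsC (c j) * fpsX ^+ n) * g j).
    move=> i; rewrite addnS ltnS leq_eqVlt => /orP[/eqP ->|]; last exact: vtB.
    rewrite fps_coefB fps_coef_sum ec; apply/eqP; rewrite subr_eq0; apply/eqP.
    apply: eq_bigr => j _; rewrite addnC vtM_coef //; last first.
      by rewrite -[n]add0n; apply: vtM => //; exact: fpsX_vt.
    by rewrite fps_coefCM fpsX_exp eqxx mulr1.
  exists (f1 - \sum_j (fpsC (c j) * fpsX ^+ n) * g j); split; last by split=> //; exists c.
  by split=> //; apply: idealB => //; apply: ideal_sum => j _; exact: ideal_mull.
have ch n := cid (hS n).2; pose c n := sval (ch n).
have hc' n : h n.+1 = h n - \sum_j (fpsC (c n j) * fpsX ^+ n) * g j := svalP (ch n).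
pose C j : fps R := fun n => c n j.
have hn n : f = h n + \sum_j (\sum_(i < n) fpsC (c i j) * fpsX ^+ i) * g j.
  elim: n => [|n IH].
    by rewrite h0 big1 ?addr0 // => j _; rewrite big_ord0 mul0r.
  have -> : \sum_j (\sum_(i < n.+1) fpsC (c i j) * fpsX ^+ i) * g j =
      \sum_j (fpsC (c n j) * fpsX ^+ n) * g j +
      \sum_j (\sum_(i < n) fpsC (c i j) * fpsX ^+ i) * g j.
    by rewrite -big_split; apply: eq_bigr => j _; rewrite big_ord_recr /= mulrDl addrC.
  by rewrite hc' addrA subrK.
exists C; apply/funext => i; rewrite {1}(hn i.+1) fps_coefD.
have -> : h i.+1 i = 0 by apply: (hS i).1; lia.
rewrite add0r !fps_coef_sum; apply: eq_bigr => j _; apply/eqP.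
rewrite -subr_eq0 -fps_coefB -mulrBl; apply/eqP; apply: (@vtM i.+1 k); last by lia.
  move=> l li; rewrite fps_coefB fps_coef_sum (bigD1 (Ordinal li)) //= fps_coefCM.
  rewrite fpsX_exp eqxx mulr1 big1 ?addr0 ?subrr // => l' ll'.
  rewrite fps_coefCM fpsX_exp; case: eqP => [e|]; last by rewrite mulr0.
  by case/eqP: ll'; apply: val_inj.
exact: gk.
Qed.
End FpsRing.

Lemma idl_map (R S : comNzRingType) (f : {rmorphism R -> S}) z a :
  a \in idl z -> f a \in idl [seq f c | c <- z].
Proof.
move=> /in_idl[r ->]; rewrite rmorph_sum; apply: ideal_sum => i _.
by rewrite rmorphM; apply: ideal_mull; apply: mem_idl; apply: map_f; exact: mem_nth.
Qed.

(** ** Restriction of scalars along a surjection *)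
Section RestrictionAlong.
Variables (S R : comNzRingType) (f : {rmorphism S -> R}).
Hypothesis fs : forall r, exists s, f s = r.
Variable V : lmodType R.

Lemma rseq_restr (N : submodClosed (restr f V)) (N' : submodClosed V) q :
  N =i N' -> rseq N' (map f q) -> rseq N q.
Proof.
elim: q N N' => [|a q IH] N N' e //= [na hr]; split=> [v|].
  by rewrite !e; exact: na.
apply: IH hr => x; apply/idP/idP => /in_adds[v hv]; apply/in_adds; exists v.
  by rewrite -e.
by rewrite e.
Qed.

Lemma addseq_restr (N : submodClosed (restr f V)) (N' : submodClosed V) q :
  N =i N' -> addseq N q =i addseq N' (map f q).
Proof.
elim: q N N' => [|a q IH] N N' e //=; apply: IH => x.
by apply/idP/idP => /in_adds[v hv]; apply/in_adds; exists v; rewrite ?e // -e.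
Qed.

Lemma zerom_restr : zerom (restr f V) =i zerom V.
Proof. by move=> x; apply/idP/idP => /in_zerom ->; exact: rpred0. Qed.

End RestrictionAlong.

Section FpsLocal.
Variables (R : comNzRingType) (mR : ideal R).
Hypotheses (hR : noetherian R) (hm : loc_ring mR).
Local Notation S := (fps R).
Local Notation X := (fpsX R).

(** Hilbert basis theorem for power series: as in [succ_approx], above a degree
    where the ideals of lowest coefficients become stationary. *)
Lemma fps_noetherian : noetherian S.
Proof.
apply/noetherian_noethm => I.
have hL k : @submod_set R R^o [set a | exists f : S, [/\ f \in I, vt k f & f k = a]].
  split=> [|a u v [f [fI fk <-]] [g [gI gk <-]]].
    by exists 0; split=> //; exact: ideal0.
  exists (fpsC a * f + g); split.
  - by apply: idealD => //; exact: ideal_mull.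
  - by move=> i ik; rewrite fps_coefD fps_coefCM fk ?gk ?mulr0 ?addr0.
  - by rewrite fps_coefD fps_coefCM.
pose L k : ideal R := mksubm (hL k).
have hR' : noethm R^o by exact/noetherian_noethm.
have inL k a : a \in L k <-> exists f : S, [/\ f \in I, vt k f & f k = a].
  exact: (@inmk R R^o _ (hL k) a).
have Lmono k : sle (L k) (L k.+1).
  move=> a /inL[f [fI fk <-]]; apply/inL; exists (X * f); split.
  - exact: ideal_mull.
  - by rewrite -[k.+1]/(1 + k)%N; apply: vtM => // i; rewrite ltnS leqn0 => /eqP ->.
  - by rewrite fps_coefXM.
have [d hd] := noethm_chain hR' Lmono.
have gens k : exists r (g : 'I_r -> S), (forall j, g j \in I /\ vt k (g j)) /\
    forall f, f \in I -> vt k f -> exists c : 'I_r -> R, f k = \sum_j c j * g j k.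
  have [r [a [aL ha]]] := fin_gens (L k) hR'.
  have ch j : {g : S | [/\ g \in I, vt k g & g k = a j]}.
    by apply: cid; have /inL := aL j.
  exists r, (fun j => sval (ch j)); split=> [j|f fI fk].
    by have [] := svalP (ch j).
  have [|b ->] := ha (f k); first by apply/inL; exists f.
  exists (fun j => b 0 j); apply: eq_bigr => j _.
  by have [_ _ ->] := svalP (ch j).
have step k : (k <= d)%N -> exists s : seq S, (forall x, x \in s -> x \in I) /\
    forall f, f \in I -> vt (d - k) f -> f \in idl s.
  elim: k => [|k IH] kd.
    have [r [g [gI gc]]] := gens d; exists [seq g j | j <- enum 'I_r]; split.
      by move=> _ /mapP[j _ ->]; have [] := gI j.
    rewrite subn0 => f fI fk.
    have [||n f1 f1I f1k|C ->] := @succ_approx R I r g d _ _ _ f fI fk.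
    - by move=> j; have [] := gI j.
    - by move=> j; have [] := gI j.
    - have /inL[f2 [f2I f2k e2]] : f1 (d + n)%N \in L d.
        by apply: (hd (d + n)%N); apply/inL; exists f1.
      by have [c ec] := gc f2 f2I f2k; exists c; rewrite -e2.
    - apply: ideal_sum => j _; apply: ideal_mull; apply: mem_idl; apply/mapP.
      by exists j; rewrite ?mem_enum.
  have [s [sI hs]] := IH (ltnW kd); have [r [g [gI gc]]] := gens (d - k.+1)%N.
  exists ([seq g j | j <- enum 'I_r] ++ s); split.
    by move=> x; rewrite mem_cat => /orP[/mapP[j _ ->]|/sI //]; have [] := gI j.
  move=> f fI fk; have [c ec] := gc f fI fk.
  rewrite -(subrK (\sum_j fpsC (c j) * g j) f); apply: idealD.
    apply: (@idl_sub _ s) => [x xs|]; first by rewrite mem_cat xs orbT.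
    apply: hs; first by apply: idealB => //; apply: ideal_sum => j _; apply: ideal_mull; have [] := gI j.
    have e : (d - k = (d - k.+1).+1)%N by lia.
    rewrite e => i; rewrite ltnS leq_eqVlt => /orP[/eqP ->|ik].
      rewrite fps_coefB ec fps_coef_sum; apply/eqP; rewrite subr_eq0; apply/eqP.
      by apply: eq_bigr => j _; rewrite fps_coefCM.
    rewrite fps_coefB fk // fps_coef_sum big1 ?subrr // => j _.
    by rewrite fps_coefCM (gI j).2 ?mulr0.
  apply: ideal_sum => j _; apply: ideal_mull; apply: mem_idl.
  by rewrite mem_cat; apply/orP; left; apply/mapP; exists j; rewrite ?mem_enum.
have [s [sI hs]] := step d (leqnn d); exists s; split=> // f fI.
rewrite -idgenE idgen_idl; apply: hs => //; by rewrite subnn.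
Qed.

Lemma fps_unit (f : S) : f 0%N \notin mR -> exists g, f * g = 1.
Proof.
move=> /hm.2[b hb].
have h3 n (f1 : S) : f1 \in topm S^o -> vt (0 + n) f1 ->
    exists c : 'I_1 -> R, f1 (0 + n)%N = \sum_j c j * f 0%N.
  by exists (fun=> f1 n * b); rewrite big_ord1 add0n -mulrA (mulrC b) hb mulr1.
have [||C] := @succ_approx R (topm S^o) 1 (fun=> f) 0 (fun=> in_topm _) _ h3 1 (in_topm _);
  try by [].
by rewrite big_ord1 mulrC => h; exists (C ord0).
Qed.

Lemma fps_max_subproof : @submod_set S S^o [set f | fps0 f \in mR].
Proof.
split=> [|a u v /= hu hv] /=; first exact: ideal0.
by rewrite rmorphD rmorphM; apply: idealD => //; exact: ideal_mull.
Qed.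
Definition fps_max : ideal S := mksubm fps_max_subproof.

Lemma fps_loc_ring : loc_ring fps_max.
Proof.
split=> [|f]; first by apply/negP => /inmkI /=; apply/negP; exact: hm.1.
by move=> hf; apply: fps_unit; apply: contra hf => h; apply/inmkI.
Qed.

Lemma fps_max_idl z : mR = idl z -> fps_max = idl (X :: [seq fpsC c | c <- z]).
Proof.
move=> mz; apply: subm_ext => [f /inmkI hf|].
  rewrite (fps_decomp f); apply: idealD.
    have /(idl_map (@fpsC R : {rmorphism R -> S})) : f 0%N \in idl z by rewrite -mz.
    by apply: idl_sub => x xz; rewrite inE xz orbT.
  by apply: ideal_mulr; apply: mem_idl; rewrite mem_head.
apply: idl_min => f; rewrite inE => /orP[/eqP ->|/mapP[c cz ->]]; apply/inmkI => /=.
  exact: ideal0.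
by rewrite mz; exact: mem_idl.
Qed.

Lemma fps_rseq z : @rseq R R^o (zerom R^o) z ->
  @rseq S S^o (zerom S^o) (X :: [seq fpsC c | c <- z]).
Proof.
move=> hz; split=> [v /in_zerom h|].
  apply/in_zerom/funext => n; have := congr1 (fun f : S => f n.+1) h.
  by rewrite -[_ *: _]/(X * v) fps_coefXM.
pose V := restr (@fps0 R : {rmorphism S -> R}) R^o.
have lf : linear (@fps0 R : S^o -> V).
  by move=> a u v; rewrite -[_ *: _]/(a * u) rmorphD rmorphM.
pose L := GRing.isLinear.Build S S^o V _ _ lf.
pose g := HB.pack_for {linear S^o -> V} (@fps0 R : S^o -> V) L.
have -> : adds (zerom S^o) X = pre g (zerom V).
  apply: subm_ext => f.
    move=> /in_adds[v /in_zerom/eqP]; rewrite subr_eq0 => /eqP ->; apply/in_pre/in_zerom.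
    by rewrite /= -[_ *: _]/(X * v) /fps0 fps_coefM big_ord1 mul0r.
  move=> /in_pre/in_zerom h; apply/in_adds; exists (fun n => f n.+1 : R).
  apply/in_zerom/eqP; rewrite subr_eq0; apply/eqP; rewrite {1}(fps_decomp f).
  have -> : f 0%N = 0 by exact: h.
  by rewrite rmorph0 add0r.
apply: rseq_pre => [v|]; first by exists (fpsC v).
apply: (@rseq_restr S R (@fps0 R : {rmorphism S -> R}) R^o (zerom V) (zerom R^o) _
  (@zerom_restr _ _ _ _)).
by rewrite -map_comp map_id_in.
Qed.
End FpsLocal.
(** * Presentations by power series rings *)

Section Evaluation.
Variables (A R : comNzRingType) (m : ideal A) (ev0 : {rmorphism R -> A}) (y : A).
Hypotheses (hA : noetherian A) (hm : loc_ring m) (hc : adic_complete m) (ym : y \in m).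
Local Notation I n := (ipow m A^o n).
Implicit Types f g : fps R.

Definition psum f n := \sum_(i < n) ev0 (f i) * y ^+ i.

Lemma y_ipow n (a : A) : y ^+ n * a \in I n.
Proof. exact: (@mem_ipow A A^o m y n a ym). Qed.

Lemma psum_lim f : {l | (forall n, l - psum f n \in I n) /\
  forall l', (forall n, l' - psum f n \in I n) -> l = l'}.
Proof.
apply: cid; have [n|l [h1 h2]] := @hc (psum f); last by exists l.
rewrite /psum big_ord_recr /= addrC addrK mulrC; exact: y_ipow.
Qed.

Definition fps_eval f : A := sval (psum_lim f).

Lemma fps_evalP f n : fps_eval f - psum f n \in I n.
Proof. exact: (svalP (psum_lim f)).1. Qed.

Lemma fps_evalE f l : (forall n, l - psum f n \in I n) -> fps_eval f = l.
Proof. exact: (svalP (psum_lim f)).2. Qed.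

Fact fps_eval_additive : zmod_morphism fps_eval.
Proof.
move=> f g; apply: fps_evalE => n.
have -> : psum (f - g) n = psum f n - psum g n.
  by rewrite /psum -sumrB; apply: eq_bigr => i _; rewrite fps_coefB rmorphB mulrBl.
have -> : fps_eval f - fps_eval g - (psum f n - psum g n) =
    (fps_eval f - psum f n) - (fps_eval g - psum g n) by ring.
by apply: idealB; exact: fps_evalP.
Qed.

Fact fps_eval_mult : monoid_morphism fps_eval.
Proof.
split=> [|f g]; apply: fps_evalE => n.
  case: n => [|n]; first exact/in_topm.
  rewrite /psum big_ord_recl [X in X * _]rmorph1 mul1r big1 ?addr0 ?subrr; first exact: ideal0.
  by move=> i _; rewrite /= rmorph0 mul0r.
pose P f : {poly A} := \poly_(i < n) ev0 (f i).
have PE h : (P h).[y] = psum h n.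
  rewrite (@horner_coef_wide _ n) ?size_poly //.
  by apply: eq_bigr => i _; rewrite coef_poly ltn_ord.
have hPQ : (P f * P g).[y] - psum (f * g) n \in I n.
  rewrite (@horner_coef_wide _ (n + n)); last first.
    apply: leq_trans (size_polyMleq _ _) _.
    have := size_poly n (fun i => ev0 (f i)); have := size_poly n (fun i => ev0 (g i)).
    by rewrite /P; lia.
  rewrite big_split_ord /= addrAC (_ : _ - _ = 0) ?add0r.
    apply: ideal_sum => i _; rewrite exprD mulrCA; exact: y_ipow.
  apply/eqP; rewrite subr_eq0; apply/eqP; apply: eq_bigr => i _; congr (_ * _).
  rewrite coefM fps_coefM rmorph_sum; apply: eq_bigr => j _.
  have := ltn_ord i; have := ltn_ord j => hj hi.
  by rewrite !coef_poly rmorphM; do 2!(case: ltnP => ?; last by lia).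
have -> : fps_eval f * fps_eval g - psum (f * g) n =
  (fps_eval f - psum f n) * fps_eval g + psum f n * (fps_eval g - psum g n) +
  (psum f n * psum g n - psum (f * g) n) by ring.
apply: idealD; last by rewrite -(PE f) -(PE g) -hornerM.
apply: idealD; first by apply: ideal_mulr; exact: fps_evalP.
by apply: ideal_mull; exact: fps_evalP.
Qed.
HB.instance Definition _ := GRing.isZmodMorphism.Build (fps R) A fps_eval fps_eval_additive.
HB.instance Definition _ := GRing.isMonoidMorphism.Build (fps R) A fps_eval fps_eval_mult.

Lemma fps_evalC c : fps_eval (fpsC c) = ev0 c.
Proof.
apply: fps_evalE => -[|n]; first exact/in_topm.
rewrite /psum big_ord_recl mulr1 big1 ?addr0 ?subrr; first exact: ideal0.
by move=> i _; rewrite /= rmorph0 mul0r.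
Qed.

Lemma fps_evalX : fps_eval (fpsX R) = y.
Proof.
apply: fps_evalE => -[|[|n]]; first exact/in_topm.
  rewrite /psum big_ord1 rmorph0 mul0r subr0 -[y]mulr1 -[y]expr1; exact: y_ipow.
rewrite /psum 2!big_ord_recl /= rmorph0 mul0r add0r rmorph1 mul1r expr1.
rewrite big1 ?addr0 ?subrr; first exact: ideal0.
by move=> i _; rewrite mul0r.
Qed.

(** Elements of [R + yA] modulo [J] are values of power series, by iteration. *)
Lemma fps_eval_gen (J : ideal A) : (forall a, exists r b, a - ev0 r - y * b \in J) ->
  forall a, exists f, a - fps_eval f \in J.
Proof.
move=> h a.
have ch b : {rb : R * A | b - ev0 rb.1 - y * rb.2 \in J}.
  by apply: cid; have [r [b' hb]] := h b; exists (r, b').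
pose b n := iter n (fun b => (sval (ch b)).2) a.
pose f : fps R := fun n => (sval (ch (b n))).1.
have hb n : a - psum f n - y ^+ n * b n \in J.
  elim: n => [|n IH].
    by rewrite /psum big_ord0 subr0 mul1r subrr ideal0.
  have := svalP (ch (b n)) => hn; have {hn} := ideal_mull (y ^+ n) hn.
  move=> /(idealD IH); congr (_ \in J).
  have bS : b n.+1 = (sval (ch (b n))).2 by [].
  have fn : f n = (sval (ch (b n))).1 by [].
  rewrite /psum big_ord_recr /= -/(psum f n) -bS -fn exprSr.
  by ring.
exists f; apply: (krull_intersection hm hA); first exact/noetherian_noethm.
move=> n; apply/in_addm; exists (a - psum f n - y ^+ n * b n) => //.
have -> : a - fps_eval f - (a - psum f n - y ^+ n * b n) =
  y ^+ n * b n - (fps_eval f - psum f n) by ring.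
by apply: idealB; [exact: y_ipow|exact: fps_evalP].
Qed.
End Evaluation.

(** The structure theorem for complete rings over [R]: the variables are added one
    by one and sent to the [ys], and completeness evaluates the power series. *)
Lemma cohen (A : comNzRingType) (m : ideal A) : noetherian A -> loc_ring m ->
  adic_complete m -> forall (ys : seq A) (R : comNzRingType) (mR : ideal R) (z : seq R)
    (ev0 : {rmorphism R -> A}), noetherian R -> loc_ring mR -> mR = idl z ->
  @rseq R R^o (zerom R^o) z -> {subset ys <= m} ->
  (forall a, exists r, a - ev0 r \in idl ys) ->
  exists (S : comNzRingType) (mS : ideal S) (T : seq S) (i : {rmorphism R -> S})
    (ev : {rmorphism S -> A}),
  [/\ noetherian S, loc_ring mS, mS = idl (T ++ map i z),
      @rseq S S^o (zerom S^o) (T ++ map i z) &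
      [/\ forall r, ev (i r) = ev0 r, map ev T = rev ys & forall a, exists s, ev s = a]].
Proof.
move=> hA hm hc; elim=> [|y ys IH] R mR z ev0 hR hmR mz rz ysm gen.
  exists R, mR, [::], idfun, ev0; rewrite map_id; split=> //; split=> // a.
  have [r /(@in_zerom A A^o)/eqP] := gen a; rewrite subr_eq0 => /eqP ->.
  by exists r.
have ym : y \in m by apply: ysm; exact: mem_head.
pose ev := fps_eval ev0 hc ym : {rmorphism fps R -> A}.
have ysm' : {subset ys <= m} by move=> a ha; apply: ysm; rewrite inE ha orbT.
have [a|S [mS [T [i [ev' [h1 h2 h3 h4 [h5 h6 h7]]]]]]] :=
    IH _ (fps_max mR) _ ev (fps_noetherian hR) (fps_loc_ring hmR)
    (fps_max_idl mz) (fps_rseq rz) ysm'.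
  apply: (@fps_eval_gen A R m ev0 y hA hm hc ym (idl ys)) => a'.
  have [r] := gen a'; rewrite /idl /= => h.
  have : a' - ev0 r \in @adds A A^o (idl ys) y.
    by move: h; rewrite addseq_adds.
  by move=> /(@in_adds A A^o)[b hb]; exists r, b.
exists S, mS, (rcons T (i (fpsX R))), (i \o @fpsC R), ev'.
have e : rcons T (i (fpsX R)) ++ map (i \o @fpsC R) z = T ++ map i (fpsX R :: map (@fpsC R) z).
  by rewrite cat_rcons /= -map_comp.
have evC r : ev (fpsC r) = ev0 r by exact: fps_evalC.
have evX : ev (fpsX R) = y by exact: fps_evalX.
rewrite e; split=> //; split=> [r||//]; first exact: etrans (h5 _) (evC r).
by rewrite map_rcons h6 h5 evX rev_cons.
Qed.
(** * Vanishing defect: splitting off a free module over a complete intersection *)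

Lemma filter_enum_ord n r : (r <= n)%N ->
  [seq i : 'I_n <- enum 'I_n | (r <= i)%N] = drop r (enum 'I_n).
Proof.
move=> rn; apply: (inj_map val_inj); rewrite map_drop val_enum_ord drop_iota.
rewrite -filter_map val_enum_ord -{1}(subnKC rn) iotaD filter_cat add0n.
rewrite (eq_in_filter (a2 := pred0)) ?filter_pred0; last first.
  by move=> i; rewrite mem_iota /= => ?; apply/negbTE; lia.
rewrite (eq_in_filter (a2 := predT)) ?filter_predT // => i.
by rewrite mem_iota => /andP[-> _].
Qed.

(** The block triangular matrix expressing [f], the free variables and [Y] in
    terms of the variables and the uniformizer. *)
Section BlockDet.
Variables (S : comNzRingType) (r s : nat) (H : nat -> nat -> S) (c : nat -> S) (g : S).
Definition blockf i j : S :=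
  if (i < r)%N then (if (j < r + s)%N then H i j else 0)
  else if (i < r + s)%N then (i == j)%:R
  else if (j < r + s)%N then c j else g.

Lemma det_blockf N : N = (r + s + 1)%N ->
  \det (\matrix_(i < N, j < N) blockf i j) = \det (\matrix_(i < r, j < r) H i j) * g.
Proof.
move=> ->.
have -> : \matrix_(i < r + s + 1, j < r + s + 1) blockf i j =
    block_mx (block_mx (\matrix_(i < r, j < r) H i j) (\matrix_(i < r, j < s) H i (r + j)%N)
        0 1%:M) 0 (\row_(j < r + s) c j) g%:M.
  apply/matrixP => i j; rewrite [LHS]mxE /blockf.
  rewrite -[i]splitK -[j]splitK; case: (fintype.split i) => i1; case: (fintype.split j) => j1;
    rewrite /= ?block_mxEul ?block_mxEur ?block_mxEdl ?block_mxEdr.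
  - rewrite !ltn_ord -[i1]splitK -[j1]splitK.
    case: (fintype.split i1) => i2; case: (fintype.split j1) => j2;
      rewrite /= ?block_mxEul ?block_mxEur ?block_mxEdl ?block_mxEdr !mxE ?ltn_ord //.
    + by rewrite ltnNge leq_addr /= gtn_eqF //; have := ltn_ord j2; lia.
    + by rewrite ltnNge leq_addr /= eqn_add2l.
  - have -> : (r + s + j1 < r + s)%N = false by apply/negbTE; lia.
    rewrite mxE ltn_ord; case: ifP => // _.
    by rewrite ltn_eqF //; have := ltn_ord i1; lia.
  - have -> : (r + s + i1 < r)%N = false by apply/negbTE; lia.
    have -> : (r + s + i1 < r + s)%N = false by apply/negbTE; lia.
    by rewrite mxE ltn_ord.
  - have -> : (r + s + i1 < r)%N = false by apply/negbTE; lia.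
    have -> : (r + s + i1 < r + s)%N = false by apply/negbTE; lia.
    have -> : (r + s + j1 < r + s)%N = false by apply/negbTE; lia.
    by rewrite !ord1 mxE eqxx mulr1n.
by rewrite det_lblock det_ublock det1 mulr1 det_scalar expr1.
Qed.
End BlockDet.

Section Vanishing.
Variables (O : idomainType) (w : O) (A : comAlgType O) (lam : {rmorphism A -> O}).
Hypotheses (hO : dvr O) (hw : uniformizer w) (lamK : forall x : O, lam x%:A = x).
Variable m : ideal A.
Hypotheses (hA : noetherian A) (hm : loc_ring m) (hc : adic_complete m).
Local Notation p := (kerI lam).
Local Notation lc y := (lincomb (y : _ -> A^o)).
Let w0 : w != 0 := (dvr_loc_ring hO hw).2.
Let pp : primeI p := kerI_prime lam.
Variable M : lmodType A.
Hypothesis hM : noethm M.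
Local Notation pM := (imul p (topm M)).
Variables (n r : nat) (k : nat -> nat) (y : 'I_n -> A) (mu : nat) (nb : 'I_mu -> M).
Local Notation xs := (free_gens r y).
Hypotheses (cot : cotangent w lam r k y) (xr : rseq (zerom M) xs)
  (xdep : dep m (addseq (zerom M) xs) 1) (hnb : tf_basis lam nb) (mu0 : (0 < mu)%N).
(** The elements of [M / xM] killed by [p] have their image in [w ^ K X]. *)
Hypothesis hL : forall v, (forall a, a \in p -> a *: v \in addseq (zerom M) xs) ->
  exists u (t : O), t != 0 /\ t%:A *: (v - (w ^+ (\sum_(i < r) k i))%:A *: u) \in pM.

(** In a power series ring [S] over [O] with variables [T] lifting [y], the relations
    [w ^ k_i y_i = sum_j q_ij y_j] lift to elements [f_i] of the kernel of [S -> A].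
    Together with lifts of an [M]-regular sequence they are obtained from the
    regular sequence [z = (T, w)] by a matrix [G], with [det G] acting like [a0 g].
    If the image of the elements killed by [p] is no larger than [w ^ K X], then
    [det G] keeps the basis [nb] independent, so [free_summand_criterion] makes [M]
    a module with free summand over [S / (f)]; hence [S / (f)] is [A]. *)
Lemma vanishing_splits : exists (S : comNzRingType) (ev : {rmorphism S -> A})
    (mS : ideal S) (z f xs' : seq S) (rho : {linear M -> 'rV[A]_mu}),
  [/\ noetherian S, loc_ring mS, mS = idl z, @rseq S S^o (zerom S^o) z &
  [/\ forall a, exists s, ev s = a,
      {subset f <= mS}, @rseq S S^o (zerom S^o) f,
      (forall s, ev s = 0 <-> s \in idl f) &
  [/\ forall i, rho (nb i) = delta_mx 0 i, size z = size (f ++ xs'),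
      {subset f ++ xs' <= mS}, @rseq S S^o (zerom S^o) (f ++ xs') &
      rseq (zerom M) (map ev xs')]]].
Proof.
have [rn yp ygen rel] := cot; have [q hq] := cotangent_rel lamK cot.
have [hloc _] := dvr_loc_ring hO hw.
have ym : {subset rev [seq y i | i <- enum 'I_n] <= m}.
  by move=> a; rewrite mem_rev => /mapP[i _ ->]; exact: (kerI_sub_max hm).
have rw : @rseq O O^o (zerom O^o) [:: w].
  split=> // v /in_zerom/eqP; rewrite -[_ *: _]/(w * (v : O)) mulf_eq0 (negPf w0) /=.
  by move/eqP => ->; apply/in_zerom.
have sgen a : exists o, a - in_alg A o \in idl (rev [seq y i | i <- enum 'I_n]).
  exists (lam a); have [b ->] := ygen _ (kerI_sub_lam lamK a).
  apply: ideal_sum => i _; apply: ideal_mull; apply: mem_idl.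
  by rewrite mem_rev map_f // mem_enum.
have [S [mS [T [io [ev [hS hmS mz rz [ev_io evT ev_s]]]]]]] :=
  cohen hA hm hc (dvr_noetherian hO) hloc (erefl _) rw ym sgen.
rewrite revK in evT; rewrite /= in mz rz.
have sT : size T = n by rewrite -(size_map ev) evT size_map size_enum_ord.
set z := T ++ [:: io w] in mz rz.
have sz : size z = n.+1 by rewrite size_cat sT addn1.
have zT i : (i < n)%N -> z`_i = T`_i by move=> lt; rewrite nth_cat sT lt.
have zn : z`_n = io w by rewrite nth_cat sT ltnn subnn.
have evz (i : 'I_n) : ev z`_i = y i.
  rewrite zT // -(nth_map _ 0) ?sT // evT (nth_map i) ?size_enum_ord //.
  by congr y; apply: val_inj; rewrite /= nth_enum_ord.
have [ys1 [sys1 ys1m rys1]] := xdep.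
have [ystar eys] : exists a, ys1 = [:: a] by case: ys1 sys1 {ys1m rys1} => [|a []] // _; exists a.
have ysm : ystar \in m by apply: ys1m; rewrite eys mem_head.
have ynz : nzd (addseq (zerom M) xs) ystar by move: rys1; rewrite eys => -[].
have unit_ev s : s \notin mS -> exists b, ev s * b = 1.
  by move=> /hmS.2[b hb]; exists (ev b); rewrite -rmorphM hb rmorph1.
have [Y eY] := ev_s ystar.
have Ym : Y \in mS.
  have [//|/unit_ev[b hb]] := boolP (Y \in mS); case/negP: hm.1.
  by rewrite -hb eY; exact: ideal_mulr.
have [c Yc] : exists c : nat -> S, Y = \sum_(i < size z) c i * z`_i.
  by move: Ym; rewrite mz => /in_idl.
rewrite sz big_ord_recr /= zn in Yc; set g := c n in Yc.
have hQ (i j : nat) : {x : S | forall i' j' : 'I_n, i = i' :> nat -> j = j' :> nat -> ev x = q i' 0 j'}.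
  apply: cid; case: (ltnP i n) => [lin|]; last first.
    by move=> h; exists 0 => i' j' ei; have := ltn_ord i'; lia.
  case: (ltnP j n) => [ljn|]; last first.
    by move=> h; exists 0 => i' j' _ ej; have := ltn_ord j'; lia.
  have [x hx] := ev_s (q (Ordinal lin) 0 (Ordinal ljn)); exists x => i' j' ei ej.
  by rewrite hx; congr (q _ 0 _); apply: val_inj.
pose H i j : S := io w ^+ k i *+ (i == j) - sval (hQ i j).
pose fi i := \sum_(j < n) H i j * z`_j.
pose f := mkseq fi r; pose Xs := drop r T; pose xs' := Xs ++ [:: Y].
have sXs : size Xs = (n - r)%N by rewrite size_drop sT.
have sfx : size z = size (f ++ xs') by rewrite !size_cat size_mkseq sXs sT /=; lia.
have evH (i j : 'I_n) : ev (H i j) = (w ^+ k i)%:A *+ (i == j) - q i 0 j.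
  by rewrite /H rmorphB rmorphMn rmorphXn ev_io -rmorphXn (svalP (hQ i j) i j).
have evf a : a \in f -> ev a = 0.
  move=> /mapP[i]; rewrite mem_iota add0n /= => ir ->.
  have lin : (i < n)%N by exact: leq_trans ir rn.
  have [_ /(_ ir) e] := hq (Ordinal lin).
  rewrite /fi rmorph_sum.
  rewrite (eq_bigr (fun j : 'I_n => (w ^+ k i)%:A * y j *+ (Ordinal lin == j) -
      q (Ordinal lin) 0 j * y j)).
    rewrite sumrB (bigD1 (Ordinal lin)) //= eqxx mulr1n big1 ?addr0 => [|j ji].
      by rewrite e subrr.
    by rewrite eq_sym (negPf ji).
  by move=> j _; rewrite rmorphM evz (evH (Ordinal lin) j) mulrBl mulrnAl.
have zm : {subset z <= mS} by move=> a az; rewrite mz; exact: mem_idl.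
have mzl : sle mS (idl z) by rewrite -mz; exact: sle_refl.
have fm : {subset f <= mS}.
  move=> _ /mapP[i _ ->]; apply: ideal_sum => j _; apply: ideal_mull.
  by apply: zm; rewrite mem_nth // sz ltnS ltnW.
have fxm : {subset f ++ xs' <= mS}.
  move=> a; rewrite !mem_cat inE => /orP[/fm //|/orP[/mem_drop aT|/eqP -> //]].
  by apply: zm; rewrite mem_cat aT.
pose G := \matrix_(i < size z, j < size z) blockf r (n - r) H c g i j.
have nE : (r + (n - r) = n)%N by lia.
have hG (i : 'I_(size z)) : (f ++ xs')`_i = \sum_j G i j * z`_j.
  under eq_bigr do rewrite mxE.
  transitivity (\sum_(j < n.+1) blockf r (n - r) H c g i j * z`_j); last first.
    exact: (congr1 (fun N => \sum_(j < N) blockf r (n - r) H c g i j * z`_j) (esym sz)).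
  rewrite big_ord_recr /= zn nth_cat size_mkseq /blockf nE ltnn.
  case: ltnP => ir.
    rewrite nth_mkseq // mul0r addr0 /fi; apply: eq_bigr => j _.
    by rewrite ltn_ord.
  rewrite nth_cat sXs; have := ltn_ord i; rewrite {2}sz ltnS leq_eqVlt => /orP[/eqP ein|lin].
    rewrite ein ltnn ltnn subnn /= Yc; congr (_ + _).
    by apply: eq_bigr => j _; rewrite ltn_ord.
  rewrite lin ifT; last by lia.
  rewrite nth_drop subnKC // (ltn_eqF lin) mul0r addr0.
  rewrite (bigD1 (Ordinal lin)) //= eqxx mul1r big1 ?addr0 ?zT // => j ji.
  have /negPf -> : (i : nat) != j by apply: contraNneq ji => e; apply/eqP/val_inj.
  by rewrite mul0r.
have [rg [gg [_ hgg]]] := fin_gens (topm M) hM.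
pose V := restr ev M.
have lcE q0 (v : 'I_q0 -> M) (a : 'rV[S]_q0) :
    lincomb (v : 'I_q0 -> V) a = lincomb v (map_mx ev a) :> M.
  by apply: eq_bigr => i _; rewrite mxE.
have liftv q0 (b : 'rV[A]_q0) : exists a : 'rV[S]_q0, map_mx ev a = b.
  exists (\row_j sval (cid (ev_s (b 0 j)))); apply/rowP => j; rewrite !mxE.
  exact: (svalP (cid (ev_s (b 0 j)))).
have gV (v : V) : exists a, lincomb (gg : _ -> V) a = v.
  have [b ->] := hgg v (in_topm _); have [a <-] := liftv _ b.
  by exists a; rewrite lcE.
have fV a (v : V) : a \in f -> a *: v = 0.
  by move=> /evf e; rewrite -[_ *: _]/(ev a *: (v : M)) e scale0r.
have evX : map ev Xs = xs.
  by rewrite /Xs map_drop evT /free_gens filter_enum_ord // map_drop.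
have evxs' : map ev xs' = xs ++ [:: ystar] by rewrite map_cat evX /= eY.
have rV' : rseq (zerom V) xs'.
  apply: (rseq_restr (@zerom_restr _ _ ev M)); rewrite evxs'; apply/rseq_cat.
  by split=> //=.
have hL' := hL; set K := (\sum_(i < r) k i)%N in hL'.
pose a0 := \det (torsion_mx cot q).
have lam_a0 : lam a0 = w ^+ K by apply: (lam_det_torsion_mx lamK) => i; exact: (hq i).1.
have ha0 a : a \in p -> a0 * a \in idl xs.
  by apply: det_torsion_mx_kills => i; [exact: (hq i).1|exact: (hq i).2].
have idlN a v : a \in idl xs -> a *: v \in addseq (zerom M) xs.
  have : sle (idl xs) (annv (addseq (zerom M) xs) v).
    by apply: idl_min => b hb; apply/in_annv; exact: mem_addseq.
  by move=> h /h/in_annv.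
have detG : ev (\det G) = a0 * ev g.
  rewrite /G det_blockf; last by rewrite sz nE addn1.
  rewrite rmorphM -det_map_mx; congr (\det _ * _); apply/matrixP => i j; rewrite !mxE.
  have -> := evH (widen_ord rn i) (widen_ord rn j).
  have e (l : 'I_r) : widen_ord (let: And4 rn0 _ _ _ := cot in rn0) l = widen_ord rn l.
    exact: val_inj.
  by rewrite !e -val_eqE.
have ystarE : ystar - ev g * w%:A \in p.
  rewrite -eY Yc rmorphD rmorphM ev_io addrK rmorph_sum; apply: ideal_sum => j _.
  by rewrite rmorphM evz; apply: ideal_mull; exact: yp.
have hdet (a : 'rV[S]_mu) : \det G *: lincomb (nb : _ -> V) a \in addseq (zerom V) xs' ->
    a \in vecI mS mu.
  rewrite (addseq_restr xs' (@zerom_restr _ _ ev M)) evxs' addseq_cat => /in_adds[v].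
  rewrite -[_ *: _]/(ev (\det G) *: (lincomb (nb : _ -> V) a : M)) lcE detG.
  set b := map_mx ev a; set N := addseq (zerom M) xs => hv.
  have h1 : a0 *: lincomb nb b - w%:A *: v \in N.
    apply: ynz.
    have -> : ystar *: (a0 *: lincomb nb b - w%:A *: v) =
        (a0 * (ystar - ev g * w%:A)) *: lincomb nb b +
        w%:A *: ((a0 * ev g) *: lincomb nb b - ystar *: v).
      rewrite !scalerBr !scalerA mulrBr scalerBl.
      rewrite (mulrC w%:A (a0 * ev g)) -mulrA (mulrC ystar a0) (mulrC ystar w%:A).
      by rewrite addrA subrK.
    by apply: rpredD; [apply: idlN; exact: ha0|apply: rpredZ; exact: hv].
  have h2 e : e \in p -> e *: v \in N.
    move=> he; apply: ynz; rewrite scalerA mulrC -scalerA.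
    rewrite -(@subm_eqmod _ _ N (e *: ((a0 * ev g) *: lincomb nb b))).
      have -> : e *: ((a0 * ev g) *: lincomb nb b) = (a0 * e) *: (ev g *: lincomb nb b).
        by rewrite !scalerA; congr (_ *: _); ring.
      by apply: idlN; exact: ha0.
    by rewrite -scalerBr rpredZ.
  have [u [t [t0 ht]]] := hL' _ h2.
  have [t' t'0 /(_ u)[beta hbeta]] := hnb.2.
  have h3 : (t * t' * w ^+ K)%:A *: lincomb nb (b - w%:A *: beta) \in pM.
    have xp : {subset xs <= p} by move=> e /mapP[i _ ->].
    have T1 := addseq_pM xp h1.
    have T2 := pM_scale_lam lamK a0 (lincomb nb b); rewrite lam_a0 in T2.
    pose x0 := (t%:A * t'%:A * (w ^+ K)%:A) *: lincomb nb b.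
    pose x1 := (t%:A * t'%:A * a0) *: lincomb nb b.
    pose x2 := (t%:A * t'%:A * w%:A) *: v.
    pose x3 := (t%:A * t'%:A * w%:A * (w ^+ K)%:A) *: u.
    pose x4 := (t%:A * t'%:A * w%:A * (w ^+ K)%:A) *: lincomb nb beta.
    have -> : (t * t' * w ^+ K)%:A *: lincomb nb (b - w%:A *: beta) = x0 - x4.
      rewrite linearB linearZ /= scalerBr scalerA.
      have inA (a1 b1 : O) : (a1 * b1)%:A = a1%:A * b1%:A :> A by exact: (rmorphM (in_alg A)).
      by rewrite !inA /x0 /x4; congr (_ - _ *: _); ring.
    have -> : x0 - x4 = (x0 - x1) + (x1 - x2) + (x2 - x3) + (x3 - x4).
      by rewrite !addrA !subrK.
    rewrite rpredD //; last first.
      have -> : x3 - x4 = (t%:A * w%:A * (w ^+ K)%:A) *: (t'%:A *: (u - lincomb nb beta)).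
        by rewrite scalerA scalerBr; congr (_ *: _ - _ *: _); ring.
      by rewrite rpredZ.
    rewrite rpredD //; last first.
      have -> : x2 - x3 = (t'%:A * w%:A) *: (t%:A *: (v - (w ^+ K)%:A *: u)).
        by rewrite scalerA scalerBr scalerA; congr (_ *: _ - _ *: _); ring.
      by rewrite rpredZ.
    rewrite rpredD //; last first.
      have -> : x1 - x2 = (t%:A * t'%:A) *: (a0 *: lincomb nb b - w%:A *: v).
        by rewrite scalerBr !scalerA.
      by rewrite rpredZ.
    have -> : x0 - x1 = - (t%:A * t'%:A) *: (a0 *: lincomb nb b - (w ^+ K)%:A *: lincomb nb b).
      by rewrite scaleNr scalerBr !scalerA opprB.
    by rewrite rpredZ.
  have h4 j : exists e, lam (b 0 j) = e * w.
    have := hnb.1 _ _ _ h3 j; rewrite !mulf_neq0 ?expf_neq0 // => /(_ isT).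
    rewrite !mxE rmorphB rmorphM lamK => /eqP; rewrite subr_eq0 => /eqP ->.
    by exists (lam (beta 0 j)); rewrite mulrC.
  apply/in_vecI => j; have [//|/unit_ev[e he]] := boolP (a 0 j \in mS).
  have [e' he'] := h4 j; have ub : lam (b 0 j) \is a GRing.unit.
    by apply/unitrPr; exists (lam e); rewrite -rmorphM mxE he rmorph1.
  by have := w_dvd_unit hO hw ub he'.
have [rfx [sv [sv1 sv2]]] := free_summand_criterion hmS hS (G := G) sfx zm mzl fxm rz hG gV
  fV rV' hdet mu0.
have rf : @rseq S S^o (zerom S^o) f by have [] := (rseq_cat _ _ _).1 rfx.
have ev_idl t : t \in idl f -> ev t = 0.
  move=> /in_idl[e ->]; rewrite rmorph_sum big1 // => i _.
  by rewrite rmorphM (evf f`_i) ?mulr0 // mem_nth.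
have chv x : {v : 'rV[S]_rg | lincomb (gg : _ -> V) v = x} by apply: cid; exact: gV.
pose rh (x : M) : 'rV[A]_mu := \row_j ev (dot (sval (chv x)) (sv j)).
have rhE v x : lincomb (gg : _ -> V) v = x -> forall j, rh x 0 j = ev (dot v (sv j)).
  move=> e j; rewrite mxE; apply/eqP; rewrite -subr_eq0 -rmorphB -dotBl; apply/eqP/ev_idl.
  by apply: sv1; rewrite linearB /= (svalP (chv x)) e subrr.
have lrh : linear rh.
  move=> a u v; apply/rowP => j; have [s es] := ev_s a.
  rewrite (rhE (s *: sval (chv u) + sval (chv v))).
    by rewrite dotDl dotZl rmorphD rmorphM es !mxE.
  by rewrite linearP /= (svalP (chv u)) (svalP (chv v)) -[s *: _]/(ev s *: _) es.
pose L := GRing.isLinear.Build A M 'rV[A]_mu _ rh lrh.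
exists S, ev, mS, z, f, xs', (HB.pack_for {linear M -> 'rV[A]_mu} rh L).
split=> //; split=> //.
  move=> t; split=> [et|]; last exact: ev_idl.
  pose i0 := Ordinal mu0; have [v hv] := gV (nb i0).
  have h1 := sv2 _ _ hv i0; rewrite eqxx in h1.
  have h2 : dot (t *: v) (sv i0) \in idl f.
    apply: sv1; transitivity (t *: lincomb (gg : _ -> V) v); first exact: linearZ.
    by rewrite hv -[_ *: _]/(ev t *: (nb i0 : M)) et scale0r.
  rewrite dotZl in h2.
  have -> : t = t * dot v (sv i0) - t * (dot v (sv i0) - 1) by ring.
  by apply: idealB => //; exact: ideal_mull.
split=> //; last by rewrite evxs'; apply/rseq_cat; split=> //=.
move=> i; apply/rowP => j /=; have [v hv] := gV (nb i).
rewrite (rhE _ _ hv) mxE eqxx /=.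
have := ev_idl _ (sv2 _ _ hv j); rewrite rmorphB rmorph_nat => /eqP.
by rewrite subr_eq0 => /eqP ->; rewrite eq_sym.
Qed.
End Vanishing.
(** * Chains of prime ideals *)

Section PrimeOfIdeal.
Variables (R : comNzRingType) (I : ideal R).

Definition prime_pred of primeI I : R -> bool := fun a => (a : R^o) \in I.
Fact prime_pred_idealr (h : primeI I) : idealr_closed (prime_pred h).
Proof.
split=> [||a u v]; rewrite /prime_pred !unfold_in.
- exact: ideal0.
- exact: h.1.
- by move=> hu hv; apply: idealD => //; exact: ideal_mull.
Qed.
HB.instance Definition _ (h : primeI I) :=
  isIdealr.Build R (prime_pred h) (prime_pred_idealr h).
Fact prime_pred_prime (h : primeI I) : prime_idealr_closed (prime_pred h).
Proof.
by move=> u v huv; apply/orP; case: (h.2 u v huv) => ?; [left|right].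
Qed.
HB.instance Definition _ (h : primeI I) :=
  isPrimeIdealrClosed.Build R (prime_pred h) (@prime_pred_prime h).
Definition prime_of (h : primeI I) : prime_idealr R :=
  PrimeIdealr.clone R (prime_pred h) _.

End PrimeOfIdeal.

Section IdealOfPrime.
Variables (R : comNzRingType) (P : prime_idealr R).
Lemma ideal_of_prime_subproof : @submod_set R R^o [set a | (a : R) \in P].
Proof.
split=> [|a u v /= hu hv]; first exact: idealr0.
by rewrite rpredD // -[_ *: _]/(a * (u : R)) prime_idealrM hu orbT.
Qed.
Definition ideal_of_prime : ideal R := mksubm ideal_of_prime_subproof.
Lemma in_ideal_of_prime a : (a \in ideal_of_prime) = (a \in P).
Proof.
have [h1 h2] := @inmk R R^o _ ideal_of_prime_subproof a.
by apply/idP/idP.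
Qed.
Lemma primeI_of_prime : primeI ideal_of_prime.
Proof.
split=> [|a b]; first by rewrite in_ideal_of_prime idealr1.
by rewrite !in_ideal_of_prime prime_idealrM => /orP.
Qed.
End IdealOfPrime.

(** An ideal maximal among those avoiding a multiplicative set is prime. *)
Lemma prime_avoiding (R : comNzRingType) (I : ideal R) (T : R -> Prop) : noetherian R ->
  T 1 -> (forall s t, T s -> T t -> T (s * t)) -> (forall a, T a -> a \notin I) ->
  exists P : ideal R, [/\ primeI P, sle I P & forall a, T a -> a \notin P].
Proof.
move=> hR T1 TM hI; have hR' : noethm R^o by exact/noetherian_noethm.
have [P [hP IP hmax]] := noethm_max (P := fun J : ideal R => forall a, T a -> a \notin J) hR' hI.
exists P; split=> //; split=> [|a b abP]; first exact: hP.
have key c : c \notin P -> exists2 t, T t & exists r, t - r * c \in P.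
  move=> /negP hc; apply: contrapT => h; apply: hc.
  apply: (hmax (@addv R R^o P c)); last exact: (@mem_addv R R^o).
    move=> t Tt; apply/negP => /(@in_addv R R^o)[r hr]; apply: h; exists t => //.
    by exists r.
  exact: (@sle_addv R R^o).
have [aP|/key[t Tt [r hr]]] := boolP (a \in P); first by left.
have [bP|/key[t' Tt' [r' hr']]] := boolP (b \in P); first by right.
have /negP[] := hP _ (TM _ _ Tt Tt').
have -> : t * t' = (t - r * a) * t' + r * a * (t' - r' * b) + r * r' * (a * b) by ring.
apply: idealD; last exact: ideal_mull.
by apply: idealD; [exact: ideal_mulr|exact: ideal_mull].
Qed.

Section LocalizedIdeals.
Variables (R : comNzRingType) (P : ideal R) (pP : primeI P).
Hypothesis hR : noetherian R.
Local Notation Q := (prime_of pP).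
Local Notation L := (locR Q).
Definition lfrac (a : R) (t : den Q) : L := Defs.frac (a : R^o) t.

Lemma lfracM a b t u : lfrac a t * lfrac b u = lfrac (a * b) (denM t u).
Proof. exact: loc_scaleE. Qed.
Lemma lfracD a b t u : lfrac a t + lfrac b u = lfrac ((u : R) * a + (t : R) * b) (denM t u).
Proof. exact: frac_add. Qed.
Lemma lfrac_eq a b t u : lfrac a t = lfrac b u <->
  exists2 s : R, s \notin P & s * ((u : R) * a) = s * ((t : R) * b).
Proof.
split=> [/frac_eq[s h]|[s sP h]]; first by exists (s : R) => //; exact: (valP s).
by apply/frac_eq; exists (@Den _ Q s sP).
Qed.
Lemma lfrac_surj (z : L) : exists a t, z = lfrac a t.
Proof. exact: (@Defs.frac_surj R Q R^o z). Qed.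
Lemma lfrac1 (t : den Q) : lfrac (t : R) t = 1.
Proof.
rewrite -[1]/(lfrac 1 (den1 Q)); apply/lfrac_eq; exists 1; first exact: pP.1.
by rewrite /=; ring.
Qed.

Section Ext.
Variable J : ideal R.
Lemma ext_subproof : @submod_set L L^o
  [set z | exists b t, b \in J /\ z = lfrac b t].
Proof.
split=> [|z u v [b [t [hb ->]]] [b' [t' [hb' ->]]]].
  by exists 0, (den1 Q); split; [exact: ideal0|].
have [r [q ->]] := lfrac_surj z.
exists ((t' : R) * (r * b) + (denM q t : R) * b'), (denM (denM q t) t'); split.
  by apply: idealD; apply: ideal_mull => //; exact: ideal_mull.
by rewrite -[_ *: _]/(lfrac r q * lfrac b t) lfracM lfracD.
Qed.
Definition ext : ideal L := mksubm ext_subproof.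

Lemma in_ext z : z \in ext <-> exists b t, b \in J /\ z = lfrac b t.
Proof. exact: (@inmk L L^o). Qed.

Lemma lfrac_ext a t : lfrac a t \in ext <-> exists2 s, s \notin P & s * a \in J.
Proof.
rewrite in_ext; split=> [[b [u [hb /lfrac_eq[s sP h]]]]|[s sP h]].
  exists (s * (u : R)); first by apply/negP => /pP.2[]; [exact/negP|exact/negP/(valP u)].
  by rewrite -mulrA h; apply: ideal_mull; exact: ideal_mull.
exists (s * a), (denM (@Den _ Q s sP) t); split=> //.
apply/lfrac_eq; exists 1; first exact: pP.1.
by rewrite !mul1r /=; ring.
Qed.
End Ext.

Lemma lfrac_ext_prime J a t : primeI J -> sle J P -> lfrac a t \in ext J <-> a \in J.
Proof.
move=> pJ JP; rewrite lfrac_ext; split=> [[s sP /pJ.2[/JP|//]]|h].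
  by rewrite (negPf sP).
by exists 1; [exact: pP.1|rewrite mul1r].
Qed.

Lemma loc_noetherian : noetherian L.
Proof.
apply/noetherian_noethm => I.
have hJ : @submod_set R R^o [set a | lfrac a (den1 Q) \in I].
  split=> [|a u v /= hu hv]; first exact: (ideal0 I).
  have -> : lfrac (a *: u + v) (den1 Q) =
      lfrac a (den1 Q) * lfrac u (den1 Q) + lfrac v (den1 Q).
    rewrite lfracM lfracD; apply/lfrac_eq; exists 1; first exact: pP.1.
    by rewrite /= /GRing.scale /=; ring.
  by apply: idealD => //; exact: ideal_mull.
have [s hs] := hR (mksubm hJ); exists [seq lfrac a (den1 Q) | a <- s].
have sI x : x \in s -> lfrac x (den1 Q) \in I.
  move=> xs; have : x \in mksubm hJ by rewrite hs idgen_idl; exact: mem_idl.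
  by move/inmkI.
split=> [_ /mapP[x /sI h ->] //|z zI].
have [a [t ez]] := lfrac_surj z.
have za : lfrac a (den1 Q) = lfrac (t : R) (den1 Q) * z.
  rewrite ez lfracM; apply/lfrac_eq; exists 1; first exact: pP.1.
  by rewrite /=; ring.
have : a \in mksubm hJ by apply/inmkI; rewrite /= za; exact: ideal_mull.
rewrite hs idgen_idl => /in_idl[r er].
rewrite -idgenE idgen_idl.
have -> : z = lfrac 1 t * lfrac a (den1 Q).
  rewrite lfracM ez; apply/lfrac_eq; exists 1; first exact: pP.1.
  by rewrite /=; ring.
apply: ideal_mull; rewrite er.
have sumE (F : 'I_(size s) -> R) : lfrac (\sum_i F i) (den1 Q) = \sum_i lfrac (F i) (den1 Q).
  apply: (big_morph (fun x => lfrac x (den1 Q))) => // x y.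
  rewrite lfracD; apply/lfrac_eq; exists 1; first exact: pP.1.
  by rewrite /=; ring.
rewrite sumE; apply: ideal_sum => i _.
have -> : lfrac (r i * s`_i) (den1 Q) = lfrac (r i) (den1 Q) * lfrac s`_i (den1 Q).
  by rewrite lfracM; apply/lfrac_eq; exists 1; [exact: pP.1|rewrite /=; ring].
by apply: ideal_mull; apply: mem_idl; apply: map_f; exact: mem_nth.
Qed.

Lemma ext_loc_ring : loc_ring (ext P).
Proof.
split=> [|z].
  rewrite -(lfrac1 (den1 Q)); apply/negP => /lfrac_ext[s sP].
  by rewrite mulr1 (negPf sP).
have [a [t ->]] := lfrac_surj z => h.
have aP : a \notin P.
  by apply: contra h => aP; apply/lfrac_ext; exists 1; [exact: pP.1|rewrite mul1r].
exists (lfrac (t : R) (@Den _ Q a aP)); rewrite lfracM.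
rewrite -(lfrac1 (den1 Q)); apply/lfrac_eq; exists 1; first exact: pP.1.
by rewrite /=; ring.
Qed.
End LocalizedIdeals.

Lemma mem_adds1 (R : comNzRingType) (I : ideal R) x : x \in @adds R R^o I x.
Proof. by have := @mem_adds R R^o I x (1 : R); rewrite -[_ *: _]/(x * 1) mulr1. Qed.

(** Krull's principal ideal theorem, in the form of an exchange: if [P2] were
    minimal over [P0 + (x)] then, in the localization at [P2], the ideal
    [P0 + (x)] and hence [P0 + (y)] for every [y] in [P1] outside of [P0] would
    contain a power of the maximal ideal. *)
Lemma prime_exchange (R : comNzRingType) (P0 P1 P2 : ideal R) x : noetherian R ->
  primeI P0 -> primeI P1 -> primeI P2 -> sle P0 P1 -> ~ sle P1 P0 -> sle P1 P2 ->
  ~ sle P2 P1 -> x \in P2 ->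
  exists P1', [/\ primeI P1', sle (@adds R R^o P0 x) P1', sle P1' P2,
    ~ sle P2 P1' & ~ sle P1' P0].
Proof.
move=> hR p0 p1 p2 h01 n10 h12 n21 xP2.
have memA (J : ideal R) : sle P0 J -> x \in J -> sle (@adds R R^o P0 x) J.
  by move=> h xJ; apply: adds_min => // v; exact: ideal_mulr.
have [xP0|xP0] := boolP (x \in P0).
  by exists P1; split=> //; apply: memA => //; exact: h01.
apply: contrapT => hno.
have hmin J : primeI J -> sle (@adds R R^o P0 x) J -> sle J P2 -> sle P2 J.
  move=> pJ hJ J2; apply: contrapT => h; apply: hno; exists J; split=> //.
  move=> JP0; move/negP: xP0; apply; apply: JP0; apply: hJ.
  exact: mem_adds1.
have hpow a : a \in P2 -> exists j t, t \notin P2 /\ t * a ^+ j \in @adds R R^o P0 x.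
  move=> aP2; apply: contrapT => h.
  pose T b := exists j t, t \notin P2 /\ b = t * a ^+ j.
  have [|b c [j [t [tP ->]]] [j' [t' [tP' ->]]]|b [j [t [tP eb]]]|J [pJ hJ TJ]] :=
      @prime_avoiding R (@adds R R^o P0 x) T hR.
  - by exists 0%N, 1; rewrite mulr1; split=> //; exact: p2.1.
  - exists (j + j')%N, (t * t'); split; last by rewrite exprD; ring.
    by apply/negP => /p2.2[]; exact/negP.
  - by apply/negP => hb; apply: h; exists j, t; rewrite -eb.
  have J2 : sle J P2.
    move=> b bJ; have [//|bP] := boolP (b \in P2).
    have tb : T b by exists 0%N, b; rewrite mulr1.
    by have := TJ b tb; rewrite bJ.
  have aJ : a \in J by exact: (hmin J pJ hJ J2).
  have /TJ : T a by exists 1%N, 1; rewrite mul1r expr1; split=> //; exact: p2.1.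
  by rewrite aJ.
have [y yP1 yP0] : exists2 y, y \in P1 & y \notin P0.
  apply: contrapT => h; apply: n10 => y yP1; have [//|yP0] := boolP (y \in P0).
  by case: h; exists y.
have h02 : sle P0 P2 by exact: sle_trans h01 h12.
pose fr a := lfrac a (den1 (prime_of p2)).
have hloc : loc_ring (ext p2 P2) by exact: ext_loc_ring.
have hnoe : noetherian (locR (prime_of p2)) by exact: loc_noetherian.
pose N : ideal _ := ext p2 P0.
have nz a : a \notin P0 -> @nzd _ (locR (prime_of p2))^o N (fr a).
  move=> aP0 z; have [b [t ->]] := lfrac_surj z.
  rewrite -[_ *: _]/(fr a * lfrac b t) lfracM => /(lfrac_ext_prime _ _ p0 h02).
  by move=> /p0.2[|h]; [rewrite (negPf aP0)|apply/lfrac_ext_prime].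
have frX a j : fr a ^+ j = fr (a ^+ j).
  elim: j => [|j IH]; first by apply: esym; exact: (lfrac1 (den1 (prime_of p2))).
  rewrite !exprS IH lfracM; apply/lfrac_eq; exists 1; first exact: p2.1.
  by rewrite /=; ring.
have c1 : cofin (ext p2 P2) (@adds _ (locR (prime_of p2))^o N (fr x)).
  move=> z v /in_ext[a [t [aP2 ->]]]; have [j [s [sP hs]]] := hpow a aP2.
  exists j; have hs' := hs; move: hs' => /(@in_adds R R^o)[r hr].
  have -> : @lfrac R P2 p2 a t ^+ j *: v = fr (a ^+ j) * (@lfrac R P2 p2 1 t ^+ j * v).
    rewrite -[_ *: _]/(@lfrac R P2 p2 a t ^+ j * v) mulrA -frX -exprMn; congr (_ ^+ _ * _).
    by rewrite lfracM; apply/lfrac_eq; exists 1; [exact: p2.1|rewrite /=; ring].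
  apply: ideal_mulr; apply/(@in_adds _ (locR (prime_of p2))^o).
  exists (@lfrac R P2 p2 r (@Den _ (prime_of p2) s sP)).
  apply/in_ext; exists (s * a ^+ j - x * r), (@Den _ (prime_of p2) s sP); split=> //.
  rewrite -[_ *: _]/(fr x * _) lfracM -[- lfrac _ _]mulN1r.
  have -> : -1 = fr (-1).
    apply/eqP; rewrite eq_sym -addr_eq0 -(lfrac1 (den1 (prime_of p2))) lfracD; apply/eqP.
    rewrite -[0]/(fr 0); apply/lfrac_eq; exists 1; first exact: p2.1.
    by rewrite /=; ring.
  rewrite lfracM lfracD; apply/lfrac_eq; exists 1; first exact: p2.1.
  by rewrite /=; ring.
have hnoe' : noethm (locR (prime_of p2))^o by exact/noetherian_noethm.
have xext : fr x \in ext p2 P2 by apply/in_ext; exists x, (den1 (prime_of p2)).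
have c2 := cofin_exchange hloc hnoe hnoe' xext (nz x xP0) (nz y yP0) c1.
apply: n21 => a aP2.
have aext : fr a \in ext p2 P2 by apply/in_ext; exists a, (den1 (prime_of p2)).
have [j] := c2 (fr a) (1 : locR _) aext.
rewrite -[_ *: _]/(fr a ^+ j * 1) mulr1 frX => /(@in_adds _ (locR (prime_of p2))^o)[z].
have [r [t ->]] := lfrac_surj z; rewrite -[_ *: _]/(fr y * lfrac r t) lfracM => h.
have hP1 : fr (a ^+ j) \in ext p2 P1.
  rewrite -(subrK (@lfrac R P2 p2 (y * r) (denM (den1 (prime_of p2)) t)) (fr (a ^+ j))).
  apply: idealD.
    move: h => /in_ext[b [u [hb ->]]]; apply/in_ext; exists b, u; split=> //.
    exact: h01.
  by apply/lfrac_ext_prime => //; exact: ideal_mulr.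
have /(lfrac_ext_prime _ _ p1 h12) := hP1.
exact: primeI_exp.
Qed.

Section Dimension.
Variables (R : comNzRingType) (m : ideal R).
Hypotheses (hR : noetherian R) (hm : loc_ring m).

(** A strictly descending chain of [n + 1] primes from [P], all containing [I]. *)
Fixpoint pch (I P : ideal R) n : Prop := primeI P /\
  if n is n'.+1 then exists P', [/\ pch I P' n', sle P' P & ~ sle P P'] else sle I P.

Lemma pch_prime I P n : pch I P n -> primeI P.
Proof. by case: n => [|n] []. Qed.

Lemma pch_sle I P n : pch I P n -> sle I P.
Proof.
elim: n P => [|n IH] P []; first by [].
by move=> _ [P' [/IH h h' _]]; exact: sle_trans h h'.
Qed.

(** Krull's theorem pushes all members of a chain but the top above [x], from the
    top down, at the cost of the lowest one. *)
Lemma pch_step (I P : ideal R) n (x : R) : pch I P n.+1 -> x \in P -> pch (@adds R R^o I x) P n.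
Proof.
elim: n P => [|n IH] P [pP [P1 [h1 h1P nP1]]] xP.
  split=> //; apply: adds_min => [|v]; last exact: ideal_mulr.
  by apply: sle_trans h1P; exact: h1.2.
split=> //; have [p1 [P2 [h2 h21 n12]]] := h1.
have [P1' [pP1' hx h1'P nP nP2]] := prime_exchange hR (pch_prime h2) p1 pP h21 n12 h1P nP1 xP.
exists P1'; split=> //; apply: IH.
  split=> //; exists P2; split=> //.
  by apply: sle_trans hx; exact: sle_adds.
by apply: hx; exact: mem_adds1.
Qed.

Lemma pch_addseq I (P : ideal R) n (q : seq R) : {subset q <= P} -> pch I P (size q + n) ->
  pch (@addseq R R^o I q) P n.
Proof.
elim: q I => [|x q IH] I //= hq h; apply: IH => [y hy|].
  by apply: hq; rewrite inE hy orbT.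
by apply: pch_step => //; apply: hq; exact: mem_head.
Qed.

Lemma pch_bottom I P n : pch I P n -> exists Q, [/\ primeI Q, sle I Q & pch Q P n].
Proof.
elim: n P => [|n IH] P [pP]; first by exists P; split=> //; split.
move=> [P' [/IH[Q [pQ IQ h]] h1 h2]]; exists Q; split=> //.
by split=> //; exists P'.
Qed.

Lemma pch_extend (I J P : ideal R) n : pch J P n -> primeI I -> sle I J -> ~ sle J I -> pch I P n.+1.
Proof.
move=> + pI IJ JI; elim: n P => [|n IH] P [pP].
  move=> JP; split=> //; exists I; split; first by split=> //; exact: sle_refl.
    exact: sle_trans IJ JP.
  by move=> h; apply: JI; exact: sle_trans JP h.
move=> [P' [/IH h h1 h2]]; split=> //; by exists P'.
Qed.

Lemma primeI_max : primeI m.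
Proof.
split=> [|a b ab]; first exact: hm.1.
have [am|/hm.2[a' ha]] := boolP (a \in m); first by left.
by right; rewrite -[b]mul1r -ha (mulrC a) -mulrA; exact: ideal_mull.
Qed.

Lemma prime_sub_max (P : ideal R) : primeI P -> sle P m.
Proof.
move=> pP a aP; have [//|/hm.2[b hb]] := boolP (a \in m).
by case/negP: pP.1; rewrite -hb; exact: ideal_mulr.
Qed.

Lemma pch_max I P n : pch I P n -> pch I m n.
Proof.
case: n => [|n] [pP]; first by move=> IP; split; [exact: primeI_max|
  exact: sle_trans IP (prime_sub_max pP)].
move=> [P' [h h1 h2]]; split; first exact: primeI_max.
exists P'; split=> //; first exact: prime_sub_max (pch_prime h).
by move=> h'; apply: h2; exact: sle_trans (prime_sub_max pP) h'.
Qed.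

Lemma pch_upper (I : ideal R) (q : seq R) : {subset q <= m} -> cofin m (@addseq R R^o I q) ->
  ~ pch I m (size q).+1.
Proof.
move=> qm hc; rewrite -addn1 => /(pch_addseq qm)[_ [P [h Pm mP]]]; apply: mP => a am.
have [j] := hc a 1 am; rewrite -[_ *: _]/(a ^+ j * 1) mulr1 => ha.
by exact: (primeI_exp h.1 (h.2 _ ha)).
Qed.

(** A prime [J] containing the first entries and avoiding the powers of [x] exists
    because [x] is a nonzerodivisor modulo these entries. *)
Lemma pch_lower (I : ideal R) (q : seq R) (P : ideal R) : @rseq R R^o I q -> primeI P -> sle (@addseq R R^o I q) P ->
  pch I P (size q).
Proof.
elim/last_ind: q P => [|q x IH] P; first by move=> _ pP h; split.
rewrite -cats1 => /rseq_cat[hr [nx _]] pP; rewrite addseq_cat /= => hP.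
rewrite size_cat addn1; split=> //.
pose T b := exists j s, s \notin P /\ b = s * x ^+ j.
have [|b c [j [t [tP ->]]] [j' [t' [tP' ->]]]|b [j [t [tP ->]]]|J [pJ hJ TJ]] :=
    @prime_avoiding R (@addseq R R^o I q) T hR.
- by exists 0%N, 1; rewrite mulr1; split=> //; exact: pP.1.
- exists (j + j')%N, (t * t'); split; last by rewrite exprD; ring.
  by apply/negP => /pP.2[]; exact/negP.
- apply/negP; rewrite mulrC => /(nzd_exp nx) h; move/negP: tP; apply.
  by apply: hP; apply: (@sle_adds R R^o).
have xT : T x by exists 1%N, 1; rewrite mul1r expr1; split=> //; exact: pP.1.
exists J; split; first exact: IH.
  move=> b bJ; have [//|bP] := boolP (b \in P).
  have tb : T b by exists 0%N, b; rewrite mulr1.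
  by have := TJ b tb; rewrite bJ.
move=> /(_ x) h; have /negP := TJ x xT; apply; apply: h; apply: hP.
exact: mem_adds1.
Qed.

(** Some generator [x] avoids the bottom [Q] of a longest chain. Modulo [x] both [I]
    and [Q] satisfy the hypotheses in one dimension less, so [I + (x)] is prime and
    contains [Q], and [Q = I + x Q] gives [Q = I] by Nakayama. *)
Lemma regular_rseq (I : ideal R) (q : seq R) : {subset q <= m} -> sle m (@addseq R R^o I q) -> pch I m (size q) ->
  primeI I /\ @rseq R R^o I q.
Proof.
have hR' : noethm R^o by exact/noetherian_noethm.
move: {2}(size q) (erefl (size q)) => d; elim: d q I => [|d IH] q I.
  move=> /size0nil -> _ /= mI [pm Im]; split=> //.
  by have -> : I = m by apply: subm_ext.
move=> sq qm mI h; have [Q [pQ IQ hQ]] := pch_bottom h.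
have [x xq xQ] : exists2 x, x \in q & x \notin Q.
  apply: contrapT => hno; rewrite sq in hQ; have [_ [P' [hP' _ mP']]] := hQ.
  apply: mP'; apply: sle_trans mI _; apply: addseq_min; first exact: sle_trans IQ (pch_sle hP').
  move=> a v aq; apply: ideal_mulr; apply: (pch_sle hP').
  by have [//|aQ] := boolP (a \in Q); case: hno; exists a.
have pe := perm_to_rem xq; set q' := rem x q in pe.
have sq' : size q' = d by rewrite size_rem // sq.
have q'm : {subset q' <= m} by move=> a /mem_rem; exact: qm.
have xm : x \in m by exact: qm.
have hpe J : @addseq R R^o J q = @addseq R R^o (@adds R R^o J x) q'.
  rewrite -[RHS]/(@addseq R R^o J (x :: q')); apply: subm_ext; apply: addseq_sub => a;
  by rewrite (perm_mem pe).
have st J : sle I J -> pch J m (size q) -> primeI (@adds R R^o J x) /\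
    @rseq R R^o (@adds R R^o J x) q'.
  move=> IJ hJ; apply: IH => //.
    by rewrite -hpe; apply: sle_trans mI _; exact: addseq_mono.
  by rewrite sq'; apply: pch_step => //; rewrite -sq.
have [pIx rIx] := st I (@sle_refl _ _ _) h; have [pQx rQx] := st Q IQ hQ.
have QIx : sle Q (@adds R R^o I x).
  apply: contrapT => hn.
  have : pch (@adds R R^o I x) m (size q').+1.
    apply: (@pch_extend _ (@adds R R^o Q x)) => //.
    - by rewrite sq'; apply: pch_step => //; rewrite -sq.
    - exact: adds_mono.
    - by move=> h'; apply: hn; exact: sle_trans (@sle_adds _ _ _ _) h'.
  apply: pch_upper => //; rewrite -hpe => a v /mI am; exists 1%N.
  by rewrite expr1; exact: ideal_mulr.
have IQe : I = Q.
  apply: subm_ext => //; apply: (nakayama1 hm hR' xm) => b bQ.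
  have /(@in_adds R R^o)[v hv] := QIx b bQ; exists v => //.
  have : x * v \in Q by rewrite -(ideal_eqmod (IQ _ hv)).
  by move=> /pQ.2[|//]; rewrite (negPf xQ).
have pI : primeI I by rewrite IQe.
have xqm : {subset x :: q' <= m} by move=> a; rewrite inE => /orP[/eqP ->|/q'm].
have pe' : perm_eq (x :: q') q by rewrite perm_sym.
have rx : @rseq R R^o I (x :: q').
  split=> // v; rewrite -[_ *: _]/(x * (v : R)) => /pI.2[|//].
  by rewrite IQe (negPf xQ).
by split=> //; apply: (rseq_perm (m := m)) pe' rx.
Qed.

Lemma prime_chain_pch n : prime_chain R n <-> exists P, pch (zerom R^o) P n.
Proof.
split=> [[P hP]|].
  exists (ideal_of_prime (P n)); elim: n hP => [|n IH] hP.
    by split; [exact: primeI_of_prime|exact: zerom_sle].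
  split; first exact: primeI_of_prime.
  exists (ideal_of_prime (P n)); have [h1 h2] := hP n (ltnSn n); split.
  - by apply: IH => i ni; apply: hP; lia.
  - by move=> a; rewrite !in_ideal_of_prime; exact: h1.
  - by move=> h; apply: h2 => a; have := h a; rewrite !in_ideal_of_prime.
suff H P : pch (zerom R^o) P n -> exists Pf : nat -> prime_idealr R, Pf n =i P /\
    forall i, (i < n)%N -> {subset Pf i <= Pf i.+1} /\ ~ {subset Pf i.+1 <= Pf i}.
  by move=> [P /H[Pf [_ h]]]; exists Pf.
elim: n P => [|n IH] P [pP]; first by move=> _; exists (fun=> prime_of pP).
move=> [P' [/IH[Pf [e hPf]] h1 h2]].
exists (fun i => if (i <= n)%N then Pf i else prime_of pP); rewrite ltnn; split=> // i.
rewrite ltnS => ni; rewrite ni; case: (ltnP i n) => lin; first exact: hPf.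
have -> : i = n by lia.
split=> [a|h]; first by rewrite e; exact: h1.
by apply: h2 => a aP; rewrite -e; exact: h.
Qed.

Lemma krull_dim_rseq (q : seq R) : {subset q <= m} -> @rseq R R^o (zerom R^o) q ->
  cofin m (idl q) -> krull_dim R (size q).
Proof.
move=> qm hr hc; split.
  apply/prime_chain_pch; exists m; apply: pch_lower => //; first exact: primeI_max.
  by apply: idl_min.
by move=> /prime_chain_pch[P /pch_max]; exact: pch_upper.
Qed.

Lemma krull_dim_regular (q : seq R) : {subset q <= m} -> sle m (idl q) -> krull_dim R (size q) ->
  @rseq R R^o (zerom R^o) q.
Proof.
move=> qm mq [/prime_chain_pch[P /pch_max h] _].
by have [] := regular_rseq qm mq h.
Qed.

Lemma krull_dim_uniq d d' : krull_dim R d -> krull_dim R d' -> d = d'.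
Proof.
have mono a b : (a <= b)%N -> prime_chain R b -> prime_chain R a.
  by move=> ab [P hP]; exists P => i ia; apply: hP; exact: leq_trans ab.
move=> [h1 h2] [h1' h2']; case: (ltngtP d d') => // lt.
  by case: h2; exact: mono lt h1'.
by case: h2'; exact: mono lt h1.
Qed.
End Dimension.
(** * From vanishing defect to the structure of the module *)

Section SplitStructure.
Variables (O : idomainType) (A : comAlgType O) (lam : {rmorphism A -> O}).
Variable M : lmodType A.

(** A retraction [rho] sending a basis of the torsion-free quotient to the standard
    basis splits [M]; its kernel dies at the prime [p] because the basis generates
    [M] up to elements outside of [p]. *)
Lemma retraction_splits mu (nb : 'I_mu -> M) (rho : {linear M -> 'rV[A]_mu}) :
  (forall i, rho (nb i) = delta_mx 0 i) ->
  (exists2 s, s \notin kerI lam & forall v, exists b, s *: v = lincomb nb b) ->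
  exists W : lmodType A,
    isom M ('rV[A]_mu * W)%type /\ (forall x : loc (kerP lam) W, x = 0).
Proof.
move=> hrho [s sp hs].
have rhoE b : rho (lincomb nb b) = b.
  rewrite /lincomb linear_sum [RHS]row_sum_delta; apply: eq_bigr => i _.
  by rewrite linearZ hrho.
pose W := kerm rho.
have hW v : v - lincomb nb (rho v) \in W.
  have e : rho (v - lincomb nb (rho v)) = 0 by rewrite (linearB rho) rhoE subrr.
  by apply: (inmk (kerm_subproof rho) _).2.
exists (subm W); split.
  pose f v : 'rV[A]_mu * subm W := (rho v, Subm (hW v)).
  have flin : linear f.
    move=> a u v; congr (_, _); first exact: linearP.
    apply: val_inj => /=; rewrite (linearP rho) (linearP (lincomb nb)).
    by rewrite scalerBr opprD addrACA.
  pose F : {linear M -> ('rV[A]_mu * subm W)%type} :=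
    HB.pack f (GRing.isLinear.Build A M ('rV[A]_mu * subm W)%type _ f flin).
  exists F; exists (fun u => lincomb nb u.1 + val u.2) => [v|[b [u uW]]] /=.
    by rewrite addrC subrK.
  have u0 : rho u = 0 by exact: ((inmk (kerm_subproof rho) u).1 uW).
  congr (_, _); first by rewrite linearD rhoE u0 addr0.
  by apply: val_inj; rewrite /= linearD rhoE u0 addr0 addrC addKr.
move=> x; have [u [t ->]] := frac_surj x; apply/frac_eq0; exists s.
  by rewrite kerP_kerI.
apply: val_inj => /=; have [b eb] := hs (val u).
have u0 : rho (val u) = 0 by case: u eb => u uW _; exact: ((inmk (kerm_subproof rho) u).1 uW).
have := rhoE b; rewrite -eb linearZ /= u0 scaler0 => b0.
by rewrite -[LHS]/(s *: val u) eb -b0 linear0.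
Qed.
End SplitStructure.

Lemma regular_local_rseq (S : comNzRingType) (mS : ideal S) (z : seq S) :
  noetherian S -> loc_ring mS -> mS = idl z -> @rseq S S^o (zerom S^o) z ->
  regular_local S (size z).
Proof.
move=> hS hm mz rz; have zm : {subset z <= mS} by move=> a az; rewrite mz; exact: mem_idl.
split=> //; split.
  apply: (krull_dim_rseq hS hm) => // a v am; exists 1%N; rewrite expr1.
  by apply: ideal_mulr; rewrite -mz.
exists mS; split; first exact: loc_ring_local.
by exists z; split=> // a; rewrite mz idgen_idl.
Qed.

Lemma regular_quotient_ci (S A : comNzRingType) (ev : {rmorphism S -> A}) (mS : ideal S)
    (z f : seq S) :
  noetherian S -> loc_ring mS -> mS = idl z -> @rseq S S^o (zerom S^o) z ->
  (forall a, exists s, ev s = a) -> {subset f <= mS} -> @rseq S S^o (zerom S^o) f ->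
  (forall s, ev s = 0 <-> s \in idl f) -> complete_intersection A.
Proof.
move=> hS hm mz rz hev fm rf hker; exists S, ev, f; split=> //.
- by exists (size z); apply: (regular_local_rseq hS hm mz rz).
- apply/regular_seqE; split=> //; exists (1 : S^o).
  by apply/negP => /(idl_min (I := mS) fm); exact/negP/hm.1.
- move=> q; have e := idgen_idl f q.
  by split=> [/hker h|h]; [rewrite e|apply/hker; rewrite -e].
Qed.
(** * Complete intersections have vanishing defect *)

(** The last coefficient is a combination of the other entries, as the last entry is
    a nonzerodivisor; substituting it gives a relation between those. *)
Lemma rseq_relations (R : comNzRingType) (V : lmodType R) (N : submodClosed V) q (v : nat -> V) :
  rseq N q -> \sum_(i < size q) q`_i *: v i \in N ->
  forall i, (i < size q)%N -> v i \in addseq N q.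
Proof.
elim/last_ind: q v => [|q x IH] v // /[dup] hr.
rewrite -cats1 => /rseq_cat[hq [nx _]] hv.
rewrite addseq_cat /=.
rewrite size_cat addn1 big_ord_recr /= nth_cat ltnn subnn /= in hv.
rewrite (eq_bigr (fun i : 'I_(size q) => q`_i *: v i)) in hv; last first.
  by move=> i _; rewrite nth_cat ltn_ord.
have vx : v (size q) \in addseq N q.
  apply: nx; set S := \sum_(i < size q) _ in hv.
  have SN : S \in addseq N q.
    by apply: rpred_sum => i _; apply: mem_addseq; exact: mem_nth.
  by rewrite -(addKr S (x *: v (size q))); apply: rpredD; [exact: subm_opp|exact: sle_addseq hv].
have [v' hv'] := (in_addseq N q _).1 vx.
have h i : (i < size q)%N -> v i + x *: v' i \in addseq N q.
  apply: (IH (fun i => v i + x *: v' i) hq).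
  have -> : \sum_(i < size q) q`_i *: (v i + x *: v' i) =
      (\sum_(i < size q) q`_i *: v i + x *: v (size q)) -
      x *: (v (size q) - \sum_(i < size q) q`_i *: v' i).
    rewrite scalerBr opprB [RHS]addrCA addrK [RHS]addrC scaler_sumr -big_split /=.
    by apply: eq_bigr => t _; rewrite scalerDr !scalerA (mulrC x).
  by apply: rpredD => //; apply: subm_opp; exact: rpredZ.
rewrite size_cat addn1 => i; rewrite ltnS leq_eqVlt => /orP[/eqP ->|lt].
  exact: (@sle_adds _ _ _ x).
rewrite -(addrK (x *: v' i) (v i)); apply: rpredB; last exact: mem_adds.
by apply: (@sle_adds _ _ _ x); exact: h.
Qed.

Section MaximalSequences.
Variables (R : comNzRingType) (m : ideal R).
Hypotheses (hR : noetherian R) (hm : loc_ring m).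

Lemma rseq_size_leq (q : seq R) d : {subset q <= m} -> @rseq R R^o (zerom R^o) q ->
  krull_dim R d -> (size q <= d)%N.
Proof.
move=> qm hr [_ hd]; rewrite leqNgt; apply/negP => lt; apply: hd.
have : prime_chain R (size q).
  apply/prime_chain_pch; exists m; apply: pch_lower => //; first exact: (primeI_max hm).
  exact: idl_min.
by move=> [P hP]; exists P => i id; apply: hP; exact: leq_trans id lt.
Qed.

(** Otherwise a prime containing [q] and avoiding the powers of some [a] in [m] would
    be the last but one member of a chain of length greater than the dimension. *)
Lemma krull_dim_cofin (q : seq R) : {subset q <= m} -> @rseq R R^o (zerom R^o) q ->
  krull_dim R (size q) -> cofin m (idl q).
Proof.
move=> qm hr [_ hd] a v am; apply: contrapT => hno.
have hno' j : a ^+ j \notin idl q.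
  by apply/negP => h; apply: hno; exists j; exact: ideal_mulr.
have [|s t [i ->] [j ->]|s [i ->]|J [pJ qJ hJ]] :=
    @prime_avoiding R (idl q) (fun b => exists j, b = a ^+ j) hR.
- by exists 0%N.
- by exists (i + j)%N; rewrite exprD.
- exact: hno'.
apply: hd; apply/prime_chain_pch; exists m; split; first exact: (primeI_max hm).
exists J; split; first exact: pch_lower.
  exact: prime_sub_max.
by move=> mJ; have := hJ a; rewrite mJ // => h; have /h : exists j, a = a ^+ j by exists 1%N.
Qed.
End MaximalSequences.

Section RegularKernel.
Variables (Q : comNzRingType) (mQ : ideal Q).
Hypotheses (hQ : noetherian Q) (hm : loc_ring mQ).
Variables (O : idomainType) (w : O) (phi : {rmorphism Q -> O}).
Hypotheses (hO : dvr O) (hw : uniformizer w) (phiT : forall x, exists a, phi a = x).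
Hypothesis (phim : forall a, a \in mQ -> exists e, phi a = e * w).

Lemma kerphi_subproof : @submod_set Q Q^o [set a | phi a = 0].
Proof.
split=> [|a u v /= hu hv]; first exact: rmorph0.
by rewrite /= rmorphD rmorphM hu hv mulr0 addr0.
Qed.
Definition kerphi : ideal Q := mksubm kerphi_subproof.
Lemma in_kerphi a : a \in kerphi <-> phi a = 0.
Proof. exact: (@inmk Q Q^o _ kerphi_subproof a). Qed.

Lemma kerphi_max : sle kerphi mQ.
Proof.
move=> a /in_kerphi a0; have [//|/hm.2[b hb]] := boolP (a \in mQ).
by move/eqP: (rmorph1 phi); rewrite -hb rmorphM a0 mul0r eq_sym oner_eq0.
Qed.

(** Some generator of the maximal ideal maps to a uniformizer, and subtracting
    multiples of it moves the other ones into the kernel; these generate the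
    kernel by Nakayama. *)
Lemma regular_kernel_gens (v : seq Q) : mQ = idl v -> exists (u : seq Q) (v0 : Q),
  [/\ (size u).+1 = size v, {subset u <= kerphi}, sle kerphi (@idl Q u), v0 \in mQ &
      mQ = idl (u ++ [:: v0])].
Proof.
move=> mv; have [hloc w0] := dvr_loc_ring hO hw.
have vm : {subset v <= mQ} by move=> a av; rewrite mv; exact: mem_idl.
have [x xv [e eu ex]] : exists2 x, x \in v & exists2 e, e \is a GRing.unit & phi x = e * w.
  apply: contrapT => hno; have [W eW] := phiT w.
  have WmQ : W \in mQ.
    have [//|/hm.2[b hb]] := boolP (W \in mQ); case/negP: hloc.1.
    by rewrite -(rmorph1 phi) -hb rmorphM eW; apply/in_idl1; exists (phi b); rewrite mulrC.
  have : phi W \in idl [:: w * w].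
    have : phi W \in idl [seq phi c | c <- v] by apply: idl_map; rewrite -mv.
    apply: idl_min => _ /mapP[c cv ->]; have [e ec] := phim (vm c cv).
    apply/in_idl1; have [eu|[e' ee]] := dvr_unit hO hw e.
      by case: hno; exists c => //; exists e.
    by exists e'; rewrite ec ee mulrA.
  rewrite eW => /in_idl1[a ea]; case/negP: hloc.1; apply/in_idl1; exists a.
  by apply: (mulIf w0); rewrite mul1r -mulrA.
have hc (y : Q) : {c : Q | y \in mQ -> phi (y - c * x) = 0}.
  apply: cid; case: (boolP (y \in mQ)) => [/phim[d ed]|_]; last by exists 0.
  have [c ec] := phiT (d / e); exists c => _.
  by rewrite rmorphB rmorphM ec ex ed mulrA divrK // subrr.
pose g (y : Q) : Q := y - sval (hc y) * x; pose u : seq Q := [seq g y | y <- rem x v].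
have xm := vm x xv.
have pe := perm_to_rem xv.
have rm y : y \in rem x v -> y \in mQ by move=> /mem_rem; exact: vm.
have uk : {subset u <= kerphi}.
  by move=> _ /mapP[y /rm ym ->]; apply/in_kerphi; exact: (svalP (hc y) ym).
have mu : mQ = idl (u ++ [:: x]).
  rewrite mv; apply: subm_ext; apply: idl_min => y.
    rewrite (perm_mem pe) inE => /orP[/eqP ->|yr].
      by apply: mem_idl; rewrite mem_cat mem_head orbT.
    rewrite -(subrK (sval (hc y) * x) y); apply: idealD.
      by apply: mem_idl; rewrite mem_cat (map_f g).
    by apply: ideal_mull; apply: mem_idl; rewrite mem_cat mem_head orbT.
  rewrite mem_cat inE -mv => /orP[/uk/kerphi_max //|/eqP ->]; exact: xm.
exists u, x; split=> //.
  by rewrite size_map size_rem // prednK //; case: (v) xv.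
have hQ' : noethm Q^o by exact/noetherian_noethm.
apply: (nakayama1 hm hQ' xm) => z /[dup] zk /kerphi_max.
rewrite mu /idl (@addseq_cat Q Q^o) => /(@in_adds Q Q^o)[y hy]; exists y => //.
apply/in_kerphi; have uk' : sle (idl u) kerphi by exact: idl_min.
have /in_kerphi := uk' _ hy; rewrite rmorphB -[_ *: _]/(x * (y : Q)) rmorphM.
rewrite (in_kerphi z).1 // ex sub0r => /eqP; rewrite oppr_eq0 !mulf_eq0 (negPf w0) orbF.
by move: eu; case: eqP => [-> |_ _ /eqP //]; rewrite unitr0.
Qed.
End RegularKernel.
(** * The annihilated elements over a complete intersection *)

Lemma det_col_dvd (R : comNzRingType) (w : R) r (k : nat -> nat) (M : 'M[R]_r) :
  (forall i j, exists e, M i j = e * w ^+ k j) ->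
  exists e, \det M = e * w ^+ (\sum_(i < r) k i).
Proof.
move=> h; pose E := \matrix_(i, j) sval (cid (h i j)).
have -> : M = E *m diag_mx (\row_j w ^+ k j).
  apply/matrixP => i j; rewrite mul_mx_diag !mxE; exact: (svalP (cid (h i j))).
rewrite det_mulmx det_diag; exists (\det E); congr (_ * _).
by rewrite -prodrXr; apply: eq_bigr => i _; rewrite mxE.
Qed.

Section CITorsion.
Variables (O : idomainType) (w : O) (A : comAlgType O) (lam : {rmorphism A -> O}).
Hypotheses (hO : dvr O) (hw : uniformizer w) (lamK : forall x : O, lam x%:A = x).
Variable m : ideal A.
Hypotheses (hA : noetherian A) (hm : loc_ring m).
Local Notation p := (kerI lam).
Local Notation lc y := (lincomb (y : _ -> A^o)).
Let w0 : w != 0 := (dvr_loc_ring hO hw).2.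
Let pp : primeI p := kerI_prime lam.
Variables (Q : comNzRingType) (f : {rmorphism Q -> A}) (mQ : ideal Q) (s v : seq Q).
Hypotheses (hQ : noetherian Q) (hmQ : loc_ring mQ) (fT : forall a, exists q, f q = a)
  (sm : {subset s <= mQ}) (sr : @rseq Q Q^o (zerom Q^o) s)
  (fs : forall q, f q = 0 <-> q \in idl s) (mv : mQ = idl v) (dv : krull_dim Q (size v)).
Let phi : {rmorphism Q -> O} := lam \o f.
Local Notation P := (kerphi phi).
Local Notation lq y := (lincomb (y : _ -> Q^o)).

Let lift a := sval (cid (fT a)).
Let liftE a : f (lift a) = a := svalP (cid (fT a)).

Let f_max q : q \in mQ -> f q \in m.
Proof.
move=> qm; have [//|/hm.2[b hb]] := boolP (f q \in m); case/negP: hmQ.1.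
have h : q * lift b - 1 \in idl s by apply/fs; rewrite rmorphB rmorphM liftE hb rmorph1 subrr.
have -> : 1 = q * lift b - (q * lift b - 1) by rewrite opprB addrC subrK.
apply: idealB; first exact: ideal_mulr.
by move: h; apply: idl_min.
Qed.

Let f_max' a q : a \in m -> f q = a -> q \in mQ.
Proof.
move=> am e; have [//|/hmQ.2[b hb]] := boolP (q \in mQ); case/negP: hm.1.
by rewrite -(rmorph1 f) -hb rmorphM e; exact: ideal_mulr.
Qed.

Let phim a : a \in mQ -> exists e, phi a = e * w.
Proof. by move=> /f_max; exact: (lam_max hO hw lamK hm). Qed.

Let phiT x : exists a, phi a = x.
Proof. by exists (lift x%:A); rewrite /= liftE lamK. Qed.

Let idl_lift xs q : f q \in idl (map f xs) -> q \in idl (s ++ xs).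
Proof.
move=> /in_idl[r er]; pose q' := \sum_(i < size xs) lift (r i) * xs`_i.
have h : q - q' \in idl s.
  apply/fs; rewrite rmorphB er size_map rmorph_sum -sumrB big1 // => i _.
  by rewrite rmorphM liftE (nth_map 0) // subrr.
rewrite -(subrK q' q); apply: idealD; first by move: h; apply: idl_sub => a; rewrite mem_cat => ->.
apply: ideal_sum => i _; apply: ideal_mull; apply: mem_idl.
by rewrite mem_cat mem_nth ?orbT.
Qed.

(** Regular sequences on [A] lift to continuations of [s]. *)
Let rseq_lift xs : @rseq A A^o (zerom A^o) (map f xs) -> @rseq Q Q^o (zerom Q^o) (s ++ xs).
Proof.
move=> hr; apply/rseq_cat; split=> //.
pose F0 : Q^o -> restr f A^o := fun q => f q.
have Flin : linear F0 by move=> a x y; rewrite /F0 rmorphD rmorphM.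
pose F : {linear Q^o -> restr f A^o} :=
  HB.pack F0 (GRing.isLinear.Build Q Q^o (restr f A^o) _ F0 Flin).
have <- : pre F (zerom (restr f A^o)) = @addseq Q Q^o (zerom Q^o) s.
  apply: subm_ext => q; rewrite in_pre zerom_restr.
    by move/in_zerom => h; apply/fs.
  by move=> /fs h; apply/in_zerom.
apply: rseq_pre; first by move=> a; exists (lift a); exact: liftE.
by apply: (rseq_restr (@zerom_restr _ _ f A^o)).
Qed.

(** Write the relations [s] as [E uh + E' xh] in generators [uh] of the kernel [P]
    of [Q -> O] adapted to the cotangent structure, so that the [j]-th column of
    [E] is divisible by [w ^ k j]. If [a] kills [p] modulo [xs] then its lift
    multiplies [(uh, Y ^ k)] into [(s, xh, Y ^ k)], hence is a multiple of
    [det E] modulo this ideal, by Wiebe's theorem. *)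
Lemma ci_torsion : exists n (ys : 'I_n -> A), [/\ forall i, ys i \in p,
  forall a, a \in p -> exists b, a = lc ys b &
  forall (B : 'M[O]_n) r k (y : 'I_n -> A), B \in unitmx -> cotangent w lam r k y ->
    (forall i, y i - lc ys (row i (map_mx (in_alg A) B)) \in imul p p) ->
    @rseq A A^o (zerom A^o) (free_gens r y) ->
    dep m (@addseq A A^o (zerom A^o) (free_gens r y)) 1 ->
    forall a, (forall b, b \in p -> a * b \in idl (free_gens r y)) ->
    exists e, lam a = e * w ^+ (\sum_(i < r) k i)].
Proof.
have [u [v0 [su uP Pu v0m mu]]] := regular_kernel_gens hQ hmQ hO hw phiT phim mv.
pose n := size u; pose ys (i : 'I_n) := f u`_i.
have ysp i : ys i \in p.
  by apply/in_kerI; apply: ((in_kerphi phi _).1 (uP _ _)); exact: mem_nth.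
exists n, ys; split=> // [a /in_kerI la|B r k y Bu cot hy xr xdep a ha].
  have /Pu/in_idl[b eb] : lift a \in P by apply/in_kerphi; rewrite /= liftE.
  exists (\row_i f (b i)); rewrite -(liftE a) eb rmorph_sum; apply: eq_bigr => i _.
  by rewrite mxE rmorphM.
have ysgen b : b \in p -> exists c, b = lc ys c.
  move=> /in_kerI la; have /Pu/in_idl[c ec] : lift b \in P by apply/in_kerphi; rewrite /= liftE.
  exists (\row_i f (c i)); rewrite -(liftE b) ec rmorph_sum; apply: eq_bigr => i _.
  by rewrite mxE rmorphM.
have [rn yp ygen rel] := cot; have [q hq] := cotangent_rel lamK cot.
pose a0 := \det (torsion_mx cot q).
have lam_a0 : lam a0 = w ^+ (\sum_(i < r) k i) by apply: (lam_det_torsion_mx lamK) => i; exact: (hq i).1.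
have ha0 b : b \in p -> a0 * b \in idl (free_gens r y).
  by apply: det_torsion_mx_kills => i; [exact: (hq i).1|exact: (hq i).2].
have lift_row (i : 'I_n) : exists b : 'rV[Q]_n,
    f (lq (fun j : 'I_n => u`_j) b) = y i /\ forall j, phi (b 0 j) = B i j.
  have [|c hc /in_zerom/eqP] := imul_lincomb (N := zerom A^o) (g := (ys : _ -> A^o)) _ (hy i).
    by move=> x /ysgen[b ->]; exists b; rewrite subrr rpred0.
  rewrite subr_eq0 => /eqP e.
  exists (\row_j lift ((B i j)%:A + c 0 j)); split=> [|j].
    rewrite rmorph_sum -[y i](subrK (lc ys (row i (map_mx (in_alg A) B)))) e.
    rewrite -big_split /=; apply: eq_bigr => j _; rewrite !mxE rmorphM liftE.
    by rewrite mulrDl addrC.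
  rewrite mxE /= liftE rmorphD lamK.
  by have /in_kerI -> := (in_vecI p c).1 hc j; rewrite addr0.
pose Bh : 'M[Q]_n := \matrix_(i, j) sval (cid (lift_row i)) 0 j.
pose uh (i : 'I_n) : Q := \sum_j Bh i j * u`_j.
have fuh i : f (uh i) = y i.
  apply: (etrans _ (svalP (cid (lift_row i))).1); congr (f _); apply: eq_bigr => j _.
  by rewrite mxE.
pose U := [seq uh i | i <- enum 'I_n].
have sU : size U = n by rewrite size_map size_enum_ord.
have nthU (i : 'I_n) : U`_i = uh i.
  by rewrite (nth_map i) ?size_enum_ord // nth_ord_enum.
have detB : \det Bh \notin mQ.
  apply/negP => /phim[e]; rewrite -det_map_mx.
  have -> : map_mx phi Bh = B.
    by apply/matrixP => i j; rewrite !mxE; exact: (svalP (cid (lift_row i))).2.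
  move=> eB; have [hloc _] := dvr_loc_ring hO hw; case/negP: hloc.1.
  apply/in_idl1; exists (e / \det B); rewrite mulrAC -eB divrr //.
have [D hD] := hmQ.2 _ detB.
have uU : sle (idl u) (idl U).
  apply: idl_min => x /(nthP 0)[i ui <-].
  rewrite -[u`_i]mul1r -hD (mulrC _ D) -mulrA; apply: ideal_mull.
  apply: (@det_mul_mem _ _ Bh (fun j => u`_j) uh _ _ _ (Ordinal ui)) => // j.
  by apply: mem_idl; apply: map_f; rewrite mem_enum.
have uhP i : uh i \in P.
  apply: ideal_sum => j _; apply: ideal_mull; apply: uP; exact: mem_nth.
have UP : {subset U <= P} by move=> _ /mapP[i _ ->].
have PU : sle P (idl U) by exact: sle_trans Pu uU.
have Pm : sle P mQ by exact: kerphi_max.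
have sUv : size (U ++ [:: v0]) = size v by rewrite size_cat sU addn1.
have rU : @rseq Q Q^o (zerom Q^o) U.
  suff : @rseq Q Q^o (zerom Q^o) (U ++ [:: v0]) by move/rseq_cat => [].
  apply: (krull_dim_regular hQ hmQ); last by rewrite sUv.
    by move=> x; rewrite mem_cat inE => /orP[/UP/Pm //|/eqP ->].
  rewrite {1}mu; apply: idl_min => x; rewrite mem_cat inE => /orP[/uP/PU|/eqP ->].
    by apply: idl_sub => z; rewrite mem_cat => ->.
  by apply: mem_idl; rewrite mem_cat mem_head orbT.
have hE (i : nat) : {c : nat -> Q | s`_i = \sum_(j < n) c j * U`_j}.
  apply: cid; have /in_idl[c] : s`_i \in idl U.
    apply/PU/in_kerphi; case: (ltnP i (size s)) => si; last by rewrite nth_default ?rmorph0.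
    by have /= -> : f s`_i = 0 by [apply/fs; apply: mem_idl; exact: mem_nth]; rewrite rmorph0.
  by rewrite sU => ->; exists c.
pose E i j := sval (hE i) j.
have sE i : s`_i = \sum_(j < n) E i j * U`_j := svalP (hE i).
have hEw i (j : 'I_n) : (i < size s)%N ->
    if (j < r)%N then exists e, phi (E i j) = e * w ^+ k j else phi (E i j) = 0.
  move=> si; have := rel (\row_j f (E i j)).
  have -> : lc y (\row_j f (E i j)) = 0 :> A.
    have <- : f s`_i = 0 by apply/fs; apply: mem_idl; exact: mem_nth.
    rewrite sE rmorph_sum; apply: eq_bigr => l _.
    by rewrite mxE rmorphM nthU fuh.
  move=> [/(_ (rpred0 _))/(_ j) h _]; by move: h; rewrite mxE.
pose xh := [seq uh i | i : 'I_n <- enum 'I_n & (r <= i)%N].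
have fxh : map f xh = free_gens r y.
  by rewrite -map_comp; apply: eq_map => i; exact: fuh.
have xhU : xh = drop r U by rewrite /xh filter_enum_ord // map_drop.
have sxh : size xh = (n - r)%N by rewrite xhU size_drop sU.
have xhP : {subset xh <= P} by move=> _ /mapP[i _ ->].
have [ys1 [sys1 ys1m rys1]] := xdep.
have [ystar eys] : exists b, ys1 = [:: b] by case: ys1 sys1 {ys1m rys1} => [|b []] // _; exists b.
have ysm : ystar \in m by apply: ys1m; rewrite eys mem_head.
have ynz : nzd (@addseq A A^o (zerom A^o) (free_gens r y)) ystar by move: rys1; rewrite eys => -[].
have yslam : lam ystar != 0.
  apply: contraTneq isT => ly; have yp' : ystar \in p by apply/in_kerI.
  have /ynz a0x : ystar *: (a0 : A^o) \in @addseq A A^o (zerom A^o) (free_gens r y).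
    by rewrite -[_ *: _]/(ystar * a0) mulrC; exact: ha0.
  have xp : sle (idl (free_gens r y)) p by apply: idl_min => b /mapP[i _ ->].
  have /in_kerI := xp _ a0x; rewrite lam_a0 => /eqP.
  by rewrite expf_eq0 (negPf w0) andbF.
pose Y := lift ystar; have fY : f Y = ystar := liftE _.
have Ym : Y \in mQ by exact: f_max' ysm fY.
have rsx j : @rseq Q Q^o (zerom Q^o) (s ++ xh ++ [:: Y ^+ j]).
  apply: rseq_lift; rewrite map_cat fxh /= rmorphXn fY; apply/rseq_cat; split=> //.
  by split=> //; exact: nzd_exp.
have bm j : (0 < j)%N -> {subset s ++ xh ++ [:: Y ^+ j] <= mQ}.
  move=> j0 x; rewrite !mem_cat inE => /or3P[/sm //|/xhP/Pm //|/eqP ->].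
  by case: j j0 => // j _; rewrite exprS; exact: ideal_mulr.
have lr : (size s <= r)%N.
  have := rseq_size_leq hQ hmQ (bm 1%N isT) (rsx 1%N) dv.
  by rewrite !size_cat sxh -su /=; lia.
have rl : (r <= size s)%N.
  pose Wq (j : 'I_n) (l : nat) : Q :=
    lift ((w ^+ k j)%:A) *+ (j == l :> nat) - (if insub l is Some l' then lift (q j 0 l') else 0).
  have WqE (j l : 'I_n) : Wq j l = lift ((w ^+ k j)%:A) *+ (j == l) - lift (q j 0 l).
    by rewrite /Wq valK.
  have hF (j : 'I_n) : exists F : nat -> Q, (j < r)%N ->
      \sum_(l < n) Wq j l * U`_l = \sum_(i < size s) F i * s`_i.
    case: (ltnP j r) => jr; last by exists (fun=> 0).
    suff /in_idl[F eF] : \sum_(l < n) Wq j l * U`_l \in idl s by exists F.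
    apply/fs; rewrite rmorph_sum.
    rewrite (eq_bigr (fun l : 'I_n => (w ^+ k j)%:A * y l *+ (j == l) - q j 0 l * y l)).
      rewrite sumrB (bigD1 j) //= eqxx mulr1n big1 ?addr0 => [|l lj].
        by rewrite (hq j).2 // subrr.
      by rewrite eq_sym (negPf lj).
    by move=> l _; rewrite WqE rmorphM rmorphB rmorphMn !liftE nthU fuh mulrBl mulrnAl.
  pose F (j : 'I_n) := sval (cid (hF j)).
  have key (j l : 'I_n) : (j < r)%N ->
      (w ^+ k j) *+ (j == l) = \sum_(i < size s) phi (F j i) * phi (E i l).
    move=> jr; have eF := svalP (cid (hF j)) jr; rewrite -/(F j) in eF.
    pose c (i : nat) : Q^o := Wq j i - \sum_(t < size s) F j t * E t i.
    have hc : \sum_(i < size U) U`_i *: c i \in zerom Q^o.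
      apply/in_zerom; rewrite sU.
      have -> : \sum_(i < n) U`_i *: c i = \sum_(i < n) Wq j i * U`_i -
          \sum_(t < size s) F j t * s`_t.
        rewrite [X in _ = _ - X](eq_bigr (fun t : 'I_(size s) =>
          \sum_(i < n) F j t * (E t i * U`_i))); last by move=> t _; rewrite sE mulr_sumr.
        rewrite exchange_big -sumrB /=; apply: eq_bigr => i _.
        rewrite -[_ *: _]/(U`_i * c i) mulrC /c mulrBl mulr_suml; congr (_ - _).
        by apply: eq_bigr => t _; rewrite mulrA.
      by rewrite eF subrr.
    have /(_ l) := rseq_relations rU hc; rewrite sU => /(_ (ltn_ord l)) cl.
    have UP' : sle (idl U) P by exact: idl_min.
    have /in_kerphi/eqP := UP' _ cl; rewrite rmorphB rmorph_sum subr_eq0 WqE => /eqP.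
    rewrite rmorphB rmorphMn /= !liftE lamK.
    have /in_kerI -> := (in_vecI p (q j)).1 (hq j).1 l; rewrite subr0 => ->.
    by apply: eq_bigr => t _; rewrite !rmorphM.
  pose wo (i : 'I_r) := widen_ord rn i.
  pose FF : 'M[O]_(r, size s) := \matrix_(j, i) phi (F (wo j) i).
  pose EE : 'M[O]_(size s, r) := \matrix_(i, l) phi (E i l).
  apply: (@det_factor_leq _ _ _ FF EE).
  have -> : FF *m EE = diag_mx (\row_j w ^+ k j).
    apply/matrixP => j l; rewrite !mxE.
    have := key (wo j) (wo l) (ltn_ord j); rewrite -val_eqE /= => ->.
    by apply: eq_bigr => i _; rewrite !mxE.
  rewrite det_diag; apply/prodf_neq0 => i _; rewrite mxE; exact: expf_neq0.
have sr' : size s = r by apply/eqP; rewrite eqn_leq lr rl.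
set K := (\sum_(i < r) k i)%N.
pose YK := Y ^+ K.+1; pose z := U ++ [:: YK]; pose b := s ++ xh ++ [:: YK].
have sz : size z = n.+1 by rewrite size_cat sU addn1.
have szb : size z = size b by rewrite sz !size_cat sr' sxh /=; lia.
have YKm : YK \in mQ by apply: (bm K.+1 isT); rewrite !mem_cat mem_head !orbT.
have zm : {subset z <= mQ}.
  by move=> x; rewrite mem_cat inE => /orP[/UP/Pm //|/eqP ->].
have rz : @rseq Q Q^o (zerom Q^o) z.
  apply/rseq_cat; split=> //; split=> // x hx.
  have UP' : sle (idl U) P by exact: idl_min.
  apply: PU; have /in_kerphi/eqP := UP' _ hx.
  rewrite -[_ *: _]/(YK * (x : Q)) rmorphM rmorphXn mulf_eq0 expf_eq0 /= fY (negPf yslam) /=.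
  by move/eqP => h; apply/in_kerphi.
have cb : cofin mQ (idl b).
  apply: krull_dim_cofin => //; first exact: bm.
    exact: rsx.
  by rewrite -szb sz su.
have nE : (r + (n - r) = n)%N := subnKC rn.
pose G := \matrix_(i < size z, j < size z) blockf r (n - r) E (fun=> 0) 1 i j.
have hG (i : 'I_(size z)) : b`_i = \sum_j G i j * z`_j.
  under eq_bigr do rewrite mxE.
  transitivity (\sum_(j < n.+1) blockf r (n - r) E (fun=> 0) 1 i j * z`_j); last first.
    exact: (congr1 (fun N => \sum_(j < N) blockf r (n - r) E (fun=> 0) 1 i j * z`_j) (esym sz)).
  have zU (j : 'I_n) : z`_j = U`_j by rewrite nth_cat sU ltn_ord.
  have zn : z`_n = YK by rewrite nth_cat sU ltnn subnn.
  rewrite big_ord_recr /= zn nth_cat sr' /blockf nE ltnn.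
  under eq_bigr do rewrite zU.
  case: ltnP => ir.
    rewrite mul0r addr0 sE; apply: eq_bigr => j _.
    by rewrite ltn_ord.
  rewrite nth_cat sxh; have := ltn_ord i; rewrite {2}sz ltnS leq_eqVlt => /orP[/eqP ein|lin].
    rewrite ein ltnn ltnn subnn /= mul1r big1 ?add0r // => j _.
    by rewrite ltn_ord mul0r.
  rewrite lin ifT; last exact: ltn_sub2r (leq_ltn_trans ir lin) lin.
  rewrite xhU nth_drop subnKC // (ltn_eqF lin) mul0r addr0.
  rewrite (bigD1 (Ordinal lin)) //= eqxx mul1r big1 ?addr0 // => j ji.
  have /negPf -> : (i : nat) != j by apply: contraNneq ji => e; apply/eqP/val_inj.
  by rewrite mul0r.
have hv x : x \in z -> lift a * x \in idl b.
  rewrite mem_cat inE => /orP[/mapP[i _ ->]|/eqP ->]; last first.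
    by apply: ideal_mull; apply: mem_idl; rewrite !mem_cat mem_head !orbT.
  have /idl_lift : f (lift a * uh i) \in idl (map f xh).
    by rewrite fxh rmorphM liftE fuh; exact: ha.
  by apply: idl_sub => c h; rewrite /b catA mem_cat h.
have [rho hrho] := wiebe_param hmQ hQ szb zm (bm K.+1 isT) rz cb hG hv.
have [c ec] : exists c, phi (lift a - \det G * rho) = c * w ^+ K.
  apply/in_idl1.
  have : phi (lift a - \det G * rho) \in idl [seq phi x | x <- b] by exact: idl_map.
  apply: idl_min => _ /mapP[x xb ->]; apply/in_idl1; move: xb.
  rewrite !mem_cat inE => /or3P[xs'|/xhP/in_kerphi ->|/eqP ->].
  - exists 0; rewrite mul0r /=; have -> : f x = 0 by apply/fs; exact: mem_idl.
    by rewrite rmorph0.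
  - by exists 0; rewrite mul0r.
  - have [e ee] := phim Ym; exists (e ^+ K.+1 * w).
    by rewrite rmorphXn ee exprMn -mulrA -exprS.
have [e ee] : exists e, phi (\det G) = e * w ^+ K.
  rewrite /G det_blockf; last by rewrite sz nE addn1.
  rewrite mulr1 -det_map_mx; apply: det_col_dvd => i j; rewrite !mxE.
  have := hEw i (widen_ord rn j); rewrite sr' => /(_ (ltn_ord i)).
  by rewrite /= ltn_ord.
have la : lam a = phi (lift a - \det G * rho) + phi (\det G) * phi rho.
  by rewrite rmorphB rmorphM subrK /= liftE.
exists (c + e * phi rho); rewrite la ec ee mulrDl; congr (_ + _).
by rewrite mulrAC.
Qed.
End CITorsion.
(** * Eventually polynomial functions and staircases of monomials *)

Section Polynomials.
Import Order.TTheory Num.Theory.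
Implicit Types P : {poly rat}.

Definition evpoly (f : nat -> nat) := exists P n0,
  forall n, (n0 <= n)%N -> (f n)%:R = P.[n%:R] :> rat.

Lemma evpoly_eq f g n1 : (forall n, (n1 <= n)%N -> f n = g n) -> evpoly g -> evpoly f.
Proof.
move=> e [P [n0 h]]; exists P, (maxn n0 n1) => n; rewrite geq_max => /andP[h0 h1].
by rewrite e // h.
Qed.

Lemma evpoly0 : evpoly (fun=> 0%N).
Proof. by exists 0, 0%N => n _; rewrite horner0. Qed.

Lemma evpolyD f g : evpoly f -> evpoly g -> evpoly (fun n => f n + g n)%N.
Proof.
move=> [P [n0 h]] [P' [n1 h']]; exists (P + P'), (maxn n0 n1) => n.
by rewrite geq_max => /andP[h0 h1]; rewrite natrD hornerD h // h'.
Qed.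

Lemma evpoly_big (T : Type) (s : seq T) (F : T -> nat -> nat) : (forall t, evpoly (F t)) ->
  evpoly (fun n => \sum_(t <- s) F t n)%N.
Proof.
move=> h; elim: s => [|t s IH].
  by apply: (@evpoly_eq _ (fun=> 0%N) 0) evpoly0 => n _; rewrite big_nil.
by apply: (@evpoly_eq _ (fun n => F t n + \sum_(t <- s) F t n)%N 0) (evpolyD _ _) => // n _;
  rewrite big_cons.
Qed.

Lemma evpoly_shift f a t : evpoly f -> evpoly (fun n => f (n + a - t)%N).
Proof.
move=> [P [n0 h]]; exists (P \Po ('X + (a%:R - t%:R)%:P)), (n0 + t)%N => n hn.
rewrite h; last by lia.
rewrite horner_comp hornerD hornerX hornerC natrB ?natrD; last by lia.
by rewrite addrA.
Qed.

(** [X ^ k.+1] has the difference [(k + 1) X ^ k] up to lower terms. *)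
Lemma poly_antidifference P : exists S : {poly rat}, S \Po ('X + 1%:P) - S = P.
Proof.
suff H k : forall P, (size P <= k)%N -> exists S : {poly rat}, S \Po ('X + 1%:P) - S = P.
  exact: (H _ P (leqnn _)).
elim: k => [|k IH] {}P sP.
  exists 0; rewrite comp_poly0 subr0; apply/esym/eqP.
  by rewrite -size_poly_leq0.
pose D : {poly rat} := 'X^(k.+1) \Po ('X + 1%:P) - 'X^(k.+1).
have eD : D = \sum_(i < k.+1) 'X^i *+ 'C(k.+1, i).
  by rewrite /D comp_Xn_poly polyC1 exprD1n big_ord_recr /= binn mulr1n addrK.
have cD j : (k <= j)%N -> D`_j = (k.+1)%:R *+ (j == k).
  move=> kj; rewrite eD coef_sum.
  rewrite (bigD1 ord_max) //= big1 ?addr0 => [|i ik].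
    by rewrite coefMn coefXn; case: eqP => _; rewrite ?mul0rn // mulr1n binSn.
  rewrite coefMn coefXn gtn_eqF ?mul0rn //.
  have := ltn_ord i; rewrite ltnS leq_eqVlt => /orP[/eqP e|lt]; last exact: leq_trans lt kj.
  by case/eqP: ik; apply: val_inj.
pose c := P`_k / (k.+1)%:R.
have [|S hS] := IH (P - c *: D).
  apply/leq_sizeP => j kj; rewrite coefB coefZ cD //.
  case: eqP => [->|/eqP jk]; last first.
    by rewrite mulr0 subr0; apply: (leq_sizeP _ _ sP); rewrite ltn_neqAle eq_sym jk.
  by rewrite mulr1n /c divfK ?subrr // pnatr_eq0.
exists (S + c *: 'X^(k.+1)); rewrite comp_polyD comp_polyZ.
rewrite opprD addrACA hS -scalerBr -/D.
by rewrite subrK.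
Qed.

Lemma evpoly_sum f : evpoly f -> evpoly (fun n => \sum_(i < n) f i)%N.
Proof.
move=> [P [n0 h]]; have [S hS] := poly_antidifference P.
exists (S + ((\sum_(i < n0) f i)%N%:R - S.[n0%:R])%:P), n0 => n.
move=> n0n; rewrite -(subnKC n0n); elim: (n - n0)%N => [|k IH].
  by rewrite addn0 hornerD hornerC addrC subrK.
rewrite addnS big_ord_recr /= natrD IH h ?leq_addr // -hS.
rewrite !(hornerD, hornerN, hornerC, horner_comp, hornerX) -natr1; ring.
Qed.

(** Horner's scheme: a positive lower bound far out for [P] gives one for [P X + c]. *)
Lemma lead_pos_eventually P : 0 < lead_coef P ->
  exists e, 0 < e /\ exists n0, forall n, (n0 <= n)%N -> e <= P.[n%:R].
Proof.
elim/poly_ind: P => [|P c IH]; first by rewrite lead_coef0 ltxx.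
have [->|P0] := eqVneq P 0.
  rewrite mul0r add0r lead_coefC => c0; exists c; split=> //; exists 0%N => n _.
  by rewrite hornerC.
rewrite lead_coefDl; last first.
  by rewrite size_mulX // size_polyC ltnS; case: (c != 0); rewrite ?leqn0 //= lt0n size_poly_eq0.
rewrite lead_coefMX => /IH[e [e0 [n0 h]]]; exists e; split=> //.
exists (maxn n0 (Num.bound (1 + `|c| / e))) => n; rewrite geq_max => /andP[hn hb].
rewrite !hornerE; have h1 := h n hn.
have hbn : 1 + `|c| / e <= n%:R.
  apply: (@le_trans _ _ (Num.bound (1 + `|c| / e))%:R); last by rewrite ler_nat.
  apply: ltW; apply: archi_boundP; apply: addr_ge0 => //; apply: divr_ge0 => //; exact: ltW.
have h2 : e * (1 + `|c| / e) <= P.[n%:R] * n%:R.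
  apply: ler_pM => //; first exact: ltW.
  by apply: addr_ge0 => //; apply: divr_ge0 => //; exact: ltW.
rewrite mulrDr mulr1 mulrCA divff ?mulr1 ?gt_eqF // in h2.
have h3 : - `|c| <= c by rewrite lerNl ler_normr lexx orbT.
by have := lerD h2 h3; rewrite addrK.
Qed.

Lemma evpoly_uniq P P' n0 : (forall n, (n0 <= n)%N -> P.[n%:R] = P'.[n%:R]) -> P = P'.
Proof.
move=> h; apply/eqP; rewrite -subr_eq0; apply/negPn/negP => ne.
have H (D : {poly rat}) : 0 < lead_coef D -> (forall n, (n0 <= n)%N -> D.[n%:R] = 0) -> False.
  move=> /lead_pos_eventually[e [e0 [n1 h1]]] h2; have := h1 (maxn n0 n1) (leq_maxr _ _).
  by rewrite h2 ?leq_maxl // leNgt e0.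
have hd n : (n0 <= n)%N -> (P - P').[n%:R] = 0 by move=> /h e; rewrite !hornerE e subrr.
have : lead_coef (P - P') != 0 by rewrite lead_coef_eq0.
rewrite neq_lt => /orP[l|l]; last exact: H l hd.
apply: (H (- (P - P'))); first by rewrite lead_coefN oppr_gt0.
by move=> n /hd; rewrite hornerN => ->; rewrite oppr0.
Qed.

(** A degree larger than [d] would contradict the first pair of bounds, and a
    nonpositive coefficient in degree [d] the last one. *)
Lemma coef_pos_of_bounds P d l a b n0 : (0 < l)%N ->
  (forall n, (n0 <= n)%N -> 0 <= P.[n%:R] /\ P.[n%:R] <= (l * n ^ d)%:R) ->
  (forall n, (n0 <= n)%N -> (l * n ^ d)%:R <= P.[(a * n + b)%:R]) ->
  0 < P`_d.
Proof.
move=> l0 up low.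
have lX (D : {poly rat}) : (size D <= d)%N -> lead_coef (l%:R *: 'X^d - D) = l%:R.
  move=> sD; rewrite lead_coefDl ?lead_coefZ ?lead_coefXn ?mulr1 //.
  by rewrite size_polyN size_scale ?size_polyXn ?ltnS // pnatr_eq0 -lt0n.
have sP : (size P <= d.+1)%N.
  rewrite leqNgt; apply/negP => lt.
  have : lead_coef P != 0 by rewrite lead_coef_eq0 -size_poly_eq0; lia.
  rewrite neq_lt => /orP[ln|lp].
    have [|e [e0 [n1 h1]]] := @lead_pos_eventually (- P); first by rewrite lead_coefN oppr_gt0.
    have := h1 (maxn n0 n1) (leq_maxr _ _); have [h2 _] := up (maxn n0 n1) (leq_maxl _ _).
    by rewrite hornerN => h3; have := lt_le_trans e0 h3; rewrite oppr_gt0 ltNge h2.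
  have [|e [e0 [n1 h1]]] := @lead_pos_eventually (P - l%:R *: 'X^d).
    rewrite lead_coefDl // size_polyN; apply: leq_ltn_trans lt.
    by apply: leq_trans (size_scale_leq _ _) _; rewrite size_polyXn.
  have := h1 (maxn n0 n1) (leq_maxr _ _); have [_ h2] := up (maxn n0 n1) (leq_maxl _ _).
  rewrite !hornerE => h3; have := lt_le_trans e0 h3.
  by rewrite subr_gt0 ltNge -natrX -natrM h2.
rewrite ltNge; apply/negP => c0.
pose R := P - P`_d *: 'X^d.
have sR : (size R <= d)%N.
  apply/leq_sizeP => j dj; rewrite coefB coefZ coefXn.
  have [->|jd] := eqVneq j d; first by rewrite mulr1 subrr.
  by rewrite mulr0 subr0; apply: (leq_sizeP _ _ sP); rewrite ltn_neqAle eq_sym jd.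
pose L : {poly rat} := a%:R *: 'X + b%:R%:P.
have sL : (size L <= 2)%N.
  apply: leq_trans (size_polyD _ _) _; rewrite geq_max; apply/andP; split.
    by apply: leq_trans (size_scale_leq _ _) _; rewrite size_polyX.
  by apply: leq_trans (size_polyC_leq1 _) _.
have sRL : (size (R \Po L) <= d)%N.
  have [R0|R0] := eqVneq R 0; first by rewrite R0 comp_poly0 size_poly0.
  apply: leq_trans (size_comp_poly_leq _ _) _.
  have : (0 < size R)%N by rewrite lt0n size_poly_eq0.
  have : ((size R).-1 * (size L).-1 <= (size R).-1 * 1)%N.
    by rewrite leq_mul2l; apply/orP; right; move: sL; case: (size L) => [|[|[]]].
  by lia.
have [|e [e0 [n1 h1]]] := @lead_pos_eventually (l%:R *: 'X^d - (R \Po L)).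
  by rewrite lX // ltr0n.
have := h1 (maxn n0 n1) (leq_maxr _ _); set n := maxn n0 n1.
have hR : (l * n ^ d)%:R <= R.[(a * n + b)%:R].
  apply: le_trans (low n (leq_maxl _ _)) _.
  rewrite /R hornerD hornerN hornerZ hornerXn lerDl oppr_ge0.
  by apply: mulr_le0_ge0 => //; rewrite -natrX ler0n.
have -> : (l%:R *: 'X^d - (R \Po L)).[n%:R] = (l * n ^ d)%:R - R.[(a * n + b)%:R].
  rewrite !(hornerD, hornerN, hornerZ, hornerXn, horner_comp, hornerC, hornerX).
  by rewrite natrM natrX natrD natrM.
by move=> h3; have := lt_le_trans e0 h3; rewrite subr_gt0 ltNge hR.
Qed.
End Polynomials.

(** The exponents of the monomials of degree [n] in [r] variables. *)
Fixpoint mons r n : seq (seq nat) :=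
  if r is r'.+1 then flatten [seq [seq t :: b | b <- mons r' (n - t)%N] | t <- iota 0 n.+1]
  else if n == 0%N then [:: [::]] else [::].

Lemma monsS r n : mons r.+1 n =
  flatten [seq [seq t :: b | b <- mons r (n - t)%N] | t <- iota 0 n.+1].
Proof. by []. Qed.

Lemma mem_mons r n a : (a \in mons r n) = (size a == r) && (sumn a == n).
Proof.
elim: r n a => [|r IH] n a.
  rewrite /=; by case: a => [|t a]; case: n => [|n] //=; rewrite ?inE ?andbF.
rewrite monsS; apply/flatten_mapP/idP => [[t]|].
  rewrite mem_iota add0n ltnS /= => tn /mapP[b]; rewrite IH => /andP[sb /eqP eb] -> /=.
  by rewrite eqSS sb eb; apply/eqP; lia.
case: a => [|t a] //=; rewrite eqSS => /andP[sa /eqP e]; exists t.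
  by change (t \in iota 0 n.+1); rewrite mem_iota add0n ltnS /=; lia.
by apply: map_f; rewrite IH sa /=; apply/eqP; lia.
Qed.

(** Closure under decreasing one entry, in a form adapted to slicing by the first
    exponent. *)
Fixpoint staircase r (D : seq nat -> Prop) : Prop := if r is r'.+1 then
  (forall t, staircase r' (fun b => D (t :: b))) /\
  forall t b, size b = r' -> D (t.+1 :: b) -> D (t :: b) else True.

Lemma staircase_incr r (D : seq nat -> Prop) :
  (forall a i, size a = r -> (i < r)%N -> D (incr_nth a i) -> D a) -> staircase r D.
Proof.
elim: r D => [|r IH] D //= h; split=> [t|t b sb hD].
  by apply: IH => a i sa ir hD; apply: (h (t :: a) i.+1) => //=; rewrite sa.
by apply: (h (t :: b) 0%N) => //=; rewrite sb.
Qed.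

(** Descending chains of staircases are stationary: along the diagonal by
    induction, and then in each of the finitely many first slices. *)
Lemma staircase_dcc r (C : nat -> seq nat -> Prop) : (forall i, staircase r (C i)) ->
  (forall i b, size b = r -> C i.+1 b -> C i b) ->
  exists N, forall i b, (N <= i)%N -> size b = r -> C N b -> C i b.
Proof.
elim: r C => [|r IH] C hC dec.
  have [h|/existsNP[N hN]] := pselect (forall i, C i [::]).
    by exists 0%N => i b _ /size0nil -> _; exact: h.
  by exists N => i b _ /size0nil -> /hN.
have mono i j b : (i <= j)%N -> size b = r.+1 -> C j b -> C i b.
  move=> ij sb; rewrite -(subnKC ij); elim: (j - i)%N => [|k IHk]; first by rewrite addn0.
  by rewrite addnS => /(dec _ _ sb)/IHk.
have hmono i t t' b : (t <= t')%N -> size b = r -> C i (t' :: b) -> C i (t :: b).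
  move=> tt sb; rewrite -(subnKC tt); elim: (t' - t)%N => [|k IHk]; first by rewrite addn0.
  by rewrite addnS => /((hC i).2 _ _ sb)/IHk.
have [N0 h0] : exists N, forall i b, (N <= i)%N -> size b = r -> C N (N :: b) -> C i (i :: b).
  apply: (IH (fun i b => C i (i :: b))) => [i|i b sb h]; first exact: (hC i).1.
  by apply: (hmono i i i.+1) => //; apply: dec => //=; rewrite sb.
have ht t : {N | forall i b, (N <= i)%N -> size b = r -> C N (t :: b) -> C i (t :: b)}.
  apply: cid; apply: (IH (fun i b => C i (t :: b))) => [i|i b sb]; first exact: (hC i).1.
  by apply: dec; rewrite /= sb.
exists (N0 + \sum_(t < N0) sval (ht t))%N => i [|t b] // Ni [sb] hN.
have sb' : size (t :: b) = r.+1 by rewrite /= sb.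
case: (ltnP t N0) => tN.
  have le : (sval (ht t) <= N0 + \sum_(t < N0) sval (ht t))%N.
    by rewrite (bigD1 (Ordinal tN)) //=; lia.
  apply: (svalP (ht t)) => //; first exact: leq_trans le Ni.
  exact: mono hN.
have h1 : C N0 (N0 :: b) by apply: (hmono _ _ t) => //; apply: mono hN => //; exact: leq_addr.
have h2 := h0 (maxn i t) b _ sb h1.
apply: (hmono _ _ (maxn i t)) => //; first exact: leq_maxr.
apply: (mono i (maxn i t)); rewrite ?leq_maxl //= ?sb //.
apply: h2; apply: leq_trans (leq_maxl _ _); apply: leq_trans Ni; exact: leq_addr.
Qed.

(** The number of elements of degree [n] of a staircase is eventually polynomial
    in [n], because all but finitely many slices agree. *)
Lemma staircase_evpoly r (D : seq nat -> Prop) : staircase r D ->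
  evpoly (fun n => count (fun a => `[< D a >]) (mons r n)).
Proof.
elim: r D => [|r IH] D hD; first by apply: (@evpoly_eq _ _ 1) evpoly0 => -[|n].
have [hsl hdec] := hD.
have [T hT] := staircase_dcc hsl (fun t b sb => hdec t b sb).
pose h t n := count (fun a => `[< D (t :: a) >]) (mons r n).
have hh t : evpoly (h t) by exact: IH (hsl t).
have mono t t' b : (t <= t')%N -> size b = r -> D (t' :: b) -> D (t :: b).
  move=> tt sb; rewrite -(subnKC tt); elim: (t' - t)%N => [|k IHk]; first by rewrite addn0.
  by rewrite addnS => /(hdec _ _ sb)/IHk.
have hE t n : (T <= t)%N -> h t n = h T n.
  move=> Tt; apply: eq_in_count => b; rewrite mem_mons => /andP[/eqP sb _].
  by apply: asbool_equiv_eq; split; [exact: mono|exact: hT].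
apply: (@evpoly_eq _ (fun n => \sum_(t <- iota 0 T) h t (n + 0 - t) +
    \sum_(i < n + 1 - T) h T i)%N T); last first.
  apply: evpolyD; first by apply: evpoly_big => t; apply: evpoly_shift.
  exact: (evpoly_shift 1 T (evpoly_sum (hh T))).
move=> n Tn; rewrite monsS count_flatten sumnE -!map_comp !big_map.
have -> : iota 0 n.+1 = iota 0 T ++ iota T (n + 1 - T) by rewrite -iotaD; congr iota; lia.
rewrite big_cat /=; congr (_ + _)%N.
  by apply: eq_bigr => t _; rewrite /= count_map addn0.
rewrite -{1}[T]addn0 iotaDl big_map -(big_mkord xpredT (h T)) big_nat_rev /=.
rewrite /index_iota subn0 big_seq [RHS]big_seq; apply: eq_bigr => t; rewrite mem_iota => tn.
rewrite count_map -[LHS]/(h (T + t)%N (n - (T + t))%N) hE ?leq_addr //.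
by congr (h T _); lia.
Qed.
(** * Hilbert-Samuel functions *)

(** The lexicographic order on sequences of equal length. *)
Fixpoint ltl (a b : seq nat) : bool := match a, b with
  | x :: a', y :: b' => (x < y)%N || (x == y) && ltl a' b'
  | _, _ => false end.

Lemma ltl_irr a : ltl a a = false.
Proof. by elim: a => //= x a ->; rewrite ltnn andbF. Qed.

Lemma ltl_asym a b : ltl a b -> ltl b a = false.
Proof.
elim: a b => [|x a IH] [|y b] //= /orP[lt|/andP[/eqP -> /IH ->]].
  by rewrite ltnNge (ltnW lt) /= gtn_eqF.
by rewrite ltnn andbF.
Qed.

Lemma ltl_incr a b i : size a = size b -> ltl a b -> ltl (incr_nth a i) (incr_nth b i).
Proof.
elim: a b i => [|x a IH] [|y b] i //= [sab]; case: i => [|i] //=.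
by case/orP=> [->//|/andP[-> /(IH _ i sab) ->]]; rewrite orbT.
Qed.

Lemma pairwise_slices (B : nat -> seq (seq nat)) k n : (forall t, pairwise ltl (B t)) ->
  pairwise ltl (flatten [seq [seq t :: b | b <- B t] | t <- iota k n]).
Proof.
move=> hB; elim: n k => [|n IH] k //=; rewrite pairwise_cat IH andbT; apply/andP; split.
  apply/allrelP => _ c /mapP[b _ ->] /flatten_mapP[t].
  by rewrite mem_iota => /andP[kt _] /mapP[b' _ ->] /=; rewrite kt.
by rewrite pairwise_map; apply: sub_pairwise (hB k) => b b' /= h; rewrite eqxx h orbT.
Qed.

Lemma pairwise_mons r n : pairwise ltl (mons r n).
Proof.
elim: r n => [|r IH] n; first by case: n.
by rewrite monsS; apply: (@pairwise_slices (fun t => mons r (n - t)%N)).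
Qed.

Definition mlist r s n := flatten [seq [seq j :: a | a <- mons r n] | j <- iota 0 s].

Lemma pairwise_mlist r s n : pairwise ltl (mlist r s n).
Proof. by apply: (@pairwise_slices (fun=> mons r n)) => t; exact: pairwise_mons. Qed.

Lemma mem_mlist r s n j a : (j :: a \in mlist r s n) = [&& (j < s)%N, size a == r & sumn a == n].
Proof.
apply/flatten_mapP/and3P => [[t]|[js ha hn]].
  by rewrite mem_iota => ts /mapP[b]; rewrite mem_mons => /andP[h1 h2] [-> ->]; split.
by exists j; [rewrite mem_iota|apply: map_f; rewrite mem_mons ha].
Qed.

Lemma mlist_cons r s n a : a \in mlist r s n -> exists j b, a = j :: b.
Proof. by move=> /flatten_mapP[t _ /mapP[b _ ->]]; exists t, b. Qed.

Lemma sumn_incr a i : sumn (incr_nth a i) = (sumn a).+1.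
Proof.
elim: a i => [|t a IH] [|i] //=; first by elim: i => //= i ->.
by rewrite IH addnS.
Qed.

Section Monomials.
Variables (R : comNzRingType) (V : lmodType R).

Fixpoint monv (xs : seq R) (a : seq nat) : R := match xs, a with
  | x :: xs', t :: a' => x ^+ t * monv xs' a' | _, _ => 1 end.

Lemma monv_incr xs a i : size a = size xs -> (i < size xs)%N ->
  monv xs (incr_nth a i) = xs`_i * monv xs a.
Proof.
elim: xs a i => [|x xs IH] [|t a] [|i] //= [sa] ix; first by rewrite exprS mulrA.
by rewrite IH // mulrCA.
Qed.

Lemma monv0 xs r : monv xs (nseq r 0%N) = 1.
Proof. by elim: xs r => [|x xs IH] [|r] //=; rewrite IH mulr1. Qed.

Lemma monv_pigeon xs a n : size a = size xs -> (size xs * n < sumn a)%N ->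
  exists2 x, x \in xs & exists c, monv xs a = c * x ^+ n.
Proof.
elim: xs a => [|x xs IH] [|t a] //= [sa]; rewrite mulSn => h.
case: (leqP n t) => nt.
  exists x; first exact: mem_head.
  by exists (x ^+ (t - n) * monv xs a); rewrite mulrAC -exprD subnK.
have [|y yx [c ->]] := IH a sa; first by move: h nt; move: (size xs * n)%N => N; lia.
by exists y; [rewrite inE yx orbT|exists (x ^+ t * c); rewrite mulrA].
Qed.

Variables (xs : seq R) (gs : seq V).
Hypothesis hgs : sle (topm V) (addvs (zerom V) gs).
Local Notation r := (size xs).
Local Notation L n := (mlist r (size gs) n).
Definition mval (a : seq nat) : V := monv xs (behead a) *: gs`_(head 0%N a).

Lemma mval_incr j a i : size a = r -> (i < r)%N ->
  mval (j :: incr_nth a i) = xs`_i *: mval (j :: a).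
Proof. by move=> sa ir; rewrite /mval /= monv_incr // scalerA. Qed.

Lemma mlist_incr n j a i : j :: a \in L n -> (i < r)%N -> j :: incr_nth a i \in L n.+1.
Proof.
rewrite !mem_mlist => /and3P[-> /eqP sa /eqP <-] ir.
by rewrite size_incr_nth sa ir eqxx sumn_incr eqxx.
Qed.

Lemma ipow_span n : sle (ipow (idl xs) V n) (addvs (zerom V) [seq mval a | a <- L n]).
Proof.
elim: n => [|n IH].
  apply: sle_trans hgs _; apply: addvs_min; first exact: sle_addvs.
  move=> g /(nthP 0)[j js <-]; apply: mem_addvs; apply/mapP; exists (j :: nseq r 0%N).
    by rewrite mem_mlist js size_nseq eqxx sumn_nseq mul0n.
  by rewrite /mval /= monv0 scale1r.
set K := addvs _ _; apply: imul_min => a v ha /IH/in_addvs[c].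
move=> /in_zerom/eqP; rewrite subr_eq0 => /eqP ->.
rewrite scaler_sumr; apply: rpred_sum => k _; rewrite scalerA mulrC -scalerA; apply: rpredZ.
have : sle (idl xs) (annv K [seq mval a | a <- L n]`_k); last by move=> /(_ a ha)/in_annv.
apply: idl_min => x /(nthP 0)[i ir <-]; apply/in_annv.
case: k => k /= kl; rewrite size_map in kl; rewrite (nth_map [::]) //.
have := mem_nth [::] kl; set b := nth _ _ _ => bL.
have [j [b' eb]] := mlist_cons bL; rewrite eb in bL *.
rewrite -mval_incr //; last by move: bL; rewrite mem_mlist => /and3P[_ /eqP].
by apply: mem_addvs; apply: map_f; exact: mlist_incr.
Qed.
End Monomials.

Definition mklin (R : comNzRingType) (U V : lmodType R) (f : U -> V) (h : linear f) :
  {linear U -> V} := HB.pack f (GRing.isLinear.Build R U V _ f h).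

Section HilbertSamuel.
Variables (R : comNzRingType) (m : ideal R).
Hypotheses (hR : noetherian R) (hm : loc_ring m).

(** The monomials that do not belong to the span of the smaller ones form a
    composition series. *)
Lemma rlen_std (V : lmodType R) (N : submodClosed V) (f : seq nat -> V) s :
  pairwise ltl s -> (forall a c, a \in s -> c \in m -> c *: f a \in N) ->
  rlen N (addvs N [seq f a | a <- s])
    (count (fun a => `[< f a \notin addvs N [seq f b | b <- s & ltl b a] >]) s).
Proof.
elim/last_ind: s => [|s a IH] hs hN; first exact: rlen_refl.
move: hs; rewrite -cats1 pairwise_cat => /and3P[/allrelP hsa hs _].
have hN' b c : b \in s -> c \in m -> c *: f b \in N.
  by move=> bs; apply: hN; rewrite mem_rcons inE bs orbT.
have ltsa b : b \in s -> ltl b a by move=> bs; apply: hsa => //; exact: mem_head.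
have addvs_cat s1 s2 : addvs N (s1 ++ s2) = addvs (addvs N s1) s2.
  by elim: s1 N {IH hN hN'} => //= x s1 IHs N'.
have fa : [seq b <- s ++ [:: a] | ltl b a] = s.
  rewrite filter_cat /= ltl_irr cats0; apply/all_filterP/allP => b; exact: ltsa.
have fb b : b \in s -> [seq c <- s ++ [:: a] | ltl c b] = [seq c <- s | ltl c b].
  by move=> bs; rewrite filter_cat /= (ltl_asym (ltsa b bs)) cats0.
rewrite count_cat /= addn0 fa map_cat addvs_cat /=.
rewrite (eq_in_count (a2 := fun b => `[< f b \notin addvs N [seq f c | c <- s & ltl c b] >])); last first.
  by move=> b bs /=; rewrite fb.
have {}IH := IH hs hN'; set S := addvs N _ in IH *.
have [h|h] := boolP (f a \in S).
  rewrite asboolF ?addn0 //.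
  suff -> : addv S (f a) = S by [].
  by apply: subm_ext; [exact: addv_min|exact: sle_addv].
rewrite asboolT //; apply: (rlen_add _ _ IH); [exact: sle_addvs|exact: sle_addv|].
apply: (rlen_simple hm) => // c cm; apply: sle_addvs; apply: hN => //.
by rewrite mem_rcons mem_head.
Qed.

Section Function.
Variable V : lmodType R.
Hypothesis hV : noethm V.

Lemma monv_ipow (xs : seq R) a (v : V) : {subset xs <= m} -> size a = size xs ->
  monv xs a *: v \in ipow m V (sumn a).
Proof.
elim: xs a => [|x xs IH] [|t a] //= xm; first by move=> _; exact: in_topm.
move=> [sa]; rewrite -scalerA.
have : monv xs a *: v \in ipow m V (sumn a).
  by apply: IH => // y hy; apply: xm; rewrite inE hy orbT.
elim: t => [|t IHt] h; first by rewrite expr0 scale1r.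
rewrite exprS -scalerA addSn; apply: mem_imul; last exact: IHt.
by apply: xm; exact: mem_head.
Qed.

(** The length of [m^n V / m^(n+1) V] is the number of standard monomials of degree
    [n]: those which do not belong to the span of the smaller ones of the same
    degree modulo [m^(n+1) V]. Multiples of nonstandard monomials are nonstandard. *)
Lemma hilbert_samuel : exists f, evpoly f /\ forall n, rlen (ipow m V n) (topm V) (f n).
Proof.
have [xs hxs] : exists xs, m = idl xs.
  by have [xs h] := hR m; exists xs; apply: subm_ext => a; rewrite h idgen_idl.
have xm : {subset xs <= m} by move=> a ax; rewrite hxs; exact: mem_idl.
have [gs [_ hgs]] := hV (topm V).
pose r := size xs; pose L n := mlist r (size gs) n; pose ev := mval xs gs.
pose std n a := ev a \notin addvs (ipow m V n.+1) [seq ev b | b <- L n & ltl b a].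
pose D j a := std (sumn a) (j :: a) : Prop.
have stair j : staircase r (D j).
  apply: staircase_incr => a i sa ir; rewrite /D sumn_incr; apply: contraNN.
  set S := [seq ev b | b <- L (sumn a) & _]; set S' := [seq ev b | b <- _ & _].
  move=> /in_addvs[c hc]; rewrite /ev mval_incr //.
  rewrite -(subrK (\sum_(k < size S) c k *: S`_k) (mval xs gs (j :: a))) scalerDr.
  apply: rpredD.
    by apply: sle_addvs; apply: mem_imul => //; apply: xm; exact: mem_nth.
  rewrite scaler_sumr; apply: rpred_sum => k _; rewrite scalerA mulrC -scalerA; apply: rpredZ.
  have /mapP[b] : S`_k \in S by exact: mem_nth.
  rewrite mem_filter => /andP[lb bL] ->.
  have [j' [b' eb]] := mlist_cons bL; rewrite eb in bL lb *.
  have sb : size b' = r by move: bL; rewrite mem_mlist => /and3P[_ /eqP].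
  rewrite /ev -mval_incr //; apply: mem_addvs; apply: map_f; rewrite mem_filter.
  rewrite mlist_incr // andbT /=; move: lb => /= /orP[->//|/andP[-> h]].
  by rewrite ltl_incr ?orbT // sa.
pose h n := (\sum_(j <- iota 0 (size gs)) count (fun a => `[< D j a >]) (mons r n))%N.
have hh : evpoly h by apply: evpoly_big => j; exact: staircase_evpoly.
exists (fun n => \sum_(i < n) h i)%N; split; first exact: evpoly_sum.
elim=> [|n IH]; first by rewrite big_ord0; exact: rlen_refl.
rewrite big_ord_recr /= addnC; apply: (rlen_add _ _ _ IH).
- exact: ipow_decr.
- by move=> v _; exact: in_topm.
have e : ipow m V n = addvs (ipow m V n.+1) [seq ev a | a <- L n].
  apply: subm_ext.
    have sp : sle (ipow m V n) (addvs (zerom V) [seq ev a | a <- L n]).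
      by have := @ipow_span R V xs gs hgs n; rewrite -hxs.
    apply: sle_trans sp _.
    by apply: addvs_min; [exact: sle_trans (@zerom_sle _ _ _) (@sle_addvs _ _ _ _)|exact: mem_addvs].
  apply: addvs_min; first exact: ipow_decr.
  move=> _ /mapP[a aL ->]; have [j [b eb]] := mlist_cons aL; rewrite eb in aL *.
  move: aL; rewrite mem_mlist => /and3P[_ /eqP sb /eqP <-].
  exact: monv_ipow.
rewrite [X in rlen _ X _]e.
have -> : h n = count (fun a => `[< std n a >]) (L n).
  rewrite /L /mlist count_flatten sumnE -map_comp big_map; apply: eq_bigr => j _.
  rewrite /= count_map; apply: eq_in_count => a; rewrite mem_mons => /andP[_ /eqP ea] /=.
  by rewrite /D ea.
apply: rlen_std; first exact: pairwise_mlist.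
move=> a c aL cm; have [j [b eb]] := mlist_cons aL; rewrite eb in aL *.
move: aL; rewrite mem_mlist => /and3P[_ /eqP sb /eqP <-].
by apply: mem_imul => //; exact: monv_ipow.
Qed.

Lemma rlen_adds_exp (N : submodClosed V) x n l : nzd N x -> rlen (adds N x) (topm V) l ->
  rlen (adds N (x ^+ n)) (topm V) (n * l).
Proof.
move=> nx hl; elim: n => [|n IH].
  have -> : adds N (x ^+ 0) = topm V.
    apply: subm_ext => v _; first exact: in_topm.
    by rewrite -[v]scale1r -[1]/(x ^+ 0); exact: mem_adds.
  by rewrite mul0n; exact: rlen_refl.
have sx : linear (fun v : V => x *: v).
  by move=> a u v; rewrite scalerDr !scalerA mulrC.
pose f := mklin sx.
have h1 : sle (adds N (x ^+ n.+1)) (adds N x).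
  apply: adds_min; first exact: sle_adds.
  by move=> v; rewrite exprS -scalerA; exact: mem_adds.
rewrite mulSn addnC; apply: (rlen_add h1 _ _ hl); first by move=> v _; exact: in_topm.
have h2 y : y \in adds N x -> exists u, y - f u \in adds N (x ^+ n.+1).
  by move=> /in_adds[u hu]; exists u; apply: (@sle_adds _ _ N).
apply: (rlen_pre _ h1 h2).2.
have -> : pre f (adds N (x ^+ n.+1)) = adds N (x ^+ n).
  apply: subm_ext => u; rewrite in_pre /=.
    move=> /in_adds[v hv]; apply/in_adds; exists v; apply: nx.
    by rewrite scalerBr scalerA -exprS.
  move=> /in_adds[v hv]; apply/in_adds; exists v.
  by rewrite exprS -scalerA -scalerBr; exact: rpredZ.
have -> // : pre f (adds N x) = topm V.
apply: subm_ext => u _; first exact: in_topm.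
by apply/in_pre; exact: mem_adds.
Qed.

(** One entry at a time: [V / x^n V] is filtered by [n] copies of [V / x V], and
    permutability brings each entry to the end. *)
Lemma rseq_exp_len (N : submodClosed V) q n l : (0 < n)%N -> {subset q <= m} -> rseq N q ->
  rlen (addseq N q) (topm V) l ->
  rseq N [seq x ^+ n | x <- q] /\
  rlen (addseq N [seq x ^+ n | x <- q]) (topm V) (n ^ size q * l).
Proof.
move=> n0; elim: q N => [|x q IH] N qm /=; first by move=> _; rewrite mul1n.
move=> [nx hr] hl.
have xm : x \in m by apply: qm; exact: mem_head.
have qm' : {subset q <= m} by move=> y hy; apply: qm; rewrite inE hy orbT.
have [hr' hl'] := IH (adds N x) qm' hr hl.
set qn := [seq x ^+ n | x <- q] in hr' hl' *.
have em y : y \in m -> y ^+ n \in m by case: n n0 {hr' hl' qn IH} => // k _ ym; rewrite exprS; exact: ideal_mulr.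
have qnm : {subset qn <= m} by move=> _ /mapP[y /qm' ym ->]; exact: em.
have pe y : perm_eq (y :: qn) (qn ++ [:: y]) by rewrite -cat1s perm_catC.
have r1 : rseq N (x :: qn) by [].
have m1 : {subset x :: qn <= m} by move=> y; rewrite inE => /orP[/eqP ->|/qnm].
have /rseq_cat[r2 [nx' _]] : rseq N (qn ++ [:: x]).
  by apply: (rseq_perm (m := m)) (pe x) r1.
have m2 : {subset qn ++ [:: x ^+ n] <= m}.
  by move=> y; rewrite mem_cat inE => /orP[/qnm //|/eqP ->]; exact: em.
have r3 : rseq N (qn ++ [:: x ^+ n]).
  by apply/rseq_cat; split=> //; split=> //; exact: nzd_exp.
have pe' : perm_eq (qn ++ [:: x ^+ n]) (x ^+ n :: qn) by rewrite perm_sym.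
have r4 : rseq N (x ^+ n :: qn) by apply: (rseq_perm (m := m)) pe' r3.
have swap y : addseq (adds N y) qn = adds (addseq N qn) y.
  rewrite -[LHS]/(addseq N (y :: qn)) -[RHS]/(addseq (addseq N qn) [:: y]) -addseq_cat.
  by apply: subm_ext; apply: addseq_sub => a; rewrite (perm_mem (pe y)).
split; first exact: r4.
by rewrite swap expnS -mulnA; apply: rlen_adds_exp => //; rewrite -swap.
Qed.

Lemma imul_swap (I J : ideal R) (N : submodClosed V) : sle (imul I (imul J N)) (imul J (imul I N)).
Proof.
apply: imul_min => a v ha; set K := imul J (imul I N).
have hcol u : u \in colon K a <-> a *: u \in K by exact: inmk.
have : sle (imul J N) (colon K a); last by move=> h /h/hcol.
apply: imul_min => b u hb hu; apply/hcol.
by rewrite scalerA mulrC -scalerA; apply: mem_imul => //; exact: mem_imul.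
Qed.

Lemma ipow_iter (I : ideal R) k i : sle (ipow m V k) (imul I (topm V)) ->
  sle (ipow m V (k * i)) (ipow I V i).
Proof.
move=> hk; elim: i => [|i IH]; first by rewrite muln0; exact: sle_refl.
rewrite mulnS /ipow iterD -/(ipow m V (k * i)).
have swap j (N : submodClosed V) : sle (iter j (@imul R m V) (imul I N)) (imul I (iter j (@imul R m V) N)).
  elim: j => [|j IHj] /=; first exact: sle_refl.
  by apply: sle_trans (imul_mono IHj) _; exact: imul_swap.
have mono j (N K : submodClosed V) : sle N K -> sle (iter j (@imul R m V) N) (iter j (@imul R m V) K).
  by move=> h; elim: j => [|j IHj] //=; exact: imul_mono.
apply: sle_trans (mono k _ _ IH) _.
have swap2 t : sle (iter k (@imul R m V) (ipow I V t)) (iter t (@imul R I V) (ipow m V k)).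
  elim: t => [|t IHt]; first exact: sle_refl.
  by apply: sle_trans (swap k _) _; exact: imul_mono.
apply: sle_trans (swap2 i) _; rewrite iterSr.
by elim: i {IH swap2} => [|i IHi] //=; exact: imul_mono.
Qed.

(** The lengths of [V / b^[n] V] bound the Hilbert-Samuel function from above,
    and from below after a linear change of the variable. *)
Lemma hilbert_samuel_pos (b : seq R) (f : nat -> nat) (P : {poly rat}) n0 (v0 : V) : v0 != 0 ->
  {subset b <= m} -> rseq (zerom V) b -> cofin m (addseq (zerom V) b) ->
  (forall n, rlen (ipow m V n) (topm V) (f n)) ->
  (forall n, (n0 <= n)%N -> (f n)%:R = P.[n%:R]) -> 0 < P`_(size b).
Proof.
move=> vn0 bm br bc hf hP; have [l hl] := cofin_rlen hm hR hV bc.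
have top (N : submodClosed V) : sle N (topm V) by move=> v _; exact: in_topm.
have l0 : (0 < l)%N.
  rewrite lt0n; apply/eqP => l0; rewrite l0 in hl.
  have : sle (topm V) (zerom V).
    apply: (nakayama hm hV) => v; rewrite (rlen0 hl); apply: addseq_min.
      exact: sle_addml.
    move=> a u /bm am; apply: sle_addmr; apply: mem_imul => //; rewrite -(rlen0 hl); exact: in_topm.
  by move=> /(_ v0 (in_topm _))/in_zerom/eqP; rewrite (negPf vn0).
have [k0 hk0] := nil_pow hR hV bc.
pose k := (k0 + n0).+1; pose d := size b.
have hk : sle (ipow m V k) (imul (idl b) (topm V)).
  apply: sle_trans (ipow_mono _) _; first by apply: leqW; exact: leq_addr.
  apply: sle_trans hk0 _; apply: addseq_min; first exact: zerom_sle.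
  by move=> a v ab; apply: mem_imul; [exact: mem_idl|exact: in_topm].
have [gs [_ hgs]] := hV (topm V).
have bn n : (0 < n)%N -> rlen (addseq (zerom V) [seq x ^+ n | x <- b]) (topm V) (l * n ^ d).
  by move=> n1; rewrite mulnC; have [] := rseq_exp_len n1 bm br hl.
apply: (@coef_pos_of_bounds P d l (k * d) k (maxn n0 1)) => // n; rewrite geq_max => /andP[hn n1].
  rewrite -hP //; split; first exact: Num.Theory.ler0n.
  rewrite Num.Theory.ler_nat.
  have le : sle (addseq (zerom V) [seq x ^+ n | x <- b]) (ipow m V n).
    apply: addseq_min; first exact: zerom_sle.
    by move=> _ v /mapP[x /bm xm ->]; exact: mem_ipow.
  have [a [c [-> _ hc]]] := rlen_split le (top _) (bn n n1).
  by rewrite (rlen_uniq (hf n) hc) leq_addl.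
have kn : (k * d * n + k = k * (d * n + 1))%N by rewrite mulnDr muln1 mulnA.
rewrite -hP; last by rewrite kn /k; nia.
rewrite Num.Theory.ler_nat kn.
have le : sle (ipow m V (k * (d * n + 1))) (addseq (zerom V) [seq x ^+ n | x <- b]).
  have s1 : sle (ipow m V (k * (d * n + 1))) (ipow (idl b) V (d * n + 1)) by exact: ipow_iter.
  have s2 := @ipow_span R V b gs hgs (d * n + 1).
  apply: sle_trans s1 _; apply: sle_trans s2 _.
  apply: addvs_min; first exact: zerom_sle.
  move=> _ /mapP[a aL ->]; have [j [c eb]] := mlist_cons aL; rewrite eb in aL *.
  move: aL; rewrite mem_mlist => /and3P[_ /eqP sc /eqP hc].
  have [|x xb [e he]] := @monv_pigeon _ b c n sc; first by rewrite hc addn1.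
  by rewrite /mval /= he mulrC -scalerA; apply: mem_addseq; exact: (map_f (fun x => x ^+ n)).
have [a [c [e _ hc]]] := rlen_split le (top _) (hf _).
by rewrite e (rlen_uniq (bn n n1) hc) leq_addl.
Qed.

Lemma multiplicityE d (f : nat -> nat) (P : {poly rat}) n0 : krull_dim R d ->
  (forall n, rlen (ipow m V n) (topm V) (f n)) ->
  (forall n, (n0 <= n)%N -> (f n)%:R = P.[n%:R]) ->
  multiplicity m V = (d`!)%:R * P`_d.
Proof.
move=> hd hf hP; apply: xget_subset1.
  exists d, P, n0; split=> // n hn; rewrite (quotm_len (hf n)); exact: hP.
move=> e e' [d1 [P1 [n1 [hd1 hP1 ->]]]] [d2 [P2 [n2 [hd2 hP2 ->]]]].
rewrite (krull_dim_uniq hd1 hd2).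
suff -> : P1 = P2 by [].
apply: (@evpoly_uniq _ _ (maxn n1 n2)) => n; rewrite geq_max => /andP[h1 h2].
by rewrite -hP1 // hP2.
Qed.
End Function.

Lemma ipow_lin (U V : lmodType R) (g : {linear U -> V}) n u :
  u \in ipow m U n -> g u \in ipow m V n.
Proof.
elim: n u => [|n IH] u; first by move=> _; exact: in_topm.
have : sle (ipow m U n.+1) (pre g (ipow m V n.+1)); last by move=> h /h/in_pre.
apply: imul_min => a v am hv; apply/in_pre; rewrite linearZ /=.
by apply: mem_imul => //; exact: IH.
Qed.

Lemma rlen_ipow_sum (U W V : lmodType R) (i1 : {linear U -> V}) (p1 : {linear V -> U})
    (i2 : {linear W -> V}) (p2 : {linear V -> W}) n a b :
  cancel i1 p1 -> cancel i2 p2 -> (forall w, p1 (i2 w) = 0) ->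
  (forall v, v = i1 (p1 v) + i2 (p2 v)) ->
  rlen (ipow m U n) (topm U) a -> rlen (ipow m W n) (topm W) b ->
  rlen (ipow m V n) (topm V) (b + a).
Proof.
move=> K1 K2 h0 hv ha hb; pose K := pre p1 (ipow m U n).
have NK : sle (ipow m V n) K by move=> v hv'; apply/in_pre; exact: ipow_lin.
have pT (X Y : lmodType R) (g : {linear X -> Y}) : pre g (topm Y) = topm X.
  by apply: subm_ext => x _; [exact: in_topm|apply/in_pre; exact: in_topm].
apply: (rlen_add NK); first by move=> v _; exact: in_topm.
  have h2 v : v \in K -> exists w, v - i2 w \in ipow m V n.
    by move=> /in_pre hv'; exists (p2 v); rewrite {1}[v]hv addrK; exact: ipow_lin.
  apply: (rlen_pre _ NK h2).2.
  have -> : pre i2 (ipow m V n) = ipow m W n.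
    apply: subm_ext => w; rewrite in_pre; last exact: ipow_lin.
    by move=> /(ipow_lin p2); rewrite K2.
  have -> // : pre i2 K = topm W.
  apply: subm_ext => w _; first exact: in_topm.
  by apply/in_pre/in_pre; rewrite h0; exact: rpred0.
rewrite -(pT _ _ p1); apply: (rlen_pre _ _ _).1 ha; first by move=> v _; exact: in_topm.
by move=> u _; exists (i1 u); rewrite K1 subrr; exact: rpred0.
Qed.

Lemma rlen_ipow_rV mu n a : rlen (ipow m R^o n) (topm R^o) a ->
  rlen (ipow m 'rV[R]_mu n) (topm 'rV[R]_mu) (mu * a).
Proof.
move=> ha; elim: mu => [|mu IH].
  have -> : ipow m 'rV[R]_0 n = topm 'rV[R]_0.
    apply: subm_ext => v _; first exact: in_topm.
    by rewrite (_ : v = 0) ?rpred0 //; apply/rowP => -[].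
  exact: rlen_refl.
have l1 : linear (fun c : R^o => row_mx (const_mx c) 0 : 'rV[R]_(1 + mu)).
  by move=> c u v; apply/rowP => j; rewrite !mxE; case: fintype.splitP => k _; rewrite !mxE ?mulr0 ?addr0.
have l2 : linear (fun v : 'rV[R]_(1 + mu) => v 0 0 : R^o) by move=> c u v; rewrite !mxE.
have l3 : linear (fun v : 'rV[R]_mu => row_mx 0 v : 'rV[R]_(1 + mu)).
  by move=> c u v; apply/rowP => j; rewrite !mxE; case: fintype.splitP => k _; rewrite !mxE ?mulr0 ?addr0.
have l4 : linear (fun v : 'rV[R]_(1 + mu) => rsubmx v) by move=> c u v; apply/rowP => j; rewrite !mxE.
have e0 : (0 : 'I_(1 + mu)) = lshift mu 0 by apply: val_inj.
rewrite mulSn addnC -[mu.+1]/(1 + mu)%N.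
apply: (@rlen_ipow_sum R^o 'rV[R]_mu 'rV[R]_(1 + mu) (mklin l1) (mklin l2) (mklin l3) (mklin l4)) => //.
- by move=> c; rewrite /= e0 row_mxEl mxE.
- by move=> v; rewrite /= row_mxKr.
- by move=> v; rewrite /= e0 row_mxEl mxE.
- move=> v; apply/rowP => j; rewrite -[j]splitK; case: (fintype.split j) => k /=.
    by rewrite mxE !row_mxEl !mxE addr0 ord1 e0.
  by rewrite mxE !row_mxEr !mxE add0r.
Qed.
End HilbertSamuel.
(** * The structure theorem *)

Section Summands.
Variable R : comNzRingType.

Lemma isom_split (V U W : lmodType R) : isom V (U * W)%type ->
  exists (i1 : {linear U -> V}) (p1 : {linear V -> U}) (i2 : {linear W -> V})
    (p2 : {linear V -> W}), [/\ cancel i1 p1, cancel i2 p2, forall w, p1 (i2 w) = 0 &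
    forall v, v = i1 (p1 v) + i2 (p2 v)].
Proof.
move=> [f [g gK fK]]; have gl : linear g := can2_linear gK fK.
pose G := mklin gl.
have l1 : linear (fun u => g (u, 0) : V).
  by move=> a u v; rewrite -gl; congr g; congr (_, _); rewrite /= scaler0 addr0.
have l2 : linear (fun w => g (0, w) : V).
  by move=> a u v; rewrite -gl; congr g; congr (_, _); rewrite /= scaler0 addr0.
have l3 : linear (fun v => (f v).1) by move=> a u v; rewrite linearP.
have l4 : linear (fun v => (f v).2) by move=> a u v; rewrite linearP.
exists (mklin l1), (mklin l3), (mklin l2), (mklin l4); split=> [u|w|w|v] /=; rewrite ?fK //.
rewrite -[LHS]gK -[g (_, 0) + _]/(G ((f v).1, 0) + G (0, (f v).2)) -raddfD /=.
by congr g; rewrite [LHS]surjective_pairing; congr (_, _); rewrite /= ?addr0 ?add0r.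
Qed.

Lemma addseq_lin (U V : lmodType R) (g : {linear U -> V}) q u :
  u \in addseq (zerom U) q -> g u \in addseq (zerom V) q.
Proof.
have : sle (addseq (zerom U) q) (pre g (addseq (zerom V) q)); last by move=> h /h/in_pre.
apply: addseq_min; first exact: zerom_sle.
by move=> a v aq; apply/in_pre; rewrite linearZ; exact: mem_addseq.
Qed.

Lemma rseq_summand (U V : lmodType R) (i : {linear U -> V}) (p : {linear V -> U}) q :
  cancel i p -> rseq (zerom V) q -> rseq (zerom U) q.
Proof.
move=> K /rseqP h; apply/rseqP => j jq u hu; rewrite -[u]K; apply: addseq_lin.
by apply: (h j jq); rewrite -linearZ; exact: addseq_lin.
Qed.

Lemma noethm_summand (U V : lmodType R) (i : {linear U -> V}) (p : {linear V -> U}) :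
  noetherian R -> cancel i p -> finitely_generated V -> noethm U.
Proof.
move=> hR K [s hs]; apply: (noethm_fg hR); exists [seq p x | x <- s] => u.
pose N := genby [set x | x \in [seq p x | x <- s]]%classic.
have : i u \in pre p N; last by move/in_pre; rewrite K.
move: (hs (i u)) => /(inmk _ _).1 h; apply: h => y ys; apply/in_pre/inmk => L hL.
by apply: hL; exact: map_f.
Qed.
End Summands.

Section Structure.
Variables (O : idomainType) (w : O) (A : comAlgType O) (lam : {rmorphism A -> O}).
Variables (m : ideal A) (c : nat) (M : lmodType A).
Hypotheses (hO : dvr O) (hw : uniformizer w) (hC : in_CO lam m c).
Hypotheses (hfg : finitely_generated M) (hdep : depth_ge m M c.+1).
Hypothesis hx : exists x : loc (kerP lam) M, x <> 0.
Local Notation p := (kerI lam).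
Local Notation lc y := (lincomb (y : _ -> A^o)).
Local Notation pM := (imul p (topm M)).
Let hA : noetherian A. Proof. by case: hC => -[]. Qed.
Let hm : loc_ring m. Proof. by case: hC => -[h1 h2 _] _; exact: local_loc_ring. Qed.
Let hcomp : adic_complete m. Proof. by case: hC => -[]. Qed.
Let lamK : forall x : O, lam x%:A = x. Proof. by case: hC => _ []. Qed.
Let hM : noethm M := noethm_fg hA hfg.

(** The elements of [M / xM] killed by [p] have their image in [w ^ K X], where [X] is
    the torsion-free quotient of [M / pM]; [t] accounts for the torsion. *)
Definition annihilated_divisible K xs := forall v : M,
  (forall a, a \in p -> a *: v \in addseq (zerom M) xs) ->
  exists (u : M) (t : O), t != 0 /\ t%:A *: (v - (w ^+ K)%:A *: u) \in pM.

Lemma defect_data n (ys : 'I_n -> A) : (forall i, ys i \in p) ->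
  (forall a, a \in p -> exists b, a = lc ys b) ->
  exists (B : 'M[O]_n) r k (y : 'I_n -> A) mu (nb : 'I_mu -> M),
  [/\ B \in unitmx, cotangent w lam r k y,
      forall i, y i - lc ys (row i (map_mx (in_alg A) B)) \in imul p p,
      rseq (zerom M) (free_gens r y) &
  [/\ dep m (addseq (zerom M) (free_gens r y)) 1, tf_basis lam nb, (0 < mu)%N,
      isom (loc (kerP lam) M) 'rV[locR (kerP lam)]_mu &
      0 <= wiles_defect lam c M /\
      (wiles_defect lam c M = 0 <->
        annihilated_divisible (\sum_(i < r) k i) (free_gens r y))]].
Proof.
move=> ysp gen; have [x x0] := hx; have [v0 [t0 ex]] := frac_surj x.
have hv0 s : s \notin p -> s *: v0 <> 0.
  move=> sp sv; apply: x0; rewrite ex; apply/frac_eq0; exists s => //.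
  by rewrite kerP_kerI.
have hreg : regular_local (locR (kerP lam)) c by case: hC => _ [].
have [B [r [k [y [Bu cot hy hPhi [nr xr xd]]]]]] :=
  setup hO hw lamK hA hm hM ysp gen hreg (depth_ge_dep hdep) hv0.
have [mu [nb hnb]] := tf_basis_exists hO hw lamK hM.
have [q hq] := cotangent_rel lamK cot.
pose a0 := \det (torsion_mx cot q); set xs := free_gens r y in xr xd *.
have lam_a0 : lam a0 = w ^+ (\sum_(i < r) k i) by apply: (lam_det_torsion_mx lamK) => i; exact: (hq i).1.
have ha0 a : a \in p -> a0 * a \in idl xs.
  by apply: det_torsion_mx_kills => i; [exact: (hq i).1|exact: (hq i).2].
have [_ w0] := dvr_loc_ring hO hw.
have a0p : a0 \notin p by apply/notin_kerI; rewrite lam_a0 expf_neq0.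
have [rn yp _ _] := cot.
have xp : {subset xs <= p} by move=> a /mapP[i _ ->].
have xm : {subset xs <= m} by move=> a /xp; exact: kerI_sub_max.
have hloc := tf_basis_loc lamK hA hM hnb xp xr a0p ha0.
have mu0 : (0 < mu)%N.
  rewrite lt0n; apply/eqP => mu0; apply: x0; have [f [g gK _]] := hloc.
  rewrite -[x]gK -[RHS]gK; congr g; apply/rowP => j; have := ltn_ord j; by rewrite {2}mu0.
have [s1 s1p hs1] := sreg_exists hA hm hM hnb xp xm xr a0p ha0 mu0.
have [Ds hDs] := dual_free_gens lamK cot.
have sx : size xs = c by rewrite -nr /xs /free_gens filter_enum_ord // size_map size_drop size_enum_ord.
have hPsi : isom (Psi lam (size xs) M) (quotm (congL lam M xs)).
  apply: (@Psi_isom _ _ _ lamK M xs (s1 * a0) Ds) => //.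
  - by apply/negP => /(kerI_prime lam).2[]; exact/negP.
  - exact: sregM.
  - by move=> a ap; rewrite -mulrA; apply: ideal_mull; exact: ha0.
have := defect_char hO hw lamK hA hM hnb xp xr a0p ha0 lam_a0 hPhi hPsi.
rewrite sx => hd; exists B, r, k, y, mu, nb; split=> //; split=> //.
Qed.

Lemma kerI_gens : exists n (ys : 'I_n -> A), (forall i, ys i \in p) /\
  forall a, a \in p -> exists b, a = lc ys b.
Proof. by apply: (@fin_gens A A^o p); exact/noetherian_noethm. Qed.

(** Over a complete intersection, the elements of [A] killed by [p] modulo the
    free generators map to multiples of [w ^ K]; on [A ^ mu] this is applied to
    each coordinate, and [W] is torsion modulo [p]. *)
Lemma ci_divisible K xs mu (W : lmodType A) :
  (forall a : A, (forall b, b \in p -> a * b \in idl xs) -> exists e, lam a = e * w ^+ K) ->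
  isom M ('rV[A]_mu * W)%type -> (forall x : loc (kerP lam) W, x = 0) ->
  annihilated_divisible K xs.
Proof.
move=> hT /isom_split[i1 [p1 [i2 [p2 [_ _ _ hv]]]]] hW v hv'.
have cl (j : 'I_mu) : linear (fun v : M => p1 v 0 j : A^o).
  by move=> a u u'; rewrite linearP !mxE.
have he (j : 'I_mu) : {e | lam (p1 v 0 j) = e * w ^+ K}.
  apply: cid; apply: hT => b bp.
  have := addseq_lin (mklin (cl j)) (hv' b bp).
  by rewrite /= linearZ mxE mulrC.
have [s sp hs] := (frac_eq0 (p2 v) (den1 (kerP lam))).1 (hW _).
have st : lam s != 0 by apply/notin_kerI; rewrite -kerP_kerI.
pose e : 'rV[A]_mu := \row_j (sval (he j))%:A.
exists (i1 e), (lam s); split=> //.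
have -> : v - (w ^+ K)%:A *: i1 e = i1 (p1 v - (w ^+ K)%:A *: e) + i2 (p2 v).
  have -> : i1 (p1 v - (w ^+ K)%:A *: e) = i1 (p1 v) - (w ^+ K)%:A *: i1 e.
    by rewrite (linearB i1) linearZ.
  by rewrite {1}[v]hv addrAC.
rewrite scalerDr; apply: rpredD.
  apply: rpredZ; rewrite [X in i1 X]row_sum_delta linear_sum; apply: rpred_sum => j _.
  rewrite linearZ /=; apply: mem_pM; apply/in_kerI.
  rewrite !mxE rmorphB rmorphM !lamK; case: (he j) => t /= ->.
  by rewrite mulrC subrr.
have := pM_scale_lam lamK s (i2 (p2 v)).
have -> : s *: i2 (p2 v) = 0 by rewrite -linearZ /= hs linear0.
by rewrite sub0r => /subm_opp; rewrite opprK.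
Qed.

Lemma ci_vanishing mu (W : lmodType A) : complete_intersection A -> (0 < mu)%N ->
  isom M ('rV[A]_mu * W)%type -> (forall x : loc (kerP lam) W, x = 0) ->
  wiles_defect lam c M = 0.
Proof.
move=> [Q [f [s [[d [hQ [hd [mQ [lQ [v [sv hv]]]]]]] fT rs fs]]]] mu0 hiso hW.
have hmQ := local_loc_ring hQ lQ.
have mv : mQ = idl v by apply: subm_ext => a; rewrite hv idgen_idl.
have [rs' [u hu]] := (regular_seqE _ _).1 rs.
have sm : {subset s <= mQ}.
  move=> a as'; have [//|/hmQ.2[b hb]] := boolP (a \in mQ); case/negP: hu.
  rewrite -[u]mul1r -hb -mulrA; apply: (@ideal_mulr Q (idl s)); exact: mem_idl.
have fs' q : f q = 0 <-> q \in idl s.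
  by have e := idgen_idl s q; have h := fs q; split=> [/h|h']; [rewrite e|apply/h; rewrite e].
have dv : krull_dim Q (size v) by rewrite sv.
have [n [ys [ysp gen hT]]] := ci_torsion hO hw lamK hm hQ hmQ fT sm rs' fs' mv dv.
have [B [r [k [y [mu' [nb [Bu cot hy xr [xd _ _ _ [_ hd0]]]]]]]]] := defect_data ysp gen.
apply/hd0; apply: (ci_divisible (mu := mu) (W := W)) => //.
have [i1 [p1 [i2 [p2 [K1 _ _ _]]]]] := isom_split hiso.
pose j0 := Ordinal mu0.
have l1 : linear (fun a : A^o => i1 (a *: delta_mx 0 j0) : M).
  by move=> a x y'; rewrite -linearP scalerDl scalerA.
have l2 : linear (fun v : M => p1 v 0 j0 : A^o) by move=> a x y'; rewrite linearP !mxE.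
have K0 : cancel (mklin l1) (mklin l2) by move=> a; rewrite /= K1 !mxE !eqxx mulr1.
have [q1 [sq1 q1m rq1]] := xd.
have rA : @rseq A A^o (zerom A^o) (free_gens r y ++ q1).
  by apply: (rseq_summand K0); apply/rseq_cat.
have [rA1 rA2] := (rseq_cat _ _ _).1 rA.
by apply: (hT B) => //; exists q1.
Qed.

(** A module [W] carrying a parameter sequence has positive multiplicity unless
    it is zero, and multiplicity is additive. *)
Lemma multiplicity_free (b : seq A) mu (W : lmodType A) : {subset b <= m} ->
  @rseq A A^o (zerom A^o) b -> cofin m (idl b) -> rseq (zerom M) b ->
  isom M ('rV[A]_mu * W)%type ->
  multiplicity m M <= mu%:R * multiplicity m A^o -> isom M 'rV[A]_mu.
Proof.
move=> bm rA cA rM hiso; have [i1 [p1 [i2 [p2 [K1 K2 h0 hv]]]]] := isom_split hiso.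
have hd := krull_dim_rseq hA hm bm rA cA.
have hW : noethm W by exact: noethm_summand K2 hfg.
have hA' : noethm A^o by exact/noetherian_noethm.
have [fA [[PA [nA hPA]] lA]] := hilbert_samuel hA hm hA'.
have [fW [[PW [nW hPW]] lW]] := hilbert_samuel hA hm hW.
have lM n : rlen (ipow m M n) (topm M) (fW n + mu * fA n).
  by apply: (rlen_ipow_sum K1 K2 h0 hv) => //; exact: rlen_ipow_rV.
rewrite (multiplicityE hd lA hPA).
rewrite (@multiplicityE _ _ M _ _ (PW + mu%:R *: PA) (maxn nA nW) hd lM); last first.
  move=> n; rewrite geq_max => /andP[h1 h2].
  by rewrite natrD natrM hPA // hPW // hornerD hornerZ.
rewrite coefD coefZ mulrDr mulrCA Num.Theory.gerDr => hle.
have [W0|/existsNP[v0 /eqP vn0]] := pselect (forall x : W, x = 0).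
  by exists p1; exists i1 => // v; rewrite [RHS]hv (W0 (p2 v)) linear0 addr0.
have rW := rseq_summand K2 rM.
have cW : cofin m (addseq (zerom W) b).
  move=> a v am; have [j hj] := cA a 1 am; exists j.
  have : sle (idl b) (annv (addseq (zerom W) b) v).
    by apply: idl_min => x xb; apply/in_annv; exact: mem_addseq.
  by move=> /(_ (a ^+ j)); rewrite -[a ^+ j]mulr1 => /(_ hj)/in_annv; rewrite mulr1.
have := hilbert_samuel_pos hA hm hW vn0 bm rW cW lW hPW.
have f0 : 0 < ((size b)`!)%:R :> rat by rewrite Num.Theory.ltr0n fact_gt0.
move=> /(Num.Theory.mulr_gt0 f0) hp.
by rewrite (Order.POrderTheory.lt_geF hp) in hle.
Qed.

Lemma vanishing_structure mu : isom (loc (kerP lam) M) 'rV[locR (kerP lam)]_mu ->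
  wiles_defect lam c M = 0 ->
  [/\ complete_intersection A,
      exists W : lmodType A, isom M ('rV[A]_mu * W)%type /\ (forall x : loc (kerP lam) W, x = 0) &
      multiplicity m M <= mu%:R * multiplicity m A^o -> isom M 'rV[A]_mu].
Proof.
move=> hmu; have [n [ys [ysp gen]]] := kerI_gens.
have [B [r [k [y [mu' [nb [_ cot _ xr [xd hnb mu0 hloc [_ hd0]]]]]]]]] := defect_data ysp gen.
have emu : mu' = mu by rewrite -(rank_eq hmu) (rank_eq hloc).
rewrite -emu => /hd0 hL.
have [S [ev [mS [z [f [xs' [rho [hS hmS mz rz [evT fm rf hker [hrho sz fxm rfx rM]]]]]]]]]] :=
  vanishing_splits hO hw lamK hA hm hcomp hM cot xr xd hnb mu0 hL.
have [W [hiso hW]] := retraction_splits hrho (tf_basis_gen lamK hM hnb).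
split; first exact: (regular_quotient_ci hS hmS mz rz evT fm rf hker).
  by exists W.
pose b := [seq ev x | x <- xs'].
have evm x : x \in mS -> ev x \in m.
  move=> xm; have [//|/hm.2[a ha]] := boolP (ev x \in m); case/negP: hmS.1.
  have [a' ea] := evT a.
  have h : x * a' - 1 \in idl f by apply/hker; rewrite rmorphB rmorphM ea ha rmorph1 subrr.
  have -> : 1 = x * a' - (x * a' - 1) by rewrite opprB addrC subrK.
  by apply: idealB; [exact: ideal_mulr|move: h; apply: idl_min].
have bm : {subset b <= m}.
  by move=> _ /mapP[x xx ->]; apply: evm; apply: fxm; rewrite mem_cat xx orbT.
have [i1 [p1 [i2 [p2 [K1 _ _ _]]]]] := isom_split hiso.
pose j0 := Ordinal mu0.
have l1 : linear (fun a : A^o => i1 (a *: delta_mx 0 j0) : M).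
  by move=> a x y'; rewrite -linearP scalerDl scalerA.
have l2 : linear (fun v : M => p1 v 0 j0 : A^o) by move=> a x y'; rewrite linearP !mxE.
have K0 : cancel (mklin l1) (mklin l2) by move=> a; rewrite /= K1 !mxE !eqxx mulr1.
have rA : @rseq A A^o (zerom A^o) b by exact: rseq_summand K0 rM.
have cS : cofin mS (idl (f ++ xs')).
  by apply: krull_dim_cofin => //; rewrite -sz; case: (regular_local_rseq hS hmS mz rz) => _ [].
have cA : cofin m (idl b).
  move=> a v am; have [x ex] := evT a; have xm : x \in mS.
    have [//|/hmS.2[t ht]] := boolP (x \in mS); case/negP: hm.1.
    by rewrite -(rmorph1 ev) -ht rmorphM ex; exact: ideal_mulr.
  have [j] := cS x 1 xm; rewrite -[_ *: _]/(x ^+ j * 1) mulr1 => /(idl_map ev).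
  rewrite rmorphXn ex map_cat => hj; exists j; apply: ideal_mulr; move: hj.
  apply: idl_min => t; rewrite mem_cat => /orP[/mapP[g gf ->]|]; last exact: mem_idl.
  have -> : ev g = 0 by apply/hker; exact: mem_idl.
  exact: ideal0.
exact: (multiplicity_free bm rA cA rM hiso).
Qed.
End Structure.

Theorem theorem1 (O : idomainType) (w : O) (A : comAlgType O)
    (lam : {rmorphism A -> O}) (m : ideal A) (c : nat) (M : lmodType A) :
  dvr O -> uniformizer w ->
  in_CO lam m c ->
  finitely_generated M ->
  depth_ge m M c.+1 ->
  (exists x : loc (kerP lam) M, x <> 0) ->
  let mu := rank (loc (kerP lam) M) in
  [/\ isom (loc (kerP lam) M) 'rV[locR (kerP lam)]_mu,
      0 <= wiles_defect lam c M,
      wiles_defect lam c M = 0 <->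
        complete_intersection A /\
        exists W : lmodType A,
          isom M ('rV[A]_mu * W)%type /\ (forall x : loc (kerP lam) W, x = 0)
    & wiles_defect lam c M = 0 ->
        multiplicity m M <= mu%:R * multiplicity m A^o ->
        isom M 'rV[A]_mu].
Proof.
move=> hO hw hC hfg hdep hx mu.
have [n [ys [ysp gen]]] := kerI_gens hC.
have [_ [_ [_ [_ [mu' [_ [_ _ _ _ [_ _ mu0 hloc [hd _]]]]]]]]] :=
  defect_data hO hw hC hfg hdep hx ysp gen.
have emu : mu = mu' by exact: rank_eq.
rewrite emu; split=> //.
  split=> [h0|[hci [W [hiso hW]]]]; last first.
    exact: (ci_vanishing hO hw hC hfg hdep hx hci mu0 hiso hW).
  by have [] := vanishing_structure hO hw hC hfg hdep hx hloc h0.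
by move=> h0; have [] := vanishing_structure hO hw hC hfg hdep hx hloc h0.
Qed.
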